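(* Let $0<\sigma<1$. Let $v_0\in L^1(\mathbb{X})$ be bi-$K$-invariant (i.e. $v_0(kx)=v_0(x)$ for all $k\in K$, $x\in\mathbb{X}$), let $v(t,\cdot)=v_0*Q_t^\sigma$ be the solution to the extension problem with initial data $v_0$, and set $M=\int_{\mathbb{X}}v_0$. Then for all $1<p<\infty$, with $p'$ the dual exponent ($\frac1p+\frac1{p'}=1$), $$\|v(t,\cdot)-M\,Q_t^\sigma\|_{L^p(\mathbb{X})}=\mathrm{o}\Big(t^{\frac{1}{p'}\left(\sigma-\frac{\ell}{2}-\frac12-|\Sigma_r^+|\right)}\,e^{-\frac{|\rho|t}{p'}}\Big)\qquad\text{as }t\to+\infty .$$
   Context: Let $G$ be a connected, noncompact, semisimple Lie group with finite center, $K$ a maximal compact subgroup, $\mathbb{X}=G/K$, $\mathfrak g=\mathfrak k\oplus\mathfrak p$ the Cartan decomposition, $\langle\cdot,\cdot\rangle$ the inner product on $\mathfrak p$ induced by the Killing form (norm $|\cdot|$), which gives the $G$-invariant metric on $\mathbb{X}$, and $\Delta$ the Laplace-Beltrami operator. Let $\mathfrak a\subset\mathfrak p$ be maximal abelian (identified with its dual), $\ell=\dim\mathfrak a$ the rank, $\Sigma\subset\mathfrak a$ the restricted root system with multiplicities $m_\alpha$, $\Sigma^+$ a choice of positive roots, $\Sigma_r^+$ the positive reduced (indivisible) roots, $\rho=\frac12\sum_{\alpha\in\Sigma^+}m_\alpha\alpha$. Functions on $\mathbb{X}$ are identified with right-$K$-invariant functions on $G$; $dg$ is the Haar measure normalized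 so that $\int_G f(gK)\,dg=\int_{\mathbb X}f$ (Riemannian measure). Convolution: $(f*k)(g)=\int_Gf(y)k(y^{-1}g)\,dy$. Let $h_u$ be the heat kernel (bi-$K$-invariant, $e^{u\Delta}f=f*h_u$), and $$Q_t^\sigma(g)=\frac{t^{2\sigma}}{2^{2\sigma}\Gamma(\sigma)}\int_0^{+\infty}h_u(g)\,e^{-\frac{t^2}{4u}}\frac{du}{u^{1+\sigma}}.$$ The solution to the extension problem $\Delta v+\frac{1-2\sigma}{t}\partial_tv+\partial_{tt}^2v=0$, $v(0,\cdot)=v_0$, is by definition $v(t,\cdot)=v_0*Q_t^\sigma$. *)

(* Defs.v *)
From HB Require Import structures.
From mathcomp Require Import all_boot all_order all_algebra.
From mathcomp Require Import all_classical all_reals all_analysis.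
From mathcomp Require Import complex.

Set Implicit Arguments.
Unset Strict Implicit.
Unset Printing Implicit Defensive.
Import Order.TTheory GRing.Theory Num.Theory.
Import numFieldNormedType.Exports.
Local Open Scope classical_set_scope.
Local Open Scope ring_scope.

(* The distinguished point of ptopologicalType is only there because the library
   requires one to build the Borel sigma-algebra; it plays no role. *)
HB.mixin Record PTopological_isTopGroup G
    of Group G & PointedTopological G := {
  mulg_continuous : continuous (fun x : G * G => (x.1 * x.2)%g) ;
  invg_continuous : continuous (fun x : G => (x^-1)%g)
}.

#[short(type="topGroupType")]
HB.structure Definition TopGroup :=
  {G of PTopological_isTopGroup G & Group G & PointedTopological G}.

Section Smooth.
Context {R : realType} {V W : normedModType R}.

(* Only meaningful for U open: every iterated directional derivative of order
   at most k exists and is continuous at every point of U. *)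
Fixpoint Ck_on (k : nat) (U : set V) (f : V -> W) : Prop :=
  (forall x, U x -> {for x, continuous f}) /\
  (if k is k'.+1 then forall v : V,
     (forall x, U x -> derivable f x v) /\ Ck_on k' U (fun x => 'D_v f x)
   else True).

Definition smooth_on (U : set V) (f : V -> W) := forall k, Ck_on k U f.

End Smooth.

Section LieGroup.
Variables (R : realType) (G : topGroupType) (n : nat).

Record chart := Chart {
  chart_dom : set G ;
  chart_map : G -> 'rV[R]_n ;
  chart_inv : 'rV[R]_n -> G
}.

Definition chart_img (c : chart) := chart_map c @` chart_dom c.

Definition is_chart (c : chart) := [/\ open (chart_dom c), open (chart_img c),
  forall x, chart_dom c x -> chart_inv c (chart_map c x) = x,
  forall x, chart_dom c x -> {for x, continuous (chart_map c)} &
  forall y, chart_img c y -> {for y, continuous (chart_inv c)}].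

Definition is_atlas (A : set chart) := [/\ A `<=` is_chart,
  forall x, exists2 c, A c & chart_dom c x &
  forall c d, A c -> A d ->
    smooth_on (chart_map c @` (chart_dom c `&` chart_dom d))
              (chart_map d \o chart_inv c)].

Definition is_lie_group (A : set chart) := [/\ hausdorff_space G, is_atlas A,
  forall a b c, A a -> A b -> A c ->
    smooth_on [set y : 'rV[R]_n * 'rV[R]_n | [/\ chart_img a y.1,
                 chart_img b y.2 &
                 chart_dom c (chart_inv a y.1 * chart_inv b y.2)%g]]
      (fun y => chart_map c (chart_inv a y.1 * chart_inv b y.2)%g) &
  forall a b, A a -> A b ->
    smooth_on [set y : 'rV[R]_n | chart_img a y /\
                 chart_dom b (chart_inv a y)^-1%g]
      (fun y => chart_map b (chart_inv a y)^-1%g)].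

Variable A : set chart.

Definition smooth_fun (f : G -> R) :=
  forall c, A c -> smooth_on (chart_img c) (f \o chart_inv c).

Definition smooth_curve (gamma : R -> G) := continuous gamma /\
  forall c, A c -> smooth_on (gamma @^-1` chart_dom c) (chart_map c \o gamma).

(* joint smoothness of h on ]0, +oo[ * G *)
Definition smooth_pos_time (h : R -> G -> R) := forall c, A c ->
  smooth_on [set y : R * 'rV[R]_n | 0 < y.1 /\ chart_img c y.2]
            (fun y => h y.1 (chart_inv c y.2)).

Definition one_param (gamma : R -> G) := smooth_curve gamma /\
  forall s t, gamma (s + t) = (gamma s * gamma t)%g.

Section LieAlgebra.
Variables (g : vectType R) (exp : g -> G) (br : g -> g -> g).

(* action of X on functions as a left-invariant vector field *)
Definition linv_field (X : g) (f : G -> R) : G -> R :=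
  fun x => derive1 (fun s : R => f (x * exp (s *: X))%g) 0.

(* (g, br) is the Lie algebra of G, with exponential map exp: g parametrizes
   the one-parameter subgroups of G, and its linear structure and bracket are
   those of the left-invariant vector fields. *)
Record is_lie_algebra : Prop := IsLieAlgebra {
  exp_one_param : forall X, one_param (fun s => exp (s *: X)) ;
  one_param_exp : forall gamma, one_param gamma ->
    exists! X, forall s, gamma s = exp (s *: X) ;
  linv_field_linear : forall a X Y f, smooth_fun f -> forall x,
    linv_field (a *: X + Y) f x = a * linv_field X f x + linv_field Y f x ;
  linv_field_bracket : forall X Y f, smooth_fun f -> forall x,
    linv_field (br X Y) f x =
    linv_field X (linv_field Y f) x - linv_field Y (linv_field X f) x
}.

End LieAlgebra.
End LieGroup.

Section Groups.
Variable G : topGroupType.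

Definition is_subgroup (K : set G) := [/\ K 1%g,
  forall x y, K x -> K y -> K (x * y)%g & forall x, K x -> K x^-1%g].

Definition maximal_compact_subgroup (K : set G) :=
  [/\ is_subgroup K, compact K &
      forall L, is_subgroup L -> compact L -> K `<=` L -> L = K].

Definition group_center : set G := [set z | forall x, (z * x = x * z)%g].

Definition right_invariant {T : Type} (K : set G) (f : G -> T) :=
  forall x k, K k -> f (x * k)%g = f x.

Definition bi_invariant {T : Type} (K : set G) (f : G -> T) :=
  right_invariant K f /\ forall x k, K k -> f (k * x)%g = f x.

End Groups.

Section LieAlgebraStructure.
Variables (R : realType) (g : vectType R) (br : g -> g -> g).

Definition ad (X : g) : 'End(g) := linfun (br X).

Definition lftrace (f : 'End(g)) : R :=
  \sum_(i < \dim {:g}) coord (vbasis {:g}) i (f (vbasis {:g})`_i).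

Definition killing (X Y : g) : R := lftrace (ad X \o ad Y)%VF.

Definition semisimple := forall X, (forall Y, killing X Y = 0) -> X = 0.

(* The Killing form is positive definite only on p, where knorm is used. *)
Definition knorm (X : g) : R := Num.sqrt (killing X X).

Definition is_cartan_involution (theta : 'End(g)) := [/\
  forall X Y, theta (br X Y) = br (theta X) (theta Y),
  forall X, theta (theta X) = X &
  forall X, X != 0 -> 0 < - killing X (theta X)].

Definition cartan_p (theta : 'End(g)) : {vspace g} := lker (theta + \1)%VF.

Definition orthonormal_basis (p : {vspace g}) (E : seq g) := basis_of p E /\
  forall i j, (i < size E)%N -> (j < size E)%N ->
    killing E`_i E`_j = (i == j)%:R.

Definition abelian_subspace (a : {vspace g}) :=
  forall X Y, X \in a -> Y \in a -> br X Y = 0.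

Definition maximal_abelian (p a : {vspace g}) := [/\ (a <= p)%VS,
  abelian_subspace a &
  forall b : {vspace g}, (a <= b)%VS -> (b <= p)%VS -> abelian_subspace b ->
    b = a].

Variable a : {vspace g}.

(* { X | [H, X] = <alpha, H> X for all H in a } *)
Definition root_space (alpha : g) : {vspace g} :=
  (\bigcap_(H <- vbasis a) lker (ad H - killing alpha H *: \1)%VF)%VS.

(* a is identified with its dual by the Killing form *)
Definition is_root (alpha : g) : bool :=
  [&& alpha \in a, alpha != 0 & root_space alpha != 0%VS].

Definition multiplicity (alpha : g) : nat := \dim (root_space alpha).

(* Sp lists a choice of positive roots without repetition. *)
Definition positive_system (Sp : seq g) := [/\ uniq Sp,
  forall alpha, is_root alpha = (alpha \in Sp) || (- alpha \in Sp),
  forall alpha, alpha \in Sp -> - alpha \notin Sp &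
  forall alpha beta, alpha \in Sp -> beta \in Sp -> is_root (alpha + beta) ->
    alpha + beta \in Sp].

Definition rho (Sp : seq g) : g :=
  2^-1 *: \sum_(alpha <- Sp) (multiplicity alpha)%:R *: alpha.

Definition reduced_roots (Sp : seq g) : seq g :=
  [seq alpha <- Sp | ~~ is_root (2^-1 *: alpha)].

End LieAlgebraStructure.

Section Analysis.
Variable R : realType.

Definition Gamma (z : R) : R :=
  \int[lebesgue_measure]_(x in `]0, +oo[) (x `^ (z - 1) * expR (- x)).

(* volume of the unit ball of the Euclidean space of dimension d *)
Definition unit_ball_volume (d : nat) : R :=
  pi `^ (d%:R / 2) / Gamma (d%:R / 2 + 1).

Variable G : topGroupType.

Definition borel : measurableType _ := g_sigma_algebraType (@open G).

Implicit Types mu : {measure set borel -> \bar R}.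

Definition is_haar mu := [/\
  forall (x : G) (B : set borel), measurable B ->
    mu ((fun y : G => (x * y)%g) @^-1` B) = mu B,
  forall C : set G, compact C -> (mu C < +oo)%E &
  forall U : set G, open U -> U !=set0 -> (0 < mu U)%E].

Definition convolution mu (f k : G -> R) : G -> R :=
  fun x => \int[mu]_y (f y * k (y^-1 * x)%g).

Section Space.
Variables (K : set G) (g : vectType R) (exp : g -> G) (br : g -> g -> g).
Variable (p : {vspace g}).

(* preimage in G of the geodesic ball of radius r centered at the base point
   of G/K: its geodesics through that point are s |-> exp (s X) K, X in p *)
Definition geodesic_ball (r : R) : set G :=
  [set x | exists X k, [/\ X \in p, knorm br X < r, K k & x = (exp X * k)%g]].

(* The Riemannian measure of G/K is singled out among the G-invariant ones by
   vol B(o, r) ~ r^d * (volume of the Euclidean unit ball), as r -> 0. *)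
Definition riemannian_normalized mu :=
  fine (mu (geodesic_ball r)) / r ^+ \dim p @[r --> 0^'+] -->
  unit_ball_volume (\dim p).

Variable E : seq g.

(* Laplace-Beltrami operator as the trace of the Hessian, computed along the
   geodesics s |-> x exp (s X) K, X in an orthonormal basis E of p. *)
Definition laplacian (f : G -> R) : G -> R :=
  fun x => \sum_(X <- E) derive1n 2 (fun s : R => f (x * exp (s *: X))%g) 0.

(* h is the kernel of the heat semigroup, exp(u Delta) f = f * h_u: the
   fundamental solution of the heat equation on G/K. Since G/K is complete with
   Ricci curvature bounded below, it is stochastically complete (hence the total
   mass 1) and these conditions determine h u for all u > 0. The values h u for
   u <= 0 are irrelevant. *)
Definition is_heat_kernel n (A : set (chart R G n)) mu (h : R -> G -> R) :=
  [/\ smooth_pos_time A h,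
      forall u, 0 < u -> bi_invariant K (h u),
      forall u, 0 < u -> (forall x, 0 <= h u x) /\
                         (\int[mu]_x (h u x)%:E = 1)%E,
      forall u x, 0 < u -> derive1 (h^~ x) u = laplacian (h u) x &
      forall f : G -> R, continuous f -> right_invariant K f ->
        (exists2 C, compact C & forall x, ~ C x -> f x = 0) ->
        forall x, convolution mu f (h u) x @[u --> 0^'+] --> f x].

End Space.

(* Q_t^sigma; the integral is taken to be 0 if it diverges (it never does for
   the heat kernel and t > 0). *)
Definition extension_kernel (h : R -> G -> R) (sigma t : R) : G -> R :=
  fun x => t `^ (2 * sigma) / (2 `^ (2 * sigma) * Gamma sigma) *
    \int[lebesgue_measure]_(u in `]0, +oo[)
      (h u x * expR (- (t ^+ 2 / (4 * u))) / u `^ (1 + sigma)).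

Definition cintegrable mu (f : G -> R[i]) :=
  mu.-integrable setT (EFin \o (fun x => complex.Re (f x))) /\
  mu.-integrable setT (EFin \o (fun x => complex.Im (f x))).

Definition cintegral mu (f : G -> R[i]) : R[i] :=
  Complex (\int[mu]_x complex.Re (f x)) (\int[mu]_x complex.Im (f x)).

Definition cconvolution mu (f : G -> R[i]) (k : G -> R) : G -> R[i] :=
  fun x => cintegral mu (fun y => f y * (k (y^-1 * x)%g)%:C%C).

Definition cLnorm mu (q : R) (f : G -> R[i]) : \bar R :=
  Lnorm mu q%:E (fun x => (ComplexField.Normc.normc (f x))%:E).

End Analysis.

(* Main.v *)
(** The estimate leaves exponential room, so crude bounds on the heat kernel suffice:
    with d = dim p, h_u <= C u^-d for small u and h_u <= C e^(- |rho|^2 u) for large u.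
    Cut the integral defining Q_t at u = 4 t / |rho|. The first part is at most about
    e^(- |rho| t) and its mass is exponentially small, because the weight e^(- t^2 / 4u)
    is; the second part has bounded mass and is at most C e^(- 2 |rho| t). As the L^p norm
    of f satisfies |f|_p^p <= (sup f)^(p-1) |f|_1, both Q_t and |v_0| * Q_t are
    o(t^b e^(- |rho| t / p')) in L^p for every b.

    The decay of the heat kernel comes from the L^2 gap |rho|^2 |v|^2 <= |grad v|^2. Let
    n be the sum of the positive root spaces, P_x the orthogonal projection onto
    Ad(x^-1) n and b_X(x) = tr (P_x ad X). Then over an orthonormal basis of p the sum of
    the b_X^2 is |2 rho|^2 everywhere, while the sum of the - X b_X is at least
    |2 rho|^2, so that the gap follows by integrating by parts. Applied to f * h_u for a
    bump f, this makes the energy decay exponentially; for small u, Nash's argument uses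
    the volume of small geodesic balls in place of the gap. Symmetry of the heat flow
    turns the energy bounds into pointwise ones. *)
From HB Require Import structures.
Require Import Defs.
From mathcomp Require Import all_boot all_order all_algebra.
From mathcomp Require Import all_classical all_reals all_analysis.
From mathcomp Require Import complex.
From mathcomp Require Import ring lra measurable_realfun.
Set Implicit Arguments.
Unset Strict Implicit.
Unset Printing Implicit Defensive.
Import Order.TTheory GRing.Theory Num.Theory.
Import numFieldNormedType.Exports.
Local Open Scope classical_set_scope.
Local Open Scope ring_scope.

(** What shapes the proof is how little structure theory is at hand: neither the Iwasawa and polar
    decompositions nor the unimodularity of G, the semigroup law or the symmetry of [h] is a
    hypothesis. For X in p the drift b_X is the derivative along X of 2 rho of the Iwasawa
    projection of NAK, a horospherical function; describing it by the subspaces Ad(x^-1) n makes its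
    derivative computable from Ad alone. Integration by parts needs a right invariant measure: the
    modular function is 1 on exp g because g is perfect, on K because K is compact, and elsewhere
    because exp(p) K, not yet known to be G, has positive volume. The symmetry of the flow is the
    constancy of s |-> <F_s, H_(w-s)> for two solutions, up to cutoffs with gradient O(1/m). In the
    last step p - 1 = p / p', so that (sup)^(p-1) already decays like the p-th power of the target
    rate, up to an arbitrarily small loss, and the small mass provides the spare exponential that
    absorbs every power of t. *)

Section Lines.
Context {R : realType} {V W : normedModType R}.
Implicit Types (f : V -> W).

Lemma is_derive_line f (y w : V) (t : R) : derivable f (y + t *: w) w ->
  is_derive t 1 (fun s => f (y + s *: w)) ('D_w f (y + t *: w)).
Proof.
have E : (fun h : R => h^-1 *: (f (h *: w + (y + t *: w)) - f (y + t *: w))) =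
   (fun h : R => h^-1 *: (f (y + (h *: 1 + t) *: w) - f (y + t *: w))).
  apply/funext => h; congr (_ *: (f _ - _)).
  by rewrite scalerDl addrCA -[h *: 1]/(h * 1) mulr1.
by rewrite /derivable /derive => df; split; rewrite /derivable /derive /= -E.
Qed.

(** Directional derivability says nothing about other directions, except for multiples of w: these
    are handled by the one-variable function s |-> f (x + s w), which is differentiable at 0. *)
Lemma is_derive_scalev f (x w : V) (a : R) : derivable f x w ->
  is_derive x (a *: w) f (a *: 'D_w f x).
Proof.
have [->|a0] := eqVneq a 0.
  by rewrite !scale0r => _; exact: is_derive0.
move=> /(@derivableP _ _ _ f x w) H.
have L : differentiable (fun s : R => f (x + s *: w)) 0.
  apply/derivable1_diffP.
  have [] := @is_derive_line f x w 0 _; first by rewrite scale0r addr0.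
  by [].
have D1 : is_derive (0:R) (1:R) (fun s => f (x + s *: w)) ('D_w f x).
  have := @is_derive_line f x w 0; rewrite scale0r addr0; apply.
  by case: H.
have E : (fun h : R => h^-1 *: (f (h *: (a *: w) + x) - f x)) =
   (fun h : R => h^-1 *: ((fun s => f (x + s *: w)) (h *: a + 0)  - (fun s => f (x + s *: w)) 0)).
  apply/funext => h /=; congr (_ *: (f _ - f _)); last by rewrite scale0r addr0.
  by rewrite addr0 addrC scalerA.
suff : is_derive (0:R) a (fun s => f (x + s *: w)) (a *: 'D_w f x).
  by move=> [K1 K2]; split; rewrite /derivable /derive E.
split; first exact: diff_derivable.
rewrite deriveE //.
have -> : a = a *: (1 : R) by rewrite -[a *: _]/(a * 1) mulr1.
rewrite linearZ /= -deriveE // derive_val.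
by rewrite -[a *: 1]/(a * 1) mulr1.
Qed.

End Lines.

Section LinesR.
Context {R : realType} {V : normedModType R}.

Lemma line_MVT (f : V -> R) (y w : V) :
  (forall t : R, 0 <= t <= 1 -> derivable f (y + t *: w) w) ->
  exists2 t : R, 0 < t < 1 & f (y + w) - f y = 'D_w f (y + t *: w).
Proof.
move=> H.
have [||c] := @MVT R (fun s => f (y + s *: w)) (fun t => 'D_w f (y + t *: w)) 0 1 ltr01.
- move=> t; rewrite in_itv /= => /andP[t0 t1].
  by apply: is_derive_line; apply: H; rewrite !ltW.
- apply: derivable_within_continuous => t; rewrite in_itv /= => tI.
  by have [] := @is_derive_line _ _ _ f y w t (H t tI).
rewrite in_itv /= => c01; rewrite scale1r scale0r addr0 subr0 mulr1 => E.
by exists c.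
Qed.

Lemma line_MVTZ (f : V -> R) (y w : V) (a : R) :
  (forall t : R, `|t| <= `|a| -> derivable f (y + t *: w) w) ->
  exists2 t : R, `|t| <= `|a| & f (y + a *: w) - f y = a * 'D_w f (y + t *: w).
Proof.
move=> H.
have tb (t : R) : 0 <= t <= 1 -> `|t * a| <= `|a|.
  by move=> /andP[t0 t1]; rewrite normrM ger0_norm // ler_piMl.
have [t /andP[t0 t1]|t /andP[t0 t1] ->] := @line_MVT f y (a *: w).
  rewrite scalerA; apply: (ex_derive (is_derive := is_derive_scalev a _)).
  by apply: H; apply: tb; rewrite t0 t1.
exists (t * a); first by apply: tb; rewrite !ltW.
have h : derivable f (y + (t * a) *: w) w by apply: H; apply: tb; rewrite !ltW.
by rewrite scalerA; have [_ ->] := is_derive_scalev a h.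
Qed.

End LinesR.

(** * Calculus of C^k functions *)

Section CkBasics.
Context {R : realType}.
Implicit Types (V W : normedModType R).

Lemma Ck_on_cont V W k (U : set V) (f : V -> W) : Ck_on k U f ->
  forall x, U x -> {for x, continuous f}.
Proof. by case: k => [|k] []. Qed.

Lemma Ck_on_derivable V W k (U : set V) (f : V -> W) x v : Ck_on k.+1 U f ->
  U x -> derivable f x v.
Proof. by move=> [_ /(_ v)[+ _]]; apply. Qed.

Lemma Ck_on_D V W k (U : set V) (f : V -> W) v : Ck_on k.+1 U f ->
  Ck_on k U (fun x => 'D_v f x).
Proof. by move=> [_ /(_ v)[_ ]]. Qed.

Lemma Ck_onS V W k (U : set V) (f : V -> W) : Ck_on k.+1 U f -> Ck_on k U f.
Proof.
elim: k f => [|k IH] f Hf; first by split=> //; exact: (Ck_on_cont Hf).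
split; first exact: (Ck_on_cont Hf).
move=> v; split=> [x Ux|]; first exact: (Ck_on_derivable Hf).
by apply: IH; exact: Ck_on_D.
Qed.

Lemma Ck_on_le V W k l (U : set V) (f : V -> W) : (l <= k)%N ->
  Ck_on k U f -> Ck_on l U f.
Proof.
move=> /subnK <-; elim: (k - l)%N => // m IH /Ck_onS; exact: IH.
Qed.

Lemma Ck_on_sub V W k (U U' : set V) (f : V -> W) : U' `<=` U ->
  Ck_on k U f -> Ck_on k U' f.
Proof.
move=> UU'; elim: k f => [|k IH] f Hf.
  by split=> // x /UU'; exact: (Ck_on_cont Hf).
split=> [x /UU'|v]; first exact: (Ck_on_cont Hf).
by split=> [x /UU'|]; [exact: (Ck_on_derivable Hf)|exact/IH/Ck_on_D].
Qed.

Lemma Ck_on_ext V W k (U : set V) (f g : V -> W) : open U ->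
  (forall x, U x -> f x = g x) -> Ck_on k U f -> Ck_on k U g.
Proof.
move=> oU; elim: k f g => [|k IH] f g fg Hf.
  split=> // x Ux; have := Ck_on_cont Hf Ux.
  rewrite /prop_for /continuous_at -(fg x) //; apply: cvg_trans; apply: near_eq_cvg.
  by near=> y; rewrite fg //; near: y; exact: open_nbhs_nbhs.
have c : forall x, U x -> {for x, continuous g}.
  move=> x Ux; have := Ck_on_cont Hf Ux.
  rewrite /prop_for /continuous_at -(fg x) //; apply: cvg_trans; apply: near_eq_cvg.
  by near=> y; rewrite fg //; near: y; exact: open_nbhs_nbhs.
split=> // v.
(* The direction 0 is treated apart, since [near_eq_derivable] and [near_eq_derive] ask for a
   nonzero direction. *)
have [v0|v0] := eqVneq v 0.
  split=> [x _|]; first by rewrite v0; exact: derivable0.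
  apply: (IH (fun x => 'D_v f x)); last exact: Ck_on_D Hf.
  by move=> x _; rewrite v0 !derive0.
have nfg x : U x -> {near x, f =1 g}.
  by move=> Ux; near=> y; apply: fg; near: y; exact: open_nbhs_nbhs.
split=> [x Ux|].
  apply: (near_eq_derivable (f := f)) => //; first exact: nfg.
  exact: (Ck_on_derivable Hf).
apply: (IH (fun x => 'D_v f x)); last exact: Ck_on_D Hf.
by move=> x Ux; apply: near_eq_derive => //; exact: nfg.
Unshelve. all: by end_near. Qed.

Lemma Ck_on_local V W k (U : set V) (f : V -> W) :
  (forall x, U x -> exists D : set V, [/\ open D, D x & Ck_on k D f]) -> Ck_on k U f.
Proof.
elim: k f => [|k IH] f H.
  by split=> // x /H [D [_ Dx /Ck_on_cont h]]; apply: h.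
split=> [x /H [D [_ Dx /Ck_on_cont h]]|v]; first exact: h.
split=> [x /H [D [_ Dx HD]]|]; first exact: (Ck_on_derivable HD).
by apply: IH => x /H [D [oD Dx HD]]; exists D; split=> //; exact: Ck_on_D.
Qed.

Lemma Ck_on_cst V W k (U : set V) (a : W) : Ck_on k U (fun _ => a).
Proof.
elim: k a => [|k IH] a; first by split=> // x _; exact: cvg_cst.
split=> [x _|v]; first exact: cvg_cst.
split=> [x _|]; first exact: derivable_cst.
have -> : 'D_v (fun _ : V => a) = fun _ => 0; last exact: IH.
by apply/funext => x; rewrite derive_cst.
Qed.

Lemma Ck_on_lin V W k (U : set V) (l : {linear V -> W}) : continuous l -> Ck_on k U l.
Proof.
move=> lc; have dl x v : is_derive x v l (l v).
  have := linear_differentiable x lc => dl; split; first exact: diff_derivable.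
  by rewrite deriveE // diff_lin.
case: k => [|k]; first by split=> // x _; exact: lc.
split=> [x _|v]; first exact: lc.
split=> [x _|]; first by case: (dl x v).
have -> : 'D_v l = fun _ => l v; last exact: Ck_on_cst.
by apply/funext => x; have [_ ->] := dl x v.
Qed.

Lemma Ck_on_add V W k (U : set V) (f g : V -> W) : open U ->
  Ck_on k U f -> Ck_on k U g -> Ck_on k U (fun x => f x + g x).
Proof.
move=> oU; elim: k f g => [|k IH] f g Hf Hg.
  by split=> // x Ux; apply: cvgD; [exact: (Ck_on_cont Hf)|exact: (Ck_on_cont Hg)].
split=> [x Ux|v].
  by apply: cvgD; [exact: (Ck_on_cont Hf)|exact: (Ck_on_cont Hg)].
split=> [x Ux|].
  by apply: derivableD; [exact: (Ck_on_derivable Hf)|exact: (Ck_on_derivable Hg)].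
apply: (@Ck_on_ext _ _ _ _ (fun x => 'D_v f x + 'D_v g x)) => //.
  move=> x Ux; rewrite deriveD //; first exact: (Ck_on_derivable Hf).
  exact: (Ck_on_derivable Hg).
by apply: IH; exact: Ck_on_D.
Qed.

Lemma Ck_on_linl V W W' k (U : set V) (f : V -> W) (l : W -> W') : open U ->
  (forall a x, l (a *: x) = a *: l x) -> (forall x y, l (x - y) = l x - l y) ->
  continuous l -> Ck_on k U f -> Ck_on k U (fun x => l (f x)).
Proof.
move=> oU lZ lB lc; elim: k f => [|k IH] f Hf.
  by split=> // x Ux; apply: continuous_comp; [exact: (Ck_on_cont Hf)|exact: lc].
split=> [x Ux|v].
  by apply: continuous_comp; [exact: (Ck_on_cont Hf)|exact: lc].
have E x : U x -> is_derive x v (fun x => l (f x)) (l ('D_v f x)).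
  move=> Ux; have dfx := Ck_on_derivable (v:=v) Hf Ux.
  have : h^-1 *: ((l \o f) (h *: v + x) - (l \o f) x) @[h --> 0^'] --> l ('D_v f x).
    rewrite (_ : (fun h => _) = l \o (fun h => h^-1 *: (f (h *: v + x) - f x))).
      by apply: continuous_cvg; [exact: lc|exact: dfx].
    by apply/funext => h /=; rewrite lZ lB.
  move=> L; split; last by apply/cvg_lim => //; exact: L.
  by apply/cvg_ex; exists (l ('D_v f x)); exact: L.
split=> [x Ux|]; first by have [] := E x Ux.
apply: (@Ck_on_ext _ _ _ _ (fun x => l ('D_v f x))) => //.
  by move=> x Ux; have [_ ->] := E x Ux.
by apply: IH; exact: Ck_on_D.
Qed.

Lemma Ck_on_sum V W k (U : set V) n (f : 'I_n -> V -> W) : open U ->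
  (forall i, Ck_on k U (f i)) -> Ck_on k U (fun x => \sum_i f i x).
Proof.
move=> oU; elim: n f => [|n IH] f H.
  under [X in Ck_on _ _ X]funext do rewrite big_ord0.
  exact: Ck_on_cst.
under [X in Ck_on _ _ X]funext do rewrite big_ord_recl.
by apply: Ck_on_add => //; exact: IH.
Qed.

Lemma Ck_on_mul V k (U : set V) (f g : V -> R) : open U ->
  Ck_on k U f -> Ck_on k U g -> Ck_on k U (fun x => f x * g x).
Proof.
move=> oU; elim: k f g => [|k IH] f g Hf Hg.
  by split=> // x Ux; apply: cvgM; [exact: (Ck_on_cont Hf)|exact: (Ck_on_cont Hg)].
split=> [x Ux|v].
  by apply: cvgM; [exact: (Ck_on_cont Hf)|exact: (Ck_on_cont Hg)].
split=> [x Ux|].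
  by apply: derivableM; [exact: (Ck_on_derivable Hf)|exact: (Ck_on_derivable Hg)].
apply: (@Ck_on_ext _ _ _ _ (fun x => f x * 'D_v g x + g x * 'D_v f x)) => //.
  move=> x Ux; rewrite deriveM //; first exact: (Ck_on_derivable Hf).
  exact: (Ck_on_derivable Hg).
by apply: Ck_on_add => //; apply: IH => //; (exact: Ck_on_D || exact: Ck_onS).
Qed.

Lemma Ck_on_mx V n k (U : set V) (f : V -> 'rV[R]_n) : open U ->
  (forall j, Ck_on k U (fun x => f x ord0 j)) -> Ck_on k U f.
Proof.
move=> oU H.
have -> : f = fun x => \sum_j (fun x => f x ord0 j *: (delta_mx ord0 j : 'rV[R]_n)) x.
  by apply/funext => x; rewrite {1}(row_sum_delta (f x)); apply: eq_bigr => j _.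
apply: Ck_on_sum => // j.
apply: (@Ck_on_linl _ R^o _ _ _ _ ( *:%R^~ (delta_mx ord0 j : 'rV[R]_n))) => //.
- by move=> a b; rewrite scalerA.
- by move=> a b; rewrite scalerBl.
- exact: scalel_continuous.
Qed.

Lemma Ck_on_coord V n k (U : set V) (f : V -> 'rV[R]_n) j : open U ->
  Ck_on k U f -> Ck_on k U (fun x => f x ord0 j).
Proof.
move=> oU; apply: (@Ck_on_linl _ _ R^o _ _ _ (fun M : 'rV[R]_n => M ord0 j)) => //.
- by move=> a b; rewrite mxE.
- by move=> a b; rewrite !mxE.
- exact: coord_continuous.
Qed.

End CkBasics.

(** Finite dimension, as a finite system of continuous linear coordinates. [Ck_on] speaks of one
    direction at a time; such coordinates are what assembles the partial derivatives into a
    differential. *)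
Record fincoord (R : realType) (V : normedModType R) := Fincoord {
  fdim : nat ;
  fvec : 'I_fdim -> V ;
  fcrd : 'I_fdim -> V -> R ;
  fcrdZ : forall i a x, fcrd i (a *: x) = a * fcrd i x ;
  fcrdD : forall i x y, fcrd i (x + y) = fcrd i x + fcrd i y ;
  fcrd_cont : forall i, continuous (fcrd i) ;
  fcrdE : forall x, x = \sum_i fcrd i x *: fvec i
}.

Arguments fvec {R V} f i.
Arguments fcrd {R V} f i x.

Section FincoordInst.
Context {R : realType}.

Lemma fincoordR : fincoord R^o.
Proof.
refine (@Fincoord R R^o 1 (fun _ => 1) (fun _ x => x) _ _ _ _) => //.
- by move=> _ x; exact: cvg_id.
- by move=> x; rewrite big_ord1 -[_ *: _]/(_ * _) mulr1.
Defined.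

Lemma fincoord_rV n : fincoord ('rV[R]_n).
Proof.
refine (@Fincoord R _ n (fun j => delta_mx ord0 j) (fun j x => x ord0 j) _ _ _ _).
- by move=> i a x; rewrite mxE.
- by move=> i x y; rewrite mxE.
- by move=> i; exact: coord_continuous.
- exact: row_sum_delta.
Defined.

Lemma fincoord_prod (V W : normedModType R) : fincoord V -> fincoord W ->
  fincoord (V * W)%type.
Proof.
move=> cV cW.
refine (@Fincoord R _ (fdim cV + fdim cW)
  (fun i => match fintype.split i with inl j => (fvec cV j, 0) | inr j => (0, fvec cW j) end)
  (fun i x => match fintype.split i with inl j => fcrd cV j x.1 | inr j => fcrd cW j x.2 end) _ _ _ _).
- by move=> i a x; case: fintype.split => j; rewrite fcrdZ.
- by move=> i x y; case: fintype.split => j; rewrite fcrdD.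
- move=> i; case: fintype.split => j x.
    by apply: continuous_comp; [exact: cvg_fst|exact: fcrd_cont].
  by apply: continuous_comp; [exact: cvg_snd|exact: fcrd_cont].
- move=> [x y]; rewrite big_split_ord /=.
  under eq_bigr do rewrite (unsplitK (inl _)).
  under [X in _ + X]eq_bigr do rewrite (unsplitK (inr _)).
  rewrite {1}(fcrdE cV x) {1}(fcrdE cW y).
  have E1 n (a : 'I_n -> R) (v : 'I_n -> V) :
      \sum_(i < n) a i *: (v i, 0 : W) = (\sum_(i < n) a i *: v i, 0).
    elim: n a v => [|n IH] a v; first by rewrite !big_ord0.
    by rewrite !big_ord_recl IH; congr pair; rewrite /= ?scaler0 ?addr0.
  have E2 n (a : 'I_n -> R) (v : 'I_n -> W) :
      \sum_(i < n) a i *: (0 : V, v i) = (0, \sum_(i < n) a i *: v i).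
    elim: n a v => [|n IH] a v; first by rewrite !big_ord0.
    by rewrite !big_ord_recl IH; congr pair; rewrite /= ?scaler0 ?addr0.
  by rewrite E1 E2; congr pair; rewrite /= ?addr0 ?add0r.
Defined.
End FincoordInst.

(** * Chain rule and symmetry of second derivatives *)

Section ChainRule.
Context {R : realType}.
Implicit Types (V W : normedModType R).

Lemma sum_cont V n (f : 'I_n -> V -> R) : (forall i, continuous (f i)) ->
  continuous (fun x => \sum_i f i x).
Proof.
move=> H x.
have : Ck_on 0 setT (fun x => \sum_i f i x : R^o).
  by apply: Ck_on_sum => [|i]; [exact: openT|split=> // y _; exact: H].
by move=> /Ck_on_cont; apply.
Qed.

(** The summand 1 lets one bound serve twice in [Ck1_differentiable]: for the displacement, a sum of
    |h_i| |e_i|, and for the error, a multiple of the sum of the |h_i|. *)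
Lemma fcrd_bound V (c : fincoord V) : exists2 C : R, 0 < C &
  forall h, \sum_i `|fcrd c i h| * (`|fvec c i| + 1) <= C * `|h|.
Proof.
suff H i : exists2 C : R, 0 < C & forall h, `|fcrd c i h| <= C * `|h|.
  pose C i := sval (cid2 (H i)).
  have C0 i : 0 < C i by rewrite /C; case: cid2.
  have HC i h : `|fcrd c i h| <= C i * `|h| by rewrite /C; case: cid2.
  exists (1 + \sum_i C i * (`|fvec c i| + 1)).
    rewrite ltr_wpDr //; apply: sumr_ge0 => i _.
    by rewrite mulr_ge0 ?ltW// ltr_wpDl.
  move=> h; rewrite mulrDl mul1r ler_wpDl // mulr_suml; apply: ler_sum => i _.
  by rewrite mulrAC ler_wpM2r // addr_ge0.
have lin : linear (fcrd c i : V -> R^o) by move=> a u v; rewrite fcrdD fcrdZ.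
pose l : {linear V -> R^o} := HB.pack (fcrd c i : V -> R^o) (GRing.isLinear.Build _ _ _ _ _ lin).
have [|C C0 HC] := @linear_lipschitz _ _ _ l.
  exact: fcrd_cont.
by exists C.
Qed.

(** Continuous partial derivatives give differentiability: go from x to x + h one coordinate at a
    time, apply the mean value theorem on each leg, and compare each partial derivative with its
    value at x. *)
Lemma Ck1_differentiable V (c : fincoord V) (U : set V) (g : V -> R) x :
  open U -> Ck_on 1 U g -> U x -> differentiable g x.
Proof.
move=> oU Hg Ux.
pose dg (h : V) := \sum_i fcrd c i h * 'D_(fvec c i) g x.
have dgL : linear (dg : V -> R^o).
  move=> a u v; rewrite /dg scaler_sumr -big_split /=; apply: eq_bigr => i _.
  by rewrite fcrdD fcrdZ mulrDl -mulrA.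
pose dgl : {linear V -> R^o} := HB.pack (dg : V -> R^o) (GRing.isLinear.Build _ _ _ _ _ dgL).
have dgc : continuous dgl.
  apply: sum_cont => i y; apply: cvgM; [exact: fcrd_cont|exact: cvg_cst].
have [C C0 HC] := fcrd_bound c.
suff L : (g : V -> R^o) \o shift x = cst (g x) + dgl +o_ 0 id.
  have E := diff_unique dgc L.
  by apply/diff_locallyP; split; rewrite E.
apply/eqaddoP => e e0 /=.
have e1 : 0 < e / C by rewrite divr_gt0.
have HU : \forall y \near x, U y by exact: open_nbhs_nbhs.
have HD : \forall y \near x, forall i, `|'D_(fvec c i) g x - 'D_(fvec c i) g y| <= e / C.
  apply: filter_forall => i.
  have /Ck_on_cont/(_ x Ux) := @Ck_on_D _ _ _ _ _ _ (fvec c i) Hg.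
  by move=> /cvgrPdist_le/(_ _ e1).
have [d /= d0 Hd] := (nbhs_ballP _ _).1 (filterI HU HD).
have d1 : 0 < d / C by rewrite divr_gt0.
apply/nbhs_ballP; exists (d / C) => // h; rewrite -ball_normE /= sub0r normrN => hd.
(* The vertex reached after the first j legs; [pb] keeps every leg inside the ball where the partial
   derivatives are close to those at x. *)
pose p (j : nat) := \sum_(i < fdim c | (i < j)%N) fcrd c i h *: fvec c i.
have hC : \sum_i `|fcrd c i h| * (`|fvec c i| + 1) < d.
  by apply: le_lt_trans (HC h) _; rewrite mulrC -ltr_pdivlMr.
have pb (i : 'I_(fdim c)) t : `|t| <= `|fcrd c i h| -> ball x d (x + p i + t *: fvec c i).
  move=> ht; rewrite -ball_normE /= -addrA opprD addrA subrr sub0r normrN.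
  apply: le_lt_trans hC; apply: le_trans (ler_normD _ _) _.
  rewrite [X in _ <= X](bigID (fun k : 'I_(fdim c) => (k < i)%N)) /=; apply: lerD.
    apply: le_trans (ler_norm_sum _ _ _) _; apply: ler_sum => k _.
    by rewrite normrZ ler_wpM2l // lerDl.
  rewrite (bigD1 i) ?ltnn //= ler_wpDr //; first by apply: sumr_ge0 => k _; rewrite mulr_ge0 ?addr_ge0.
  by rewrite normrZ; apply: ler_pM => //; rewrite lerDl.
have pS (i : 'I_(fdim c)) : p i.+1 = p i + fcrd c i h *: fvec c i.
  rewrite /p (bigD1 i) /= ?ltnSn // addrC; congr (_ + _); apply: eq_bigl => k.
  by rewrite ltnS leq_eqVlt -val_eqE /=; case: ltngtP.
have T n : (n <= fdim c)%N -> `|g (x + p n) - g x - \sum_(i < fdim c | (i < n)%N) fcrd c i h * 'D_(fvec c i) g x| <=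
   \sum_(i < fdim c | (i < n)%N) `|fcrd c i h| * (e / C).
  elim: n => [|n IH] nc.
    by rewrite /p !big_pred0 // addr0 subrr subr0 normr0.
  pose i := Ordinal nc.
  have sp (F : 'I_(fdim c) -> R) : \sum_(k < fdim c | (k < n.+1)%N) F k = F i + \sum_(k < fdim c | (k < n)%N) F k.
    rewrite (bigD1 i) /= ?ltnSn //; congr (_ + _); apply: eq_bigl => k.
    by rewrite ltnS leq_eqVlt -val_eqE /=; case: ltngtP.
  rewrite !sp (pS i) addrA /=.
  have [t|t tb Et] := @line_MVTZ _ _ g (x + p n) (fvec c i) (fcrd c i h).
    move=> /(pb i) /Hd [Uy _]; exact: (Ck_on_derivable Hg).
  have [_ /(_ i) Dt] := Hd _ (pb i t tb).
  rewrite (_ : _ - _ - _ = (g (x + p n + fcrd c i h *: fvec c i) - g (x + p n) - fcrd c i h * 'D_(fvec c i) g x) +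
     (g (x + p n) - g x - \sum_(k < fdim c | (k < n)%N) fcrd c k h * 'D_(fvec c k) g x)); last by ring.
  apply: le_trans (ler_normD _ _) _; apply: lerD; last by apply: IH; exact: ltnW.
  rewrite Et -mulrBr normrM ler_wpM2l // distrC.
  by [].
have := T _ (leqnn _).
under eq_bigl do rewrite ltn_ord.
under [X in _ <= X -> _]eq_bigl do rewrite ltn_ord.
have -> : p (fdim c) = h.
  by rewrite [RHS](fcrdE c) /p; apply: eq_bigl => i; rewrite ltn_ord.
move=> T'; apply: le_trans (_ : _ <= \sum_i `|fcrd c i h| * (e / C)) _.
  rewrite (_ : ((_ - _) h) = g (h + x) - (g x + dg h)) // addrC [h + x]addrC.
  by rewrite opprD addrC addrA; exact: T'.
rewrite -mulr_suml mulrCA ler_pM2l // -ler_pdivlMr ?invr_gt0 // invrK mulrC.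
apply: le_trans (HC h); apply: ler_sum => i _.
by rewrite ler_peMr // lerDr.
Qed.

(** Induction on k: the derivative along v is the sum over i of the i-th coordinate of D_v phi times
    the i-th partial of g at phi, and both factors have one derivative less to provide. *)
Lemma Ck_on_comp V W (cV : fincoord V) (cW : fincoord W) k (U : set V) (U' : set W)
    (phi : V -> W) (g : W -> R) :
  open U -> open U' -> (forall x, U x -> U' (phi x)) ->
  Ck_on k U phi -> Ck_on k U' g -> Ck_on k U (fun x => g (phi x)).
Proof.
move=> oU oU' UU'; elim: k g => [|k IH] g Hphi Hg.
  by split=> // x Ux; apply: continuous_comp; [exact: (Ck_on_cont Hphi)|exact/(Ck_on_cont Hg)/UU'].
split=> [x Ux|v].
  by apply: continuous_comp; [exact: (Ck_on_cont Hphi)|exact/(Ck_on_cont Hg)/UU'].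
have E x : U x -> is_derive x v (fun x => g (phi x)) (\sum_i fcrd cW i ('D_v phi x) * 'D_(fvec cW i) g (phi x)).
  move=> Ux.
  have dphi : derivable phi x v := Ck_on_derivable Hphi Ux.
  have dg : differentiable g (phi x) by apply: Ck1_differentiable oU' _ (UU' _ Ux) => //; exact: Ck_on_le Hg.
  have dline : differentiable (fun s : R => phi (x + s *: v)) 0.
    apply/derivable1_diffP.
    by have [] := @is_derive_line _ _ _ phi x v 0; rewrite ?scale0r ?addr0.
  have [_ Dline] : is_derive (0:R) (1:R) (fun s => phi (x + s *: v)) ('D_v phi x).
    by have := @is_derive_line _ _ _ phi x v 0; rewrite ?scale0r ?addr0; apply.
  have dg' : differentiable g ((fun s : R => phi (x + s *: v)) 0) by rewrite scale0r addr0.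
  have dcomp := differentiable_comp dline dg'.
  have EQ : (fun h : R => h^-1 *: (g (phi (h *: v + x)) - g (phi x))) =
    (fun h : R => h^-1 *: ((g \o (fun s : R => phi (x + s *: v))) (h *: 1 + 0) - (g \o (fun s : R => phi (x + s *: v))) 0)).
    apply/funext => h /=; congr (_ *: (g (phi _) - g (phi _))).
      by rewrite addr0 addrC -[h *: 1]/(h * 1) mulr1.
    by rewrite scale0r addr0.
  suff : is_derive (0:R) (1:R) (g \o (fun s : R => phi (x + s *: v))) (\sum_i fcrd cW i ('D_v phi x) * 'D_(fvec cW i) g (phi x)).
    by move=> [K1 K2]; split; rewrite /derivable /derive EQ.
  split; first exact: diff_derivable.
  rewrite deriveE // diff_comp //= -(deriveE _ dline) Dline scale0r addr0.
  rewrite [in LHS](fcrdE cW ('D_v phi x)) linear_sum; apply: eq_bigr => i _.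
  by rewrite linearZ /= -deriveE.
split=> [x Ux|]; first by have [] := E x Ux.
apply: (@Ck_on_ext _ _ _ _ _ (fun x => \sum_i fcrd cW i ('D_v phi x) * 'D_(fvec cW i) g (phi x))) => //.
  by move=> x Ux; have [_ ->] := E x Ux.
apply: Ck_on_sum => // i; apply: Ck_on_mul => //.
  apply: (@Ck_on_linl _ _ _ R^o _ _ _ (fcrd cW i)) => //.
  - by move=> a y; rewrite fcrdZ.
  - by move=> y z; rewrite fcrdD -scaleN1r fcrdZ mulN1r.
  - exact: fcrd_cont.
  - exact: Ck_on_D.
by apply: (IH (fun y => 'D_(fvec cW i) g y)); [exact: Ck_onS|exact: Ck_on_D].
Qed.

Lemma Ck1_DvD V (cV : fincoord V) (U : set V) (g : V -> R) x v w :
  open U -> Ck_on 1 U g -> U x -> 'D_(v + w) g x = 'D_v g x + 'D_w g x.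
Proof.
move=> oU Hg Ux; have d := Ck1_differentiable cV oU Hg Ux.
by rewrite !deriveE // linearD.
Qed.

(** The second difference [Q] over a small parallelogram is, by two applications of the mean value
    theorem in either order, s^2 times either mixed derivative at some point nearby; continuity does
    the rest. *)
Lemma Ck2_schwarz V (U : set V) (f : V -> R) x v w :
  open U -> Ck_on 2 U f -> U x -> 'D_v (fun y => 'D_w f y) x = 'D_w (fun y => 'D_v f y) x.
Proof.
move=> oU Hf Ux.
have Hvw := Ck_on_D v (Ck_on_D w Hf).
have Hwv := Ck_on_D w (Ck_on_D v Hf).
apply/eqP; rewrite -subr_eq0 -normr_le0; apply/ler_addgt0Pr => e e0; rewrite add0r.
have e2 : 0 < e / 2 by rewrite divr_gt0.
have HU : \forall y \near x, U y by exact: open_nbhs_nbhs.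
have H1 : \forall y \near x, `|'D_v ('D_w f) x - 'D_v ('D_w f) y| <= e / 2.
  by have /cvgrPdist_le/(_ _ e2) := Ck_on_cont Hvw Ux.
have H2 : \forall y \near x, `|'D_w ('D_v f) x - 'D_w ('D_v f) y| <= e / 2.
  by have /cvgrPdist_le/(_ _ e2) := Ck_on_cont Hwv Ux.
have [d /= d0 Hd] := (nbhs_ballP _ _).1 (filterI HU (filterI H1 H2)).
pose s := d / (`|v| + `|w| + 1).
have D0 : 0 < `|v| + `|w| + 1 by rewrite ltr_wpDl ?addr_ge0.
have s0 : 0 < s by rewrite divr_gt0.
have inb (a b : R) : `|a| <= `|s| -> `|b| <= `|s| -> ball x d (x + a *: v + b *: w).
  move=> sa sb; rewrite -ball_normE /= -addrA opprD addrA subrr sub0r normrN.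
  apply: le_lt_trans (_ : s * (`|v| + `|w|) < d).
    rewrite mulrDr; apply: le_trans (ler_normD _ _) _.
    by rewrite !normrZ -[s]gtr0_norm //; apply: lerD; apply: ler_wpM2r.
  by rewrite /s mulrAC ltr_pdivrMr // ltr_pM2l // ltrDl.
have inbU a b ha hb := (Hd _ (inb a b ha hb)).1.
pose Q := f (x + s *: v + s *: w) - f (x + s *: v) - (f (x + s *: w) - f x).
have ss : `|s| <= `|s| by [].
have s0' : `|0 : R| <= `|s| by rewrite normr0.
have Q1 : exists2 y, ball x d y & Q = s * (s * 'D_w ('D_v f) y).
  have dv z u : ball x d z -> derivable f z u by move=> /Hd[Uz _]; exact: (Ck_on_derivable Hf).
  have D2 (t : R) : `|t| <= `|s| -> is_derive (x + t *: v) v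
      (fun z => f (z + s *: w) - f z) ('D_v f (x + t *: v + s *: w) - 'D_v f (x + t *: v)).
    move=> ht; apply: is_deriveB.
      have /derivableP := dv _ v (inb _ _ ht ss).
      have EQ : (fun h : R => h^-1 *: (f (h *: v + (x + t *: v + s *: w)) - f (x + t *: v + s *: w)))
        = fun h : R => h^-1 *: ((fun z => f (z + s *: w)) (h *: v + (x + t *: v)) - (fun z => f (z + s *: w)) (x + t *: v)).
        by apply/funext => h /=; rewrite !addrA.
      by move=> [K1 K2]; split; rewrite /derivable /derive -EQ.
    by apply: derivableP; apply: dv; have := inb _ _ ht s0'; rewrite scale0r addr0.
  have [t ht|t ts E] := @line_MVTZ _ _ (fun z => f (z + s *: w) - f z) x v s.
    by have [] := D2 t ht.
  have [_ E2] := D2 _ ts; move: E; rewrite E2.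
  have [r hr|r rs E3] := @line_MVTZ _ _ ('D_v f) (x + t *: v) w s.
    by have /Hd[Uz _] := inb _ _ ts hr; exact: (Ck_on_derivable (Ck_on_D v Hf)).
  rewrite E3 => E; exists (x + t *: v + r *: w); first exact: inb.
  by rewrite -E /Q; ring.
have Q2 : exists2 y, ball x d y & Q = s * (s * 'D_v ('D_w f) y).
  have dv z u : ball x d z -> derivable f z u by move=> /Hd[Uz _]; exact: (Ck_on_derivable Hf).
  have D2 (t : R) : `|t| <= `|s| -> is_derive (x + t *: w) w
      (fun z => f (z + s *: v) - f z) ('D_w f (x + t *: w + s *: v) - 'D_w f (x + t *: w)).
    move=> ht; apply: is_deriveB.
      have /derivableP := dv _ w (inb _ _ ss ht); rewrite addrAC.
      have EQ : (fun h : R => h^-1 *: (f (h *: w + (x + t *: w + s *: v)) - f (x + t *: w + s *: v)))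
        = fun h : R => h^-1 *: ((fun z => f (z + s *: v)) (h *: w + (x + t *: w)) - (fun z => f (z + s *: v)) (x + t *: w)).
        by apply/funext => h /=; rewrite !addrA.
      by move=> [K1 K2]; split; rewrite /derivable /derive -EQ.
    by apply: derivableP; apply: dv; have := inb _ _ s0' ht; rewrite scale0r addr0.
  have [t ht|t ts E] := @line_MVTZ _ _ (fun z => f (z + s *: v) - f z) x w s.
    by have [] := D2 t ht.
  have [_ E2] := D2 _ ts; move: E; rewrite E2.
  have [r hr|r rs E3] := @line_MVTZ _ _ ('D_w f) (x + t *: w) v s.
    have /Hd[Uz _] := inb _ _ hr ts; rewrite addrAC in Uz.
    exact: (Ck_on_derivable (Ck_on_D w Hf)).
  rewrite E3 => E; exists (x + r *: v + t *: w); first exact: inb.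
  by rewrite addrAC -E /Q (addrAC x (s *: v)); ring.
have [y1 b1 E1] := Q1; have [y2 b2 E2] := Q2.
have s00 : s != 0 by rewrite gt_eqF.
have [_ [B1 _]] := Hd _ b2; have [_ [_ B2]] := Hd _ b1.
move: E1 B1 B2; rewrite E2 => {E2}.
move: ('D_v ('D_w f) x) ('D_v ('D_w f) y2) ('D_w ('D_v f) x) ('D_w ('D_v f) y1) => a1 a2 a3 a4.
move=> /(mulfI s00)/(mulfI s00) ->; rewrite !ler_norml => /andP[? ?] /andP[? ?].
by apply/andP; split; lra.
Qed.
End ChainRule.

Section DeriveCongr.
Context {R : realType} {V V' W : normedModType R}.

(** The two lines may live in different spaces: this exchanges derivatives in a chart or in a
    product for derivatives along a one-parameter subgroup. *)
Lemma derive_congr (f : V -> W) (f' : V' -> W) a v a' v' :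
  (forall h : R, f (h *: v + a) = f' (h *: v' + a')) -> 'D_v f a = 'D_v' f' a'.
Proof.
move=> E; have E0 : f a = f' a' by have := E 0; rewrite !scale0r !add0r.
by rewrite /derive /= E0; under eq_fun do rewrite E.
Qed.

Lemma derivable_congr (f : V -> W) (f' : V' -> W) a v a' v' :
  (forall h : R, f (h *: v + a) = f' (h *: v' + a')) -> derivable f a v -> derivable f' a' v'.
Proof.
move=> E; have E0 : f a = f' a' by have := E 0; rewrite !scale0r !add0r.
by rewrite /derivable /= E0; under eq_fun do rewrite E.
Qed.
End DeriveCongr.

Section CkPairs.
Context {R : realType}.
Implicit Types (V W : normedModType R).

Lemma Ck_on_pair V W W' k (U : set V) (f : V -> W) (g : V -> W') : open U ->
  Ck_on k U f -> Ck_on k U g -> Ck_on k U (fun x => (f x, g x)).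
Proof.
move=> oU; elim: k f g => [|k IH] f g Hf Hg.
  by split=> // x Ux; apply: cvg_pair; [exact: (Ck_on_cont Hf)|exact: (Ck_on_cont Hg)].
split=> [x Ux|v].
  by apply: cvg_pair; [exact: (Ck_on_cont Hf)|exact: (Ck_on_cont Hg)].
have E x : U x -> is_derive x v (fun x => (f x, g x)) ('D_v f x, 'D_v g x).
  move=> Ux.
  have L : h^-1 *: ((f (h *: v + x), g (h *: v + x)) - (f x, g x)) @[h --> 0^'] --> ('D_v f x, 'D_v g x).
    exact: (cvg_pair (Ck_on_derivable (v := v) Hf Ux) (Ck_on_derivable (v := v) Hg Ux)).
  split; last by apply/cvg_lim => //; exact: L.
  by apply/cvg_ex; exists ('D_v f x, 'D_v g x); exact: L.
split=> [x Ux|]; first by have [] := E x Ux.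
apply: (@Ck_on_ext _ _ _ _ _ (fun x => ('D_v f x, 'D_v g x))) => //.
  by move=> x Ux; have [_ ->] := E x Ux.
by apply: IH; exact: Ck_on_D.
Qed.

Lemma Ck_on_comp_mx V W (cV : fincoord V) (cW : fincoord W) n k (U : set V) (U' : set W)
    (phi : V -> W) (g : W -> 'rV[R]_n) :
  open U -> open U' -> (forall x, U x -> U' (phi x)) ->
  Ck_on k U phi -> Ck_on k U' g -> Ck_on k U (fun x => g (phi x)).
Proof.
move=> oU oU' UU' Hphi Hg; apply: Ck_on_mx => // j.
apply: (@Ck_on_comp _ _ _ cV cW k U U' phi (fun y => g y ord0 j)) => //.
exact: Ck_on_coord.
Qed.

Lemma open_preimage_on (V T : topologicalType) (U : set V) (B : set T) (f : V -> T) :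
  open U -> (forall x, U x -> {for x, continuous f}) -> open B ->
  open (U `&` f @^-1` B).
Proof.
move=> oU cf oB; rewrite openE => x [Ux Bx]; apply: filterI.
  exact: open_nbhs_nbhs.
by apply: cf => //; exact: open_nbhs_nbhs.
Qed.

Lemma continuous_pair (T T' T'' : topologicalType) (f : T -> T') (h : T -> T'') x :
  {for x, continuous f} -> {for x, continuous h} ->
  {for x, continuous (fun y => (f y, h y))}.
Proof. by move=> cf ch; exact: (cvg_pair cf ch). Qed.

Lemma open_setX (T T' : topologicalType) (B : set T) (C : set T') :
  open B -> open C -> open (B `*` C).
Proof.
move=> oB oC; rewrite (_ : B `*` C = fst @^-1` B `&` snd @^-1` C) //.
by apply: openI; apply: open_comp => // x _; [exact: cvg_fst|exact: cvg_snd].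
Qed.

Lemma smooth_on_lin V W (U : set V) (l : {linear V -> W}) : continuous l -> smooth_on U l.
Proof. by move=> lc k; exact: Ck_on_lin. Qed.

Lemma smooth_on_fst V W (U : set (V * W)) : smooth_on U (fst : V * W -> V).
Proof. by apply: (@smooth_on_lin _ _ U fst) => x; exact: cvg_fst. Qed.

Lemma smooth_on_snd V W (U : set (V * W)) : smooth_on U (snd : V * W -> W).
Proof. by apply: (@smooth_on_lin _ _ U snd) => x; exact: cvg_snd. Qed.

Lemma smooth_on_fstE V W W' (U : set V) (f : V -> W * W') : open U ->
  smooth_on U f -> smooth_on U (fun x => (f x).1).
Proof.
move=> oU hf k; apply: (@Ck_on_linl _ _ (W * W')%type W k U f fst) => //.
by move=> x; exact: cvg_fst.
Qed.

Lemma smooth_on_sndE V W W' (U : set V) (f : V -> W * W') : open U ->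
  smooth_on U f -> smooth_on U (fun x => (f x).2).
Proof.
move=> oU hf k; apply: (@Ck_on_linl _ _ (W * W')%type W' k U f snd) => //.
by move=> x; exact: cvg_snd.
Qed.

End CkPairs.

(** * Smooth functions on a Lie group *)

Section Manifold.
Variables (R : realType) (G : topGroupType) (n : nat) (A : set (chart R G n)).
Hypothesis hG : is_lie_group A.
Implicit Types (V W : normedModType R).

(** Smoothness of maps into G, tested in the charts of the target. Continuity is asked for
    separately, so that the sets on which a chart applies are open ([gsmooth_open]). *)
Definition gsmooth V (U : set V) (phi : V -> G) :=
  (forall x, U x -> {for x, continuous phi}) /\
  forall c, A c -> smooth_on (U `&` phi @^-1` chart_dom c) (chart_map c \o phi).

Lemma chart_of (x : G) : exists2 c, A c & chart_dom c x.
Proof. by have [_ [_ + _] _ _] := hG; apply. Qed.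

Lemma chartP c : A c -> is_chart c.
Proof. by have [_ [+ _ _] _ _] := hG; apply. Qed.

Lemma chart_dom_open c : A c -> open (chart_dom c).
Proof. by move=> /chartP[]. Qed.

Lemma chart_img_open c : A c -> open (chart_img c).
Proof. by move=> /chartP[]. Qed.

Lemma chart_mapK c x : A c -> chart_dom c x -> chart_inv c (chart_map c x) = x.
Proof. by move=> /chartP[_ _ + _ _]; apply. Qed.

Lemma chart_map_img (c : chart R G n) x : chart_dom c x -> chart_img c (chart_map c x).
Proof. by exists x. Qed.

Lemma chart_inv_dom c y : A c -> chart_img c y -> chart_dom c (chart_inv c y).
Proof. by move=> Ac [x dx <-]; rewrite chart_mapK. Qed.

Lemma chart_invK c y : A c -> chart_img c y -> chart_map c (chart_inv c y) = y.
Proof. by move=> Ac [x dx <-]; rewrite chart_mapK. Qed.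

Lemma chart_map_cont c x : A c -> chart_dom c x -> {for x, continuous (chart_map c)}.
Proof. by move=> /chartP[_ _ _ + _]; apply. Qed.

Lemma chart_inv_cont c y : A c -> chart_img c y -> {for y, continuous (chart_inv c)}.
Proof. by move=> /chartP[_ _ _ _]; apply. Qed.

Lemma gsmooth_open V (U : set V) phi c : open U -> gsmooth U phi -> A c ->
  open (U `&` phi @^-1` chart_dom c).
Proof. by move=> oU [cp _] Ac; apply: open_preimage_on => //; exact: chart_dom_open. Qed.

(** The single bridge from smoothness in charts to smoothness in vector variables. Functions on G
    alone pass through it as functions constant in time ([smooth_fun_pos]). *)
Lemma smooth_pos_timeP V (cV : fincoord V) (U : set V) (H : R -> G -> R)
    (w : V -> R) (phi : V -> G) :
  smooth_pos_time A H -> open U -> smooth_on U (w : V -> R^o) -> (forall x, U x -> 0 < w x) ->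
  gsmooth U phi -> smooth_on U (fun x => H (w x) (phi x) : R^o).
Proof.
move=> hH oU hw w0 hphi k; apply: Ck_on_local => x Ux.
have [c Ac cx] := chart_of (phi x).
exists (U `&` phi @^-1` chart_dom c).
have oD := gsmooth_open oU hphi Ac.
split=> //.
pose U' := [set y : R * 'rV[R]_n | 0 < y.1 /\ chart_img c y.2].
have oU' : open U'.
  rewrite (_ : U' = [set t : R | 0 < t] `*` chart_img c) //.
  by apply: open_setX; [exact: open_gt|exact: chart_img_open].
apply: (@Ck_on_ext _ _ _ _ _ (fun x => H (w x) (chart_inv c (chart_map c (phi x))))) => //.
  by move=> y [Uy cy]; rewrite chart_mapK.
apply: (@Ck_on_comp _ _ _ cV (fincoord_prod (fincoordR (R:=R)) (fincoord_rV n)) k _ U' (fun x => (w x, chart_map c (phi x)))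
   (fun y => H y.1 (chart_inv c y.2))) => //.
- by move=> y [Uy cy]; split; [exact: w0|exact: chart_map_img].
- apply: Ck_on_pair => //; last exact: hphi.2.
  by apply: Ck_on_sub (hw k) => y [].
- exact: hH.
Qed.

Lemma smooth_fun_pos f : smooth_fun A f -> smooth_pos_time A (fun _ => f).
Proof.
move=> hf c Ac k.
have oU' : open [set y : R * 'rV[R]_n | 0 < y.1 /\ chart_img c y.2].
  rewrite (_ : mkset _ = [set t : R | 0 < t] `*` chart_img c) //.
  by apply: open_setX; [exact: open_gt|exact: chart_img_open].
apply: (@Ck_on_comp _ _ _ (fincoord_prod (fincoordR (R:=R)) (fincoord_rV n)) (fincoord_rV n) k _ (chart_img c) snd (f \o chart_inv c)) => //.
- exact: chart_img_open.
- by move=> x [].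
- exact: smooth_on_snd.
- exact: hf.
Qed.

Lemma smooth_funP V (cV : fincoord V) (U : set V) (f : G -> R) (phi : V -> G) :
  smooth_fun A f -> open U ->
  gsmooth U phi -> smooth_on U (fun x => f (phi x) : R^o).
Proof.
move=> /smooth_fun_pos hf oU hphi.
apply: (@smooth_pos_timeP _ cV U _ (fun _ => 1) phi hf) => //.
by move=> k; exact: Ck_on_cst.
Qed.

Lemma gsmooth_cst V (U : set V) (x : G) : gsmooth U (fun _ => x).
Proof.
split=> [y _|c Ac k]; first exact: cvg_cst.
exact: Ck_on_cst.
Qed.

Lemma gsmooth_comp V W (cV : fincoord V) (cW : fincoord W) (U : set V) (U' : set W) (w : V -> W) (phi : W -> G) :
  open U -> open U' -> smooth_on U w -> (forall x, U x -> U' (w x)) -> gsmooth U' phi ->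
  gsmooth U (fun x => phi (w x)).
Proof.
move=> oU oU' hw UU' hphi.
have cw x : U x -> {for x, continuous w} by exact: (Ck_on_cont (hw 0)).
split=> [x Ux|c Ac k].
  by apply: continuous_comp; [exact: cw|exact/hphi.1/UU'].
apply: (@Ck_on_comp_mx _ _ _ cV cW _ _ _ (U' `&` phi @^-1` chart_dom c) w (chart_map c \o phi)).
- apply: open_preimage_on => //; last exact: chart_dom_open.
  by move=> x Ux; apply: continuous_comp; [exact: cw|exact/hphi.1/UU'].
- exact: gsmooth_open.
- by move=> x [Ux cx]; split => //; exact: UU'.
- by apply: Ck_on_sub (hw k) => x [].
- exact: hphi.2.
Qed.

Lemma gsmooth_chart_inv c : A c -> gsmooth (chart_img c) (chart_inv c).
Proof.
move=> Ac; split=> [y|d Ad k]; first exact: chart_inv_cont.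
have [_ [_ _ tr] _ _] := hG.
apply: Ck_on_sub (tr c d Ac Ad k) => y [yc yd].
by exists (chart_inv c y); [split=> //; exact: chart_inv_dom|exact: chart_invK].
Qed.

Lemma gsmooth_curve (gamma : R -> G) : smooth_curve A gamma -> gsmooth setT (gamma : R^o -> G).
Proof.
move=> [cg sg]; split=> [x _|c Ac k]; first exact: cg.
by rewrite setTI; exact: sg.
Qed.

(** Locally, three charts apply, around the two factors and around their product; there the map is
    the multiplication read in charts after a pair of smooth maps. *)
Lemma gsmooth_mul V (cV : fincoord V) (U : set V) (phi psi : V -> G) : open U ->
  gsmooth U phi -> gsmooth U psi -> gsmooth U (fun x => phi x * psi x)%g.
Proof.
move=> oU hphi hpsi.
have cm x : U x -> {for x, continuous (fun x => phi x * psi x)%g}.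
  move=> Ux; apply: (@continuous2_cvg _ _ _ _ _ _ phi psi (fun x y => x * y)%g (phi x) (psi x)).
  - exact: (@mulg_continuous G (phi x, psi x)).
  - exact: hphi.1.
  - exact: hpsi.1.
split=> // c Ac k; apply: Ck_on_local => x [Ux cx].
have [a Aa ax] := chart_of (phi x).
have [b Ab bx] := chart_of (psi x).
have [_ _ hm _] := hG.
have oa := gsmooth_open oU hphi Aa.
have ob := gsmooth_open oU hpsi Ab.
have oc : open (U `&` (fun x => phi x * psi x)%g @^-1` chart_dom c).
  by apply: open_preimage_on => //; exact: chart_dom_open.
pose D := (U `&` phi @^-1` chart_dom a) `&` ((U `&` psi @^-1` chart_dom b) `&` (U `&` (fun x => phi x * psi x)%g @^-1` chart_dom c)).
have oD : open D by apply: openI => //; apply: openI.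
exists D; split=> //.
apply: (@Ck_on_ext _ _ _ _ _ (fun x => chart_map c (chart_inv a (chart_map a (phi x)) * chart_inv b (chart_map b (psi x)))%g)) => //.
  by move=> y [[_ ya] [[_ yb] _]]; rewrite !chart_mapK.
pose Q := [set y : 'rV[R]_n * 'rV[R]_n | [/\ chart_img a y.1, chart_img b y.2 & chart_dom c (chart_inv a y.1 * chart_inv b y.2)%g]].
have oQ : open Q.
  have -> : Q = (chart_img a `*` chart_img b) `&` (fun y => chart_inv a y.1 * chart_inv b y.2)%g @^-1` chart_dom c.
    by apply/seteqP; split=> [y []|y [[]]].
  apply: open_preimage_on; [|move=> [y1 y2] [/= h1 h2]|exact: chart_dom_open].
    by apply: open_setX; exact: chart_img_open.
  apply: (@continuous2_cvg _ _ _ _ _ _ (fun y => chart_inv a y.1) (fun y => chart_inv b y.2) (fun x y => x * y)%g).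
  - exact: (@mulg_continuous G (_, _)).
  - by apply: continuous_comp; [exact: cvg_fst|exact: chart_inv_cont].
  - by apply: continuous_comp; [exact: cvg_snd|exact: chart_inv_cont].
apply: (@Ck_on_comp_mx _ _ _ cV (fincoord_prod (fincoord_rV n) (fincoord_rV n)) _ _ _ Q (fun x => (chart_map a (phi x), chart_map b (psi x)))
   (fun y => chart_map c (chart_inv a y.1 * chart_inv b y.2)%g)) => //.
- by move=> y [[_ ya] [[_ yb] [_ yc]]]; split; rewrite /= ?chart_mapK //; exact: chart_map_img.
- apply: Ck_on_pair => //.
    by apply: Ck_on_sub (hphi.2 a Aa k) => y [].
  by apply: Ck_on_sub (hpsi.2 b Ab k) => y [_ []].
- exact: hm.
Qed.

End Manifold.

(* Sealed, because unfolding the derivative makes conversion tests diverge. *)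
Fact lie_der_key : unit. Proof. exact: tt. Qed.

Definition lie_der (R : realType) (G : topGroupType) (g : vectType R) (exp : g -> G) :=
  locked_with lie_der_key (@linv_field R G g exp).

Lemma lie_derE (R : realType) (G : topGroupType) (g : vectType R) (exp : g -> G) :
  lie_der exp = linv_field exp.
Proof. by rewrite /lie_der unlock. Qed.

(** * Left-invariant vector fields *)

Section LieField.
Variables (R : realType) (G : topGroupType) (n : nat) (A : set (chart R G n)).
Hypothesis hG : is_lie_group A.
Variables (g : vectType R) (exp : g -> G) (br : g -> g -> g).
Hypothesis hg : is_lie_algebra A exp br.
Implicit Types (V W : normedModType R) (X Y Z : g) (f : G -> R) (H : R -> G -> R).

Local Notation linv := (lie_der exp).

Lemma exp_add X s t : exp ((s + t) *: X) = (exp (s *: X) * exp (t *: X))%g.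
Proof. by have [_ ->] := exp_one_param hg X. Qed.

Lemma exp0 : exp 0 = 1%g.
Proof.
have := exp_add 0 0 0; rewrite addr0 scale0r => E.
by rewrite -(mulgK (exp 0) (exp 0)) -E mulgV.
Qed.

Lemma expN X : exp (- X) = (exp X)^-1%g.
Proof.
have := exp_add X (-1) 1; rewrite addNr scale0r exp0 scale1r scaleN1r => E.
by rewrite -[RHS]mul1g E mulgK.
Qed.

(** [is_lie_algebra] gives smoothness of [exp] along each line through 0 only, whence a fixed X with
    a variable scalar factor; continuity in several variables has to wait for [exp_continuous]. *)
Lemma gsmooth_exp V (cV : fincoord V) (U : set V) (w : V -> R) X : open U ->
  smooth_on U (w : V -> R^o) -> gsmooth A U (fun v => exp (w v *: X)).
Proof.
move=> oU hw.
apply: (@gsmooth_comp _ _ _ _ hG _ _ cV (fincoordR (R:=R)) U setT w (fun s => exp (s *: X))) => //.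
  exact: openT.
by apply: gsmooth_curve; have [] := exp_one_param hg X.
Qed.

Lemma exp_line_continuous X : continuous (fun s : R => exp (s *: X)).
Proof. by have [[]] := exp_one_param hg X. Qed.

Lemma smooth_fun_line f (phi psi : R -> G) : smooth_fun A f -> gsmooth A setT (phi : R^o -> G) ->
  gsmooth A setT (psi : R^o -> G) -> smooth_on setT (fun s : R^o => f (phi s * psi s)%g : R^o).
Proof.
move=> hf h1 h2; apply: (@smooth_funP _ _ _ _ hG _ (fincoordR (R:=R)) setT f) => //; first exact: openT.
apply: gsmooth_mul => //; [exact: fincoordR|exact: openT].
Qed.

Lemma smooth_fun_translate f x y : smooth_fun A f -> smooth_fun A (fun z => f (x * z * y)%g).
Proof.
move=> hf c Ac; apply: (@smooth_funP _ _ _ _ hG _ (fincoord_rV n) _ f (fun v => x * chart_inv c v * y)%g) => //.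
  exact: chart_img_open Ac.
have cV := fincoord_rV (R := R) n; have oU := chart_img_open hG Ac.
apply: (gsmooth_mul hG cV oU); last exact: gsmooth_cst.
apply: (gsmooth_mul hG cV oU); [exact: gsmooth_cst|exact: gsmooth_chart_inv].
Qed.

Lemma smooth_funL f x : smooth_fun A f -> smooth_fun A (fun z => f (x * z)%g).
Proof.
move=> /(smooth_fun_translate x 1%g); congr smooth_fun.
by apply/funext => z; rewrite mulg1.
Qed.

Lemma smooth_funR f y : smooth_fun A f -> smooth_fun A (fun z => f (z * y)%g).
Proof.
move=> /(smooth_fun_translate 1%g y); congr smooth_fun.
by apply/funext => z; rewrite mul1g.
Qed.

Lemma smooth_fun_of_pos H u : smooth_pos_time A H -> 0 < u -> smooth_fun A (H u).
Proof.
move=> hH u0 c Ac.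
apply: (@smooth_pos_timeP _ _ _ _ hG _ (fincoord_rV n) _ H (fun _ => u) (chart_inv c) hH) => //.
- exact: chart_img_open Ac.
- by move=> k; exact: Ck_on_cst.
- exact: gsmooth_chart_inv.
Qed.

Lemma linvE X f x : linv X f x = 'D_1 (fun s : R => f (x * exp (s *: X))%g) 0.
Proof. by rewrite lie_derE /linv_field derive1E. Qed.

Lemma linv_at X f (x : G) (s : R) : 'D_1 (fun s : R => f (x * exp (s *: X))%g) s = linv X f (x * exp (s *: X))%g.
Proof.
rewrite linvE; apply: derive_congr => h.
by rewrite addr0 addrC exp_add mulgA.
Qed.

Lemma smooth_fun_exp f x y X : smooth_fun A f ->
  smooth_on setT (fun s : R^o => f (x * exp (s *: X) * y)%g : R^o).
Proof.
move=> hf; have oT : open [set: R^o] by exact: openT.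
have cR := fincoordR (R := R).
apply: smooth_fun_line => //; last exact: gsmooth_cst.
apply: (gsmooth_mul hG cR oT); first exact: gsmooth_cst.
by apply: (@gsmooth_exp _ cR setT id) => // k; apply: (@Ck_on_lin _ R^o R^o k setT idfun) => z; exact: cvg_id.
Qed.

Lemma linv_is_derive f X (x : G) (s : R) : smooth_fun A f ->
  is_derive s (1 : R) (fun s : R => f (x * exp (s *: X))%g) (linv X f (x * exp (s *: X))%g).
Proof.
move=> hf; rewrite -linv_at; apply/derivableP.
have := @smooth_fun_exp f x 1%g X hf 1.
under [X in Ck_on _ _ X]funext do rewrite mulg1.
by move=> h; apply: (Ck_on_derivable h).
Qed.

Lemma smooth_pos_chart V (cV : fincoord V) H (U : set (R^o * V)) (w : R^o * V -> R) (phi psi : R^o * V -> G) X :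
  smooth_pos_time A H -> open U -> smooth_on U (w : R^o * V -> R^o) -> (forall x, U x -> 0 < w x) ->
  gsmooth A U phi -> gsmooth A U psi ->
  smooth_on U (fun z => H (w z) (phi z * exp (z.1 *: X) * psi z)%g : R^o).
Proof.
move=> hH oU hw w0 hphi hpsi.
have cRV := fincoord_prod (fincoordR (R:=R)) cV.
apply: (smooth_pos_timeP hG cRV hH oU hw w0).
apply: (gsmooth_mul hG cRV oU) => //; apply: (gsmooth_mul hG cRV oU) => //.
by apply: gsmooth_exp => //; exact: smooth_on_fst.
Qed.

(* Differentiate along (1, 0), then restrict to {0} * V. *)
Lemma smooth_on_slice V (cV : fincoord V) (U : set V) (F : R^o * V -> R^o) :
  open U -> smooth_on (setT `*` U) F -> smooth_on U (fun v => 'D_1 (fun s : R => F (s, v)) 0 : R^o).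
Proof.
move=> oU hF k; have oT : open [set: R^o] by exact: openT.
have oTU := open_setX oT oU.
have := @Ck_on_D _ _ _ k _ F (1, 0) (hF k.+1).
have l1 : linear (fun v : V => (0, v) : R^o * V).
  by move=> a u v; congr pair; rewrite /= scaler0 addr0.
pose l : {linear V -> (R^o * V)%type} := HB.pack (fun v : V => (0, v) : R^o * V) (GRing.isLinear.Build _ _ _ _ _ l1).
have lc : continuous l by move=> v; apply: (@continuous_pair V R^o V (fun _ => 0) id); [exact: cvg_cst|exact: cvg_id].
have hl : Ck_on k U l by exact: Ck_on_lin.
move=> hD.
have := Ck_on_comp cV (fincoord_prod (fincoordR (R:=R)) cV) oU oTU _ hl hD.
move=> /(_ (fun x Ux => conj I Ux)).
congr (Ck_on _ _ _); apply/funext => v; apply: derive_congr => h.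
by congr F; congr pair; rewrite /= ?scaler0 ?add0r.
Qed.

(** In a chart, (s, u, y) |-> H u (y exp(sX)) is smooth in all variables jointly, and the
    left-invariant derivative is its s-derivative on the slice s = 0. *)
Lemma smooth_pos_linv H X : smooth_pos_time A H -> smooth_pos_time A (fun u => linv X (H u)).
Proof.
move=> hH c Ac.
pose V : normedModType R := (R^o * 'rV[R]_n)%type.
have cV : fincoord V := fincoord_prod (fincoordR (R:=R)) (fincoord_rV n).
pose U := [set y : V | 0 < y.1 /\ chart_img c y.2].
have oU : open U.
  rewrite (_ : U = [set t : R | 0 < t] `*` chart_img c) //.
  by apply: open_setX; [exact: open_gt|exact: chart_img_open Ac].
have oT : open [set: R^o] by exact: openT.
have oTU := open_setX oT oU.
have cTV := fincoord_prod (fincoordR (R:=R)) cV.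
have := @smooth_on_slice V cV U (fun z => H z.2.1 (chart_inv c z.2.2 * exp (z.1 *: X) * 1)%g) oU _.
have s2 : smooth_on (setT `*` U) (snd : R^o * V -> V) by exact: smooth_on_snd.
have h0 : smooth_on (setT `*` U) (fun z : R^o * V => H z.2.1 (chart_inv c z.2.2 * exp (z.1 *: X) * 1)%g : R^o).
  apply: (@smooth_pos_chart V cV H (setT `*` U) (fun z => z.2.1) (fun z => chart_inv c z.2.2) (fun _ => 1%g) X hH) => //.
  - exact: (smooth_on_fstE oTU s2).
  - by move=> x [_ []].
  - apply: (@gsmooth_comp _ _ _ _ hG _ _ cTV (fincoord_rV n) _ (chart_img c) (fun z => z.2.2)) => //.
    + exact: chart_img_open Ac.
    + exact: (smooth_on_sndE oTU s2).
    + by move=> x [_ []].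
    + exact: gsmooth_chart_inv.
  - exact: gsmooth_cst.
move=> /(_ h0) h k; have := h k; congr (Ck_on _ _ _); apply/funext => y /=.
by rewrite linvE; apply: derive_congr => s; rewrite mulg1.
Qed.

Lemma smooth_fun_linv f X : smooth_fun A f -> smooth_fun A (linv X f).
Proof.
by move=> /(smooth_fun_pos hG) /(@smooth_pos_linv _ X) /smooth_fun_of_pos h; exact: (h 1).
Qed.

Lemma smooth_pos_dt H : smooth_pos_time A H -> smooth_pos_time A (fun u x => derive1 (H^~ x) u).
Proof.
move=> hH c Ac k; have := @Ck_on_D _ (R * 'rV[R]_n)%type R k _ _ (1, 0) (hH c Ac k.+1).
congr (Ck_on _ _ _); apply/funext => -[u y]; rewrite derive1E; apply: derive_congr => h /=.
by rewrite scaler0 add0r.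
Qed.

Lemma smooth_pos_derivable H u x : smooth_pos_time A H -> 0 < u -> derivable (H^~ x) u 1.
Proof.
move=> hH u0; have [c Ac cx] := chart_of hG x.
have := @Ck_on_derivable _ _ _ _ _ _ (u, chart_map c x) (1, 0) (hH c Ac 1%N).
move=> /(_ (conj u0 (chart_map_img cx))).
by apply: derivable_congr => h /=; rewrite scaler0 add0r !(chart_mapK hG Ac cx).
Qed.

Lemma smooth_pos_cont H u x : smooth_pos_time A H -> 0 < u ->
  {for (u, x), continuous (fun z : R * G => H z.1 z.2)}.
Proof.
move=> hH u0; have [c Ac cx] := chart_of hG x.
have h1 := @Ck_on_cont _ _ _ _ _ _ (hH c Ac 0%N) (u, chart_map c x) (conj u0 (chart_map_img cx)).
have h2 : {for (u, x), continuous (fun z : R * G => (z.1, chart_map c z.2))}.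
  apply: continuous_pair; first exact: cvg_fst.
  by apply: (@continuous_comp _ _ _ snd); [exact: cvg_snd|exact: chart_map_cont Ac cx].
have := @continuous_comp _ _ _ (fun z : R * G => (z.1, chart_map c z.2)) _ (u, x) h2 h1.
rewrite /prop_for /continuous_at /= (chart_mapK hG Ac cx); apply: cvg_trans; apply: near_eq_cvg.
have : \forall z \near (u, x), chart_dom c z.2.
  apply: (@cvg_snd _ _ (nbhs u) (nbhs x) _); apply: open_nbhs_nbhs.
  by split=> //; exact: chart_dom_open Ac.
by apply: filterS => z cz /=; rewrite (chart_mapK hG Ac cz).
Qed.

Lemma smooth_fun_cont f : smooth_fun A f -> continuous f.
Proof.
move=> /(smooth_fun_pos hG) hf x.
have h := @smooth_pos_cont _ 1 x hf ltr01.
apply: (@continuous_comp _ _ _ (fun x : G => (1 : R, x)) (fun z : R * G => f z.2)) => //.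
by apply: (@continuous_pair G R G (fun _ => 1) id); [exact: cvg_cst|exact: cvg_id].
Qed.

(** Joint continuity in the point and in the right translation: Ad x moves both at once
    ([linv_Ad1]), and so do the averages of bumps over right translates. *)
Lemma linv_R_cont f Y :  smooth_fun A f ->
  continuous (fun z : G * G => linv Y (fun x => f (x * z.2)%g) z.1).
Proof.
move=> /(smooth_fun_pos hG) hf [z x].
have [c Ac cz] := chart_of hG z; have [d Ad dx] := chart_of hG x.
pose V : normedModType R := ('rV[R]_n * 'rV[R]_n)%type.
have cV : fincoord V := fincoord_prod (fincoord_rV n) (fincoord_rV n).
pose U : set V := chart_img c `*` chart_img d.
have oU : open U by apply: open_setX; apply: chart_img_open; eassumption.
have oT : open [set: R^o] by exact: openT.
have oTU := open_setX oT oU.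
have cTV := fincoord_prod (fincoordR (R:=R)) cV.
have s2 : smooth_on (setT `*` U) (snd : R^o * V -> V) by exact: smooth_on_snd.
have h0 : smooth_on (setT `*` U) (fun z : R^o * V => f (chart_inv c z.2.1 * exp (z.1 *: Y) * chart_inv d z.2.2)%g : R^o).
  apply: (@smooth_pos_chart V cV (fun _ => f) (setT `*` U) (fun _ => 1) (fun z => chart_inv c z.2.1) (fun z => chart_inv d z.2.2) Y hf) => //.
  - by move=> k; exact: Ck_on_cst.
  - apply: (@gsmooth_comp _ _ _ _ hG _ _ cTV (fincoord_rV n) _ (chart_img c) (fun z => z.2.1)) => //.
    + exact: chart_img_open Ac.
    + exact: (smooth_on_fstE oTU s2).
    + by move=> y [_ []].
    + exact: gsmooth_chart_inv.
  - apply: (@gsmooth_comp _ _ _ _ hG _ _ cTV (fincoord_rV n) _ (chart_img d) (fun z => z.2.2)) => //.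
    + exact: chart_img_open Ad.
    + exact: (smooth_on_sndE oTU s2).
    + by move=> y [_ []].
    + exact: gsmooth_chart_inv.
have h1 := @Ck_on_cont _ _ _ _ _ _ (smooth_on_slice cV oU h0 0%N) (chart_map c z, chart_map d x) (conj (chart_map_img cz) (chart_map_img dx)).
have h2 : {for (z, x), continuous (fun z : G * G => (chart_map c z.1, chart_map d z.2))}.
  apply: continuous_pair.
    by apply: (@continuous_comp _ _ _ fst); [exact: cvg_fst|exact: chart_map_cont Ac cz].
  by apply: (@continuous_comp _ _ _ snd); [exact: cvg_snd|exact: chart_map_cont Ad dx].
have := @continuous_comp _ _ _ (fun z : G * G => (chart_map c z.1, chart_map d z.2)) _ (z, x) h2 h1.
have E y : chart_dom c y.1 -> chart_dom d y.2 -> linv Y (fun x => f (x * y.2)%g) y.1 =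
   'D_1 (fun s : R => f (chart_inv c (chart_map c y.1) * exp (s *: Y) * chart_inv d (chart_map d y.2))%g) 0.
  by move=> cy dy; rewrite linvE (chart_mapK hG Ac cy) (chart_mapK hG Ad dy).
rewrite /prop_for /continuous_at E //; apply: cvg_trans; apply: near_eq_cvg.
have n1 : \forall y \near (z, x), chart_dom c y.1.
  apply: (@cvg_fst _ _ (nbhs z) (nbhs x) _); apply: open_nbhs_nbhs.
  by split=> //; exact: chart_dom_open Ac.
have n2 : \forall y \near (z, x), chart_dom d y.2.
  apply: (@cvg_snd _ _ (nbhs z) (nbhs x) _); apply: open_nbhs_nbhs.
  by split=> //; exact: chart_dom_open Ad.
by apply: filterS2 n1 n2 => y cy dy /=; rewrite E.
Qed.

End LieField.

(** * Smooth bumps *)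

Section FlatFunction.
Variable R : realType.

(** A family that contains the classical flat function e^(-1/t), at m = 0, and whose span is stable
    under differentiation ([is_derive_flat]). *)
Definition flat (m : nat) (t : R) : R := if 0 < t then (t^-1) ^+ m * expR (- t^-1) else 0.

Lemma flat_ge0 m t : 0 <= flat m t.
Proof.
rewrite /flat; case: ifPn => // t0.
by rewrite mulr_ge0 ?expR_ge0 // exprn_ge0 // invr_ge0 ltW.
Qed.

(** Keep one term of the exponential series: e^s >= s^(m+1) / (m+1)! at s = 1/t. *)
Lemma flat_le m t : flat m t <= (m.+1)`!%:R * `|t|.
Proof.
rewrite /flat; case: ifPn => [t0|_]; last by rewrite mulr_ge0.
have s0 : 0 < t^-1 by rewrite invr_gt0.
have h := expR_ge1Dxn m (ltW s0).
have F0 : (0 : R) < (m.+1)`!%:R by rewrite ltr0n fact_gt0.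
have h1 : t^-1 ^+ m.+1 <= (m.+1)`!%:R * expR t^-1.
  by rewrite mulrC -ler_pdivrMr //; apply: le_trans h; rewrite lerDr.
rewrite gtr0_norm // expRN ler_pdivrMr ?expR_gt0 // mulrAC -ler_pdivrMr //.
by rewrite -exprSr.
Qed.

Lemma flat_cvg0 m : flat m h @[h --> 0^'] --> 0.
Proof.
apply: (@squeeze_cvgr _ _ _ _ (fun=> 0) (fun h => (m.+1)`!%:R * `|h|)).
- by near=> h; rewrite flat_ge0 flat_le.
- exact: cvg_cst.
- rewrite -[X in _ --> X](mulr0 ((m.+1)`!%:R)); apply: cvgMr.
  rewrite -[X in _ --> X](normr0 R).
  by apply: cvg_norm; exact: (@cvg_within_filter _ _ id).
Unshelve. all: by end_near. Qed.

Lemma flatS m t : t != 0 -> flat m.+1 t = t^-1 * flat m t.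
Proof. by move=> t0; rewrite /flat; case: ifP => _; rewrite ?mulr0 // exprS mulrA. Qed.

Lemma is_derive_flat m (t : R) :
  is_derive t (1 : R) (flat m) (- m%:R * flat m.+1 t + flat m.+2 t).
Proof.
have [t0|t0|->] := ltgtP t 0.
- have z : \forall s \near t, s < 0 by exact: lt_nbhsl.
  have -> : - m%:R * flat m.+1 t + flat m.+2 t = 0.
    by rewrite /flat ltNge (ltW t0) /= mulr0 addr0.
  have [d1 d2] := is_derive_cst (0 : R) t (1 : R).
  have nE : {near t, cst 0 =1 flat m}.
    by near=> s; rewrite /flat ltNge ltW //=; near: s.
  split; first by apply: near_eq_derivable nE d1; rewrite oner_neq0.
  by rewrite -(near_eq_derive _ nE) ?oner_neq0.
- have nE : {near t, (fun s => (s^-1) ^+ m * expR (- s^-1)) =1 flat m}.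
    by near=> s; rewrite /flat ifT //; near: s; exact: lt_nbhsr.
  have tn0 : t != 0 by rewrite gt_eqF.
  have dV : is_derive t (1 : R) (fun s : R => s^-1) (- (t^-1 ^+ 2)).
    split; first by apply: (@derivableV _ _ id).
    by rewrite (@deriveV _ _ id) // derive_id -[_ *: _]/(_ * _) mulr1 exprVn.
  have dX : is_derive (t^-1) (1 : R) (fun s : R => s ^+ m) (m%:R * t^-1 ^+ m.-1).
    split; first exact: exprn_derivable.
    by rewrite exp_derive -[_ *: 1]/(_ * 1) mulr1.
  have dX' := is_derive1_comp dX dV.
  have dE := @is_derive1_comp R expR (fun s => - s^-1) t _ _ (is_derive_expR (- t^-1)) (is_deriveN dV).
  have [d1 d2] : is_derive t (1 : R) (fun s => (s^-1) ^+ m * expR (- s^-1)) (- m%:R * flat m.+1 t + flat m.+2 t).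
    apply: (is_derive_eq (is_deriveM dX' dE)).
    have F k : flat k t = t^-1 ^+ k * expR (- t^-1) by rewrite /flat t0.
    rewrite !F /= -![_ *: _]/(_ * _) opprK; move: (expR _) => e.
    case: m {nE dX dX' F} => [|m] /=; first by rewrite !mul0r expr0; ring.
    by rewrite !exprS; move: (t^-1 ^+ m) => q; ring.
  split; first by apply: near_eq_derivable nE d1; rewrite oner_neq0.
  by rewrite -(near_eq_derive _ nE) ?oner_neq0.
(* At 0 the difference quotient of [flat m] is [flat m.+1], which tends to 0. *)
- have f0 k : flat k 0 = 0 by rewrite /flat ltxx.
  rewrite !f0 mulr0 addr0.
  have L : h^-1 *: (flat m (h *: 1 + 0) - flat m 0) @[h --> 0^'] --> 0.
    apply: cvg_trans (flat_cvg0 m.+1); apply: near_eq_cvg; near=> h.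
    rewrite addr0 f0 subr0 -[h *: 1]/(h * 1) mulr1 flatS //.
    by near: h; exact: nbhs_dnbhs_neq.
  split; last exact/cvg_lim.
  by apply/cvg_ex; exists 0.
Unshelve. all: by end_near. Qed.

Lemma Ck_on_flat k m : Ck_on k setT (flat m : R^o -> R^o).
Proof.
have fc j : forall x : R^o, setT x -> {for x, continuous (flat j : R^o -> R^o)}.
  move=> x _; have [d _] := is_derive_flat j x.
  by apply: differentiable_continuous; exact/derivable1_diffP.
elim: k m => [|k IH] m; first by split=> //; exact: fc.
split=> [|v]; first exact: fc.
have dv (x : R^o) : is_derive x v (flat m : R^o -> R^o) (v *: (- m%:R * flat m.+1 x + flat m.+2 x)).
  have [d1 d2] := is_derive_flat m x.
  by have := is_derive_scalev v d1; rewrite d2 -[v *: 1]/(v * 1) mulr1.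
split=> [x _|]; first by have [] := dv x.
have oT : open [set: R^o] by exact: openT.
apply: (@Ck_on_ext _ _ _ _ _ (fun x : R^o => v *: (- m%:R * flat m.+1 x + flat m.+2 x))) => //.
  by move=> x _; have [_ ->] := dv x.
apply: Ck_on_mul => //; first exact: Ck_on_cst.
by apply: Ck_on_add => //; apply: Ck_on_mul => //; exact: Ck_on_cst.
Qed.

End FlatFunction.

Section BoxBump.
Variables (R : realType) (n : nat).

Definition box_bump (y0 : 'rV[R]_n) (r : R) (y : 'rV[R]_n) : R :=
  \prod_j flat 0 (r ^+ 2 - (y ord0 j - y0 ord0 j) ^+ 2).

Lemma smooth_on_box_bump y0 r (U : set 'rV[R]_n) : open U -> smooth_on U (box_bump y0 r).
Proof.
move=> oU k; have oT : open [set: R^o] by exact: openT.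
suff H m (F : 'I_m -> 'I_n) : Ck_on k U (fun y => \prod_(i < m) flat 0 (r ^+ 2 - (y ord0 (F i) - y0 ord0 (F i)) ^+ 2)).
  exact: (H n id).
elim: m F => [|m IH] F.
  by under [X in Ck_on _ _ X]funext do rewrite big_ord0; exact: Ck_on_cst.
under [X in Ck_on _ _ X]funext do rewrite big_ord_recl.
apply: (@Ck_on_mul _ _ k U (fun y => flat 0 (r ^+ 2 - (y ord0 (F ord0) - y0 ord0 (F ord0)) ^+ 2)) (fun y => \prod_(i < m) flat 0 (r ^+ 2 - (y ord0 (F (lift ord0 i)) - y0 ord0 (F (lift ord0 i))) ^+ 2))) => //.
apply: (@Ck_on_comp _ _ _ (fincoord_rV n) (fincoordR (R:=R)) k U setT (fun y => r ^+ 2 - (y ord0 (F ord0) - y0 ord0 (F ord0)) ^+ 2 : R^o) (flat 0)) => //.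
  have c1 : Ck_on k U (fun y : 'rV[R]_n => (y ord0 (F ord0) - y0 ord0 (F ord0)) : R^o).
    apply: Ck_on_add => //; last exact: Ck_on_cst.
    by apply: (@Ck_on_coord _ _ _ _ _ id) => //; apply: (@Ck_on_lin _ _ _ k U idfun) => z; exact: cvg_id.
  apply: Ck_on_add => //; first exact: Ck_on_cst.
  apply: (@Ck_on_linl _ _ R^o R^o k U _ -%R) => //.
  - by move=> a x; rewrite scalerN.
  - by move=> a x; rewrite opprD.
  - by move=> x; apply: cvgN; exact: cvg_id.
  - by under [X in Ck_on _ _ X]funext do rewrite expr2; exact: Ck_on_mul.
exact: Ck_on_flat.
Qed.

Lemma box_bump_ge0 y0 r y : 0 <= box_bump y0 r y.
Proof. by apply: prodr_ge0 => j _; exact: flat_ge0. Qed.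

Lemma box_bump_gt0 y0 r : 0 < r -> 0 < box_bump y0 r y0.
Proof.
move=> r0; apply: prodr_gt0 => j _; rewrite subrr expr0n /= subr0 /flat exprn_gt0 //.
by rewrite expr0 mul1r expR_gt0.
Qed.

Lemma box_bump_supp y0 r y : 0 <= r -> 0 < box_bump y0 r y ->
  forall j, `|y ord0 j - y0 ord0 j| <= r.
Proof.
move=> r0 + j; rewrite /box_bump (bigD1 j) //= /flat.
case: ifPn => [|_]; last by rewrite mul0r ltxx.
by rewrite subr_gt0 -real_normK ?num_real // ltr_sqr ?nnegrE // => /ltW.
Qed.

End BoxBump.

Section Bump.
Variables (R : realType) (G : topGroupType) (n : nat) (A : set (chart R G n)).
Hypothesis hG : is_lie_group A.

Lemma lie_hausdorff : hausdorff_space G.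
Proof. by have [] := hG. Qed.

(** A bump in one chart, extended by 0. The support is the image of a compact box, hence closed
    because G is Hausdorff, and this makes the extension smooth outside the chart domain. *)
Lemma bump_exists (W : set G) (x0 : G) : open W -> W x0 ->
  exists f : G -> R, exists C : set G,
    [/\ smooth_fun A f /\ (forall x, 0 <= f x), 0 < f x0, compact C, C `<=` W &
        forall x, ~ C x -> f x = 0].
Proof.
move=> oW Wx; have [c Ac cx] := chart_of hG x0.
pose y0 := chart_map c x0.
have oI := chart_img_open hG Ac.
pose B := chart_img c `&` chart_inv c @^-1` W.
have oB : open B by apply: open_preimage_on => // y; exact: (chart_inv_cont hG Ac).
have By0 : B y0 by split; [exact: chart_map_img|rewrite /= (chart_mapK hG Ac cx)].
have [r /= r0 rB] := (nbhs_ballP _ _).1 (open_nbhs_nbhs (conj oB By0)).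
pose D := [set y : 'rV[R]_n | forall j, `[y0 ord0 j - r / 2, y0 ord0 j + r / 2]%classic (y ord0 j)].
have cD : compact D by apply: (@rV_compact R n (fun j => `[y0 ord0 j - r / 2, y0 ord0 j + r / 2]%classic)) => j; exact: segment_compact.
have r2 : 0 < r / 2 by rewrite divr_gt0.
have DE (y : 'rV[R]_n) : (forall j, `|y ord0 j - y0 ord0 j| <= r / 2) -> D y.
  by move=> h j /=; rewrite in_itv /= -ler_distlC distrC h.
have DB : D `<=` B.
  move=> y Dy; apply: rB; split=> // i j.
  rewrite (ord1 i) /ball /= distrC.
  have := Dy j; rewrite /= in_itv /= -ler_distlC distrC => /le_lt_trans; apply.
  by rewrite ltr_pdivrMr // mulr_natr mulr2n ltrDl.
pose C := chart_inv c @` D.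
have cC : compact C.
  apply: continuous_compact => //; apply: continuous_in_subspaceT => y; rewrite inE => Dy.
  by apply: (chart_inv_cont hG Ac); exact: (DB _ Dy).1.
have clC : closed C by apply: compact_closed => //; exact: lie_hausdorff.
pose f x := if x \in chart_dom c then box_bump y0 (r / 2) (chart_map c x) else 0.
have f0 x : ~ C x -> f x = 0.
  move=> Cx; rewrite /f; case: ifPn => //; rewrite inE => dx.
  apply/eqP; rewrite eq_le box_bump_ge0 andbT leNgt; apply/negP => b0.
  apply: Cx; exists (chart_map c x); last exact: (chart_mapK hG Ac).
  by apply: DE; apply: box_bump_supp => //; exact: ltW.
exists f, C; split=> //; first split.
- move=> d Ad k; have oId := chart_img_open hG Ad.
  apply: Ck_on_local => y dy.
  (* Near a point of the chart domain the function is a composition of smooth maps; elsewhere it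
     vanishes on the complement of [C], which is open. *)
  have [dc|ndc] := pselect (chart_dom c (chart_inv d y)).
    have gd := gsmooth_chart_inv hG Ad.
    have oE := gsmooth_open hG oId gd Ac.
    exists (chart_img d `&` chart_inv d @^-1` chart_dom c); split=> //.
    apply: (@Ck_on_ext _ _ _ _ _ (fun z => box_bump y0 (r / 2) (chart_map c (chart_inv d z)))) => //.
      by move=> z [_ zc]; rewrite /f /= ifT // inE.
    apply: (@Ck_on_comp _ _ _ (fincoord_rV n) (fincoord_rV n) k _ setT (chart_map c \o chart_inv d)) => //.
    + exact: openT.
    + exact: gd.2.
    + by apply: smooth_on_box_bump; exact: openT.
  have oE : open (chart_img d `&` chart_inv d @^-1` (~` C)).
    by apply: open_preimage_on => // [z|]; [exact: (chart_inv_cont hG Ad)|exact: closed_openC].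
  have CB x : C x -> chart_dom c x by move=> [z /DB[zc _] <-]; exact: (chart_inv_dom hG Ac).
  exists (chart_img d `&` chart_inv d @^-1` (~` C)); split=> //.
    by split=> // /CB.
  apply: (@Ck_on_ext _ _ _ _ _ (fun=> 0)) => //; last exact: Ck_on_cst.
  by move=> z [_ Cz] /=; rewrite f0.
- by move=> x; rewrite /f; case: ifP => // _; exact: box_bump_ge0.
- by rewrite /f ifT ?inE //; exact: box_bump_gt0.
- by move=> x [y /DB[_ ?] <-].
Qed.

End Bump.

(** * The adjoint representation *)

Section LieAlgebraTheory.
Variables (R : realType) (G : topGroupType) (n : nat) (A : set (chart R G n)).
Hypothesis hG : is_lie_group A.
Variables (g : vectType R) (exp : g -> G) (br : g -> g -> g).
Hypothesis hg : is_lie_algebra A exp br.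
Implicit Types (X Y Z : g) (f : G -> R).

Local Notation linv := (lie_der exp).

Lemma linvP a X Y f x : smooth_fun A f -> linv (a *: X + Y) f x = a * linv X f x + linv Y f x.
Proof. by move=> hf; rewrite lie_derE (linv_field_linear hg). Qed.

Lemma linv0 f x : smooth_fun A f -> linv 0 f x = 0.
Proof.
move=> hf; have := linvP 1 0 0 x hf; rewrite scaler0 addr0 mul1r => E.
by apply: (addIr (linv 0 f x)); rewrite add0r -E.
Qed.

Lemma linvD X Y f x : smooth_fun A f -> linv (X + Y) f x = linv X f x + linv Y f x.
Proof. by move=> hf; rewrite -[X]scale1r linvP // mul1r scale1r. Qed.

Lemma linvZ a X f x : smooth_fun A f -> linv (a *: X) f x = a * linv X f x.
Proof. by move=> hf; rewrite -[a *: X]addr0 linvP // linv0 // addr0. Qed.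

Lemma linvN X f x : smooth_fun A f -> linv (- X) f x = - linv X f x.
Proof. by move=> hf; rewrite -scaleN1r linvZ // mulN1r. Qed.

Lemma linvB X Y f x : smooth_fun A f -> linv (X - Y) f x = linv X f x - linv Y f x.
Proof. by move=> hf; rewrite linvD // linvN. Qed.

Lemma linv_sum (I : Type) (r : seq I) (P : pred I) (F : I -> g) f x : smooth_fun A f ->
  linv (\sum_(i <- r | P i) F i) f x = \sum_(i <- r | P i) linv (F i) f x.
Proof.
move=> hf; elim: r => [|i r IH]; first by rewrite !big_nil linv0.
by rewrite !big_cons; case: ifP => _ //; rewrite linvD // IH.
Qed.

Lemma linv_br X Y f x : smooth_fun A f ->
  linv (br X Y) f x = linv X (linv Y f) x - linv Y (linv X f) x.
Proof. by move=> hf; rewrite lie_derE (linv_field_bracket hg). Qed.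

Lemma linv_L X f x z : linv X (fun y => f (z * y)%g) x = linv X f (z * x)%g.
Proof.
rewrite !linvE; apply: derive_congr => h; by rewrite mulgA.
Qed.

(** Smooth functions are constant along exp(sX), by left translation, and bumps separate points, so
    exp(sX) = 1 and the generator is 0. Since [br] and [exp] are known only through their action on
    functions, every identity of the Lie algebra is proved by this test. *)
Lemma linv_inj X : (forall f, smooth_fun A f -> linv X f 1%g = 0) -> X = 0.
Proof.
move=> H.
have H' f x : smooth_fun A f -> linv X f x = 0.
  move=> hf; have := H _ (smooth_funL hG x hf); by rewrite linv_L mulg1.
have E s : exp (s *: X) = 1%g.
  apply: contrapT => ne.
  have oW : open (~` [set exp (s *: X)]).
    apply: closed_openC; apply: (@compact_closed _ _ (lie_hausdorff hG)); exact: compact_set1.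
  have [f [C [[sf _] f1 _ CW Cf]]] := bump_exists hG oW (fun h => ne (esym h)).
  have f0 : f (exp (s *: X)) = 0 by apply: Cf => /CW; apply.
  have fE : f (exp (s *: X)) = f 1%g.
    have d t : is_derive t (1 : R) (fun s : R => f (1 * exp (s *: X))%g) 0.
      by have := linv_is_derive hG hg X 1%g t sf; rewrite H'.
    have := is_derive_0_is_cst s 0 d.
    by rewrite scale0r (exp0 hg) !mul1g.
  by move: f1; rewrite -fE f0 ltxx.
have [Y [_ U]] := one_param_exp hg (exp_one_param hg 0).
have Y0 : Y = 0 by apply: U => s; rewrite scaler0.
by rewrite -Y0; apply/esym/U => s; rewrite scaler0 (exp0 hg) E.
Qed.

Lemma linv_inj2 X Y : (forall f, smooth_fun A f -> linv X f 1%g = linv Y f 1%g) -> X = Y.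
Proof.
by move=> H; apply/subr0_eq/linv_inj => f hf; rewrite linvB // H // subrr.
Qed.

Local Notation smf := (smooth_fun_linv hG hg).

Lemma br_linear_r a X Y Z : br X (a *: Y + Z) = a *: br X Y + br X Z.
Proof.
apply: linv_inj2 => f hf; rewrite [LHS]linv_br // [RHS]linvD // linvZ // !linv_br //.
have -> : linv (a *: Y + Z) f = fun x => a * linv Y f x + linv Z f x.
  by apply/funext => x; rewrite linvD // linvZ.
have -> : linv X (fun x => a * linv Y f x + linv Z f x) 1%g = a * linv X (linv Y f) 1%g + linv X (linv Z f) 1%g.
  rewrite !(linvE _ X).
  have dY := linv_is_derive hG hg X 1%g 0 (smf Y hf).
  have dZ := linv_is_derive hG hg X 1%g 0 (smf Z hf).
  have [_ ->] := is_deriveD (is_deriveZ a dY) dZ.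
  have [_ ->] := dY; have [_ ->] := dZ; by [].
rewrite (linvD (a *: Y) Z 1%g (smf X hf)) (linvZ a Y 1%g (smf X hf)).
move: (linv X (linv Y f) 1%g) (linv X (linv Z f) 1%g) (linv Y (linv X f) 1%g) (linv Z (linv X f) 1%g) => a1 a2 a3 a4.
by rewrite mulrBr opprD addrACA.
Qed.

Lemma br_anti X Y : br X Y = - br Y X.
Proof. by apply: linv_inj2 => f hf; rewrite linvN // !linv_br // opprB. Qed.

Lemma br_linear_l a X Y Z : br (a *: X + Y) Z = a *: br X Z + br Y Z.
Proof. by rewrite br_anti br_linear_r opprD -scalerN -!br_anti. Qed.

Lemma linv_derB X f h x : smooth_fun A f -> smooth_fun A h ->
  linv X (fun x => f x - h x) x = linv X f x - linv X h x.
Proof.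
move=> hf hh; rewrite !(linvE _ X).
have df := linv_is_derive hG hg X x 0 hf.
have dh := linv_is_derive hG hg X x 0 hh.
have [_ ->] := is_deriveB df dh.
by have [_ ->] := df; have [_ ->] := dh.
Qed.

Lemma br_jacobi X Y Z : br X (br Y Z) = br (br X Y) Z + br Y (br X Z).
Proof.
apply: linv_inj2 => f hf; rewrite linvD //.
have E U V : linv (br U V) f = fun x => linv U (linv V f) x - linv V (linv U f) x.
  by apply/funext => x; exact: linv_br.
rewrite (linv_br X _ _ hf) (linv_br (br X Y) _ _ hf) (linv_br Y _ _ hf) !E !linv_derB; try by do 2 apply: smf.
rewrite (linv_br Y Z 1%g (smf X hf)) (linv_br X Y 1%g (smf Z hf)) (linv_br X Z 1%g (smf Y hf)).
move: (linv X (linv Y (linv Z f)) 1%g) (linv X (linv Z (linv Y f)) 1%g) (linv Y (linv Z (linv X f)) 1%g)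
  (linv Z (linv Y (linv X f)) 1%g) (linv Y (linv X (linv Z f)) 1%g) (linv Z (linv X (linv Y f)) 1%g) => a1 a2 a3 a4 a5 a6.
by ring.
Qed.

(** Conjugation carries one-parameter subgroups to one-parameter subgroups, and these have
    generators by [one_param_exp]. *)
Lemma Ad_ex x X : exists Y, forall s, (x * exp (s *: X) * x^-1)%g = exp (s *: Y).
Proof.
have op : one_param A (fun s => x * exp (s *: X) * x^-1)%g.
  split; last by move=> s t; rewrite (exp_add hg) !mulgA mulgVK.
  have oT : open [set: R^o] by exact: openT.
  have cR := fincoordR (R := R).
  have gs : gsmooth A setT (fun s : R^o => x * exp (s *: X) * x^-1)%g.
    apply: (gsmooth_mul hG cR oT); last exact: gsmooth_cst.
    apply: (gsmooth_mul hG cR oT); first exact: gsmooth_cst.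
    by apply: (@gsmooth_exp _ _ _ _ hG _ _ _ hg _ cR setT id) => // k; apply: (@Ck_on_lin _ R^o R^o k setT idfun) => z; exact: cvg_id.
  split; first by move=> s; exact: gs.1.
  by move=> c Ac k; have := gs.2 c Ac k; rewrite setTI.
by have [Y [HY _]] := one_param_exp hg op; exists Y.
Qed.

Definition Ad x X : g := sval (cid (Ad_ex x X)).

Lemma AdE x X s : (x * exp (s *: X) * x^-1)%g = exp (s *: Ad x X).
Proof. exact: (svalP (cid (Ad_ex x X))). Qed.

(** Turns Ad into right translation of functions, so that its linearity, its compatibility with
    brackets and its continuity are inherited from left-invariant fields. *)
Lemma linv_Ad x X f z : linv (Ad x X) f z = linv X (fun y => f (y * x^-1)%g) (z * x)%g.
Proof.
rewrite !linvE; apply: derive_congr => h; by rewrite addr0 -AdE !mulgA.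
Qed.

Lemma Ad_linear x a X Y : Ad x (a *: X + Y) = a *: Ad x X + Ad x Y.
Proof.
apply: linv_inj2 => f hf; rewrite linvD // linvZ // !linv_Ad.
by rewrite linvD ?linvZ //; exact: smooth_funR.
Qed.

Lemma Ad_br x X Y : Ad x (br X Y) = br (Ad x X) (Ad x Y).
Proof.
apply: linv_inj2 => f hf; rewrite linv_br // !linv_Ad.
have hfx := smooth_funR hG x^-1%g hf.
have E U : (fun y => linv (Ad x U) f (y * x^-1)%g) = linv U (fun y => f (y * x^-1)%g).
  by apply/funext => y; rewrite linv_Ad mulgVK.
by rewrite (linv_br X Y _ hfx) (E X) (E Y).
Qed.

Lemma exp_inj X Y : (forall s, exp (s *: X) = exp (s *: Y)) -> X = Y.
Proof.
move=> H; have [Z [_ U]] := one_param_exp hg (exp_one_param hg X).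
by rewrite -(U X (fun _ => erefl)); apply: U.
Qed.

Lemma AdM x y X : Ad (x * y)%g X = Ad x (Ad y X).
Proof. by apply: exp_inj => s; rewrite -!AdE invgM !mulgA. Qed.

Lemma Ad1 X : Ad 1%g X = X.
Proof. by apply: exp_inj => s; rewrite -AdE mul1g invg1 mulg1. Qed.

Lemma AdK x : cancel (Ad x) (Ad x^-1%g).
Proof. by move=> X; rewrite -AdM mulVg Ad1. Qed.

Lemma AdKV x : cancel (Ad x^-1%g) (Ad x).
Proof. by move=> X; rewrite -AdM mulgV Ad1. Qed.

Lemma linv_Ad1 x X f : linv (Ad x X) f 1%g = linv X (fun y => f (y * x^-1)%g) x.
Proof. by rewrite linv_Ad mul1g. Qed.

Lemma linv_Ad_cont X f : smooth_fun A f -> continuous (fun x => linv (Ad x X) f 1%g).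
Proof.
move=> hf x; under eq_fun do rewrite linv_Ad1.
apply: (@continuous_comp _ _ _ (fun x : G => (x, x^-1%g)) (fun z : G * G => linv X (fun y => f (y * z.2)%g) z.1)).
  by apply: continuous_pair; [exact: cvg_id|exact: invg_continuous].
exact: (linv_R_cont hG hg).
Qed.

(* The key derivative: at s = 0, Ad (exp (s X)) Y moves in the direction [X, Y].
   Both mixed second derivatives of f (exp (a X) exp (t Y) exp (- b X)) enter,
   and Schwarz's theorem exchanges the one in b. *)
Lemma linv_Ad_exp_derive X Y f : smooth_fun A f ->
  is_derive (0 : R) (1 : R) (fun s : R => linv (Ad (exp (s *: X)) Y) f 1%g) (linv (br X Y) f 1%g).
Proof.
move=> hf.
pose V : normedModType R := (R^o * (R^o * R^o))%type.
have cR := fincoordR (R := R).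
have cV : fincoord V := fincoord_prod cR (fincoord_prod cR cR).
have oT : open [set: V] by exact: openT.
pose Phi (z : V) := f (exp (z.1 *: X) * exp (z.2.1 *: Y) * exp (- z.2.2 *: X))%g.
have s2 : smooth_on setT (snd : V -> R^o * R^o) by exact: smooth_on_snd.
have sPhi : smooth_on setT Phi.
  apply: (smooth_funP hG cV hf oT).
  apply: (gsmooth_mul hG cV oT); [apply: (gsmooth_mul hG cV oT)|].
  - by apply: (gsmooth_exp hG hg cV) => //; exact: smooth_on_fst.
  - by apply: (gsmooth_exp hG hg cV) => //; exact: smooth_on_fstE.
  - apply: (gsmooth_exp hG hg cV) => // k.
    apply: (@Ck_on_linl _ _ R^o R^o k setT _ -%R) => //.
    + by move=> a x; rewrite scalerN.
    + by move=> a x; rewrite opprD.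
    + by move=> x; apply: cvgN; exact: cvg_id.
    + exact: (smooth_on_sndE oT s2).
pose e1 : V := (1, (0, 0)); pose e2 : V := (0, (1, 0)); pose e3 : V := (0, (0, 1)).
have S1 := Ck_on_D e2 (sPhi 2%N).
have E2 s b : 'D_e2 Phi (s, (0, b)) = linv Y (fun y => f (y * exp (- b *: X))%g) (exp (s *: X)).
  rewrite linvE; apply: derive_congr => h /=; rewrite /Phi /= !scaler0 !add0r !addr0.
  by rewrite -[h *: 1]/(h * 1) mulr1.
have E0 s : linv (Ad (exp (s *: X)) Y) f 1%g = 'D_e2 Phi (s, (0, s)).
  by rewrite linv_Ad1 E2 -(expN hg) scaleNr.
have Dl : is_derive (0 : R) (1 : R) (fun s : R => 'D_e2 Phi ((0 : V) + s *: (e1 + e3))) ('D_(e1 + e3) ('D_e2 Phi) 0).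
  have d0 : derivable ('D_e2 Phi) ((0 : V) + (0 : R) *: (e1 + e3)) (e1 + e3).
    by rewrite scale0r addr0; exact: (Ck_on_derivable S1).
  by have := is_derive_line d0; rewrite scale0r addr0.
have -> : (fun s : R => linv (Ad (exp (s *: X)) Y) f 1%g) = (fun s : R => 'D_e2 Phi ((0 : V) + s *: (e1 + e3))).
  apply/funext => s; rewrite E0; congr ('D_e2 Phi _).
  by rewrite add0r; congr pair; [|congr pair]; rewrite /= ?addr0 ?add0r ?scaler0 // -[s *: 1]/(s * 1) mulr1.
apply: is_derive_eq Dl _.
have EQ1 := @Ck1_DvD _ _ cV setT _ 0 e1 e3 oT S1 I.
have EQ2 := @Ck2_schwarz _ _ setT Phi 0 e3 e2 oT (sPhi 2%N) I.
apply: (etrans EQ1); rewrite (linv_br X Y 1%g hf); congr (_ + _); last apply: (etrans EQ2).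
- rewrite [RHS]linvE; apply: derive_congr => h; rewrite /= addr0.
  have -> : h *: e1 = (h, (0, 0)) :> V.
    by rewrite -[LHS]/((h * 1, (h * 0, h * 0)) : V) mulr1 mulr0.
  rewrite addr0 E2 oppr0 scale0r (exp0 hg) -[h *: 1]/(h * 1) mulr1 mul1g.
  by under eq_fun do rewrite mulg1.
- have E3 t : 'D_e3 Phi (0, (t, 0)) = - linv X f (exp (t *: Y)).
    rewrite -(linvN X _ hf) linvE; apply: derive_congr => h.
    have -> : h *: e3 + (0, (t, 0)) = (0, (t, h)) :> V.
      by rewrite -[LHS]/((h * 0 + 0, (h * 0 + t, h * 1 + 0)) : V) !mulr0 mulr1 !addr0 add0r.
    rewrite /Phi /= scale0r (exp0 hg) mul1g addr0 -[h *: 1]/(h * 1) mulr1.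
    by rewrite scalerN scaleNr.
  rewrite !(linvE _ Y).
  have [dX _] := linv_is_derive hG hg Y 1%g 0 (smf X hf).
  apply: etrans (deriveN dX); apply: derive_congr => h; rewrite /= addr0.
  have -> : h *: e2 = (0, (h, 0)) :> V.
    by rewrite -[LHS]/((h * 0, (h * 1, h * 0)) : V) mulr1 mulr0.
  by rewrite E3 -[RHS]/(- linv X f (1 * exp ((h *: 1 + 0) *: Y))%g) mul1g addr0 -[h *: 1]/(h * 1) mulr1.
Qed.

End LieAlgebraTheory.

(** * Linear functionals on the Lie algebra as derivatives of smooth functions *)

Section Functionals.
Variables (R : realType) (G : topGroupType) (n : nat) (A : set (chart R G n)).
Hypothesis hG : is_lie_group A.
Variables (g : vectType R) (exp : g -> G) (br : g -> g -> g).
Hypothesis hg : is_lie_algebra A exp br.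
Implicit Types (X Y Z : g) (f : G -> R).

Local Notation linv := (lie_der exp).

Lemma smooth_fun_add f h : smooth_fun A f -> smooth_fun A h -> smooth_fun A (fun x => f x + h x).
Proof.
move=> hf hh c Ac k.
exact: (Ck_on_add (chart_img_open hG Ac) (hf c Ac k) (hh c Ac k)).
Qed.

Lemma smooth_fun_cst (a : R) : smooth_fun A (fun=> a).
Proof. by move=> c Ac k; exact: Ck_on_cst. Qed.

Lemma smooth_fun_mul f h : smooth_fun A f -> smooth_fun A h -> smooth_fun A (fun x => f x * h x).
Proof.
move=> hf hh c Ac k.
exact: (Ck_on_mul (chart_img_open hG Ac) (hf c Ac k) (hh c Ac k)).
Qed.

Lemma smooth_fun_scale a f : smooth_fun A f -> smooth_fun A (fun x => a * f x).
Proof. by move=> hf; apply: smooth_fun_mul => //; exact: smooth_fun_cst. Qed.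

Lemma linv_add_scale X a f h x : smooth_fun A f -> smooth_fun A h ->
  linv X (fun x => a * f x + h x) x = a * linv X f x + linv X h x.
Proof.
move=> hf hh; rewrite !(linvE _ X).
have df := linv_is_derive hG hg X x 0 hf.
have dh := linv_is_derive hG hg X x 0 hh.
have [_ ->] := is_deriveD (is_deriveZ a df) dh.
by have [_ ->] := df; have [_ ->] := dh.
Qed.

Let b := vbasis {:g}.
Let N := \dim {:g}.
Let cof (Z : g) : 'cV[R]_N := \col_i coord b i Z.

Let S (v : 'rV[R]_N) := exists2 f, smooth_fun A f & forall Z, linv Z f 1%g = (v *m cof Z) ord0 ord0.

Let S_lin a u v : S u -> S v -> S (a *: u + v).
Proof.
move=> [f hf fE] [h hh hE]; exists (fun x => a * f x + h x).
  by apply: smooth_fun_add => //; exact: smooth_fun_scale.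
by move=> Z; rewrite linv_add_scale // fE hE mulmxDl -scalemxAl !mxE.
Qed.

Let S0 : S 0.
Proof.
exists (fun=> 0); first exact: smooth_fun_cst.
move=> Z; rewrite mul0mx mxE linvE.
by rewrite derive_cst.
Qed.

Let S_of f : smooth_fun A f -> S (\row_i linv b`_i f 1%g).
Proof.
move=> hf; exists f => // Z; rewrite mxE {1}(coord_vbasis (memvf Z)).
rewrite (linv_sum hg) //; apply: eq_bigr => i _.
by rewrite (linvZ hg) // !mxE mulrC.
Qed.

(** Induction on the rank of the realised rows: as long as they do not span, some nonzero Z is
    annihilated by all of them, and by [linv_inj] some smooth f has a nonzero derivative along Z,
    which gives an independent row. *)
Let S_full v : S v.
Proof.
have H k : (k <= N)%N -> exists2 M : 'M[R]_(k, N), (\rank M = k) & forall i, S (row i M).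
  elim: k => [|k IH] kN; first by exists 0; [rewrite mxrank0|case].
  have [M rM SM] := IH (ltnW kN).
  have [u u0 Mu] : exists2 u : 'cV[R]_N, u != 0 & M *m u = 0.
    have : kermx M^T != 0.
      by rewrite -mxrank_eq0 mxrank_ker mxrank_tr rM subn_eq0 -ltnNge.
    move=> /rowV0Pn[w /sub_kermxP wM w0]; exists w^T.
      by apply: contra w0 => /eqP/(congr1 trmx); rewrite trmxK trmx0 => ->.
    by rewrite -[M]trmxK -trmx_mul wM trmx0.
  pose Z := \sum_i u i ord0 *: b`_i.
  have cZ : cof Z = u.
    apply/colP => i; rewrite mxE /Z.
    rewrite linear_sum (bigD1 i) //= linearZ /= coord_free ?(basis_free (vbasisP _)) // eqxx /= big1 ?addr0 ?mulr1 // => j ji.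
    by rewrite linearZ /= coord_free ?(basis_free (vbasisP _)) // (negbTE ji) mulr0.
  have Z0 : Z != 0.
    apply: contra u0 => /eqP Z0; rewrite -cZ Z0; apply/eqP/colP => i.
    by rewrite !mxE linear0.
  have [f hf fZ] : exists2 f, smooth_fun A f & linv Z f 1%g != 0.
    apply: contrapT => H; move/eqP: Z0; apply; apply: (linv_inj hG hg) => f hf.
    by apply: contrapT => fZ; apply: H; exists f => //; exact/eqP.
  pose w := \row_i linv b`_i f 1%g : 'rV[R]_N.
  have wu : w *m u != 0.
    apply: contra fZ => /eqP wu; have [h hh hE] := S_of hf.
    rewrite (coord_vbasis (memvf Z)) (linv_sum hg) //.
    apply/eqP; transitivity ((w *m u) ord0 ord0); last by rewrite wu mxE.
    by rewrite mxE; apply: eq_bigr => i _; rewrite (linvZ hg) // -cZ !mxE mulrC.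
  exists (col_mx w M : 'M[R]_(1 + k, N)).
    apply/eqP; rewrite eqn_leq rank_leq_row /=.
    have -> : \rank (col_mx w M) = \rank (w + M)%MS by rewrite addsmxE.
    rewrite mxrank_disjoint_sum.
      by rewrite rM -add1n leq_add2r lt0n mxrank_eq0; apply: contra wu => /eqP ->; rewrite mul0mx.
    apply/eqP; rewrite -submx0; apply/rV_subP => z; rewrite sub_capmx => /andP[/sub_rVP[a ->] /submxP[D E]].
    have : a *: w *m u = 0 by rewrite E -mulmxA Mu mulmx0.
    rewrite -scalemxAl => /eqP; rewrite scaler_eq0 (negbTE wu) orbF => /eqP ->.
    by rewrite scale0r sub0mx.
  move=> i; rewrite -(@splitK 1 k i); case: fintype.split => j /=.
    have -> : row (lshift k j) (col_mx w M) = row j w := rowKu _ _ _.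
    by rewrite (ord1 j) row_id; exact: S_of.
  have -> : row (rshift 1 j) (col_mx w M) = row j M := rowKd _ _ _.
  exact: SM.
have [M rM SM] := H N (leqnn _).
have : (v <= M)%MS by apply: submx_full; rewrite /row_full rM.
move=> /submxP[D ->].
have -> : D *m M = \sum_i D ord0 i *: row i M.
  by rewrite mulmx_sum_row.
elim/big_rec: _ => [|i z _ Sz]; first exact: S0.
exact: S_lin.
Qed.

(** Gives access to the coefficients of Ad: what [linv_Ad_cont] and [linv_Ad_exp_derive] say of
    derivatives of functions at 1 becomes a statement on any linear functional. *)
Lemma functional_smooth (l : g -> R) : (forall a X Y, l (a *: X + Y) = a * l X + l Y) ->
  exists2 f, smooth_fun A f & forall Z, l Z = linv Z f 1%g.
Proof.
move=> lL; have [f hf fE] := S_full (\row_i l b`_i).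
have l0 : l 0 = 0.
  by have := lL (-1) 0 0; rewrite scaler0 addr0 mulN1r addNr.
exists f => // Z; rewrite fE mxE {1}(coord_vbasis (memvf Z)).
transitivity (\sum_(i < N) coord b i Z * l b`_i); last by apply: eq_bigr => i _; rewrite !mxE mulrC.
have H m (c : 'I_m -> R) (e : 'I_m -> g) : l (\sum_i c i *: e i) = \sum_i c i * l (e i).
  elim: m c e => [|m IH] c e; first by rewrite !big_ord0.
  by rewrite !big_ord_recl lL IH.
exact: H.
Qed.

Lemma functional_Ad_cont (l : g -> R) X : (forall a X Y, l (a *: X + Y) = a * l X + l Y) ->
  continuous (fun x => l (Ad hG hg x X)).
Proof.
move=> /functional_smooth[f hf fE]; under eq_fun do rewrite fE.
exact: linv_Ad_cont.
Qed.

(** The derivative at s reduces to the one at 0, because l composed with Ad(exp(sX)) is again a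
    linear functional. *)
Lemma functional_Ad_derive (l : g -> R) X Y (s : R) : (forall a X Y, l (a *: X + Y) = a * l X + l Y) ->
  is_derive s (1 : R) (fun s : R => l (Ad hG hg (exp (s *: X)) Y)) (l (Ad hG hg (exp (s *: X)) (br X Y))).
Proof.
move=> lL.
have lL' : forall a U V, l (Ad hG hg (exp (s *: X)) (a *: U + V)) = a * l (Ad hG hg (exp (s *: X)) U) + l (Ad hG hg (exp (s *: X)) V).
  by move=> a U V; rewrite Ad_linear lL.
have [f hf fE] := functional_smooth lL'.
have [d1 d2] := linv_Ad_exp_derive hG hg X Y hf.
have E h : (fun s : R => linv (Ad hG hg (exp (s *: X)) Y) f 1%g) (h *: 1 + 0) =
  (fun s : R => l (Ad hG hg (exp (s *: X)) Y)) (h *: 1 + s).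
  by rewrite /= addr0 addrC (exp_add hg) AdM fE.
rewrite fE -d2; split; first exact: derivable_congr E d1.
by apply/esym/derive_congr.
Qed.

End Functionals.

(** * Continuity of the exponential map *)

Section ExpContinuous.
Variables (R : realType) (G : topGroupType) (n : nat) (A : set (chart R G n)).
Hypothesis hG : is_lie_group A.
Variables (g : vectType R) (exp : g -> G) (br : g -> g -> g).
Hypothesis hg : is_lie_algebra A exp br.
Implicit Types (X Y Z : g) (f : G -> R).

Local Notation linv := (lie_der exp).

Lemma mulg_cont (T : topologicalType) (f h : T -> G) x :
  {for x, continuous f} -> {for x, continuous h} -> {for x, continuous (fun y => f y * h y)%g}.
Proof.
move=> cf ch; apply: (@continuous2_cvg _ _ _ _ _ _ f h (fun x y => x * y)%g (f x) (h x)) => //.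
exact: (@mulg_continuous G (f x, h x)).
Qed.

Lemma invg_cont (T : topologicalType) (f : T -> G) x :
  {for x, continuous f} -> {for x, continuous (fun y => (f y)^-1)%g}.
Proof. by move=> cf; apply: continuous_comp => //; exact: invg_continuous. Qed.

(* Along s |-> exp (s Z) exp ((1 - s) X) the left-invariant derivatives of X cancel. *)
Lemma exp_path_derive X Y f (s : R) : smooth_fun A f ->
  is_derive s (1 : R) (fun s : R => f (exp (s *: (X + Y)) * exp ((1 - s) *: X))%g)
    (linv Y (fun x => f (x * exp ((1 - s) *: X))%g) (exp (s *: (X + Y)))).
Proof.
move=> hf.
pose V : normedModType R := (R^o * R^o)%type.
have cR := fincoordR (R := R).
have cV : fincoord V := fincoord_prod cR cR.
have oT : open [set: V] by exact: openT.
pose Phi (z : V) := f (exp (z.1 *: (X + Y)) * exp ((1 - z.2) *: X))%g.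
have sPhi : smooth_on setT Phi.
  apply: (smooth_funP hG cV hf oT); apply: (gsmooth_mul hG cV oT).
    by apply: (gsmooth_exp hG hg cV) => //; exact: smooth_on_fst.
  apply: (gsmooth_exp hG hg cV) => // k.
  apply: (@Ck_on_add _ V R^o k setT (fun _ => 1) (fun v => - v.2)) => //; first exact: Ck_on_cst.
  apply: (@Ck_on_linl _ _ R^o R^o k setT _ -%R) => //.
  + by move=> a x; rewrite scalerN.
  + by move=> a x; rewrite opprD.
  + by move=> x; apply: cvgN; exact: cvg_id.
  + exact: smooth_on_snd.
pose e1 : V := (1, 0); pose e2 : V := (0, 1).
pose p : V := (s, s).
have Dl := @is_derive_line _ _ _ Phi 0 (e1 + e2) s.
have pE t : (0 : V) + t *: (e1 + e2) = (t, t).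
  by rewrite -[LHS]/((0 + t * (1 + 0), 0 + t * (0 + 1)) : V) !add0r addr0 mulr1.
have {}Dl : is_derive s (1 : R) (fun t : R => Phi (t, t)) ('D_(e1 + e2) Phi p).
  rewrite (_ : (fun t => _) = fun t => Phi (0 + t *: (e1 + e2))); last by apply/funext => t; rewrite pE.
  rewrite (_ : p = 0 + s *: (e1 + e2)); last by rewrite pE.
  by apply: Dl; exact: (Ck_on_derivable (sPhi 1%N)).
apply: is_derive_eq Dl _.
have EQ1 := @Ck1_DvD _ _ cV setT _ p e1 e2 oT (sPhi 1%N) I.
apply: (etrans EQ1).
set a := (1 - s) *: X.
have hfa := smooth_funR hG (exp a) hf.
have -> : 'D_e1 Phi p = linv (X + Y) (fun x => f (x * exp a)%g) (exp (s *: (X + Y))).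
  rewrite linvE; apply: derive_congr => h.
  rewrite -[h *: e1 + p]/((h * 1 + s, h * 0 + s) : V) mulr0 add0r mulr1 /Phi /= -/a.
  by rewrite addr0 -[h *: 1]/(h * 1) mulr1 addrC (exp_add hg).
have -> : 'D_e2 Phi p = linv (- X) (fun x => f (x * exp a)%g) (exp (s *: (X + Y))).
  rewrite linvE; apply: derive_congr => h.
  rewrite -[h *: e2 + p]/((h * 0 + s, h * 1 + s) : V) mulr0 add0r mulr1 /Phi /=.
  rewrite addr0 -[h *: 1]/(h * 1) mulr1 /a -mulgA; congr (f (_ * _)%g).
  by rewrite scalerN -scaleNr -(exp_add hg); congr (exp (_ *: _)); rewrite opprD addrCA addrC.
rewrite -(linvD hg _ _ _ hfa); congr (linv _ _ _).
by rewrite addrAC subrr add0r.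
Qed.

Lemma linv_supp f X C x : closed C -> (forall y, ~ C y -> f y = 0) -> ~ C x -> linv X f x = 0.
Proof.
move=> cC f0 Cx; rewrite linvE.
have c1 : {for (0 : R), continuous (fun s : R => x * exp (s *: X))%g}.
  by apply: mulg_cont; [exact: cvg_cst|exact: (exp_line_continuous hg)].
have nx : \forall s \near (0 : R), ~ C (x * exp (s *: X))%g.
  have : nbhs (x * exp (0 *: X))%g (~` C).
    by apply: open_nbhs_nbhs; split; [exact: closed_openC|rewrite scale0r (exp0 hg) mulg1].
  by move=> /c1.
have nE : {near (0 : R), cst 0 =1 (fun s : R => f (x * exp (s *: X))%g)}.
  by move: nx; apply: filterS => s /f0 ->.
by rewrite -(near_eq_derive _ nE) ?oner_neq0 // derive_cst.
Qed.

Lemma continuous_compact_bounded (T : topologicalType) (C : set T) (f : T -> R) : compact C ->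
  (forall x, C x -> {for x, continuous f}) -> exists2 M : R, 0 < M & forall x, C x -> `|f x| <= M.
Proof.
move=> cC cf.
have : compact (f @` C).
  by apply: continuous_compact => //; apply: continuous_in_subspaceT => x; rewrite inE; exact: cf.
move=> /compact_bounded[M [_ HM]]; exists (`|M| + 1); first by rewrite ltr_wpDl.
move=> x Cx; apply: HM; last by exists x.
by apply: le_lt_trans (ler_norm _) _; rewrite ltrDl.
Qed.

(** The path of [exp_path_derive] joins exp X to exp(X + Y), and its derivative is linear in Y with
    coefficients bounded uniformly on the path, by compactness of the support of f. *)
Lemma exp_lipschitz m (E : 'I_m -> g) X f C : smooth_fun A f -> compact C ->
  (forall y, ~ C y -> f y = 0) ->
  exists2 M : R, 0 < M & forall y : 'rV[R]_m,
    `|f (exp (X + \sum_i y ord0 i *: E i)) - f (exp X)| <= M * `|y|.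
Proof.
move=> hf cC f0.
have H i : exists2 M : R, 0 < M & forall (r : R) x, 0 <= r <= 1 -> `|linv (E i) (fun x => f (x * exp (r *: X))%g) x| <= M.
  pose D : set (R * G) := `[0, 1]%classic `*` C.
  have cD : compact D by apply: compact_setX => //; exact: segment_compact.
  (* Reparametrised by z.2 = x exp(rX): the derivative can only be nonzero for z.2 in [C], so that
     the bound is taken on the compact product of [0, 1] and [C]. *)
  have cF z : {for z, continuous (fun z : R * G => linv (E i) (fun x => f (x * exp (z.1 *: X))%g) (z.2 * exp (- z.1 *: X))%g)}.
    have ce (w : R * G -> R) : {for z, continuous w} -> {for z, continuous (fun z => exp (w z *: X))}.
      move=> cw; apply: (@continuous_comp _ _ _ w (fun s : R => exp (s *: X))) => //.
      exact: (exp_line_continuous hg).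
    apply: (@continuous_comp _ _ _ (fun z : R * G => ((z.2 * exp (- z.1 *: X))%g, exp (z.1 *: X)))
      (fun z : G * G => linv (E i) (fun x => f (x * z.2)%g) z.1)); last exact: (linv_R_cont hG hg).
    apply: continuous_pair; last by apply: ce; exact: cvg_fst.
    apply: mulg_cont; first exact: cvg_snd.
    by apply: ce; apply: continuousN; exact: cvg_fst.
  have [M M0 HM] := continuous_compact_bounded cD (fun z _ => cF z).
  exists M => // r x r01.
  have [Cx|Cx] := pselect (C (x * exp (r *: X))%g).
    have := HM (r, (x * exp (r *: X))%g); rewrite /= -mulgA -(exp_add hg) subrr scale0r (exp0 hg) mulg1.
    by apply; split=> //=; rewrite in_itv.
  rewrite (@linv_supp _ _ ((fun x => x * exp (r *: X))%g @^-1` C)) //.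
  - by rewrite normr0 ltW.
  - apply: closed_comp; first by move=> y _; apply: mulg_cont; [exact: cvg_id|exact: cvg_cst].
    by apply: compact_closed => //; exact: lie_hausdorff hG.
  - by move=> y; exact: f0.
pose M := \sum_i sval (cid2 (H i)).
exists (M + 1).
  by rewrite ltr_wpDl // sumr_ge0 // => i _; case: cid2 => ? /= /ltW.
move=> y; set Y := \sum_i _.
have [||t t01] := @MVT_segment R (fun s : R => f (exp (s *: (X + Y)) * exp ((1 - s) *: X))%g)
  (fun s => linv Y (fun x => f (x * exp ((1 - s) *: X))%g) (exp (s *: (X + Y)))) 0 1 ler01.
- by move=> t _; exact: exp_path_derive.
- by apply: derivable_within_continuous => t _; have [] := exp_path_derive X Y t hf.
rewrite scale1r subrr !scale0r subr0 scale1r (exp0 hg) mulg1 mul1g mulr1 => ->.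
have hft := smooth_funR hG (exp ((1 - t) *: X)) hf.
rewrite (linv_sum hg) //; apply: le_trans (ler_norm_sum _ _ _) _.
rewrite mulrDl mul1r ler_wpDr // mulr_suml; apply: ler_sum => i _.
rewrite (linvZ hg) // normrM mulrC; apply: ler_pM => //.
  case: cid2 => M' M0 /=; apply.
  by move: t01; rewrite in_itv /= => /andP[t0 t1]; rewrite subr_ge0 t1 gerBl.
by rewrite [leRHS]/Num.Def.normr/= mx_normrE; apply: (le_bigmax _ _ (ord0, i)).
Qed.

(** A bump at the image point remains positive for nearby parameters by [exp_lipschitz], so their
    images stay in its support. *)
Lemma exp_continuous m (E : 'I_m -> g) : continuous (fun y : 'rV[R]_m => exp (\sum_i y ord0 i *: E i)).
Proof.
move=> y0 W; rewrite nbhsE => -[W' [oW' W'y] W'W].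
have [f [C [[hf fge0] fy cC CW Cf]]] := bump_exists hG oW' W'y.
have [M M0 HM] := exp_lipschitz E (\sum_i y0 ord0 i *: E i) hf cC Cf.
set X := \sum_i _ in fy HM.
have d0 : 0 < f (exp X) / M by rewrite divr_gt0.
apply/nbhs_ballP; exists (f (exp X) / M) => // y; rewrite -ball_normE /= => yd.
apply: W'W; apply: CW; apply: contrapT => /Cf f0.
have := HM (y - y0).
have -> : X + \sum_i (y - y0) ord0 i *: E i = \sum_i y ord0 i *: E i.
  by rewrite /X -big_split /=; apply: eq_bigr => i _; rewrite addrC -scalerDl !mxE subrK.
rewrite f0 sub0r normrN gtr0_norm // leNgt => /negP; apply.
by rewrite mulrC -ltr_pdivlMr // distrC.
Qed.

End ExpContinuous.

(** * Killing form and restricted roots *)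

Section InnerProduct.
Variables (R : realType) (g : vectType R) (ip : g -> g -> R).
Hypothesis ipC : forall X Y, ip X Y = ip Y X.
Hypothesis ipl : forall a X Y Z, ip (a *: X + Y) Z = a * ip X Z + ip Y Z.
Hypothesis ip_gt0 : forall X, X != 0 -> 0 < ip X X.
Implicit Types (X Y Z : g) (U V : {vspace g}) (s : seq g).

Lemma ip0l X : ip 0 X = 0.
Proof. by have := ipl (-1) 0 0 X; rewrite scaler0 addr0 mulN1r addNr. Qed.

Lemma ip0r X : ip X 0 = 0. Proof. by rewrite ipC ip0l. Qed.

Lemma ipDl X Y Z : ip (X + Y) Z = ip X Z + ip Y Z.
Proof. by rewrite -[X]scale1r ipl mul1r scale1r. Qed.

Lemma ipZl a X Z : ip (a *: X) Z = a * ip X Z.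
Proof. by rewrite -[a *: X]addr0 ipl ip0l addr0. Qed.

Lemma ipDr X Y Z : ip X (Y + Z) = ip X Y + ip X Z.
Proof. by rewrite ipC ipDl !(ipC X). Qed.

Lemma ipZr a X Z : ip X (a *: Z) = a * ip X Z.
Proof. by rewrite ipC ipZl (ipC X). Qed.

Lemma ipNl X Z : ip (- X) Z = - ip X Z.
Proof. by rewrite -scaleN1r ipZl mulN1r. Qed.

Lemma ipNr X Z : ip X (- Z) = - ip X Z.
Proof. by rewrite ipC ipNl ipC. Qed.

Lemma ipBl X Y Z : ip (X - Y) Z = ip X Z - ip Y Z.
Proof. by rewrite ipDl ipNl. Qed.

Lemma ipBr X Y Z : ip X (Y - Z) = ip X Y - ip X Z.
Proof. by rewrite ipDr ipNr. Qed.

Lemma ip_suml (I : Type) (r : seq I) (P : pred I) (F : I -> g) Z :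
  ip (\sum_(i <- r | P i) F i) Z = \sum_(i <- r | P i) ip (F i) Z.
Proof.
elim: r => [|i r IH]; first by rewrite !big_nil ip0l.
by rewrite !big_cons; case: ifP => _ //; rewrite ipDl IH.
Qed.

Lemma ip_sumr (I : Type) (r : seq I) (P : pred I) (F : I -> g) Z :
  ip Z (\sum_(i <- r | P i) F i) = \sum_(i <- r | P i) ip Z (F i).
Proof. by rewrite ipC ip_suml; apply: eq_bigr => i _; rewrite ipC. Qed.

Lemma ip_ge0 X : 0 <= ip X X.
Proof. by have [->|/ip_gt0/ltW//] := eqVneq X 0; rewrite ip0l. Qed.

Lemma ip_eq0 X : ip X X = 0 -> X = 0.
Proof. by move=> h; apply/eqP/negP => /negP/ip_gt0; rewrite h ltxx. Qed.

Lemma ip_inj X Y : (forall Z, ip X Z = ip Y Z) -> X = Y.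
Proof. by move=> h; apply/subr0_eq/ip_eq0; rewrite ipBl h subrr. Qed.

(* A Parseval frame of U; all the identities below are insensitive to the choice. *)
Definition frame U s := (forall f, f \in s -> f \in U) /\
  forall X, X \in U -> X = \sum_(f <- s) ip X f *: f.

Lemma frame_exists U : exists s, [/\ frame U s, size s = \dim U &
  forall f, f \in s -> ip f f = 1].
Proof.
have [k] := ubnP (\dim U); elim: k U => // k IH U dU.
have [->|U0] := eqVneq U 0%VS.
  exists [::]; split=> //; last by rewrite dimv0.
  by split=> // X; rewrite memv0 => /eqP ->; rewrite big_nil.
pose v := vpick U.
have v0 : v != 0 by rewrite vpick0.
pose f := (Num.sqrt (ip v v))^-1 *: v.
have sv : Num.sqrt (ip v v) != 0 by rewrite gt_eqF // sqrtr_gt0 ip_gt0.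
have ff : ip f f = 1.
  by rewrite ipZl ipZr mulrA -invfM -expr2 sqr_sqrtr ?ip_ge0 // mulVf // gt_eqF // ip_gt0.
have fU : f \in U by rewrite memvZ // memv_pick.
have lin : linear (fun X => ip X f : R^o) by move=> a X Y; rewrite ipl.
pose l : {linear g -> R^o} := HB.pack (fun X => ip X f : R^o) (GRing.isLinear.Build _ _ _ _ _ lin).
pose U' := (U :&: lker (linfun l))%VS.
have U'P X : (X \in U') = (X \in U) && (ip X f == 0).
  by rewrite memv_cap memv_ker lfunE.
have sU : (U' <= U)%VS by exact: capvSl.
have nU : f \notin U' by rewrite U'P ff oner_eq0 andbF.
have dU' : (\dim U' < \dim U)%N.
  by rewrite ltn_neqAle dimvS // andbT; apply: contra nU => /eqP h; rewrite (eqP (_ : U' == U)) // eqEdim sU h leqnn.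
have [s [[s1 s2] s3 s4]] := IH U' (leq_trans dU' (ltnSE dU)).
have dUE : \dim U = (\dim U').+1.
  apply/eqP; rewrite eqn_leq dU' andbT.
  have /subvP sub : (U <= U' + <[f]>)%VS.
    apply/subvP => X XU; rewrite -[X](subrK (ip X f *: f)).
    apply: memv_add; last by rewrite memvZ ?memv_line.
    rewrite U'P (memvB XU (memvZ _ fU)) /=.
    by rewrite ipBl ipZl ff mulr1 subrr.
  have /dimvS/leq_trans : (U <= U' + <[f]>)%VS by apply/subvP.
  by apply; apply: leq_trans (dimv_add_leqif _ _) _; rewrite dim_vline -addn1 leq_add2l; case: (f != 0).
exists (f :: s); split => /=; last by move=> h; rewrite inE => /predU1P[->//|/s4].
  split=> [h|X XU].
    by rewrite inE => /predU1P[->//|/s1]; rewrite U'P => /andP[].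
  rewrite big_cons -{1}[X](subrK (ip X f *: f)) addrC; congr (_ + _).
  have XU' : X - ip X f *: f \in U'.
    by rewrite U'P (memvB XU (memvZ _ fU)) /= ipBl ipZl ff mulr1 subrr.
  rewrite {1}(s2 _ XU'); apply: eq_big_seq => h /s1; rewrite U'P => /andP[_ /eqP hf].
  by rewrite ipBl ipZl (ipC f) hf mulr0 subr0.
by rewrite s3 dUE.
Qed.

Definition proj s X := \sum_(f <- s) ip X f *: f.

Lemma projl s a X Y : proj s (a *: X + Y) = a *: proj s X + proj s Y.
Proof.
rewrite /proj scaler_sumr -big_split /=; apply: eq_bigr => f _.
by rewrite ipl scalerDl scalerA.
Qed.

Lemma proj_mem U s X : frame U s -> proj s X \in U.
Proof. by move=> [sU _]; rewrite /proj big_seq; apply: memv_suml => f /sU fU; rewrite memvZ. Qed.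

Lemma proj_id U s X : frame U s -> X \in U -> proj s X = X.
Proof. by move=> [_ h] /h. Qed.

Lemma proj_sym s X Y : ip (proj s X) Y = ip X (proj s Y).
Proof.
rewrite /proj ip_suml ip_sumr; apply: eq_bigr => f _.
by rewrite ipZl ipZr (ipC f) mulrC.
Qed.

Lemma proj_norm U s X : frame U s -> ip (proj s X) (proj s X) = \sum_(f <- s) ip X f ^+ 2.
Proof.
move=> fr; rewrite proj_sym (proj_id fr (proj_mem _ fr)) /proj ip_sumr.
by apply: eq_bigr => f _; rewrite ipZr expr2.
Qed.

Lemma proj_compl U s X Y : frame U s -> Y \in U -> ip (X - proj s X) Y = 0.
Proof. by move=> fr YU; rewrite ipBl proj_sym (proj_id fr YU) subrr. Qed.

Lemma bessel U s X : frame U s -> \sum_(f <- s) ip X f ^+ 2 <= ip X X.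
Proof.
move=> fr; rewrite -(proj_norm X fr) -subr_ge0.
have := ip_ge0 (X - proj s X); rewrite ipBr (proj_compl _ fr (proj_mem _ fr)) subr0 ipBl.
by rewrite [in X in _ -> X]proj_sym (proj_id fr (proj_mem X fr)) -proj_sym.
Qed.

Lemma frame_trace U s s' (S : g -> g) : (forall a X Y, S (a *: X + Y) = a *: S X + S Y) ->
  frame U s -> frame U s' -> \sum_(f <- s) ip (S f) f = \sum_(f <- s') ip (S f) f.
Proof.
move=> SL fr fr'.
have S0 : S 0 = 0.
  by have := SL (-1) 0 0; rewrite scaler0 addr0 scaleN1r addNr.
have Ssum (r : seq g) (c : g -> R) : S (\sum_(f <- r) c f *: f) = \sum_(f <- r) c f *: S f.
  by elim: r => [|f r IH]; rewrite ?big_nil // !big_cons SL IH.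
have h f : f \in s -> ip (S f) f = \sum_(e <- s') ip f e * ip (S e) f.
  move=> fs; rewrite {1}(fr'.2 f (fr.1 f fs)) Ssum ip_suml.
  by apply: eq_bigr => e _; rewrite ipZl.
rewrite (eq_big_seq _ h) exchange_big /=; apply: eq_big_seq => e es.
transitivity (ip (S e) (\sum_(f <- s) ip e f *: f)); last by rewrite -(fr.2 e (fr'.1 e es)).
by rewrite ip_sumr; apply: eq_bigr => f _; rewrite ipZr (ipC f).
Qed.

(** Invariance of the trace under an isomorphism that need not be an isometry: it is applied to Ad
    x, which carries Ad(x^-1) n to n without preserving the inner product. *)
Lemma frame_trace_conj U U' s s' (S phi psi : g -> g) :
  (forall a X Y, phi (a *: X + Y) = a *: phi X + phi Y) ->
  (forall a X Y, psi (a *: X + Y) = a *: psi X + psi Y) ->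
  (forall a X Y, S (a *: X + Y) = a *: S X + S Y) -> cancel phi psi ->
  (forall X, X \in U -> phi X \in U') -> (forall X, X \in U' -> psi X \in U) ->
  (forall X, X \in U -> S X \in U) -> frame U s -> frame U' s' ->
  \sum_(f <- s) ip (S f) f = \sum_(e <- s') ip (phi (S (psi e))) e.
Proof.
move=> phiL psiL SL K pU pU' SU fr fr'.
have L0 (h : g -> g) : (forall a X Y, h (a *: X + Y) = a *: h X + h Y) ->
    forall (r : seq g) (c : g -> R), h (\sum_(f <- r) c f *: f) = \sum_(f <- r) c f *: h f.
  move=> hL r c; have h0 : h 0 = 0.
    by have := hL (-1) 0 0; rewrite scaler0 addr0 scaleN1r addNr.
  by elim: r => [|f r IH]; rewrite ?big_nil // !big_cons hL IH.
have h f : f \in s -> ip (S f) f = \sum_(e <- s') ip (phi f) e * ip (S (psi e)) f.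
  move=> fs; rewrite -{1}(K f) {1}(fr'.2 (phi f) (pU _ (fr.1 f fs))) (L0 _ psiL).
  have -> : S (\sum_(e <- s') ip (phi f) e *: psi e) = \sum_(e <- s') ip (phi f) e *: S (psi e).
    have S0 : S 0 = 0 by have := SL (-1) 0 0; rewrite scaler0 addr0 scaleN1r addNr.
    by elim: (s') => [|e r IH]; rewrite ?big_nil // !big_cons SL IH.
  by rewrite ip_suml; apply: eq_bigr => e _; rewrite ipZl.
rewrite (eq_big_seq _ h) exchange_big /=; apply: eq_big_seq => e es.
have Se : S (psi e) \in U by apply/SU/pU'/(fr'.1).
rewrite [in RHS](fr.2 _ Se) (L0 _ phiL) ip_suml; apply: eq_bigr => f _.
by rewrite ipZl mulrC.
Qed.

(* Maximise the Rayleigh quotient. *)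
Lemma symmetric_eigenvector U (S : g -> g) : (forall a X Y, S (a *: X + Y) = a *: S X + S Y) ->
  (forall X Y, ip (S X) Y = ip X (S Y)) -> (forall X, X \in U -> S X \in U) -> U != 0%VS ->
  exists2 X, X \in U /\ X != 0 & exists c : R, S X = c *: X.
Proof.
move=> SL Ssym SU U0.
have [s [fr ss s1]] := frame_exists U.
pose r := size s.
pose X_ (x : 'rV[R]_r) := \sum_(j < r) x ord0 j *: s`_j.
have S0 : S 0 = 0 by have := SL (-1) 0 0; rewrite scaler0 addr0 scaleN1r addNr.
have SX x : S (X_ x) = \sum_(j < r) x ord0 j *: S s`_j.
  rewrite /X_; have H m (c : 'I_m -> R) (e : 'I_m -> g) : S (\sum_i c i *: e i) = \sum_i c i *: S (e i).
    by elim: m c e => [|m IH] c e; rewrite ?big_ord0 // !big_ord_recl SL IH.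
  exact: H.
have XU x : X_ x \in U.
  by apply: memv_suml => j _; rewrite memvZ //; apply: fr.1; rewrite mem_nth.
have Xc X : X \in U -> X_ (\row_j ip X s`_j) = X.
  move=> XinU; rewrite [RHS](fr.2 _ XinU) (big_nth 0) big_mkord; apply: eq_bigr => j _.
  by rewrite mxE.
have pc (c : 'I_r -> 'I_r -> R) : continuous (fun x : 'rV[R]_r => \sum_i \sum_j x ord0 i * x ord0 j * c i j).
  apply: sum_cont => i; apply: sum_cont => j x.
  have oT : open [set: 'rV[R]_r] by exact: openT.
  have ck k : Ck_on 0 setT (fun x : 'rV[R]_r => x ord0 k).
    by apply: (@Ck_on_coord _ _ _ 0 setT id) => //; apply: (@Ck_on_lin _ _ _ 0 setT idfun) => z; exact: cvg_id.
  have h := Ck_on_mul oT (Ck_on_mul oT (ck i) (ck j)) (@Ck_on_cst R _ _ 0 setT (c i j)).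
  exact: (Ck_on_cont h).
have c1 : continuous (fun x => ip (X_ x) (X_ x)).
  have -> : (fun x => ip (X_ x) (X_ x)) = fun x : 'rV[R]_r => \sum_i \sum_j x ord0 i * x ord0 j * ip s`_i s`_j.
    apply/funext => x; rewrite ip_suml; apply: eq_bigr => i _; rewrite ip_sumr.
    by apply: eq_bigr => j _; rewrite ipZl ipZr mulrA.
  exact: pc.
have c2 : continuous (fun x => ip (S (X_ x)) (X_ x)).
  have -> : (fun x => ip (S (X_ x)) (X_ x)) = fun x : 'rV[R]_r => \sum_i \sum_j x ord0 i * x ord0 j * ip (S s`_i) s`_j.
    apply/funext => x; rewrite SX ip_suml; apply: eq_bigr => i _; rewrite ip_sumr.
    by apply: eq_bigr => j _; rewrite ipZl ipZr mulrA.
  exact: pc.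
pose K := [set x : 'rV[R]_r | forall j, `[-1, 1]%classic (x ord0 j)] `&` [set x | ip (X_ x) (X_ x) = 1].
have cK : compact K.
  apply: compact_closedI.
    by apply: (@rV_compact R r (fun=> `[-1, 1]%classic)) => j; exact: segment_compact.
  have -> : [set x | ip (X_ x) (X_ x) = 1] = (fun x => ip (X_ x) (X_ x)) @^-1` [set 1] by [].
  by apply: closed_comp => [x _|]; [exact: c1|exact: closed_eq].
have inK X : X \in U -> ip X X = 1 -> K (\row_j ip X s`_j).
  move=> XinU X1; split; last by rewrite /= Xc.
  move=> j; rewrite /= mxE in_itv /= -ler_norml -(ler_sqr (x := `|_|)) ?nnegrE //.
  rewrite expr1n real_normK ?num_real // -X1; apply: le_trans (bessel X fr).
  by rewrite (big_nth 0) big_mkord (bigD1 j) //= lerDl sumr_ge0 // => i _; exact: sqr_ge0.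
have unit X : X \in U -> X != 0 -> exists2 Y, [/\ Y \in U & ip Y Y = 1] & X = Num.sqrt (ip X X) *: Y.
  move=> XinU X0; have n0 : Num.sqrt (ip X X) != 0 by rewrite gt_eqF // sqrtr_gt0 ip_gt0.
  exists ((Num.sqrt (ip X X))^-1 *: X); last by rewrite scalerA divff // scale1r.
  split; first by rewrite memvZ.
  by rewrite ipZl ipZr mulrA -invfM -expr2 sqr_sqrtr ?ip_ge0 // mulVf // gt_eqF // ip_gt0.
have [Y0 [Y0U Y01] _] := unit _ (memv_pick U) (etrans (congr1 negb (vpick0 U)) U0).
have [x /set_mem Kx xmax'] := @compact_EVT_max _ _ _ K (ex_intro _ _ (inK _ Y0U Y01)) cK (continuous_subspaceT c2).
have xmax y (Ky : K y) := xmax' y (mem_set Ky).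
set X := X_ x; set M := ip (S X) X.
have X1 : ip X X = 1 by case: Kx.
have X0 : X != 0 by apply/eqP => X0; move: X1; rewrite X0 ip0l => /esym/eqP; rewrite oner_eq0.
have maxM Y : Y \in U -> ip (S Y) Y <= M * ip Y Y.
  move=> YU; have [->|Y0'] := eqVneq Y 0; first by rewrite S0 !ip0l mulr0.
  have [Z [ZU Z1] YE] := unit _ YU Y0'.
  have SZ c : S (c *: Z) = c *: S Z by rewrite -[c *: Z]addr0 SL S0 addr0.
  rewrite {1 2}YE SZ ipZl ipZr mulrA -expr2 sqr_sqrtr ?ip_ge0 // mulrC ler_wpM2r ?ip_ge0 //.
  by have := xmax _ (inK _ ZU Z1); rewrite Xc.
exists X; first by split=> //; exact: XU.
exists M; apply/subr0_eq/ip_eq0.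
have [W WE] : exists W, W = S X - M *: X by exists (S X - M *: X).
rewrite -WE.
have WU : W \in U by rewrite WE memvB ?memvZ ?SU // XU.
(* Q(Y) = M |Y|^2 - <S Y, Y> is nonnegative and vanishes at X, hence so does its polarization at X. *)
have WX : ip W X = 0 by rewrite WE ipBl ipZl X1 mulr1 subrr.
have H (t : R) : 2 * t * ip W W <= t ^+ 2 * (M * ip W W - ip (S W) W).
  have YU : X + t *: W \in U by rewrite memvD ?memvZ // XU.
  have := maxM _ YU.
  rewrite addrC SL !ipDl !ipZl !ipDr !ipZr X1 -/M (ipC X W) WX !mulr0 !add0r !addr0.
  have -> : ip (S W) X = ip W W by rewrite Ssym -[S X](subrK (M *: X)) -WE ipDr ipZr WX mulr0 addr0.
  have -> : ip (S X) W = ip W W by rewrite -[S X](subrK (M *: X)) -WE ipDl ipZl (ipC X) WX mulr0 addr0.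
  by move: (ip W W) (ip (S W) W) (M) => b1 b2 b3; nra.
set w := ip W W in H *; set q := M * w - _ in H *.
have w0 : 0 <= w by exact: ip_ge0.
apply/eqP; rewrite eq_le w0 andbT leNgt; apply/negP => wp.
have q1 : 0 < `|q| + w + 1 by rewrite ltr_wpDl // addr_ge0.
(* If w > 0, this t contradicts [H]: after division by t it says 2 w <= t q, whereas t q <= t D =
   w. *)
set D := `|q| + w + 1 in q1; pose t := w / D.
have t0 : 0 < t by rewrite divr_gt0.
have tD : t * D = w by rewrite mulfVK // gt_eqF.
have h : 2 * w <= t * q.
  by rewrite -(ler_pM2l t0); have := H t; rewrite expr2; move: (w) (q) => w' q'; lra.
have h2 : t * q <= t * D.
  by rewrite ler_pM2l // /D; apply: le_trans (ler_norm q) _; rewrite -addrA lerDl addr_ge0.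
by move: (le_trans h h2); rewrite tD; lra.
Qed.

End InnerProduct.

(** * Traces, Killing form and Cartan involution *)

Section LinearTrace.
Variables (R : realType) (g : vectType R).
Implicit Types (f h : 'End(g)) (X Y Z : g).

Lemma linear_lfunE (l : g -> g) : (forall a X Y, l (a *: X + Y) = a *: l X + l Y) ->
  forall X, linfun l X = l X.
Proof.
move=> lL; have lL' : linear l by exact: lL.
pose l' : {linear g -> g} := HB.pack l (GRing.isLinear.Build _ _ _ _ _ lL').
exact: (lfunE l').
Qed.

Lemma lftraceP a f h : lftrace (a *: f + h) = a * lftrace f + lftrace h.
Proof.
rewrite /lftrace mulr_sumr -big_split /=; apply: eq_bigr => i _.
by rewrite add_lfunE scale_lfunE linearP.
Qed.

Lemma lftraceB f h : lftrace (f - h) = lftrace f - lftrace h.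
Proof. by rewrite addrC -scaleN1r lftraceP mulN1r addrC. Qed.

Lemma lftraceC f h : lftrace (f \o h)%VF = lftrace (h \o f)%VF.
Proof.
have E (u v : 'End(g)) : lftrace (u \o v)%VF =
    \sum_(i < \dim {:g}) \sum_(j < \dim {:g}) coord (vbasis {:g}) j (v (vbasis {:g})`_i) *
      coord (vbasis {:g}) i (u (vbasis {:g})`_j).
  apply: eq_bigr => i _; rewrite comp_lfunE {1}(coord_vbasis (memvf (v _))) !linear_sum /=.
  by apply: eq_bigr => j _; rewrite !linearZ.
rewrite !E exchange_big /=; apply: eq_bigr => i _; apply: eq_bigr => j _.
by rewrite mulrC.
Qed.

End LinearTrace.

Section KillingForm.
Variables (R : realType) (g : vectType R) (br : g -> g -> g).
Hypothesis br_r : forall a X Y Z, br X (a *: Y + Z) = a *: br X Y + br X Z.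
Hypothesis br_l : forall a X Y Z, br (a *: X + Y) Z = a *: br X Z + br Y Z.
Hypothesis br_jac : forall X Y Z, br X (br Y Z) = br (br X Y) Z + br Y (br X Z).
Implicit Types (X Y Z : g).

Local Notation B := (killing br).

Lemma adE X Y : ad br X Y = br X Y.
Proof. by apply: linear_lfunE => a U V; exact: br_r. Qed.

Lemma killingC X Y : B X Y = B Y X.
Proof. exact: lftraceC. Qed.

Lemma ad_linear a X Y : ad br (a *: X + Y) = a *: ad br X + ad br Y.
Proof. by apply/lfunP => Z; rewrite add_lfunE scale_lfunE !adE br_l. Qed.

Lemma killing_l a X Y Z : B (a *: X + Y) Z = a * B X Z + B Y Z.
Proof. by rewrite /killing ad_linear comp_lfunDl -comp_lfunZl lftraceP. Qed.

Lemma ad_br X Y : ad br (br X Y) = ((ad br X \o ad br Y) - (ad br Y \o ad br X))%VF.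
Proof.
apply/lfunP => Z; rewrite add_lfunE opp_lfunE !comp_lfunE !adE br_jac.
by rewrite addrK.
Qed.

Lemma killing_inv X Y Z : B (br X Y) Z = B X (br Y Z).
Proof.
rewrite /killing !ad_br comp_lfunDl comp_lfunDr comp_lfunNl comp_lfunNr !lftraceB.
congr (_ - _); first by rewrite comp_lfunA.
by rewrite -comp_lfunA lftraceC -comp_lfunA.
Qed.

(** An automorphism conjugates ad: ad(phi X) = phi ad(X) phi^-1, and the trace is cyclic. *)
Lemma killing_aut (phi psi : g -> g) :
  (forall a X Y, phi (a *: X + Y) = a *: phi X + phi Y) ->
  (forall a X Y, psi (a *: X + Y) = a *: psi X + psi Y) ->
  cancel phi psi -> cancel psi phi -> (forall X Y, phi (br X Y) = br (phi X) (phi Y)) ->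
  forall X Y, B (phi X) (phi Y) = B X Y.
Proof.
move=> phiL psiL K K' phib X Y.
pose f := linfun phi; pose h := linfun psi.
have fE Z : f Z = phi Z by exact: linear_lfunE.
have hE Z : h Z = psi Z by exact: linear_lfunE.
have E Z : ad br (phi Z) = (f \o (ad br Z \o h))%VF.
  by apply/lfunP => W; rewrite !comp_lfunE !adE fE hE phib K'.
rewrite /killing !E lftraceC.
have -> : ((f \o (ad br Y \o h)) \o (f \o (ad br X \o h)))%VF = (f \o (ad br Y \o (ad br X \o h)))%VF.
  by apply/lfunP => W; rewrite !comp_lfunE ?fE ?hE ?fE K.
rewrite lftraceC.
have -> : ((ad br Y \o (ad br X \o h)) \o f)%VF = (ad br Y \o ad br X)%VF.
  by apply/lfunP => W; rewrite !comp_lfunE ?fE ?hE ?fE K.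
exact: lftraceC.
Qed.

End KillingForm.

Section Cartan.
Variables (R : realType) (g : vectType R) (br : g -> g -> g).
Hypothesis br_r : forall a X Y Z, br X (a *: Y + Z) = a *: br X Y + br X Z.
Hypothesis br_l : forall a X Y Z, br (a *: X + Y) Z = a *: br X Z + br Y Z.
Hypothesis br_a : forall X Y, br X Y = - br Y X.
Hypothesis br_jac : forall X Y Z, br X (br Y Z) = br (br X Y) Z + br Y (br X Z).
Variable theta : 'End(g).
Hypothesis htheta : is_cartan_involution br theta.
Implicit Types (X Y Z : g).

Local Notation B := (killing br).

(** The inner product on the whole of g attached to the Cartan involution; on p it coincides with
    the Killing form. With respect to it, ad(theta X) is minus the adjoint of ad X ([cip_adj]). *)
Definition cip X Y := - B X (theta Y).

Lemma thetaK X : theta (theta X) = X. Proof. by case: htheta. Qed.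

Lemma theta_br X Y : theta (br X Y) = br (theta X) (theta Y). Proof. by case: htheta. Qed.

Lemma killing_theta X Y : B (theta X) (theta Y) = B X Y.
Proof.
by apply: (killing_aut br_r (psi := theta)) => [a U V|a U V|||]; rewrite ?linearP //; [exact: thetaK|exact: thetaK|exact: theta_br].
Qed.

Lemma cipC X Y : cip X Y = cip Y X.
Proof. by rewrite /cip -killing_theta thetaK killingC. Qed.

Lemma cip_l a X Y Z : cip (a *: X + Y) Z = a * cip X Z + cip Y Z.
Proof. by rewrite /cip (killing_l br_r br_l) opprD mulrN. Qed.

Lemma cip_gt0 X : X != 0 -> 0 < cip X X.
Proof. by case: htheta => _ _; apply. Qed.

Lemma cip_theta X Y : cip (theta X) (theta Y) = cip X Y.
Proof. by rewrite /cip killing_theta. Qed.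

Lemma br0r X : br X 0 = 0.
Proof. by have := br_r (-1) X 0 0; rewrite scaler0 addr0 scaleN1r addNr. Qed.

Lemma br0l X : br 0 X = 0. Proof. by rewrite br_a br0r oppr0. Qed.

Lemma brDr X Y Z : br X (Y + Z) = br X Y + br X Z.
Proof. by rewrite -[Y]scale1r br_r !scale1r. Qed.

Lemma brDl X Y Z : br (X + Y) Z = br X Z + br Y Z.
Proof. by rewrite -[X]scale1r br_l !scale1r. Qed.

Lemma brZr a X Y : br X (a *: Y) = a *: br X Y.
Proof. by rewrite -[a *: Y]addr0 br_r br0r addr0. Qed.

Lemma brZl a X Y : br (a *: X) Y = a *: br X Y.
Proof. by rewrite br_a brZr -scalerN -br_a. Qed.

Lemma brNl X Y : br (- X) Y = - br X Y.
Proof. by rewrite -scaleN1r brZl scaleN1r. Qed.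

Lemma br_suml (I : Type) (r : seq I) (P : pred I) (F : I -> g) Z :
  br (\sum_(i <- r | P i) F i) Z = \sum_(i <- r | P i) br (F i) Z.
Proof.
elim: r => [|i r IH]; first by rewrite !big_nil br0l.
by rewrite !big_cons; case: ifP => _ //; rewrite brDl IH.
Qed.

Lemma killing0l X : B 0 X = 0.
Proof. by have := killing_l br_r br_l (-1) 0 0 X; rewrite scaler0 addr0 mulN1r addNr. Qed.

Lemma killing0r X : B X 0 = 0. Proof. by rewrite killingC killing0l. Qed.

Lemma killingDl X Y Z : B (X + Y) Z = B X Z + B Y Z.
Proof. by rewrite -[X]scale1r (killing_l br_r br_l) mul1r scale1r. Qed.

Lemma killingDr X Y Z : B Z (X + Y) = B Z X + B Z Y.
Proof. by rewrite killingC killingDl !(killingC _ Z). Qed.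

Lemma killingZl a X Y : B (a *: X) Y = a * B X Y.
Proof. by rewrite -[a *: X]addr0 (killing_l br_r br_l) killing0l addr0. Qed.

Lemma killingZr a X Y : B Y (a *: X) = a * B Y X.
Proof. by rewrite killingC killingZl killingC. Qed.

Lemma killing_suml (I : Type) (r : seq I) (P : pred I) (F : I -> g) Z :
  B (\sum_(i <- r | P i) F i) Z = \sum_(i <- r | P i) B (F i) Z.
Proof.
elim: r => [|i r IH]; first by rewrite !big_nil killing0l.
by rewrite !big_cons; case: ifP => _ //; rewrite killingDl IH.
Qed.

Lemma killingNl X Y : B (- X) Y = - B X Y.
Proof. by rewrite -scaleN1r killingZl mulN1r. Qed.

Lemma cip_adj X Y Z : cip (br X Y) Z = - cip Y (br (theta X) Z).
Proof. by rewrite /cip br_a killingNl (killing_inv br_r br_jac) theta_br thetaK. Qed.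

Lemma memp X : (X \in cartan_p theta) = (theta X == - X).
Proof. by rewrite memv_ker add_lfunE id_lfunE addr_eq0. Qed.

End Cartan.

(** * Root space decomposition *)

Section RootDecomposition.
Variables (R : realType) (g : vectType R) (br : g -> g -> g).
Hypothesis br_r : forall a X Y Z, br X (a *: Y + Z) = a *: br X Y + br X Z.
Hypothesis br_l : forall a X Y Z, br (a *: X + Y) Z = a *: br X Z + br Y Z.
Hypothesis br_a : forall X Y, br X Y = - br Y X.
Hypothesis br_jac : forall X Y Z, br X (br Y Z) = br (br X Y) Z + br Y (br X Z).
Variable theta : 'End(g).
Hypothesis htheta : is_cartan_involution br theta.
Variable a : {vspace g}.
Hypothesis ha : maximal_abelian br (cartan_p theta) a.
Variable Sp : seq g.
Hypothesis hSp : positive_system br a Sp.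
Implicit Types (X Y Z H : g) (U : {vspace g}).

Local Notation B := (killing br).
Local Notation ip := (cip br theta).
Local Notation root := (root_space br a).
Let ipC := cipC br_r htheta.
Let ipl := cip_l br_r br_l theta.
Let ipp := cip_gt0 htheta.

Lemma sumv_ind (I : eqType) (r : seq I) (V : I -> {vspace g}) (P : g -> Prop) : P 0 ->
  (forall x y, P x -> P y -> P (x + y)) -> (forall i x, i \in r -> x \in V i -> P x) ->
  forall x, x \in (\sum_(i <- r) V i)%VS -> P x.
Proof.
move=> P0 PD; elim: r => [|i r IH] PV x; first by rewrite big_nil memv0 => /eqP ->.
rewrite big_cons => /memv_addP[y yV [z zV ->]]; apply: PD; first by apply: (PV i); rewrite ?mem_head.
by apply: IH zV => j w jr; apply: PV; rewrite inE jr orbT.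
Qed.

Lemma memv_sum_seq (I : eqType) (r : seq I) (V : I -> {vspace g}) i x : i \in r -> x \in V i ->
  x \in (\sum_(i <- r) V i)%VS.
Proof.
elim: r => // j r IH; rewrite inE big_cons => /predU1P[->|ir] xV.
  by apply: subvP xV; exact: addvSl.
by apply: subvP (IH ir xV); exact: addvSr.
Qed.

Lemma theta_a H : H \in a -> theta H = - H.
Proof. by case: ha => /subvP ap _ _ /ap; rewrite memp => /eqP. Qed.

Lemma a_comm H H' : H \in a -> H' \in a -> br H H' = 0.
Proof. by case: ha => _ + _; apply. Qed.

Lemma ip_a X H : H \in a -> ip X H = B X H.
Proof. by move=> /theta_a h; rewrite /cip h killingC (killingNl br_r br_l) opprK killingC. Qed.

Lemma ad_sym H X Y : H \in a -> ip (br H X) Y = ip X (br H Y).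
Proof. by move=> /theta_a h; rewrite (cip_adj br_r br_l br_a br_jac htheta) h (brNl br_r br_a) (ipNr ipC ipl) opprK. Qed.

Lemma ad_comm H H' X : H \in a -> H' \in a -> br H (br H' X) = br H' (br H X).
Proof. by move=> h h'; rewrite br_jac (a_comm h h') (br0l br_r br_a) add0r. Qed.

Lemma rootP al X : reflect (forall H, H \in a -> br H X = B al H *: X) (X \in root al).
Proof.
have Bl := killing_l br_r br_l.
have h H : (X \in lker (ad br H - killing br al H *: \1)%VF) = (br H X == B al H *: X).
  by rewrite memv_ker add_lfunE opp_lfunE scale_lfunE id_lfunE (adE br_r) subr_eq0.
have Bs m (c : 'I_m -> R) (e : 'I_m -> g) : B al (\sum_i c i *: e i) = \sum_i c i * B al (e i).
  elim: m c e => [|m IH] c e.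
    by rewrite !big_ord0; have := Bl (-1) 0 0 al; rewrite scaler0 addr0 mulN1r addNr killingC.
  by rewrite !big_ord_recl killingC Bl killingC (killingC _ _ al) IH.
apply: (iffP idP) => [Xr H Ha|hX].
  have {}Xr i : br (vbasis a)`_i X = B al (vbasis a)`_i *: X.
    have [/(mem_nth 0) ia|ia] := ltnP i (size (vbasis a)); last first.
      rewrite nth_default // (br0l br_r br_a).
      by have := Bs 0 (fun=> 0) (fun=> 0); rewrite !big_ord0 => ->; rewrite scale0r.
    apply/eqP; rewrite -h; apply: subvP Xr; rewrite /root_space.
    move: (vbasis a)`_i ia => v; elim: (tval (vbasis a)) => // H' r IH; rewrite inE big_cons => /predU1P[->|/IH]; first exact: capvSl.
    by move=> s; apply: subv_trans s; exact: capvSr.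
  rewrite (coord_vbasis Ha) (br_suml br_r br_l br_a) Bs scaler_suml.
  by apply: eq_bigr => i _; rewrite (brZl br_r br_a) Xr scalerA.
rewrite /root_space; have : forall H, H \in tval (vbasis a) -> H \in a by move=> H /vbasis_mem.
elim: (tval (vbasis a)) => [|H r IH] sub; first by rewrite big_nil memvf.
rewrite big_cons memv_cap h hX ?sub ?mem_head //= ?eqxx //= IH // => H' H'r.
by apply: sub; rewrite inE H'r orbT.
Qed.

Lemma killing_dual (l : g -> R) : (forall c X Y, l (c *: X + Y) = c * l X + l Y) ->
  exists2 al, al \in a & forall H, H \in a -> B al H = l H.
Proof.
move=> ll; have [s [fr _ _]] := frame_exists ipC ipl ipp a.
have l0 : l 0 = 0 by have := ll (-1) 0 0; rewrite scaler0 addr0 mulN1r addNr.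
have ls (r : seq g) (c : g -> R) : l (\sum_(f <- r) c f *: f) = \sum_(f <- r) c f * l f.
  by elim: r => [|f r IH]; rewrite ?big_nil // !big_cons ll IH.
exists (\sum_(f <- s) l f *: f).
  by rewrite big_seq; apply: memv_suml => f /fr.1 fa; rewrite memvZ.
move=> H Ha; rewrite -(ip_a _ Ha) (ip_suml ipl) [in RHS](fr.2 H Ha) ls.
by apply: eq_bigr => f _; rewrite (ipZl ipl) mulrC ipC.
Qed.

(** Induction on the dimension. If every ad H acts on U as a scalar, then U lies in one root space.
    Otherwise some ad H has an eigenspace [U1] that is neither 0 nor U; it and its orthogonal
    complement [U2] are stable, since the ad H commute and are symmetric. *)
Lemma root_decomposition_in U X : (forall H Y, H \in a -> Y \in U -> br H Y \in U) -> X \in U ->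
  exists s : seq (g * g), (forall z, z \in s -> z.1 \in a /\ z.2 \in root z.1) /\ X = \sum_(z <- s) z.2.
Proof.
have [k] := ubnP (\dim U); elim: k U X => // k IH U X dU stab XU.
have [U0|U0] := eqVneq U 0%VS.
  by exists [::]; split=> //; move: XU; rewrite U0 memv0 big_nil => /eqP.
have [sc|] := pselect (forall H, H \in a -> exists c : R, forall Y, Y \in U -> br H Y = c *: Y).
  pose v := vpick U; have v0 : 0 < ip v v by rewrite ipp // vpick0.
  have lin (c : R) Y Z : ip (br (c *: Y + Z) v) v / ip v v = c * (ip (br Y v) v / ip v v) + ip (br Z v) v / ip v v.
    by rewrite br_l ipl mulrDl mulrA.
  have [al ala hal] := killing_dual lin.
  exists [:: (al, X)]; split; last by rewrite big_seq1.
  move=> z; rewrite inE => /eqP -> /=; split=> //; apply/rootP => H Ha.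
  have [c hc] := sc H Ha; rewrite (hc _ XU) (hal _ Ha) (hc v (memv_pick U)) (ipZl ipl).
  by rewrite mulfK // gt_eqF.
move=> /existsNP[H /not_implyP[Ha nsc]].
have [v [vU v0] [c vE]] := @symmetric_eigenvector _ _ _ ipC ipl ipp U (br H) (fun c Y Z => br_r c H Y Z)
  (fun Y Z => ad_sym Y Z Ha) (fun Y => stab H Y Ha) U0.
pose U1 := (U :&: lker (ad br H - c *: \1)%VF)%VS.
have U1P Y : (Y \in U1) = (Y \in U) && (br H Y == c *: Y).
  by rewrite memv_cap memv_ker add_lfunE opp_lfunE scale_lfunE id_lfunE (adE br_r) subr_eq0.
have [s [fr _ _]] := frame_exists ipC ipl ipp U1.
(* The orthogonal complement of [U1] in U. The functionals <., f> are multiplied by f, which turns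
   them into endomorphisms with the same kernels. *)
pose U2 := (U :&: \bigcap_(f <- s) lker (linfun (fun Y => ip Y f *: f)))%VS.
have U2P Y : reflect (Y \in U /\ forall Z, Z \in U1 -> ip Y Z = 0) (Y \in U2).
  have lk f : f \in s -> (Y \in lker (linfun (fun Y => ip Y f *: f))) = (ip Y f *: f == 0).
    by move=> fs; rewrite memv_ker linear_lfunE // => b Y1 Y2; rewrite ipl scalerDl scalerA.
  apply: (iffP idP) => [|[YU YZ]]; rewrite memv_cap.
    move=> /andP[-> Yc]; split=> // Z ZU1.
    rewrite (fr.2 _ ZU1) (ip_sumr ipC ipl) big_seq big1 // => f fs.
    have fY : ip Y f *: f = 0.
      apply/eqP; rewrite -lk //; move: fs Yc; elim: (s) => // e r IHr.
      rewrite inE big_cons memv_cap => /predU1P[->|fr'] /andP[] //.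
      by move=> _; exact: IHr.
    have [->|f0] := eqVneq f 0; first by rewrite scaler0 (ip0r ipC ipl).
    rewrite (ipZr ipC ipl).
    by move/eqP: fY; rewrite scaler_eq0 (negPf f0) orbF => /eqP ->; rewrite mulr0.
  rewrite YU /=; have : forall f, f \in s -> ip Y f *: f = 0.
    by move=> f fs; rewrite YZ ?scale0r //; exact: fr.1.
  have := lk; elim: (s) => [|f r IHr] lkr hf; first by rewrite big_nil memvf.
  rewrite big_cons memv_cap lkr ?mem_head // hf ?mem_head // eqxx /= IHr // => e er.
    by apply: lkr; rewrite inE er orbT.
  by apply: hf; rewrite inE er orbT.
have stab1 H' Y : H' \in a -> Y \in U1 -> br H' Y \in U1.
  move=> H'a; rewrite !U1P => /andP[YU /eqP hY]; rewrite (stab _ _ H'a YU) /=.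
  by rewrite (ad_comm _ Ha H'a) hY (brZr br_r).
have stab2 H' Y : H' \in a -> Y \in U2 -> br H' Y \in U2.
  move=> H'a /U2P[YU hY]; apply/U2P; split; first exact: stab.
  by move=> Z ZU; rewrite (ad_sym _ _ H'a) hY // stab1.
have lt U' : (U' <= U)%VS -> (exists2 Y, Y \in U & Y \notin U') -> (\dim U' < k)%N.
  move=> sub [Y YU YU']; apply: leq_trans (ltnSE dU); rewrite ltn_neqAle dimvS // andbT.
  apply: contra YU' => /eqP d.
  by have /eqP -> : U' == U by rewrite eqEdim sub d leqnn.
have d1 : (\dim U1 < k)%N.
  apply: lt; first exact: capvSl.
  apply: contrapT => /forall2NP hn; apply: nsc; exists c => Y YU.
  by have [//|/negP/negPn] := hn Y; rewrite U1P => /andP[_ /eqP].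
have d2 : (\dim U2 < k)%N.
  apply: lt; first exact: capvSl.
  exists v => //; apply/negP => /U2P[_ /(_ v)]; rewrite U1P vU vE eqxx => /(_ isT) h.
  by move: (ipp v0); rewrite h ltxx.
have [s1 [h1 E1]] := IH U1 _ d1 stab1 (proj_mem X fr).
have X2 : X - proj ip s X \in U2.
  apply/U2P; split; last by move=> Z ZU1; exact: (proj_compl ipC ipl _ fr).
  by rewrite memvB //; have := proj_mem X fr; rewrite U1P => /andP[].
have [s2 [h2 E2]] := IH U2 _ d2 stab2 X2.
exists (s1 ++ s2); split; last by rewrite big_cat /= -E1 -E2 addrC subrK.
by move=> z; rewrite mem_cat => /orP[/h1|/h2].
Qed.

Lemma root_decomposition X :
  exists s : seq (g * g), (forall z, z \in s -> z.1 \in a /\ z.2 \in root z.1) /\ X = \sum_(z <- s) z.2.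
Proof. by apply: (@root_decomposition_in fullv) => *; rewrite memvf. Qed.

(** Invariance of the Killing form at H = al + be gives |al + be|^2 B(X, Y) = 0. *)
Lemma root_orth al be X Y : al \in a -> be \in a -> al + be != 0 -> X \in root al -> Y \in root be ->
  B X Y = 0.
Proof.
move=> ala bea ab /rootP hX /rootP hY.
have Ha : al + be \in a by rewrite memvD.
have e1 := hX _ Ha; have e2 := hY _ Ha.
have : B (br (al + be) X) Y = - B X (br (al + be) Y).
  by rewrite br_a (killingNl br_r br_l) (killing_inv br_r br_jac).
rewrite e1 e2 (killingZl br_r br_l) (killingZr br_r br_l) => /eqP; rewrite -addr_eq0 -mulrDl.
rewrite -(killingDl br_r br_l) mulf_eq0 => /orP[/eqP h|/eqP//].
by exfalso; move: (ipp ab); rewrite ip_a // h ltxx.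
Qed.

Lemma br_root al be X Y : X \in root al -> Y \in root be -> br X Y \in root (al + be).
Proof.
move=> /rootP hX /rootP hY; apply/rootP => H Ha.
rewrite br_jac (hX H Ha) (hY H Ha) (brZl br_r br_a) (brZr br_r) -scalerDl.
by rewrite (killingDl br_r br_l).
Qed.

Lemma theta_root al X : X \in root al -> theta X \in root (- al).
Proof.
move=> /rootP hX; apply/rootP => H Ha.
have -> : br H (theta X) = theta (br (- H) X) by rewrite (theta_br htheta) linearN /= (theta_a Ha) opprK.
by rewrite (brNl br_r br_a) hX // (killingNl br_r br_l) linearN linearZ scaleNr.
Qed.

Definition npos : {vspace g} := (\sum_(al <- Sp) root al)%VS.

Lemma Sp_root al : al \in Sp -> [/\ al \in a, al != 0 & root al != 0%VS].
Proof. by case: hSp => _ h _ _ hal; apply/and3P; have := h al; rewrite hal /is_root => ->. Qed.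

Lemma Sp_add al be : al \in Sp -> be \in Sp -> al + be != 0.
Proof.
case: hSp => _ _ h _ hal hbe; apply/negP => /eqP/addr0_eq E.
by move: (h _ hal); rewrite E hbe.
Qed.

Lemma npos_isotropic X Y : X \in npos -> Y \in npos -> B X Y = 0.
Proof.
move=> Xn; move: Y; apply: sumv_ind => [|Y1 Y2 h1 h2|be Y hbe Yb].
- by rewrite (killing0r br_r br_l).
- by rewrite (killingDr br_r br_l) h1 h2 addr0.
move: X Xn; apply: sumv_ind => [|X1 X2 h1 h2|al X hal Xa]; first by rewrite (killing0l br_r br_l).
  by rewrite (killingDl br_r br_l) h1 h2 addr0.
have [ala _ _] := Sp_root hal; have [bea _ _] := Sp_root hbe.
exact: root_orth ala bea (Sp_add hal hbe) Xa Yb.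
Qed.

Lemma npos_br X Y : X \in npos -> Y \in npos -> br X Y \in npos.
Proof.
move=> Xn; move: Y; apply: sumv_ind => [|Y1 Y2 h1 h2|be Y hbe Yb].
- by rewrite (br0r br_r) mem0v.
- by rewrite (brDr br_r) memvD.
move: X Xn; apply: sumv_ind => [|X1 X2 h1 h2|al X hal Xa].
- by rewrite (br0l br_r br_a) mem0v.
- by rewrite (brDl br_l) memvD.
have [-> |XY0] := eqVneq (br X Y) 0; first exact: mem0v.
have XYr := br_root Xa Yb.
have [ala _ _] := Sp_root hal; have [bea _ _] := Sp_root hbe.
have XYroot : is_root br a (al + be).
  rewrite /is_root memvD // Sp_add //=.
  by apply: contraNneq XY0 => E; move: XYr; rewrite E memv0.
by apply: memv_sum_seq XYr; case: hSp => _ _ _; apply.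
Qed.

(** The negative part [Wm] of W vanishes: theta Wm lies in n, so that <Wm, Wm> = - B(W, theta Wm) =
    0. What remains of W has weight 0 or a positive root, and such weights preserve n. *)
Lemma npos_normalized W Y : (forall Z, Z \in npos -> B W Z = 0) -> Y \in npos -> br W Y \in npos.
Proof.
move=> Wq; have [s [hs WE]] := root_decomposition W.
pose Wm := \sum_(z <- s | - z.1 \in Sp) z.2.
have thW : theta Wm \in npos.
  rewrite linear_sum /= big_seq_cond; apply: memv_suml => z /andP[zs zS].
  by apply: memv_sum_seq zS _; apply: theta_root; case: (hs z zs).
have Wm0 : Wm = 0.
  apply: (ip_eq0 ipp); rewrite /cip; apply/eqP; rewrite oppr_eq0; apply/eqP.
  rewrite -[RHS](Wq _ thW) WE /Wm !(killing_suml br_r br_l) [RHS](bigID (fun z => - z.1 \in Sp)) /= [X in _ + X]big1_seq ?addr0 //.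
  move=> z /andP[zS zs]; have [za zr] := hs z zs.
  rewrite linear_sum /= killingC; elim: (s) hs => [|z' r IH] hr; first by rewrite big_nil (killing0l br_r br_l).
  have hr' z'' (h : z'' \in r) : z''.1 \in a /\ z''.2 \in root z''.1 by apply: hr; rewrite inE h orbT.
  rewrite big_cons; case: ifP => z'S; last exact: IH.
  rewrite (killingDl br_r br_l) IH // addr0 killingC; have [z'a z'r] := hr z' (mem_head _ _).
  apply: (root_orth za _ _ zr (theta_root z'r)); first by rewrite memvN.
  by rewrite subr_eq0; apply: contraNneq zS => ->.
move: Y; apply: sumv_ind => [|Y1 Y2 h1 h2|be Y hbe Yb].
- by rewrite (br0r br_r) mem0v.
- by rewrite (brDr br_r) memvD.
have -> : W = \sum_(z <- s | - z.1 \notin Sp) z.2.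
  by rewrite WE (bigID (fun z => - z.1 \in Sp)) /= -/Wm Wm0 add0r.
rewrite (br_suml br_r br_l br_a) big_seq_cond; apply: memv_suml => z /andP[zs zS].
have [za zr] := hs z zs.
have [z2|z20] := eqVneq z.2 0; first by rewrite z2 (br0l br_r br_a) mem0v.
have [z1|z10] := eqVneq z.1 0.
  by apply: memv_sum_seq hbe _; rewrite -[be]add0r -z1; exact: br_root.
have : is_root br a z.1.
  by rewrite /is_root za z10 /=; apply: contraNneq z20 => E; move: zr; rewrite E memv0.
case: hSp => _ -> _ _; rewrite (negPf zS) orbF => zS'.
by apply: npos_br; [exact: memv_sum_seq zS' zr|exact: memv_sum_seq hbe Yb].
Qed.

(** The double orthogonal for the indefinite Killing form, reduced to the inner product by replacing
    U with theta U. *)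
Lemma killing_biorth U Z : (forall W, (forall Y, Y \in U -> B W Y = 0) -> B Z W = 0) -> Z \in U.
Proof.
move=> hZ; pose U' := (theta @: U)%VS.
have [s [fr _ _]] := frame_exists ipC ipl ipp U'.
have : theta Z - proj ip s (theta Z) = 0.
  set D := _ - _; apply: (ip_eq0 ipp).
  have DU' Y : Y \in U' -> ip D Y = 0 by exact: (proj_compl ipC ipl _ fr).
  rewrite {2}/D (ipBr ipC ipl) (DU' _ (proj_mem _ fr)) subr0 ipC /cip.
  rewrite -(killing_theta br_r htheta) !(thetaK htheta) hZ ?oppr0 // => Y YU.
  by apply/eqP; rewrite -oppr_eq0 -(thetaK htheta Y); apply/eqP; apply: DU'; rewrite memv_img.
move=> /subr0_eq E; have := proj_mem (theta Z) fr; rewrite -E => /memv_imgP[Y YU EY].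
by rewrite -(thetaK htheta Z) EY (thetaK htheta).
Qed.

End RootDecomposition.

(** * Traces over n and the vector 2 rho *)

Section BaseTrace.
Variables (R : realType) (g : vectType R) (br : g -> g -> g).
Hypothesis br_r : forall a X Y Z, br X (a *: Y + Z) = a *: br X Y + br X Z.
Hypothesis br_l : forall a X Y Z, br (a *: X + Y) Z = a *: br X Z + br Y Z.
Hypothesis br_a : forall X Y, br X Y = - br Y X.
Hypothesis br_jac : forall X Y Z, br X (br Y Z) = br (br X Y) Z + br Y (br X Z).
Variable theta : 'End(g).
Hypothesis htheta : is_cartan_involution br theta.
Variable a : {vspace g}.
Hypothesis ha : maximal_abelian br (cartan_p theta) a.
Variable Sp : seq g.
Hypothesis hSp : positive_system br a Sp.
Implicit Types (X Y Z H : g) (U : {vspace g}).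

Local Notation B := (killing br).
Local Notation ip := (cip br theta).
Local Notation root := (root_space br a).
Local Notation npos := (npos br a Sp).
Let ipC := cipC br_r htheta.
Let ipl := cip_l br_r br_l theta.
Let ipp := cip_gt0 htheta.
Let adj := cip_adj br_r br_l br_a br_jac htheta.
Let tb := theta_br htheta.
Let tK := thetaK htheta.

Lemma centralizer_a X : X \in root 0 -> X \in cartan_p theta -> X \in a.
Proof.
move=> /(rootP br_r br_l br_a) h Xp; case: ha => ap ab mx.
have h0 H : H \in a -> br H X = 0 by move=> /h ->; rewrite (killing0l br_r br_l) scale0r.
suff <- : (a + <[X]>)%VS = a by rewrite memvE addvSr.
apply: mx; first exact: addvSl.
  by rewrite subv_add ap -memvE.
move=> _ _ /memv_addP[H1 H1a [_ /vlineP[c1 ->] ->]] /memv_addP[H2 H2a [_ /vlineP[c2 ->] ->]].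
rewrite (brDr br_r) !(brDl br_l) !(brZl br_r br_a) !(brZr br_r) ab // h0 // (br_a X) h0 // oppr0.
have -> : br X X = 0.
  have /eqP : br X X + br X X = 0 by rewrite {1}br_a addNr.
  by rewrite -mulr2n -scaler_nat scaler_eq0 pnatr_eq0 => /eqP.
by rewrite !scaler0 !addr0.
Qed.

Lemma root_ip al be X Y : al \in a -> be \in a -> al != be -> X \in root al -> Y \in root be ->
  ip X Y = 0.
Proof.
move=> ala bea ab Xr Yr; rewrite /cip (root_orth br_r br_l br_a br_jac htheta ha ala _ _ Xr (theta_root br_r br_l br_a htheta ha Yr)) ?oppr0 //.
  by rewrite memvN.
by rewrite subr_eq0.
Qed.

(** Each frame vector is stored with its root, so that sums over the frame become sums over the
    roots weighted by multiplicities. *)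
Lemma root_frame (r : seq g) : uniq r -> {subset r <= Sp} -> exists s : seq (g * g),
  [/\ frame ip (\sum_(al <- r) root al)%VS (map snd s),
      forall z, z \in s -> [/\ z.1 \in r, z.2 \in root z.1 & ip z.2 z.2 = 1] &
      forall (F : g -> R), \sum_(z <- s) F z.1 = \sum_(al <- r) (\dim (root al))%:R * F al].
Proof.
elim: r => [|al r IH] /=.
  move=> _ _; exists [::]; split=> // [|F]; last by rewrite !big_nil.
  by split=> // X; rewrite big_nil memv0 => /eqP ->; rewrite big_nil.
move=> /andP[nal ur] sub.
have [s [fr hs hF]] := IH ur (fun x xr => sub x (ltac:(by rewrite inE xr orbT))).
have [s1 [fr1 d1 h1]] := frame_exists ipC ipl ipp (root al).
have alS : al \in Sp by apply: sub; rewrite mem_head.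
have orth X f : X \in (\sum_(al <- r) root al)%VS -> f \in root al -> ip X f = 0.
  move=> Xr fal; move: X Xr; apply: sumv_ind => [|X Y hX hY|be X ber Xb].
  - exact: (ip0l ipl).
  - by rewrite (ipDl ipl) hX hY addr0.
  have beS : be \in Sp by apply: sub; rewrite inE ber orbT.
  have [ala _ _] := Sp_root hSp alS; have [bea _ _] := Sp_root hSp beS.
  by apply: root_ip Xb fal => //; apply: contraNneq nal => <-.
exists ([seq (al, f) | f <- s1] ++ s); split.
- rewrite map_cat -map_comp /= map_id big_cons; split=> [f|X].
    rewrite mem_cat => /orP[/fr1.1|/fr.1] fU; first by apply: subvP fU; exact: addvSl.
    by apply: subvP fU; exact: addvSr.
  move=> /memv_addP[Y Yal [Z Zr ->]]; rewrite big_cat /=; congr (_ + _).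
    rewrite [LHS](fr1.2 _ Yal); apply: eq_big_seq => f /fr1.1 fal.
    by rewrite (ipDl ipl) (orth Z) // addr0.
  rewrite [LHS](fr.2 _ Zr); apply: eq_big_seq => f /fr.1 fr'.
  by rewrite (ipDl ipl) (ipC Y) (orth f Y) // add0r.
- move=> z; rewrite mem_cat => /orP[/mapP[f fs ->] /=|/hs[z1 z2 z3]].
    by rewrite mem_head fr1.1 // h1.
  by rewrite inE z1 orbT.
move=> F; rewrite big_cat /= hF big_cons; congr (_ + _).
by rewrite big_map /= big_const_seq count_predT iter_addr_0 d1 mulr_natl.
Qed.

Definition two_rho := \sum_(al <- Sp) (multiplicity br a al)%:R *: al.

Lemma two_rho_a : two_rho \in a.
Proof.
rewrite /two_rho big_seq; apply: memv_suml => al /(Sp_root hSp)[ala _ _].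
exact: memvZ.
Qed.

Lemma root0_of_a H : H \in a -> H \in root 0.
Proof.
move=> Ha; apply/(rootP br_r br_l br_a) => H' H'a.
by rewrite (a_comm ha) // (killing0l br_r br_l) scale0r.
Qed.

(** Checked on root vectors. For a nonzero root both sides vanish, as ad X shifts the root spaces.
    For the root 0 both sides change sign under theta, which replaces X by X - theta X in a, where
    the trace counts roots with multiplicity. *)
Lemma base_trace s X : frame ip npos s -> \sum_(f <- s) ip (br X f) f = B two_rho X.
Proof.
move=> fr; have uS : uniq Sp by case: hSp.
have [s' [fr' hs hF]] := root_frame uS (fun x => id).
pose T X := \sum_(z <- s') ip (br X z.2) z.2.
have TD Y Z : T (Y + Z) = T Y + T Z.
  by rewrite /T -big_split /=; apply: eq_bigr => z _; rewrite (brDl br_l) (ipDl ipl).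
have T0 : T 0 = 0 by rewrite /T big1 // => z _; rewrite (br0l br_r br_a) (ip0l ipl).
have TZ c Y : T (c *: Y) = c * T Y.
  by rewrite /T mulr_sumr; apply: eq_bigr => z _; rewrite (brZl br_r br_a) (ipZl ipl).
have -> : \sum_(f <- s) ip (br X f) f = T X.
  by rewrite (frame_trace ipC ipl (fun c Y Z => br_r c X Y Z) fr fr') big_map.
have Troot al Y : al \in a -> Y \in root al -> T Y = B two_rho Y.
  move=> ala Yr; have [al0|al0] := eqVneq al 0; last first.
    rewrite (root_orth br_r br_l br_a br_jac htheta ha _ ala _ (root0_of_a two_rho_a) Yr) ?mem0v ?add0r //.
    rewrite /T big_seq big1 // => z /hs[zS zr _]; have [za _ _] := Sp_root hSp zS.
    apply: (root_ip _ za _ (br_root br_r br_l br_a br_jac Yr zr) zr); first by rewrite memvD.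
    by rewrite -subr_eq0 addrK.
  have Th : T (theta Y) = - T Y.
    rewrite /T -sumrN; apply: eq_bigr => z _.
    by rewrite adj tK ipC.
  have Bh : B two_rho (theta Y) = - B two_rho Y.
    rewrite -(killing_theta br_r htheta) tK (theta_a ha two_rho_a).
    by rewrite (killingNl br_r br_l).
  rewrite al0 in Yr.
  have Ha : Y - theta Y \in a.
    apply: centralizer_a; last by rewrite memp linearB /= tK opprB.
    by rewrite memvB // -[0]oppr0; exact: theta_root.
  have H H : H \in a -> T H = B two_rho H.
    move=> Ha'; transitivity (\sum_(z <- s') B z.1 H).
      rewrite /T; apply: eq_big_seq => z /hs[_ /(rootP br_r br_l br_a) zr z1].
      by rewrite zr // (ipZl ipl) z1 mulr1.
    rewrite (hF (B^~ H)) /two_rho (killing_suml br_r br_l); apply: eq_bigr => al' _.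
    by rewrite (killingZl br_r br_l).
  have := H _ Ha; rewrite TD -scaleN1r TZ Th scaleN1r (killingDr br_r br_l).
  rewrite -scaleN1r (killingZr br_r br_l) Bh !mulN1r !opprK => h.
  by apply/eqP; rewrite -(eqr_pMn2r (n := 2)) // !mulr2n h.
have [sX [hX ->]] := root_decomposition br_r br_l br_a br_jac htheta ha X.
elim: sX hX => [|z r IH] hX; first by rewrite big_nil T0 (killing0r br_r br_l).
rewrite big_cons TD (killingDr br_r br_l) IH; last by move=> z' h; apply: hX; rewrite inE h orbT.
by have [z1 z2] := hX z (mem_head _ _); rewrite (Troot _ _ z1 z2).
Qed.

(* [ad e] maps n into itself, so its adjoint [- ad (theta e)] compressed to n has the
   same Hilbert-Schmidt norm. *)
Lemma ad_norm_proj U s e : frame ip U s -> (forall X, X \in U -> br e X \in U) ->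
  \sum_(f <- s) ip (br e f) (br e f) =
  \sum_(f <- s) ip (proj ip s (br (theta e) f)) (proj ip s (br (theta e) f)).
Proof.
move=> fr eU.
transitivity (\sum_(f <- s) \sum_(f' <- s) ip (br e f) f' ^+ 2).
  apply: eq_big_seq => f fs; rewrite -(proj_norm ipC ipl _ fr) (proj_id fr) //.
  exact/eU/fr.1.
rewrite exchange_big /=; apply: eq_bigr => f _; rewrite (proj_norm ipC ipl _ fr).
by apply: eq_bigr => f' _; rewrite adj sqrrN ipC.
Qed.

(** As - ad(theta e) is the adjoint of ad e, the difference of the two squared norms is a trace of
    their commutator. *)
Lemma ad_norm_bracket s e :
  \sum_(f <- s) ip (br (theta e) f) (br (theta e) f) =
  \sum_(f <- s) ip (br e f) (br e f) - \sum_(f <- s) ip (br (br e (theta e)) f) f.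
Proof.
rewrite -sumrB; apply: eq_bigr => f _.
have -> : br (br e (theta e)) f = br e (br (theta e) f) - br (theta e) (br e f).
  by rewrite br_jac addrK.
by rewrite (ipBl ipl) !adj tK; ring.
Qed.

(** [positive_system] offers no functional positive on all positive roots, so this is not immediate.
    If 2 rho = 0, then ad [e, theta e] has trace 0 on n for a root vector e, and comparing norms
    shows that ad(theta e) preserves n. So [theta e, e] lies in n, which is isotropic, and is
    therefore 0; but B(al, [e, theta e]) = |al|^2 B(e, theta e) is not 0. *)
Lemma two_rho_neq0 : Sp != [::] -> two_rho != 0.
Proof.
move=> S0; apply/negP => /eqP T0.
have [al alS] : exists al, al \in Sp by case: Sp S0 => // al r _; exists al; rewrite mem_head.
have [ala al0 ral] := Sp_root hSp alS.
pose e := vpick (root al); have e0 : e != 0 by rewrite vpick0.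
have er : e \in root al by exact: memv_pick.
have en : e \in npos by exact: memv_sum_seq alS er.
have [s [fr _ _]] := frame_exists ipC ipl ipp npos.
have np := npos_br br_r br_l br_a br_jac hSp.
have tr0 : \sum_(f <- s) ip (br (br e (theta e)) f) f = 0.
  by rewrite (base_trace _ fr) T0 (killing0l br_r br_l).
have := ad_norm_bracket s e; rewrite tr0 subr0 (ad_norm_proj fr (fun X => np e X en)).
have pyth X : ip X X = ip (proj ip s X) (proj ip s X) + ip (X - proj ip s X) (X - proj ip s X).
  have h := proj_compl ipC ipl X fr (proj_mem X fr).
  move: (proj ip s X) h => P; rewrite (ipBr ipC ipl) !(ipBl ipl) (ipC P X).
  by move: (ip X X) (ip X P) (ip P P) => u v w; lra.
rewrite (eq_bigr _ (fun f _ => pyth _)) big_split /= => /eqP; rewrite -subr_eq0 addrAC subrr add0r.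
have qn f : f \in s -> ip (br (theta e) f - proj ip s (br (theta e) f)) (br (theta e) f - proj ip s (br (theta e) f)) = 0 ->
  br (theta e) f \in npos.
  by move=> _ /(ip_eq0 ipp)/subr0_eq ->; exact: (proj_mem _ fr).
rewrite psumr_eq0; last by move=> f _; exact: (ip_ge0 ipl ipp).
move=> /allP h.
have te : br (theta e) e \in npos.
  have -> : br (theta e) e = \sum_(f <- s) ip e f *: br (theta e) f.
    transitivity (br (theta e) (\sum_(f <- s) ip e f *: f)); first by rewrite -(fr.2 _ en).
    elim: (s) => [|f r IH]; first by rewrite !big_nil (br0r br_r).
    by rewrite !big_cons br_r IH.
  rewrite big_seq; apply: memv_suml => f fs; rewrite memvZ // qn //.
  exact/eqP/h.
have z : br (theta e) e = 0.
  apply: (ip_eq0 ipp); rewrite /cip tb tK br_a (killingNl br_r br_l) opprK.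
  by rewrite (br_a e) (npos_isotropic br_r br_l br_a br_jac htheta ha hSp) // memvN.
have : B al (br e (theta e)) = B al al * B e (theta e).
  rewrite -(killing_inv br_r br_jac); move/(rootP br_r br_l br_a): er => -> //.
  by rewrite (killingZl br_r br_l).
rewrite br_a z oppr0 (killing0r br_r br_l) => /esym/eqP; rewrite mulf_eq0 => /orP[]/eqP hh.
  by move: (ipp al0); rewrite (ip_a br_r br_l ha _ ala) hh ltxx.
by move: (ipp e0); rewrite /cip hh oppr0 ltxx.
Qed.

Lemma two_rho_norm_gt0 : Sp != [::] -> 0 < B two_rho two_rho.
Proof. by move=> /two_rho_neq0/ipp; rewrite (ip_a br_r br_l ha _ two_rho_a). Qed.

(** Without roots a centralises g, so the Killing form vanishes on a, hence a = 0; and a = p by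
    maximality. *)
Lemma no_roots_p0 : Sp = [::] -> cartan_p theta = 0%VS.
Proof.
move=> S0; have all0 X : X \in root 0.
  have [sX [hX ->]] := root_decomposition br_r br_l br_a br_jac htheta ha X.
  rewrite big_seq; apply: memv_suml => z /hX[z1 z2].
  have [z20|z20] := eqVneq z.2 0; first by rewrite z20 mem0v.
  have [<-//|z10] := eqVneq z.1 0.
  have : is_root br a z.1.
    by rewrite /is_root z1 z10 /=; apply: contraNneq z20 => E; move: z2; rewrite E memv0.
  by case: hSp => _ -> _ _; rewrite S0.
have ap : a = cartan_p theta.
  apply/eqP; rewrite eqEsubv; case: (ha) => -> _ _ /=.
  by apply/subvP => X Xp; exact: centralizer_a.
apply/eqP; rewrite -subv0 -ap; apply/subvP => H Ha; rewrite memv0; apply/eqP/(ip_eq0 ipp).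
have ad0 X : br H X = 0.
  by have /(rootP br_r br_l br_a) -> := all0 X; rewrite // (killing0l br_r br_l) scale0r.
rewrite (ip_a br_r br_l ha _ Ha) /killing.
have -> : ad br H = 0.
  by apply/lfunP => X; rewrite (adE br_r) ad0 zero_lfunE.
by rewrite comp_lfun0l /lftrace big1 // => i _; rewrite zero_lfunE linear0.
Qed.

End BaseTrace.

(** * The drift b *)

Section HorosphericalDrift.
Variables (R : realType) (G : topGroupType) (n : nat) (A : set (chart R G n)).
Hypothesis hG : is_lie_group A.
Variables (g : vectType R) (exp : g -> G) (br : g -> g -> g).
Hypothesis hg : is_lie_algebra A exp br.
Variable theta : 'End(g).
Hypothesis htheta : is_cartan_involution br theta.
Variable a : {vspace g}.
Hypothesis ha : maximal_abelian br (cartan_p theta) a.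
Variable Sp : seq g.
Hypothesis hSp : positive_system br a Sp.
Implicit Types (X Y Z H : g) (U : {vspace g}).

Let br_r := br_linear_r hG hg.
Let br_l := br_linear_l hG hg.
Let br_a := br_anti hG hg.
Let br_jac := br_jacobi hG hg.
Local Notation Ad := (Ad hG hg).
Local Notation B := (killing br).
Local Notation ip := (cip br theta).
Local Notation npos := (npos br a Sp).
Let ipC := cipC br_r htheta.
Let ipl := cip_l br_r br_l theta.
Let ipp := cip_gt0 htheta.
Let adj := cip_adj br_r br_l br_a br_jac htheta.
Let tb := theta_br htheta.
Let tK := thetaK htheta.
Let T := two_rho br a Sp.
Let killingNr X Y : B X (- Y) = - B X Y.
Proof. by rewrite killingC (killingNl br_r br_l) killingC. Qed.

Definition nconj (x : G) : {vspace g} := (linfun (Ad x^-1%g) @: npos)%VS.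

Lemma nconjP x X : (X \in nconj x) = (Ad x X \in npos).
Proof.
have lE := linear_lfunE (Ad_linear hG hg x^-1%g).
apply/idP/idP => [/memv_imgP[Y Yn ->]|XN]; first by rewrite lE AdKV.
by apply/memv_imgP; exists (Ad x X) => //; rewrite lE AdK.
Qed.

Lemma Ad_killing x X Y : B (Ad x X) (Ad x Y) = B X Y.
Proof.
exact: (killing_aut br_r (Ad_linear hG hg x) (Ad_linear hG hg x^-1%g) (AdK hG hg x) (AdKV hG hg x) (Ad_br hG hg x)).
Qed.

Lemma nconj_isotropic x X Y : X \in nconj x -> Y \in nconj x -> B X Y = 0.
Proof.
rewrite !nconjP => hX hY; rewrite -(Ad_killing x).
exact: (npos_isotropic br_r br_l br_a br_jac htheta ha hSp).
Qed.

Lemma nconj_br x X Y : X \in nconj x -> Y \in nconj x -> br X Y \in nconj x.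
Proof. by rewrite !nconjP Ad_br => hX hY; exact: (npos_br br_r br_l br_a br_jac hSp). Qed.

Definition nframe x : seq g := sval (cid (frame_exists ipC ipl ipp (nconj x))).

Lemma nframeP x : frame ip (nconj x) (nframe x).
Proof. by rewrite /nframe; case: cid => s [] /=. Qed.

Definition nproj x := proj ip (nframe x).

Definition drift X x := \sum_(f <- nframe x) ip (br X f) f.

(** The vector representing X |-> b_X(x) through the Killing form: invariance moves the bracket from
    X to the frame. *)
Definition driftT x := - \sum_(f <- nframe x) br f (theta f).

Lemma driftE X x : drift X x = B (driftT x) X.
Proof.
rewrite /drift /driftT (killingNl br_r br_l) (killing_suml br_r br_l) -sumrN; apply: eq_bigr => f _.
by rewrite /cip (killing_inv br_r br_jac) killingC.
Qed.

Lemma driftT_p x : driftT x \in cartan_p theta.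
Proof.
rewrite memp /driftT linearN /= linear_sum /= opprK -sumrN; apply/eqP/eq_bigr => f _.
by rewrite tb tK -br_a.
Qed.

(** Modulo Ad(x^-1) n the vector equals Y = Ad(x^-1)(2 rho): against W orthogonal to Ad(x^-1) n,
    both give the trace of [base_trace] conjugated by x. As Ad(x^-1) n is isotropic and orthogonal
    to Y, the square is that of Y, although Ad x is no isometry of the inner product. *)
Lemma driftT_norm x : B (driftT x) (driftT x) = B T T.
Proof.
have Ta : T \in a by exact: two_rho_a hSp.
have Tn Z : Z \in npos -> B T Z = 0.
  move: Z; apply: sumv_ind => [|X Y hX hY|al X alS Xr].
  - exact: (killing0r br_r br_l).
  - by rewrite (killingDr br_r br_l) hX hY addr0.
  have [ala al0 _] := Sp_root hSp alS.
  apply: (root_orth br_r br_l br_a br_jac htheta ha _ ala _ (root0_of_a br_r br_l br_a ha Ta) Xr).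
    exact: mem0v.
  by rewrite add0r.
pose Y := Ad x^-1%g T.
have [s [fr _ _]] := frame_exists ipC ipl ipp npos.
have DN : driftT x - Y \in nconj x.
  apply: (killing_biorth br_r br_l htheta) => W hW.
  rewrite (killingDl br_r br_l) (killingNl br_r br_l); apply/eqP; rewrite subr_eq0; apply/eqP.
  have qW Z : Z \in npos -> B (Ad x W) Z = 0.
    by move=> Zn; rewrite -(AdKV hG hg x Z) Ad_killing hW // nconjP AdKV.
  rewrite -driftE /drift.
  rewrite (frame_trace_conj ipl (Ad_linear hG hg x) (Ad_linear hG hg x^-1%g)
    (fun c Y Z => br_r c W Y Z) (AdK hG hg x) _ _ _ (nframeP x) fr).
  - rewrite (eq_bigr (fun f => ip (br (Ad x W) f) f)); last by move=> f _; rewrite Ad_br AdKV.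
    rewrite (base_trace br_r br_l br_a br_jac htheta ha hSp _ fr).
    by rewrite -(Ad_killing x^-1%g) AdK.
  - by move=> X; rewrite nconjP.
  - by move=> X; rewrite nconjP AdKV.
  - move=> X; rewrite !nconjP Ad_br => XN.
    exact: (npos_normalized br_r br_l br_a br_jac htheta ha hSp qW XN).
have [N NE] : exists N, N = driftT x - Y by exists (driftT x - Y).
have DE : driftT x = Y + N by rewrite NE addrC subrK.
rewrite DE !(killingDl br_r br_l) !(killingDr br_r br_l) (nconj_isotropic (x := x) (X := N) (Y := N)) ?NE //.
rewrite (killingC _ _ Y) -NE.
have -> : B Y N = 0 by rewrite -(Ad_killing x) /Y AdKV Tn // -nconjP NE.
by rewrite !addr0 Ad_killing.
Qed.

(** This is - E b_E for E in p ([drift_derive]): twice the squared Hilbert-Schmidt norm of the part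
    of ad E that leads out of Ad(x^-1) n. *)
Definition dissip E x := 2 * \sum_(f <- nframe x) ip (br E f - nproj x (br E f)) (br E f - nproj x (br E f)).

(** With U = P W, isotropy makes U and theta U orthogonal, of equal length, and W in p pairs with
    them oppositely. Then |W - U + theta U|^2 = |W|^2 - 2 |U|^2. *)
Lemma nproj_p_norm x W : W \in cartan_p theta -> 2 * ip (nproj x W) (nproj x W) <= ip W W.
Proof.
rewrite memp => /eqP tW; set U := nproj x W.
have UN : U \in nconj x by exact: proj_mem (nframeP x).
have UU : ip U (theta U) = 0 by rewrite /cip tK (nconj_isotropic UN UN) oppr0.
have WU : ip W U = ip U U.
  have := proj_compl ipC ipl W (nframeP x) UN.
  by rewrite (ipBl ipl) => /eqP; rewrite subr_eq0 => /eqP.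
have WtU : ip W (theta U) = - ip U U.
  by rewrite -(cip_theta br_r htheta) tW tK (ipNl ipl) WU.
have tUU : ip (theta U) (theta U) = ip U U by exact: cip_theta.
have := ip_ge0 ipl ipp (W - U + theta U).
rewrite !(ipDl ipl) !(ipDr ipC ipl) !(ipNl ipl) !(ipNr ipC ipl).
rewrite (ipC U W) (ipC (theta U) W) (ipC (theta U) U) UU WU WtU tUU.
by move: (ip W W) (ip U U) => u v; lra.
Qed.

Variable E : seq g.
Hypothesis hE : orthonormal_basis br (cartan_p theta) E.

Lemma pframe : frame ip (cartan_p theta) E.
Proof.
case: hE => bE oE; have EP i : (i < size E)%N -> E`_i \in cartan_p theta.
  by move=> iE; apply: (basis_mem bE); rewrite mem_nth.
have oE' i j : (i < size E)%N -> (j < size E)%N -> ip E`_i E`_j = (i == j)%:R.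
  move=> iE jE; rewrite -oE // /cip; have := EP j jE; rewrite memp => /eqP ->.
  by rewrite killingNr opprK.
split=> [f fE|X XP]; first exact: (basis_mem bE).
have [c XE] : exists c : nat -> R, X = \sum_(i < size E) c i *: E`_i.
  exists (fun i => if insub i is Some j then coord (in_tuple E) j X else 0).
  have Xs : X \in <<in_tuple E>>%VS by case/andP: bE => /eqP ->.
  rewrite {1}(coord_span Xs); apply: eq_bigr => i _; rewrite valK.
  by congr (_ *: _).
rewrite (big_nth 0) big_mkord {1}XE; apply: eq_bigr => i _; congr (_ *: _).
rewrite XE (ip_suml ipl) (bigD1 i) //= (ipZl ipl) oE' // eqxx mulr1 big1 ?addr0 //.
by move=> j ji; rewrite (ipZl ipl) oE' // -val_eqE in ji *; rewrite (negPf ji) mulr0.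
Qed.

Lemma drift_norm x : \sum_(X <- E) drift X x ^+ 2 = B T T.
Proof.
rewrite -(driftT_norm x).
have fD : ip (driftT x) (driftT x) = B (driftT x) (driftT x).
  have := driftT_p x; rewrite memp /cip => /eqP ->.
  by rewrite killingNr opprK.
rewrite -fD {2}(pframe.2 _ (driftT_p x)) (ip_sumr ipC ipl); apply: eq_big_seq => X /pframe.1.
rewrite memp => /eqP tX; rewrite (ipZr ipC ipl) driftE expr2.
suff -> : B (driftT x) X = ip (driftT x) X by [].
by rewrite /cip tX killingNr opprK.
Qed.

(** Taken at X = [driftT x], the drift itself is |2 rho|^2; by [ad_norm_bracket] and [ad_norm_proj]
    it is the sum over e, f in the frame of |(1 - P)[theta e, f]|^2. The right side has X in a basis
    of p instead of theta e, with a factor 2. *)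
Lemma dissip_ge x : B T T <= \sum_(X <- E) dissip X x.
Proof.
pose Pc Z := Z - nproj x Z.
have PcL c Y Z : Pc (c *: Y + Z) = c *: Pc Y + Pc Z.
  by rewrite /Pc /nproj (projl ipl) opprD scalerBr addrACA.
have PcN Z : Pc (- Z) = - Pc Z.
  have P0 : Pc 0 = 0 by have := PcL (-1) 0 0; rewrite scaler0 addr0 scaleN1r addNr.
  by rewrite -[- Z]addr0 -scaleN1r PcL P0 addr0 scaleN1r.
have Pc0 Z : Z \in nconj x -> Pc Z = 0 by move=> h; rewrite /Pc /nproj (proj_id (nframeP x) h) subrr.
have [F [fF _ _]] := frame_exists ipC ipl ipp fullv.
have pF Z : ip Z Z = \sum_(z <- F) ip Z z ^+ 2.
  by rewrite -(proj_norm ipC ipl _ fF) !(proj_id fF) ?memvf.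
have pyth Z : ip Z Z = ip (nproj x Z) (nproj x Z) + ip (Pc Z) (Pc Z).
  have := proj_compl ipC ipl Z (nframeP x) (proj_mem Z (nframeP x)).
  rewrite /Pc -/(nproj x Z); move: (nproj x Z) => P; rewrite (ipBr ipC ipl) !(ipBl ipl) (ipC P Z).
  by move: (ip Z Z) (ip Z P) (ip P P) => u v w; lra.
rewrite -(driftT_norm x) -driftE.
have -> : drift (driftT x) x = \sum_(e <- nframe x) \sum_(f <- nframe x) ip (Pc (br (theta e) f)) (Pc (br (theta e) f)).
  transitivity (\sum_(e <- nframe x) - \sum_(f <- nframe x) ip (br (br e (theta e)) f) f).
    rewrite /drift; under [RHS]eq_bigr do rewrite -sumrN.
    rewrite exchange_big /=; apply: eq_bigr => f _.
    by rewrite /driftT (brNl br_r br_a) (br_suml br_r br_l br_a) (ipNl ipl) (ip_suml ipl) -sumrN.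
  apply: eq_big_seq => e es; have eN := (nframeP x).1 e es.
  have := ad_norm_bracket br_r br_l br_a br_jac htheta (nframe x) e.
  rewrite (ad_norm_proj br_r br_l br_a br_jac htheta (nframeP x) (fun X => nconj_br eN)).
  rewrite (eq_bigr _ (fun f _ => pyth _)) big_split /= -/(nproj x).
  by move=> /addrI ->.
have -> : \sum_(X <- E) dissip X x = \sum_(f <- nframe x) 2 * \sum_(X <- E) ip (Pc (br X f)) (Pc (br X f)).
  by rewrite /dissip -mulr_sumr exchange_big /= mulr_sumr.
rewrite [X in X <= _]exchange_big /= big_seq [X in _ <= X]big_seq; apply: ler_sum => f fs.
have fN := (nframeP x).1 f fs.
under [X in _ <= _ * X]eq_bigr do rewrite pF.
under [X in X <= _]eq_bigr do rewrite pF.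
rewrite exchange_big [X in _ <= _ * X]exchange_big mulr_sumr; apply: ler_sum => z _.
(* For fixed f and z both sides are squares of one functional, represented on p by W. As (1 -
   P)[e, f] = 0, the value at theta e is that at theta e - e in p, namely - 2 <W, e>. The sum over e
   is then 4 |P W|^2, at most 2 |W|^2 by [nproj_p_norm]. *)
pose l X := ip (Pc (br X f)) z.
have ll c X Y : l (c *: X + Y) = c * l X + l Y by rewrite /l br_l PcL ipl.
have l0 : l 0 = 0 by have := ll (-1) 0 0; rewrite scaler0 addr0 mulN1r addNr.
pose W := \sum_(X <- E) l X *: X.
have lW X : X \in cartan_p theta -> l X = ip W X.
  move=> XP; transitivity (l (\sum_(Y <- E) ip X Y *: Y)); first by rewrite -(pframe.2 X XP).
  have -> : l (\sum_(Y <- E) ip X Y *: Y) = \sum_(Y <- E) ip X Y * l Y.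
    by elim: (E) => [|Y r IH]; rewrite ?big_nil // !big_cons ll IH.
  rewrite /W (ip_suml ipl); apply: eq_bigr => Y _.
  by rewrite (ipZl ipl) mulrC ipC.
have WP : W \in cartan_p theta.
  by rewrite /W big_seq; apply: memv_suml => X XE; rewrite memvZ // pframe.1.
have -> : \sum_(X <- E) l X ^+ 2 = ip W W.
  rewrite {2}/W (ip_sumr ipC ipl); apply: eq_big_seq => X XE.
  by rewrite (ipZr ipC ipl) -lW ?pframe.1.
apply: le_trans (ler_wpM2l _ (nproj_p_norm x WP)) => //; rewrite (proj_norm ipC ipl _ (nframeP x)).
rewrite mulrA mulr_sumr big_seq [X in _ <= X]big_seq; apply: ler_sum => e es.
have eN := (nframeP x).1 e es.
have -> : ip (Pc (br (theta e) f)) z = - l (e - theta e).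
  by rewrite /l (brDl br_l) (brNl br_r br_a) -[br e f]scale1r PcL (Pc0 (br e f)) ?nconj_br // scaler0 add0r PcN (ipNl ipl) opprK.
rewrite lW; last by rewrite memp linearB /= tK opprB.
have -> : ip W (e - theta e) = 2 * ip W e.
  have tW : theta W = - W by move: WP; rewrite memp => /eqP.
  rewrite (ipBr ipC ipl) -[X in _ - X](cip_theta br_r htheta) tK tW (ipNl ipl); ring.
by rewrite sqrrN exprMn -natrX -natrM.
Qed.

End HorosphericalDrift.

(** * Continuity and derivative of the drift *)

Lemma is_derive_quot (R : realType) (f : R -> R) (x l : R) :
  is_derive x (1 : R) f l <-> h^-1 * (f (x + h) - f x) @[h --> (0 : R)^'] --> l.
Proof.
have E : (fun h : R => h^-1 *: ((f \o shift x) (h *: (1 : R)) - f x)) = fun h => h^-1 * (f (x + h) - f x).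
  apply/funext => h; rewrite /= [h%:A + x]addrC.
  by have -> : h%:A = h :> R by exact: mulr1.
split=> [[d1 <-]|h]; first by rewrite -E; exact: d1.
split; first by rewrite /derivable E; apply/cvg_ex; exists l.
by rewrite /derive E; exact: cvg_lim.
Qed.

Lemma cvg_bigsum (T I : Type) (F : set_system T) (FF : Filter F) (R : realType) (r : seq I)
  (u : I -> T -> R) (l : I -> R) : (forall i, u i t @[t --> F] --> l i) ->
  \sum_(i <- r) u i t @[t --> F] --> \sum_(i <- r) l i.
Proof.
move=> ul; elim: r => [|i r IH].
  by under eq_fun do rewrite big_nil; rewrite big_nil; exact: cvg_cst.
by under eq_fun do rewrite big_cons; rewrite big_cons; exact: cvgD.
Qed.

Lemma cvg_bigsum0 (T I : Type) (F : set_system T) (FF : Filter F) (R : realType) (r : seq I)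
  (u : I -> T -> R) : (forall i, u i t @[t --> F] --> (0 : R)) -> \sum_(i <- r) u i t @[t --> F] --> (0 : R).
Proof. by move=> h; have := cvg_bigsum FF (r := r) h; rewrite big1_eq. Qed.

Lemma cvg0_bounded (T : Type) (F : set_system T) (FF : Filter F) (R : realType) (u v : T -> R) (C : R) :
  (forall t, `|u t| <= C) -> v t @[t --> F] --> (0 : R) -> u t * v t @[t --> F] --> (0 : R).
Proof.
move=> uC v0; apply/cvgr0Pnorm_lt => e e0.
have C1 : 0 < `|C| + 1 by rewrite ltr_wpDl.
have /cvgr0Pnorm_lt/(_ _ (divr_gt0 e0 C1)) := v0.
apply: filterS => t vt; rewrite normrM.
apply: (@le_lt_trans _ _ ((`|C| + 1) * `|v t|)).
  by rewrite ler_wpM2r // (le_trans (uC t)) // (le_trans (ler_norm C)) // lerDl.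
by rewrite mulrC -ltr_pdivlMr.
Qed.

Section DriftCalculus.
Variables (R : realType) (G : topGroupType) (n : nat) (A : set (chart R G n)).
Hypothesis hG : is_lie_group A.
Variables (g : vectType R) (exp : g -> G) (br : g -> g -> g).
Hypothesis hg : is_lie_algebra A exp br.
Variable theta : 'End(g).
Hypothesis htheta : is_cartan_involution br theta.
Variable a : {vspace g}.
Variable Sp : seq g.
Implicit Types (X Y Z H : g) (U : {vspace g}) (x y : G).

Let br_r := br_linear_r hG hg.
Let br_l := br_linear_l hG hg.
Let br_a := br_anti hG hg.
Let br_jac := br_jacobi hG hg.
Local Notation Ad := (Ad hG hg).
Local Notation ip := (cip br theta).
Let ipC := cipC br_r htheta.
Let ipl := cip_l br_r br_l theta.
Let ipp := cip_gt0 htheta.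
Let adj := cip_adj br_r br_l br_a br_jac htheta.
Local Notation P := (@nproj _ _ _ _ hG _ _ _ hg _ htheta a Sp).
Local Notation nconj := (@nconj _ _ _ _ hG _ _ _ hg a Sp).
Let fr x := @nframeP _ _ _ _ hG _ _ _ hg _ htheta a Sp x.

(** g carries no topology here. Limits of vectors are weak, against each fixed vector, and a frame
    of the whole of g turns the pairing of two moving vectors into a finite sum of such limits. *)
Definition full_frame : seq g := sval (cid (frame_exists ipC ipl ipp fullv)).

Let F := full_frame.
Let fF : frame ip fullv F.
Proof. by rewrite /F /full_frame; case: cid => s [] /=. Qed.

Let expand Z : Z = \sum_(z <- F) ip Z z *: z.
Proof. exact: fF.2 (memvf Z). Qed.

Let parseval X Y : ip X Y = \sum_(z <- F) ip X z * ip Y z.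
Proof. by rewrite {1}(expand Y) (ip_sumr ipC ipl); apply: eq_bigr => z _; rewrite (ipZr ipC ipl) mulrC. Qed.

Lemma ip_cvg (T : Type) (Fl : set_system T) (FF : Filter Fl) (V W : T -> g) L M :
  (forall Z, ip (V t) Z @[t --> Fl] --> ip L Z) -> (forall Z, ip (W t) Z @[t --> Fl] --> ip M Z) ->
  ip (V t) (W t) @[t --> Fl] --> ip L M.
Proof.
move=> hV hW; under eq_fun do rewrite parseval; rewrite parseval.
by apply: cvg_bigsum => z; exact: cvgM.
Qed.

Lemma ip_bound X Y : `|ip X Y| <= ip X X + ip Y Y.
Proof.
have h1 := ip_ge0 ipl ipp (X + Y); have h2 := ip_ge0 ipl ipp (X - Y).
move: h1 h2 (ip_ge0 ipl ipp X) (ip_ge0 ipl ipp Y).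
rewrite !(ipDl ipl) !(ipDr ipC ipl) !(ipNl ipl) !(ipNr ipC ipl) (ipC Y X).
by move: (ip X X) (ip X Y) (ip Y Y) => u v w; rewrite ler_norml; lra.
Qed.

Lemma nproj_contract x Z : ip (P x Z) (P x Z) <= ip Z Z.
Proof. by rewrite (proj_norm ipC ipl Z (fr x)); exact: (bessel ipC ipl ipp Z (fr x)). Qed.

Lemma Ad_nconj x y Z : Z \in nconj y -> Ad (x^-1 * y)%g Z \in nconj x.
Proof. by rewrite !nconjP -AdM mulgA mulgV mul1g. Qed.

(* Both terms on the right are controlled by [1 - Ad (x^-1 y)], whatever the smoothness
   of [y |-> P y]. *)
Lemma nproj_defect x y Z W : ip (P y Z) W - ip (P x Z) W =
  \sum_(z <- F) ip (P y W) z * ip (Z - P x Z) (z - Ad (x^-1 * y)%g z)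
  - \sum_(z <- F) ip (W - P y W) z * ip (P x Z - Ad (y^-1 * x)%g (P x Z)) z.
Proof.
have e1 : \sum_(z <- F) ip (P y W) z * ip (Z - P x Z) (z - Ad (x^-1 * y)%g z) = ip (Z - P x Z) (P y W).
  transitivity (ip (Z - P x Z) (\sum_(z <- F) ip (P y W) z *: (z - Ad (x^-1 * y)%g z))).
    by rewrite (ip_sumr ipC ipl); apply: eq_bigr => z _; rewrite (ipZr ipC ipl).
  have -> : \sum_(z <- F) ip (P y W) z *: (z - Ad (x^-1 * y)%g z) = P y W - Ad (x^-1 * y)%g (P y W).
    under eq_bigr do rewrite scalerBr; rewrite sumrB -expand; congr (_ - _).
    rewrite [in RHS](expand (P y W)).
    have Ad0 : Ad (x^-1 * y)%g 0 = 0.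
      by have := Ad_linear hG hg (x^-1 * y)%g (-1) 0 0; rewrite scaler0 addr0 scaleN1r addNr.
    elim: (F) => [|z r IH]; first by rewrite !big_nil Ad0.
    by rewrite !big_cons Ad_linear IH.
  rewrite (ipBr ipC ipl) [X in _ - X](proj_compl ipC ipl _ (fr x)) ?subr0 //.
  exact/Ad_nconj/(proj_mem _ (fr y)).
have e2 : \sum_(z <- F) ip (W - P y W) z * ip (P x Z - Ad (y^-1 * x)%g (P x Z)) z = ip (P x Z) (W - P y W).
  rewrite -parseval ipC (ipBl ipl) [X in _ - X](ipC) [X in _ - X](proj_compl ipC ipl _ (fr y)) ?subr0 //.
  exact/Ad_nconj/(proj_mem _ (fr x)).
rewrite e1 e2 (ipBl ipl) (ipBr ipC ipl) [ip (P y Z) W](proj_sym ipC ipl).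
by rewrite -/(P y W); ring.
Qed.

Let lin_r X : forall c Y Z, ip X (c *: Y + Z) = c * ip X Y + ip X Z.
Proof. by move=> c Y Z; rewrite (ipDr ipC ipl) (ipZr ipC ipl). Qed.

Let lin_l X : forall c Y Z, ip (c *: Y + Z) X = c * ip Y X + ip Z X.
Proof. by move=> c Y Z; rewrite ipl. Qed.

(** In [nproj_defect] the factors containing P y are bounded, since projections contract, and the
    others tend to 0 by continuity of Ad. *)
Lemma nproj_cont x Z W : ip (P y Z) W @[y --> x] --> ip (P x Z) W.
Proof.
suff h l : l = 0 - 0 -> ip (P y Z) W - ip (P x Z) W @[y --> x] --> (l : R).
  rewrite -[ip (P x Z) W]add0r; under eq_fun do rewrite -(subrK (ip (P x Z) W) (ip (P _ Z) W)).
  exact: cvgD (h _ (esym (subr0 0))) (cvg_cst _).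
move=> ->; under eq_fun do rewrite nproj_defect.
have bnd y V z : `|ip (P y V) z| <= ip V V + ip z z.
  by apply: le_trans (ip_bound _ _) _; rewrite lerD2r nproj_contract.
have bnd' y V z : `|ip (V - P y V) z| <= (ip V V + ip z z) + (ip V V + ip z z).
  rewrite (ipBl ipl); apply: le_trans (ler_normB _ _) _; apply: lerD (bnd _ _ _).
  exact: ip_bound.
have cL : {for x, continuous (fun y => x^-1 * y)%g} by apply: mulg_cont; [exact: cvg_cst|exact: cvg_id].
have cR : {for x, continuous (fun y => y^-1 * x)%g}.
  by apply: mulg_cont; [apply: invg_cont; exact: cvg_id|exact: cvg_cst].
have H1 : \sum_(z <- F) ip (P y W) z * ip (Z - P x Z) (z - Ad (x^-1 * y)%g z) @[y --> x] --> (0 : R).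
  apply: cvg_bigsum0 => z.
  apply: (@cvg0_bounded _ _ _ _ _ _ (ip W W + ip z z)) => [y|]; first exact: bnd.
  have := continuous_comp cL (@functional_Ad_cont _ _ _ _ hG _ _ _ hg (fun V => ip (Z - P x Z) V) z (lin_r _) _).
  move=> /(cvgB (cvg_cst (ip (Z - P x Z) z))); rewrite /= mulVg Ad1 subrr.
  by apply: cvg_trans; apply: near_eq_cvg; apply: nearW => y; exact/esym/(ipBr ipC ipl).
have H2 : \sum_(z <- F) ip (W - P y W) z * ip (P x Z - Ad (y^-1 * x)%g (P x Z)) z @[y --> x] --> (0 : R).
  apply: cvg_bigsum0 => z.
  apply: (@cvg0_bounded _ _ _ _ _ _ ((ip W W + ip z z) + (ip W W + ip z z))) => [y|]; first exact: bnd'.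
  have := continuous_comp cR (@functional_Ad_cont _ _ _ _ hG _ _ _ hg (fun V => ip V z) (P x Z) (lin_l _) _).
  move=> /(cvgB (cvg_cst (ip (P x Z) z))); rewrite /= mulVg Ad1 subrr.
  by apply: cvg_trans; apply: near_eq_cvg; apply: nearW => y; exact/esym/(ipBl ipl).
exact: cvgB H1 H2.
Qed.

(** Divide [nproj_defect] by s: the factors with 1 - Ad supply the derivative, and continuity of P
    suffices for the others. *)
Lemma nproj_derive x E Z W : is_derive (0 : R) (1 : R) (fun s : R => ip (P (x * exp (s *: E))%g Z) W)
  (- ip (Z - P x Z) (br E (P x W)) - ip (br E (P x Z)) (W - P x W)).
Proof.
have quot (l : g -> R) Y V : (forall c Y Z, l (c *: Y + Z) = c * l Y + l Z) ->
    h^-1 * l (V - Ad (exp (h *: Y)) V) @[h --> (0 : R)^'] --> - l (br Y V).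
  move=> ll; have -> : (fun h : R => h^-1 * l (V - Ad (exp (h *: Y)) V)) =
      fun h => - (h^-1 * (l (Ad (exp ((0 + h) *: Y)) V) - l (Ad (exp (0 *: Y)) V))).
    apply/funext => h; rewrite scale0r (exp0 hg) Ad1 add0r addrC -scaleN1r ll mulN1r -mulrN opprB.
    by rewrite addrC.
  by apply: cvgN; have /is_derive_quot := functional_Ad_derive hG hg Y V 0 ll; rewrite {2}scale0r (exp0 hg) Ad1.
apply/is_derive_quot; rewrite /= scale0r (exp0 hg) mulg1.
under eq_fun => h do rewrite add0r nproj_defect mulrBr !mulr_sumr.
have e0 : (x * exp (h *: E))%g @[h --> (0 : R)^'] --> x.
  apply: cvg_within_filter.
  have ec : continuous (fun h : R => exp (h *: E)) by exact: (exp_line_continuous hg).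
  have e1 : x = (x * exp (0 *: E))%g by rewrite scale0r (exp0 hg) mulg1.
  rewrite [in X in _ --> X]e1; exact: (@mulg_cont G _ (fun=> x) (fun h : R => exp (h *: E)) 0 (cvg_cst _) (ec 0)).
apply: cvgB.
  rewrite [X in ip _ (br E X)]expand.
  have -> : - ip (Z - P x Z) (br E (\sum_(z <- F) ip (P x W) z *: z)) =
    \sum_(z <- F) ip (P x W) z * - ip (Z - P x Z) (br E z).
    rewrite br_a (br_suml br_r br_l br_a) (ipNr ipC ipl) opprK (ip_sumr ipC ipl).
    by apply: eq_bigr => z _; rewrite (brZl br_r br_a) (ipZr ipC ipl) [br E z]br_a (ipNr ipC ipl) opprK.
  apply: cvg_bigsum => z; under eq_fun do rewrite mulrCA; apply: cvgM.
    exact: (cvg_comp (fun h : R => (x * exp (h *: E))%g) (fun y => ip (P y W) z) e0 (@nproj_cont x W z)).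
  have := quot (ip (Z - P x Z)) E z (lin_r _); apply: cvg_trans; apply: near_eq_cvg.
  by near=> h; rewrite /= mulgA mulVg mul1g.
rewrite [X in _ --> X]ipC parseval; apply: cvg_bigsum => z.
under eq_fun do rewrite mulrCA; apply: cvgM.
  under eq_fun do rewrite (ipBl ipl); rewrite (ipBl ipl); apply: cvgB; first exact: cvg_cst.
  exact: (cvg_comp (fun h : R => (x * exp (h *: E))%g) (fun y => ip (P y W) z) e0 (@nproj_cont x W z)).
have := quot (fun V => ip V z) (- E) (P x Z) (lin_l _).
rewrite (brNl br_r br_a) (ipNl ipl) opprK; apply: cvg_trans; apply: near_eq_cvg.
by near=> h; rewrite /= scalerN (expN hg) invgM -mulgA mulVg mulg1.
Unshelve. all: by end_near.
Qed.

Local Notation drift := (@drift _ _ _ _ hG _ _ _ hg _ htheta a Sp).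
Local Notation dissip := (@dissip _ _ _ _ hG _ _ _ hg _ htheta a Sp).

(** The frame of Ad(x^-1) n is an arbitrary choice for each x and cannot be differentiated; over a
    fixed frame of g only the projection depends on x. *)
Lemma drift_full X x : drift X x = \sum_(z <- F) ip (P x (br X z)) z.
Proof.
rewrite /drift.
transitivity (\sum_(f <- nframe hG hg htheta a Sp x) \sum_(z <- F) ip f z * ip (br X z) f).
  apply: eq_bigr => f _; transitivity (ip (br X (\sum_(z <- F) ip f z *: z)) f); first by rewrite -expand.
  rewrite br_a (br_suml br_r br_l br_a) (ipNl ipl) (ip_suml ipl) -sumrN; apply: eq_bigr => z _.
  by rewrite (brZl br_r br_a) (ipZl ipl) -mulrN -(ipNl ipl) -br_a.
rewrite exchange_big; apply: eq_bigr => z _; rewrite /nproj /proj (ip_suml ipl).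
by apply: eq_bigr => f _; rewrite (ipZl ipl) mulrC.
Qed.

Lemma drift_cont X : continuous (drift X).
Proof.
have -> : drift X = fun x => \sum_(z <- F) ip (P x (br X z)) z by apply/funext => x; exact: drift_full.
by move=> x; apply: cvg_bigsum => z; exact: nproj_cont.
Qed.

(** As ad E is symmetric for E in p, the two terms of [nproj_derive] contribute the same sum: the
    origin of the factor 2 in [dissip]. *)
Let compl_sum x E : E \in cartan_p theta ->
  \sum_(z <- F) (- ip (br E z - P x (br E z)) (br E (P x z)) - ip (br E (P x (br E z))) (z - P x z)) = - dissip E x.
Proof.
rewrite memp => /eqP tE; have sym X Y : ip (br E X) Y = ip X (br E Y).
  by rewrite adj tE (brNl br_r br_a) (ipNr ipC ipl) opprK.
pose S := \sum_(f <- nframe hG hg htheta a Sp x) ip (br E f - P x (br E f)) (br E f).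
have Pb Z : br E (P x Z) = \sum_(f <- nframe hG hg htheta a Sp x) ip Z f *: br E f.
  rewrite /nproj /proj br_a (br_suml br_r br_l br_a) -sumrN; apply: eq_bigr => f _.
  by rewrite (brZl br_r br_a) -scalerN -br_a.
have cs X Y : ip (X - P x X) Y = ip X (Y - P x Y).
  by rewrite (ipBl ipl) (ipBr ipC ipl) [ip (P x X) Y](proj_sym ipC ipl).
have s1 : \sum_(z <- F) ip (br E z - P x (br E z)) (br E (P x z)) = S.
  under eq_bigr do rewrite Pb (ip_sumr ipC ipl).
  rewrite exchange_big; apply: eq_bigr => f _.
  under eq_bigr do rewrite (ipZr ipC ipl) cs sym.
  by rewrite cs sym parseval; apply: eq_bigr => z _; rewrite (ipC z f) (ipC z).
have s2 : \sum_(z <- F) ip (br E (P x (br E z))) (z - P x z) = S.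
  under eq_bigr do rewrite Pb (ip_suml ipl).
  rewrite exchange_big; apply: eq_bigr => f _.
  under eq_bigr do rewrite (ipZl ipl) sym -cs ipC.
  by rewrite [RHS]ipC parseval.
rewrite sumrB sumrN s1 s2 /dissip -opprD; congr (- _).
have -> : S = \sum_(f <- nframe hG hg htheta a Sp x) ip (br E f - P x (br E f)) (br E f - P x (br E f)).
  apply: eq_bigr => f _; rewrite [RHS](ipBr ipC ipl).
  have -> : ip (br E f - P x (br E f)) (P x (br E f)) = 0.
    by apply: (proj_compl ipC ipl _ (fr x)); exact: proj_mem (fr x).
  by rewrite subr0.
by rewrite mulr2n mulrDl mul1r.
Qed.

Lemma drift_derive E x s : E \in cartan_p theta ->
  is_derive s (1 : R) (fun s : R => drift E (x * exp (s *: E))%g) (- dissip E (x * exp (s *: E))%g).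
Proof.
move=> Ep; apply/is_derive_quot.
have h z := nproj_derive (x * exp (s *: E))%g E (br E z) z.
rewrite -(compl_sum _ Ep).
have -> : (fun e : R => e^-1 * (drift E (x * exp ((s + e) *: E))%g - drift E (x * exp (s *: E))%g)) =
    fun e => \sum_(z <- F) e^-1 * (ip (P (x * exp (s *: E) * exp ((0 + e) *: E))%g (br E z)) z -
      ip (P (x * exp (s *: E) * exp (0 *: E))%g (br E z)) z).
  apply/funext => e; rewrite -mulr_sumr sumrB !drift_full add0r scale0r (exp0 hg) mulg1.
  by rewrite (exp_add hg) mulgA.
by apply: cvg_bigsum => z; exact: (is_derive_quot _ _ _).1 (h z).
Qed.

Lemma dissip_cont E : E \in cartan_p theta -> continuous (dissip E).
Proof.
move=> Ep x; have E1 y : dissip E y = - \sum_(z <- F) (- ip (br E z - P y (br E z)) (br E (P y z)) - ip (br E (P y (br E z))) (z - P y z)).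
  by rewrite (compl_sum _ Ep) opprK.
have tE : theta E = - E by move: Ep; rewrite memp => /eqP.
have sym X Y : ip (br E X) Y = ip X (br E Y).
  by rewrite adj tE (brNl br_r br_a) (ipNr ipC ipl) opprK.
have -> : dissip E = _ := funext E1.
have c1 V Z : ip (V - P y V) Z @[y --> x] --> ip (V - P x V) Z.
  under eq_fun do rewrite (ipBl ipl); rewrite (ipBl ipl).
  by apply: cvgB; [exact: cvg_cst|exact: nproj_cont].
have c2 V Z : ip (br E (P y V)) Z @[y --> x] --> ip (br E (P x V)) Z.
  by under eq_fun do rewrite sym; rewrite sym; exact: nproj_cont.
apply: cvgN; apply: cvg_bigsum => z; apply: cvgB; first apply: cvgN.
  by apply: ip_cvg => Z; [exact: c1|exact: c2].
by apply: ip_cvg => Z; [exact: c2|exact: c1].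
Qed.

End DriftCalculus.

(** * Haar measure *)

Section LieTopology.
Variables (R : realType) (G : topGroupType) (n : nat) (A : set (chart R G n)).
Hypothesis hG : is_lie_group A.
Hypothesis Gc : connected [set: G].

Lemma nbhs1_open (W : set G) : nbhs (1%g : G) W -> exists V : set G, [/\ open V, V 1%g & V `<=` W].
Proof. by rewrite nbhsE => -[V [oV V1] VW]; exists V. Qed.

Lemma lmul_open (x : G) (W : set G) : open W -> open [set y | W (x * y)%g].
Proof.
move=> oW; have -> : [set y | W (x * y)%g] = setT `&` (fun y => x * y)%g @^-1` W by rewrite setTI.
apply: open_preimage_on oW => [|y _]; first exact: openT.
by apply: mulg_cont; [exact: cvg_cst|exact: cvg_id].
Qed.

Lemma inv_open (W : set G) : open W -> open [set y : G | W y^-1%g].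
Proof.
move=> oW; have -> : [set y : G | W y^-1%g] = setT `&` (fun y => y^-1)%g @^-1` W by rewrite setTI.
apply: open_preimage_on oW => [|y _]; first exact: openT.
by apply: invg_cont; exact: cvg_id.
Qed.

Lemma compact_closedG (C : set G) : compact C -> closed C.
Proof. by apply: compact_closed; exact: (lie_hausdorff hG). Qed.

Lemma compact_mul (C D : set G) : compact C -> compact D ->
  compact [set z | exists x y, [/\ C x, D y & z = (x * y)%g]].
Proof.
move=> cC cD; have -> : [set z | exists x y, [/\ C x, D y & z = (x * y)%g]] =
    (fun p : G * G => p.1 * p.2)%g @` (C `*` D).
  apply/seteqP; split=> [z [x [y [Cx Dy ->]]]|z [[x y] [/= Cx Dy] <-]]; first by exists (x, y).
  by exists x, y.
apply: continuous_compact; last exact: compact_setX.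
by apply: continuous_subspaceT; exact: mulg_continuous.
Qed.

Lemma compact_inv (C : set G) : compact C -> compact [set x : G | C x^-1%g].
Proof.
move=> cC; have -> : [set x : G | C x^-1%g] = (fun x : G => x^-1)%g @` C.
  apply/seteqP; split=> [z Cz|z [x Cx <-]]; last by rewrite /= invgK.
  by exists z^-1%g => //; rewrite invgK.
apply: continuous_compact cC.
by apply: continuous_subspaceT; exact: invg_continuous.
Qed.

Lemma nbhs1_div (W : set G) : nbhs (1%g : G) W ->
  exists V : set G, [/\ open V, V 1%g & forall x y, V x -> V y -> W (x^-1 * y)%g].
Proof.
move=> nW; have c : {for ((1, 1)%g : G * G), continuous (fun p : G * G => p.1^-1 * p.2)%g}.
  by apply: mulg_cont; [apply: invg_cont; exact: cvg_fst|exact: cvg_snd].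
have : nbhs (((1, 1)%g : G * G).1^-1 * ((1, 1)%g : G * G).2)%g W by rewrite /= invg1 mul1g.
move=> /c[[B1 B2] [/= n1 n2] sub].
have [V [oV V1 VB]] := nbhs1_open (filterI n1 n2).
by exists V; split=> // x y /VB[Bx _] /VB[_ By]; apply: (sub (x, y)).
Qed.

Lemma nbhs1_compact : exists (U C : set G), [/\ open U, U 1%g, compact C & U `<=` C].
Proof.
have [f [C [[sf f0] f1 cC _ fC]]] := bump_exists hG (@openT G) (I : [set: G] 1%g).
exists [set x | 0 < f x], C; split=> //.
  have -> : [set x | 0 < f x] = setT `&` f @^-1` [set r | 0 < r] by rewrite setTI.
  apply: open_preimage_on; [exact: openT|move=> x _; exact: (smooth_fun_cont hG sf)|exact: open_gt].
by move=> x /= fx; apply: contrapT => /fC; move: fx => /[swap] ->; rewrite ltxx.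
Qed.

Lemma countable_base1 : exists U : nat -> set G, (forall k, open (U k) /\ U k 1%g) /\
  forall W : set G, nbhs (1%g : G) W -> exists k, U k `<=` W.
Proof.
have [c Ac c1] := chart_of hG (1%g : G).
have [oD _ _ cm ci] := (let: And4 _ hA _ _ := hG in (let: And3 h _ _ := hA in h) c Ac).
pose e := chart_map c 1%g.
exists (fun k => chart_dom c `&` chart_map c @^-1` (ball e (k.+1%:R^-1 : R)))%classic; split=> [k|W nW].
  split; first by apply: open_preimage_on => //; exact: ball_open.
  by split=> //; apply: ballxx; rewrite invr_gt0.
have ie : chart_img c e by exists 1%g.
have e1 : chart_inv c e = 1%g by exact: (chart_mapK hG Ac c1).
have : nbhs (chart_inv c e) W by rewrite e1.
move=> /(ci e ie) /nbhs_ballP[r /= r0 rW].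
exists (Num.bound r^-1) => x [Dx bx].
have -> : x = chart_inv c (chart_map c x) by rewrite (chart_mapK hG Ac Dx).
apply: rW; apply: le_ball bx.
by rewrite -[leRHS]invrK lef_pV2 ?posrE ?invr_gt0 // (le_trans (ltW (archi_boundP _))) ?invr_ge0 ?(ltW r0) // ler_nat.
Qed.

(** The powers of a compact neighbourhood of 1. Their union is open, and closed since [U] is
    symmetric, hence all of G by connectedness. *)
Lemma exhaustion : exists (U : set G) (C : nat -> set G), [/\ open U, U 1%g &
  forall x, U x -> U x^-1%g] /\ [/\ forall k, compact (C k),
  forall k x y, C k x -> U y -> C k.+1 (x * y)%g, forall k, C k `<=` C k.+1,
  forall x, exists k, C k x & U `<=` C 1].
Proof.
have [U0 [C0 [oU0 U01 cC0 UC0]]] := nbhs1_compact.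
pose U := U0 `&` [set x | U0 x^-1%g].
have oU : open U by apply: openI => //; exact: inv_open.
have Ui x : U x -> U x^-1%g by move=> [h1 h2]; split=> //=; rewrite invgK.
have U1 : U 1%g by split=> //=; rewrite invg1.
pose fix C k := if k is k'.+1 then [set z | exists x y, [/\ C k' x, C0 y & z = (x * y)%g]] else [set (1%g : G)].
have C1 x y k : C k x -> U y -> C k.+1 (x * y)%g.
  by move=> Ckx [Uy _]; exists x, y; split=> //; exact: UC0.
have CS k : C k `<=` C k.+1 by move=> x /C1/(_ U1); rewrite mulg1.
exists U, C; split; first by split.
split=> //.
- by elim=> [|k IH] /=; [exact: compact_set1|exact: compact_mul].
- by move=> k x y; exact: C1.
- pose H := \bigcup_k C k.
  suff HT : H = setT by move=> x; have [k _ Cx] : H x; [rewrite HT|exists k].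
  apply: Gc; first by exists 1%g, 0%N.
    exists H; last by rewrite setTI.
    rewrite openE => x [k _ Cx].
    have : nbhs x [set y | U (x^-1 * y)%g].
      by apply: open_nbhs_nbhs; split; [exact: lmul_open|rewrite /= mulVg].
    apply: filterS => y /= Uy; exists k.+1 => //.
    have -> : y = (x * (x^-1 * y))%g by rewrite mulgA mulgV mul1g.
    exact: C1.
  exists H; last by rewrite setTI.
  move=> x Hx; have : nbhs x [set y | U (x^-1 * y)%g].
    by apply: open_nbhs_nbhs; split; [exact: lmul_open|rewrite /= mulVg].
  move=> /Hx[y [[k _ Cy] /= Uy]]; exists k.+1 => //.
  have -> : x = (y * (x^-1 * y)^-1)%g by rewrite invgM invgK mulgA mulgV mul1g.
  exact/C1/Ui.
- by move=> x Ux; rewrite -[x]mul1g; exact: C1.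
Qed.

(** Second countability puts the open sets of G x G into the product of the Borel sigma-algebras
    ([open_prod_borel]), without which continuous functions of two variables could not enter
    Tonelli's theorem. *)
Lemma countable_base : exists b : nat -> set G, (forall k, open (b k)) /\
  forall x W, nbhs x W -> exists k, b k x /\ b k `<=` W.
Proof.
have [U [C [_ [cC _ _ CT _]]]] := exhaustion.
have [B [oB hB]] := countable_base1.
have cov j k : finite_subset_cover (C j) (fun x => [set y | B k (x^-1 * y)%g]) (C j).
  have := cC j; rewrite compact_cover; apply; first by move=> x _; apply: lmul_open; exact: (oB k).1.
  by move=> x Cx; exists x => //=; rewrite mulVg; exact: (oB k).2.
have /choice[D hD] : forall jk : nat * nat, exists s : seq G,
    forall x, C jk.1 x -> exists2 y, y \in s & B jk.2 (y^-1 * x)%g.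
  move=> [j k]; have [D _ sub] := cov j k; exists (finmap.enum_fset D) => x /sub[y /= yD hy].
  by exists y.
pose b m : set G := if unpickle m is Some (j, k, i) then
  [set y | B k ((nth 1%g (D (j, k)) i)^-1 * y)%g] else set0.
exists b; split=> [m|x W nW].
  rewrite /b; case: unpickle => [[[j k] i]|]; last exact: open0.
  by apply: lmul_open; exact: (oB k).1.
have : nbhs (1%g : G) [set z | W (x * z)%g].
  have : nbhs (x * 1)%g W by rewrite mulg1.
  by apply: (mulg_cont (f := fun=> x) (h := id)); [exact: cvg_cst|exact: cvg_id].
move=> /nbhs1_div[V [oV V1 VW]].
have [k kV] := hB _ (open_nbhs_nbhs (conj oV V1)).
have [j Cx] := CT x.
have [y yD hy] := hD (j, k) x Cx.
exists (pickle (j, k, index y (D (j, k)))); rewrite /b pickleK nth_index //; split=> // z /= hz.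
have -> : z = (x * ((y^-1 * x)^-1 * (y^-1 * z)))%g by rewrite invgM invgK !mulgA mulgV mul1g mulgV mul1g.
by apply: VW; exact: kV.
Qed.

End LieTopology.

Lemma open_prod_bigcup (T1 T2 : topologicalType) (b1 : nat -> set T1) (b2 : nat -> set T2) (O : set (T1 * T2)) :
  (forall x W, nbhs x W -> exists k, b1 k x /\ b1 k `<=` W) ->
  (forall x W, nbhs x W -> exists k, b2 k x /\ b2 k `<=` W) -> open O ->
  O = \bigcup_i \bigcup_j (if `[< b1 i `*` b2 j `<=` O >] then b1 i `*` b2 j else set0).
Proof.
move=> h1 h2; rewrite openE => oO; apply/seteqP; split=> [[x y] Oxy|z [i _ [j _]]].
  have [[B1 B2] [/= n1 n2] sub] := oO _ Oxy.
  have [i [ix iB]] := h1 _ _ n1; have [j [jy jB]] := h2 _ _ n2.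
  exists i => //; exists j => //; case: asboolP => // -[] [u v] [/= iu jv].
  by apply: (sub (u, v)); split; [exact: iB|exact: jB].
by case: asboolP => // h /h.
Qed.

Lemma realType_base (R : realType) : exists b : nat -> set R, (forall k, open (b k)) /\
  forall x W, nbhs x W -> exists k, b k x /\ b k `<=` W.
Proof.
pose b m : set R := if unpickle m is Some (p, q) then `]ratr (p : rat), ratr (q : rat)[%classic else set0.
exists b; split=> [m|x W /nbhs_ballP[e /= e0 eW]].
  by rewrite /b; case: unpickle => [[p q]|]; [exact: interval_open|exact: open0].
have x1 : x - e < x by rewrite ltrBlDr ltrDl.
have x2 : x < x + e by rewrite ltrDl.
have [p] := rat_in_itvoo x1.
rewrite in_itv /= => /andP[p1 p2].
have [q] := rat_in_itvoo x2.
rewrite in_itv /= => /andP[q1 q2].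
exists (pickle (p, q)); rewrite /b pickleK; split; first by rewrite /= in_itv /= p2 q1.
move=> y /=; rewrite in_itv /= => /andP[y1 y2]; apply: eW.
by rewrite /ball /= ltr_distlC (lt_trans p1 y1) (lt_trans y2 q2).
Qed.

Section SigmaFiniteCopy.
Context d (T : measurableType d) (R : realType) (m : {measure set T -> \bar R}) (sf : sigma_finite setT m).
(** Tonelli's theorem takes a measure bundled with its sigma-finiteness. For Haar measure this is a
    theorem, so it is attached to a copy of the measure. *)
Definition sf_copy (_ : sigma_finite setT m) : set T -> \bar R := m.
HB.instance Definition _ := Measure.copy (sf_copy sf) m.
HB.instance Definition _ := Measure_isSigmaFinite.Build _ _ _ (sf_copy sf) sf.
End SigmaFiniteCopy.

Section HaarBasics.
Variables (R : realType) (G : topGroupType) (n : nat) (A : set (chart R G n)).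
Hypothesis hG : is_lie_group A.
Hypothesis Gc : connected [set: G].
Variable mu : {measure set (borel G) -> \bar R}.
Hypothesis hmu : is_haar mu.
Implicit Types (f : G -> R) (x y : G).

Lemma open_borel (U : set G) : open U -> measurable (U : set (borel G)).
Proof. by move=> oU; apply: sub_sigma_algebra. Qed.

Lemma compact_borel (C : set G) : compact C -> measurable (C : set (borel G)).
Proof.
move=> /(compact_closedG hG) cC; rewrite -[C]setCK; apply: measurableC.
by apply: open_borel; exact: closed_openC.
Qed.

Lemma open_preimage_borel (d : measure_display) (T : measurableType d) (D : set T) (f : T -> R) :
  (forall x y : R, measurable (D `&` f @^-1` `]x, y[%classic)) -> measurable_fun D f.
Proof.
move=> h; apply: (measurability _ (RGenOpens.measurableE R)).
by move=> _ [_ [x [y ->] <-]]; exact: h.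
Qed.

Lemma continuous_borel f : continuous f -> measurable_fun setT (f : borel G -> R).
Proof.
move=> cf; apply: open_preimage_borel => x y; rewrite setTI; apply: open_borel.
by rewrite -[X in open X]setTI; apply: open_preimage_on => [|z _|]; [exact: openT|exact: cf|exact: interval_open].
Qed.

Lemma haar_sigma_finite : sigma_finite setT mu.
Proof.
have [_ [C [_ [cC _ _ CT _]]]] := exhaustion hG Gc.
exists C; first by apply/seteqP; split=> // x _; have [k Cx] := CT x; exists k.
by move=> k; split; [exact: compact_borel|case: hmu => _ + _; apply].
Qed.

Local Notation haar_sf := (sf_copy haar_sigma_finite : {sigma_finite_measure set (borel G) -> \bar R}).

Lemma open_prod_borel (O : set (G * G)) : open O -> measurable (O : set (borel G * borel G)).
Proof.
have [b [ob hb]] := countable_base hG Gc => oO; rewrite (open_prod_bigcup hb hb oO).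
apply: bigcupT_measurable => i; apply: bigcupT_measurable => j; case: asboolP => // _.
by apply: measurableX; exact: open_borel.
Qed.

Lemma open_prodR_borel (O : set (R * G)) : open O -> measurable (O : set (R * borel G)).
Proof.
have [b [ob hb]] := countable_base hG Gc; have [c [oc hc]] := realType_base R => oO.
rewrite (open_prod_bigcup hc hb oO).
apply: bigcupT_measurable => i; apply: bigcupT_measurable => j; case: asboolP => // _.
by apply: measurableX; [exact: open_measurable|exact: open_borel].
Qed.

Lemma continuous2_borel (F : G * G -> R) : continuous F -> measurable_fun setT (F : (borel G * borel G)%type -> R).
Proof.
move=> cF; apply: open_preimage_borel => x y; apply: open_prod_borel.
by apply: (@open_preimage_on (G * G)%type) => [|z _|]; [exact: openT|exact: cF|exact: interval_open].
Qed.

Lemma continuousR_borel (D : set (R * G)) (F : R * G -> R) : open D ->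
  (forall z, D z -> {for z, continuous F}) -> measurable_fun (D : set (R * borel G)%type) (F : (R * borel G)%type -> R).
Proof.
move=> oD cF; apply: open_preimage_borel => x y; apply: open_prodR_borel.
by apply: (@open_preimage_on (R * G)%type) => //; exact: interval_open.
Qed.

Lemma tonelli (F : G * G -> \bar R) : measurable_fun setT (F : (borel G * borel G)%type -> \bar R) ->
  (forall z, 0 <= F z)%E -> (\int[mu]_x \int[mu]_y F (x, y) = \int[mu]_y \int[mu]_x F (x, y))%E.
Proof. by move=> mF F0; exact: (@fubini_tonelli _ _ _ _ _ haar_sf haar_sf F mF F0). Qed.

Lemma tonelliR (F : R * G -> \bar R) : measurable_fun setT (F : (R * borel G)%type -> \bar R) ->
  (forall z, 0 <= F z)%E ->
  (\int[lebesgue_measure]_u \int[mu]_y F (u, y) = \int[mu]_y \int[lebesgue_measure]_u F (u, y))%E.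
Proof. by move=> mF F0; exact: (@fubini_tonelli _ _ _ _ _ lebesgue_measure haar_sf F mF F0). Qed.

Lemma lmul_borel x : measurable_fun setT ((fun y => x * y)%g : borel G -> borel G).
Proof.
apply: (@measurability _ _ (borel G) (borel G) _ _ (@open G) erefl) => _ [U oU <-].
by rewrite setTI; apply: open_borel; exact: lmul_open.
Qed.

Lemma inv_borel : measurable_fun setT ((fun y => y^-1)%g : borel G -> borel G).
Proof.
apply: (@measurability _ _ (borel G) (borel G) _ _ (@open G) erefl) => _ [U oU <-].
by rewrite setTI; apply: open_borel; exact: inv_open.
Qed.

Lemma rmul_borel x : measurable_fun setT ((fun y => y * x)%g : borel G -> borel G).
Proof.
apply: (@measurability _ _ (borel G) (borel G) _ _ (@open G) erefl) => _ [U oU <-].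
rewrite setTI; apply: open_borel.
rewrite -[X in open X]setTI; apply: open_preimage_on oU => [|z _]; first exact: openT.
by apply: mulg_cont; [exact: cvg_id|exact: cvg_cst].
Qed.

Lemma div_borel : measurable_fun setT ((fun z => z.1^-1 * z.2)%g : borel G * borel G -> borel G).
Proof.
apply: (@measurability _ _ _ (borel G) _ _ (@open G) erefl) => _ [U oU <-].
rewrite setTI; apply: open_prod_borel.
rewrite -[X in open X]setTI; apply: open_preimage_on oU => [|z _]; first exact: openT.
by apply: mulg_cont; [apply: invg_cont; exact: cvg_fst|exact: cvg_snd].
Qed.

Lemma mul_borel : measurable_fun setT ((fun z => z.1 * z.2)%g : borel G * borel G -> borel G).
Proof.
apply: (@measurability _ _ _ (borel G) _ _ (@open G) erefl) => _ [U oU <-].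
rewrite setTI; apply: open_prod_borel.
rewrite -[X in open X]setTI; apply: open_preimage_on oU => [|z _]; first exact: openT.
by apply: mulg_cont; [exact: cvg_fst|exact: cvg_snd].
Qed.

Lemma haar_left x (F : G -> \bar R) : measurable_fun setT (F : borel G -> \bar R) ->
  (forall y, 0 <= F y)%E -> (\int[mu]_y F (x * y)%g = \int[mu]_y F y)%E.
Proof.
move=> mF F0; have := @ge0_integral_pushforward _ _ _ _ _ _ (lmul_borel x) mu setT F measurableT.
rewrite preimage_setT => /(_ mF (fun y _ => F0 y)) <-.
case: hmu => hl _ _; apply: eq_measure_integral => [mT Y mY|mp B mB _]; first exact: lmul_borel.
exact: hl.
Qed.

End HaarBasics.

(** * Integrals of compactly supported functions *)

Section CompactIntegrals.
Variables (R : realType) (G : topGroupType) (n : nat) (A : set (chart R G n)).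
Hypothesis hG : is_lie_group A.
Variable mu : {measure set (borel G) -> \bar R}.
Hypothesis hmu : is_haar mu.
Implicit Types (f w : G -> R) (x y : G) (C : set G).

Local Notation intg f := (\int[mu]_x f x).

(** The class in which integration is free of side conditions: stable under sums and under products
    with continuous functions, and containing the indicators of compact sets, which are not
    continuous. *)
Definition bmc w := [/\ measurable_fun setT (w : borel G -> R), exists M : R, forall x, `|w x| <= M &
  exists2 C : set G, compact C & forall x, ~ C x -> w x = 0].

Lemma bmc_bound w : bmc w -> exists M C, [/\ 0 < M, compact C, forall x, `|w x| <= M & forall x, ~ C x -> w x = 0].
Proof.
move=> [_ [M hM] [C cC hC]]; exists (`|M| + 1), C; split; [by rewrite ltr_wpDl|by []| |by []].
move=> x; by apply: le_trans (hM x) _; apply: le_trans (ler_norm M) _; rewrite lerDl.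
Qed.

Lemma haar_compact_fin C : compact C -> (mu C < +oo)%E.
Proof. by case: hmu => _ + _; apply. Qed.

Lemma integrable_indic_compact C : compact C -> mu.-integrable setT (fun x : borel G => (\1_(C : set (borel G)) x)%:E).
Proof.
move=> cC; have mC := compact_borel hG cC.
apply/integrableP; split; first by apply/measurable_EFinP; exact: measurable_indic.
under eq_integral => x _ do rewrite gee0_abs ?lee_fin //.
by rewrite integral_indic // setIT haar_compact_fin.
Qed.

Lemma bmc_integrable w : bmc w -> mu.-integrable setT (EFin \o w).
Proof.
move=> /[dup] [[mw _ _]] /bmc_bound[M [C [M0 cC wM wC]]].
have mC := compact_borel hG cC.
have iC : mu.-integrable setT (EFin \o (fun x : borel G => M * \1_(C : set (borel G)) x)).
  have -> : EFin \o (fun x : borel G => M * \1_(C : set (borel G)) x) =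
      (fun x : borel G => M%:E * (\1_(C : set (borel G)) x)%:E)%E by apply/funext => x; rewrite /= EFinM.
  by apply: integrableZl => //; exact: integrable_indic_compact.
apply: le_integrable iC => //; first exact/measurable_EFinP.
move=> x _; rewrite /= lee_fin indicE; have [xC|xC] := boolP (x \in (C : set (borel G))).
  by rewrite mulr1 (le_trans (wM x)) // ler_norm.
by rewrite wC ?normr0 //; move: xC; rewrite notin_setE.
Qed.

Lemma bmc_cont f C : continuous f -> compact C -> (forall x, ~ C x -> f x = 0) -> bmc f.
Proof.
move=> cf cC fC; split; [exact: continuous_borel| |by exists C].
have [M M0 hM] := continuous_compact_bounded cC (fun x _ => cf x).
exists M => x; have [/hM//|/fC ->] := pselect (C x); by rewrite normr0 ltW.
Qed.

Lemma bmcM w f : bmc w -> continuous f -> bmc (fun x => w x * f x).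
Proof.
move=> /[dup] [[mw _ _]] /bmc_bound[M [C [M0 cC wM wC]]] cf; split.
- by apply: measurable_funM => //; exact: continuous_borel.
- have [N N0 hN] := continuous_compact_bounded cC (fun x _ => cf x).
  exists (M * N) => x; rewrite normrM; have [Cx|/wC ->] := pselect (C x).
    by apply: ler_pM => //; exact: hN.
  by rewrite normr0 mul0r mulr_ge0 // ltW.
- by exists C => // x /wC ->; rewrite mul0r.
Qed.

Lemma bmcD w w' : bmc w -> bmc w' -> bmc (fun x => w x + w' x).
Proof.
move=> [m1 [M1 h1] [C1 c1 k1]] [m2 [M2 h2] [C2 c2 k2]]; split; first exact: measurable_funD.
- by exists (M1 + M2) => x; apply: le_trans (ler_normD _ _) _; exact: lerD.
- exists (C1 `|` C2); first exact: compactU.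
  by move=> x /not_orP[/k1 -> /k2 ->]; rewrite addr0.
Qed.

Lemma bmcZ a w : bmc w -> bmc (fun x => a * w x).
Proof.
move=> [m1 [M1 h1] [C1 c1 k1]]; split; first exact: measurable_funM.
- by exists (`|a| * M1) => x; rewrite normrM ler_wpM2l.
- by exists C1 => // x /k1 ->; rewrite mulr0.
Qed.

Lemma bmcB w w' : bmc w -> bmc w' -> bmc (fun x => w x - w' x).
Proof.
move=> h h'; have := bmcD h (bmcZ (-1) h'); congr bmc.
by apply/funext => x; rewrite mulN1r.
Qed.

Lemma bmc_sum (I : Type) (r : seq I) (w : I -> G -> R) : (forall i, bmc (w i)) -> bmc (fun x => \sum_(i <- r) w i x).
Proof.
move=> h; elim: r => [|i r IH].
  have -> : (fun x => \sum_(i <- [::]) w i x) = fun=> 0 by apply/funext => x; rewrite big_nil.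
  apply: (@bmc_cont _ set0) => //; [by move=> x; exact: cvg_cst|exact: compact0].
have -> : (fun x => \sum_(j <- i :: r) w j x) = fun x => w i x + \sum_(j <- r) w j x.
  by apply/funext => x; rewrite big_cons.
exact: bmcD.
Qed.

Lemma intgD w w' : bmc w -> bmc w' -> intg (fun x => w x + w' x) = intg w + intg w'.
Proof. by move=> h h'; apply: RintegralD => //; exact: bmc_integrable. Qed.

Lemma intgB w w' : bmc w -> bmc w' -> intg (fun x => w x - w' x) = intg w - intg w'.
Proof. by move=> h h'; apply: RintegralB => //; exact: bmc_integrable. Qed.

Lemma intgZ a w : bmc w -> intg (fun x => a * w x) = a * intg w.
Proof. by move=> h; apply: RintegralZl => //; exact: bmc_integrable. Qed.

Lemma intg0 : intg (fun=> 0) = 0 :> R.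
Proof. by rewrite /Rintegral integral0. Qed.

Lemma intg_sum (I : Type) (r : seq I) (w : I -> G -> R) : (forall i, bmc (w i)) ->
  intg (fun x => \sum_(i <- r) w i x) = \sum_(i <- r) intg (w i).
Proof.
move=> h; elim: r => [|i r IH]; first by under eq_Rintegral do rewrite big_nil; rewrite intg0 big_nil.
under eq_Rintegral do rewrite big_cons; rewrite big_cons intgD ?IH //.
exact: bmc_sum.
Qed.

Lemma le_intg w w' : bmc w -> bmc w' -> (forall x, w x <= w' x) -> intg w <= intg w'.
Proof. by move=> h h' le; apply: le_Rintegral => //; exact: bmc_integrable. Qed.

Lemma intg_ge0 w : (forall x, 0 <= w x) -> 0 <= intg w.
Proof. by move=> h; apply: Rintegral_ge0. Qed.

Lemma intg_bound w C M : bmc w -> compact C -> (forall x, ~ C x -> w x = 0) -> (forall x, C x -> `|w x| <= M) ->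
  `|intg w| <= M * fine (mu C).
Proof.
move=> hw cC wC wM; have mC := compact_borel hG cC.
have iC : mu.-integrable setT (EFin \o (fun x : borel G => M * \1_(C : set (borel G)) x)).
  have -> : EFin \o (fun x : borel G => M * \1_(C : set (borel G)) x) =
      (fun x : borel G => M%:E * (\1_(C : set (borel G)) x)%:E)%E by apply/funext => x; rewrite /= EFinM.
  by apply: integrableZl => //; exact: integrable_indic_compact.
apply: le_trans (le_normr_Rintegral measurableT (bmc_integrable hw)) _.
have -> : M * fine (mu C) = intg (fun x : borel G => M * \1_(C : set (borel G)) x).
  rewrite RintegralZl //; last by exact: integrable_indic_compact.
  by rewrite /Rintegral integral_indic // setIT.
apply: le_Rintegral => //; first exact/integrable_norm/bmc_integrable.
move=> x _; rewrite indicE; have [xC|xC] := boolP (x \in (C : set (borel G))).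
  by rewrite mulr1 wM //; exact/set_mem.
by rewrite wC ?normr0 ?mulr0 //; move: xC; rewrite notin_setE.
Qed.

(** Joint continuity along {p0} x G becomes uniform on the compact support of w. *)
Lemma param_cont (P : topologicalType) (p0 : P) (Phi : P -> G -> R) w : bmc w ->
  (\forall p \near p0, continuous (Phi p)) ->
  (forall y, {for (p0, y), continuous (fun z => Phi z.1 z.2)}) ->
  {for p0, continuous (fun p => intg (fun y => w y * Phi p y))}.
Proof.
move=> hw cP cPhi; have [M [C [M0 cC wM wC]]] := bmc_bound hw.
set m := fine (mu C); have m0 : 0 <= m by rewrite fine_ge0.
rewrite /continuous_at; apply/cvgrPdist_lt => e e0.
pose e' := e / (M * m + 1); have D0 : 0 < M * m + 1 by rewrite ltr_wpDl // mulr_ge0 // ltW.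
have e'0 : 0 < e' by rewrite divr_gt0.
have : \forall p \near p0, C `<=` (fun y => `|Phi p0 y - Phi p y| < e').
  have := (compact_near_coveringP C).1 cC P (nbhs p0) (fun p y => `|Phi p0 y - Phi p y| < e') _.
  apply => y _.
  have h1 : \forall z \near (p0, y), `|Phi p0 y - Phi z.1 z.2| < e' / 2.
    by have /cvgrPdist_lt/(_ (e' / 2)) := cPhi y; apply; rewrite divr_gt0.
  have h2 : \forall z \near (p0, y), `|Phi p0 y - Phi p0 z.2| < e' / 2.
    have : {for (p0, y), continuous (fun z : P * G => Phi p0 z.2)}.
      apply: (@continuous_comp _ _ _ (fun z : P * G => (p0, z.2)) (fun z => Phi z.1 z.2)); last exact: cPhi.
      by apply: continuous_pair; [exact: cvg_cst|exact: cvg_snd].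
    by move=> /cvgrPdist_lt/(_ (e' / 2)); apply; rewrite divr_gt0.
  have [[B1 B2] [/= n1 n2] sub] := filterI h1 h2.
  exists (B2, B1) => //= -[y' p] [/= By' Bp].
  have [/= k1 k2] := sub (p, y') (conj Bp By').
  have -> : Phi p0 y' - Phi p y' = (Phi p0 y - Phi p y') - (Phi p0 y - Phi p0 y') by ring.
  by apply: le_lt_trans (ler_normB _ _) _; rewrite [e']splitr; exact: ltrD.
move=> near1; near=> p.
have cp : continuous (Phi p) by near: p.
have cp0 : continuous (Phi p0) by exact: (nbhs_singleton cP).
rewrite -intgB; [|exact: bmcM|exact: bmcM].
apply: (@le_lt_trans _ _ ((M * e') * m)).
  apply: intg_bound => //; first by apply: bmcB; exact: bmcM.
    by move=> x /wC ->; rewrite !mul0r subrr.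
  move=> x Cx; rewrite -mulrBr normrM; apply: ler_pM => //.
  apply: ltW; suff : C `<=` (fun y => `|Phi p0 y - Phi p y| < e') by apply.
  by near: p.
have -> : M * e' * m = (e * (M * m)) / (M * m + 1) by rewrite /e'; ring.
  by rewrite ltr_pdivrMr // ltr_pM2l // ltrDl.
Unshelve. all: by end_near.
Qed.

(** By the mean value theorem the difference quotient at y is the value of D at an intermediate
    parameter, and D(s, y) is close to D(s0, y) uniformly on the support of w. *)
Lemma param_derive (s0 r : R) (Phi D : R -> G -> R) w : bmc w -> 0 < r ->
  (forall s y, `|s - s0| < r -> is_derive s (1 : R) (Phi^~ y) (D s y)) ->
  (forall s, `|s - s0| < r -> continuous (Phi s) /\ continuous (D s)) ->
  (forall y, {for (s0, y), continuous (fun z => D z.1 z.2)}) ->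
  is_derive s0 (1 : R) (fun s => intg (fun y => w y * Phi s y)) (intg (fun y => w y * D s0 y)).
Proof.
move=> hw r0 hd hc cD; have [M [C [M0 cC wM wC]]] := bmc_bound hw.
set m := fine (mu C); have m0 : 0 <= m by rewrite fine_ge0.
have c0 := hc s0 (ltac:(by rewrite subrr normr0)).
apply/is_derive_quot/cvgrPdist_lt => e e0.
pose e' := e / (M * m + 1); have D0 : 0 < M * m + 1 by rewrite ltr_wpDl // mulr_ge0 // ltW.
have e'0 : 0 < e' by rewrite divr_gt0.
have : \forall s \near s0, C `<=` (fun y => `|D s0 y - D s y| < e').
  have := (compact_near_coveringP C).1 cC R (nbhs s0) (fun p y => `|D s0 y - D p y| < e') _.
  apply => y _.
  have h1 : \forall z \near (s0, y), `|D s0 y - D z.1 z.2| < e' / 2.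
    by have /cvgrPdist_lt/(_ (e' / 2)) := cD y; apply; rewrite divr_gt0.
  have h2 : \forall z \near (s0, y), `|D s0 y - D s0 z.2| < e' / 2.
    have : {for (s0, y), continuous (fun z : R * G => D s0 z.2)}.
      apply: (@continuous_comp _ _ _ (fun z : R * G => (s0, z.2)) (fun z => D z.1 z.2)); last exact: cD.
      by apply: continuous_pair; [exact: cvg_cst|exact: cvg_snd].
    by move=> /cvgrPdist_lt/(_ (e' / 2)); apply; rewrite divr_gt0.
  have [[B1 B2] [/= n1 n2] sub] := filterI h1 h2.
  exists (B2, B1) => //= -[y' p] [/= By' Bp].
  have [/= k1 k2] := sub (p, y') (conj Bp By').
  have -> : D s0 y' - D p y' = (D s0 y - D p y') - (D s0 y - D s0 y') by ring.
  by apply: le_lt_trans (ler_normB _ _) _; rewrite [e']splitr; exact: ltrD.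
move=> /nbhs_ballP[d /= d0 dD].
pose d' := Num.min d r; have d'0 : 0 < d' by rewrite lt_min d0.
have near0 : \forall h \near (0 : R)^', h != 0 /\ `|h| < d'.
  near=> h; split; first by near: h; exact: nbhs_dnbhs_neq.
  by near: h; apply: dnbhs0_lt.
apply: filterS near0 => h [h0 hd'].
have hr : `|h| < r by apply: lt_le_trans hd' _; rewrite ge_min lexx orbT.
have c1 : continuous (Phi (s0 + h)) by apply: (hc _ _).1; rewrite addrAC subrr add0r.
rewrite -intgB; [|by apply: bmcM => //; exact: c1|by apply: bmcM => //; exact: c0.1].
rewrite -intgZ; last by apply: bmcB; apply: bmcM => //; exact: c0.1.
rewrite -intgB; last 2 first.
- by apply: bmcM => //; exact: c0.2.
- by apply: bmcZ; apply: bmcB; apply: bmcM => //; exact: c0.1.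
apply: (@le_lt_trans _ _ ((M * e') * m)); last first.
  have -> : M * e' * m = (e * (M * m)) / (M * m + 1) by rewrite /e'; ring.
  by rewrite ltr_pdivrMr // ltr_pM2l // ltrDl.
apply: intg_bound => //.
- apply: bmcB; first by apply: bmcM => //; exact: c0.2.
  by apply: bmcZ; apply: bmcB; apply: bmcM => //; exact: c0.1.
- by move=> x /wC ->; rewrite !mul0r subrr mulr0 subrr.
move=> y Cy; rewrite -mulrBr mulrCA -mulrBr normrM; apply: ler_pM => //.
have seg (t : R) : `|t| <= `|h| -> is_derive (s0 + t) (1 : R) (Phi^~ y) (D (s0 + t) y).
  by move=> th; apply: hd; rewrite addrAC subrr add0r (le_lt_trans th).
have [t th] := @line_MVTZ R R (Phi^~ y) s0 1 h (fun t th => ltac:(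
  by have := seg t th; rewrite -[t in s0 + t]mulr1 => -[])).
have -> : s0 + h *: 1 = s0 + h by rewrite [h *: _]mulr1.
have -> : s0 + t *: 1 = s0 + t by rewrite [t *: _]mulr1.
have [_ ->] := seg t th; move=> ->; rewrite mulKf // ltW //.
apply: (dD (s0 + t)) => //; rewrite /ball /= opprD addrA subrr add0r normrN.
by apply: le_lt_trans th _; apply: lt_le_trans hd' _; rewrite ge_min lexx.
Unshelve. all: by end_near.
Qed.

End CompactIntegrals.

(** * The modular function *)

Section Modular.
Variables (R : realType) (G : topGroupType) (n : nat) (A : set (chart R G n)).
Hypothesis hG : is_lie_group A.
Hypothesis Gc : connected [set: G].
Variable mu : {measure set (borel G) -> \bar R}.
Hypothesis hmu : is_haar mu.
Implicit Types (f w : G -> R) (x y : G) (C : set G).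

Local Notation intg f := (\int[mu]_x f x).

Lemma EFin_intg f : bmc f -> (\int[mu]_x (f x)%:E)%E = (intg f)%:E.
Proof. by move=> hf; rewrite /Rintegral fineK //; apply: integrable_fin_num => //; exact: (bmc_integrable hG hmu hf). Qed.

Lemma measurable_EFinG f : measurable_fun setT (f : borel G -> R) -> measurable_fun setT (EFin \o f : borel G -> \bar R).
Proof. by move=> h; exact/measurable_EFinP. Qed.

(** Tonelli and left invariance, applied to f(y) h(x^-1 y). On the left f enters only through its
    integral, which lets right translates of different functions be compared without any uniqueness
    theorem for Haar measure. *)
Lemma haar_inv_formula (f : G -> \bar R) (h : G -> \bar R) :
  measurable_fun setT (f : borel G -> \bar R) -> (forall x, 0 <= f x)%E ->
  measurable_fun setT (h : borel G -> \bar R) -> (forall x, 0 <= h x)%E ->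
  ((\int[mu]_y f y) * (\int[mu]_x h x^-1%g) = \int[mu]_y (h y * \int[mu]_x f (x * y)%g))%E.
Proof.
move=> mf f0 mh h0.
have mhi : measurable_fun setT (fun x : borel G => h x^-1%g) by apply: measurableT_comp mh _; exact: inv_borel.
rewrite -ge0_integralZr //; last by apply: integral_ge0 => x _.
transitivity (\int[mu]_y \int[mu]_x (f y * h (x^-1 * y)%g))%E.
  apply: eq_integral => y _; rewrite -(haar_left hmu y^-1%g mhi) // ge0_integralZl //.
    by congr (_ * _)%E; apply: eq_integral => x _; rewrite invgM invgK.
  have := measurableT_comp mhi (lmul_borel y^-1%g); congr (measurable_fun _ _).
  by apply/funext => x; rewrite /= invgM invgK.
have md : measurable_fun setT (fun z : (borel G * borel G)%type => f z.1 * h (z.2^-1 * z.1)%g)%E.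
  apply: emeasurable_funM; first exact: measurableT_comp mf measurable_fst.
  apply: (measurableT_comp mh); have := measurableT_comp (div_borel hG Gc) (@measurable_swap _ _ (borel G) (borel G)).
  by apply.
rewrite (tonelli hG Gc hmu (F := fun z => f z.1 * h (z.2^-1 * z.1)%g)%E) //; last by move=> z; exact: mule_ge0.
transitivity (\int[mu]_x \int[mu]_y (f (x * y)%g * h y))%E.
  apply: eq_integral => x _; rewrite -(haar_left hmu x) /=.
  - by apply: eq_integral => y _; rewrite mulgA mulVg mul1g.
  - apply: emeasurable_funM => //; apply: (measurableT_comp mh); exact: lmul_borel.
  - by move=> y; exact: mule_ge0.
have md2 : measurable_fun setT (fun z : (borel G * borel G)%type => f (z.1 * z.2)%g * h z.2)%E.
  apply: emeasurable_funM; last exact: measurableT_comp mh measurable_snd.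
  by apply: (measurableT_comp mf); exact: (mul_borel hG Gc).
rewrite (tonelli hG Gc hmu (F := fun z => f (z.1 * z.2)%g * h z.2)%E) //; last by move=> z; exact: mule_ge0.
apply: eq_integral => y _; rewrite -ge0_integralZl //; first by apply: eq_integral => x _; rewrite muleC.
by apply: (measurableT_comp mf); exact: rmul_borel.
Qed.

Lemma indic_bmc (U C : set G) : measurable (U : set (borel G)) -> compact C -> U `<=` C -> bmc (\1_U : G -> R).
Proof.
move=> mU cC UC; split; first exact: (measurable_indic (T := borel G)).
- by exists 1 => x; rewrite indicE; case: (_ \in _); rewrite ?normr1 ?normr0.
- exists C => // x xC; rewrite indicE memNset // => /UC; exact: xC.
Qed.

Lemma intg_indic (U C : set G) : measurable (U : set (borel G)) -> compact C -> U `<=` C ->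
  intg (\1_U : G -> R) = fine (mu U).
Proof. by move=> mU cC UC; rewrite /Rintegral (integral_indic (T := borel G)) // setIT. Qed.

Lemma intg_gt0 f C x0 : continuous f -> compact C -> (forall x, ~ C x -> f x = 0) -> (forall x, 0 <= f x) ->
  0 < f x0 -> 0 < intg f.
Proof.
move=> cf cC fC f0 fx0; pose c := f x0 / 2; have c0 : 0 < c by rewrite divr_gt0.
pose U := setT `&` f @^-1` [set r | c < r].
have oU : open U by apply: open_preimage_on; [exact: openT|move=> x _; exact: cf|exact: open_gt].
have Ux : U x0 by split=> //=; rewrite /c ltr_pdivrMr // ltr_pMr // ltr1n.
have UC : U `<=` C by move=> x [_ /= h]; apply: contrapT => /fC E; move: h; rewrite E ltNge ltW.
have mU := open_borel oU.
have bU := indic_bmc mU cC UC.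
apply: (@lt_le_trans _ _ (intg (fun x => c * \1_U x))).
  rewrite (intgZ hG hmu _ bU) (intg_indic mU cC UC) mulr_gt0 // fine_gt0 //.
  have [_ hC hU] := hmu; rewrite hU //; last by exists x0.
  by apply: le_lt_trans (hC _ cC); apply: le_measure; rewrite ?inE //; exact: (compact_borel hG).
apply: (le_intg hG hmu) => //; [exact: bmcZ|exact: (bmc_cont cf cC)|].
move=> x; rewrite indicE; have [/set_mem[_ /= /ltW]|_] := boolP (x \in U); rewrite ?mulr1 ?mulr0 //.
Qed.

Lemma rtrans_cont f y : continuous f -> continuous (fun x => f (x * y)%g).
Proof.
move=> cf x; apply: (@continuous_comp _ _ _ (fun x => x * y)%g f); last exact: cf.
by apply: mulg_cont; [exact: cvg_id|exact: cvg_cst].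
Qed.

Lemma rtrans_compact C y : compact C -> compact [set x | C (x * y)%g].
Proof.
move=> cC; have -> : [set x | C (x * y)%g] = (fun x => x * y^-1)%g @` C.
  apply/seteqP; split=> [x /= Cx|_ [x Cx <-]]; last by rewrite /= mulgVK.
  by exists (x * y)%g => //; rewrite mulgK.
apply: continuous_compact cC; apply: continuous_subspaceT => x.
by apply: (@mulg_cont G G id (fun=> y^-1%g)); [exact: cvg_id|exact: cvg_cst].
Qed.

Lemma rtrans_bmc f C y : continuous f -> compact C -> (forall x, ~ C x -> f x = 0) -> bmc (fun x => f (x * y)%g).
Proof.
move=> cf cC fC; apply: (bmc_cont (C := [set x | C (x * y)%g])); [exact: rtrans_cont|exact: rtrans_compact|].
by move=> x /= h; exact: fC.
Qed.

Lemma rtrans_intg_cont f C : continuous f -> compact C -> (forall x, ~ C x -> f x = 0) ->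
  continuous (fun y => intg (fun x => f (x * y)%g)).
Proof.
move=> cf cC fC y0.
have [U [D [oU U1 cD UD]]] := nbhs1_compact hG.
pose Y := (fun d => y0 * d)%g @` D.
have cY : compact Y.
  apply: continuous_compact cD; apply: continuous_subspaceT => x.
  by apply: (@mulg_cont G G (fun=> y0) id); [exact: cvg_cst|exact: cvg_id].
(* [N] contains the supports of all x |-> f (x y) with y near y0, so that [param_cont] applies with
   its indicator as a fixed weight. *)
pose N := [set z | exists x y, [/\ C x, [set y : G | Y y^-1%g] y & z = (x * y)%g]].
have cN : compact N by apply: compact_mul => //; exact: compact_inv.
have mN := compact_borel hG cN.
have bN := indic_bmc mN cN (fun x => id).
have E y : U (y0^-1 * y)%g -> intg (fun x => f (x * y)%g) = intg (fun x => \1_N x * f (x * y)%g).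
  move=> Uy; apply: eq_Rintegral => x _; rewrite indicE.
  have [_|xN] := boolP (x \in N); first by rewrite mul1r.
  rewrite mul0r fC // => Cxy; move: xN; rewrite notin_setE; apply.
  exists (x * y)%g, y^-1%g; split=> //; last by rewrite mulgK.
  by exists (y0^-1 * y)%g; [exact: UD|rewrite invgK mulgA mulgV mul1g].
have c := @param_cont R G n A hG mu hmu G y0 (fun y x => f (x * y)%g) _ bN.
rewrite /continuous_at E ?mulVg //; apply: cvg_trans (c _ _).
- apply: near_eq_cvg; have : nbhs y0 [set y | U (y0^-1 * y)%g].
    by apply: open_nbhs_nbhs; split; [exact: lmul_open|rewrite /= mulVg].
  by apply: filterS => y /E ->.
- by apply: nearW => y; exact: rtrans_cont.
- move=> x; apply: (@continuous_comp _ _ _ (fun z : G * G => z.2 * z.1)%g f); last exact: cf.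
  by apply: mulg_cont; [exact: cvg_snd|exact: cvg_fst].
Qed.

(** By [haar_inv_formula] the continuous function [d], comparing the right translates of f with
    those of a fixed bump f0, has integral 0 against every nonnegative test function. So it
    vanishes, and the normalised integral of x |-> f0(x y) is the modular function. *)
Lemma modular_exists : exists m : G -> R, [/\ continuous m, forall x, 0 < m x,
  forall x y, m (x * y)%g = m x * m y &
  forall f C y, continuous f -> compact C -> (forall x, ~ C x -> f x = 0) ->
    intg (fun x => f (x * y)%g) = m y * intg f].
Proof.
have [f0 [C0 [[sf0 f00] f01 cC0 _ fC0]]] := bump_exists hG (@openT G) (I : [set: G] 1%g).
have cf0 : continuous f0 := smooth_fun_cont hG sf0.
pose Rt f y := intg (fun x => f (x * y)%g).
pose c0 := intg f0.
have c00 : 0 < c0 by exact: (intg_gt0 cf0 cC0 fC0 f00 f01).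
have pos (f : G -> R) (C : set G) (y : G) : continuous f -> compact C -> (forall x, ~ C x -> f x = 0) -> (forall x, 0 <= f x) ->
    Rt f y = Rt f0 y / c0 * intg f.
  move=> cf cC fC fp; apply/eqP; rewrite mulrAC -subr_eq0; apply/eqP.
  pose d y := Rt f y - Rt f0 y * intg f / c0.
  have cd : continuous d.
    move=> z; apply: cvgB; first exact: (rtrans_intg_cont cf cC fC).
    do 2 (apply: cvgM; last exact: cvg_cst).
    exact: (rtrans_intg_cont cf0 cC0 fC0).
  have key (h : G -> R) (D : set G) : continuous h -> compact D -> (forall x, ~ D x -> h x = 0) -> (forall x, 0 <= h x) ->
      intg (fun y => h y * d y) = 0.
    move=> ch cD hD hp; have bh := bmc_cont ch cD hD.
    have F (k : G -> R) (E : set G) : continuous k -> compact E -> (forall x, ~ E x -> k x = 0) -> (forall x, 0 <= k x) ->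
        ((intg k)%:E * (\int[mu]_x (h x^-1%g)%:E) = (intg (fun y => h y * Rt k y))%:E)%E.
      move=> ck cE kE kp; have bk := bmc_cont ck cE kE.
      rewrite -(EFin_intg bk) (haar_inv_formula (f := EFin \o k) (h := EFin \o h)) //=; last 2 first.
      - by apply: measurable_EFinG; exact: continuous_borel.
      - by apply: measurable_EFinG; exact: continuous_borel.
      rewrite -EFin_intg; last by apply: bmcM => //; exact: (rtrans_intg_cont ck cE kE).
      by apply: eq_integral => y' _; rewrite EFinM -EFin_intg //; exact: (rtrans_bmc _ ck cE kE).
    have F1 := F _ _ cf cC fC fp; have F0 := F _ _ cf0 cC0 fC0 f00.
    have bR : bmc (fun y => h y * Rt f y) by apply: bmcM => //; exact: (rtrans_intg_cont cf cC fC).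
    have bR0 : bmc (fun y => h y * Rt f0 y) by apply: bmcM => //; exact: (rtrans_intg_cont cf0 cC0 fC0).
    rewrite (_ : (fun y => h y * d y) = fun y => h y * Rt f y - (intg f / c0) * (h y * Rt f0 y)); last first.
      by apply/funext => y'; rewrite /d; ring.
    rewrite (intgB hG hmu) ?(intgZ hG hmu) //; last exact: bmcZ.
    have J0 : (0 <= \int[mu]_x (h x^-1%g)%:E)%E by apply: integral_ge0 => x _; rewrite lee_fin.
    (* The integral of h(x^-1) could a priori be infinite. This is excluded because its product with
       the positive integral of f0 is finite. *)
    move: F1 F0; case: (\int[mu]_x (h x^-1%g)%:E)%E J0 => [r| |] // _; last first.
      by move=> _; rewrite gt0_muley.
    rewrite -!EFinM => -[<-] [<-]; rewrite mulrA mulfVK ?subrr //.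
    by rewrite gt_eqF.
  rewrite -/(d y).
  have sgn (e : G -> R) : continuous e -> (forall (h : G -> R) (D : set G), continuous h -> compact D -> (forall x, ~ D x -> h x = 0) ->
      (forall x, 0 <= h x) -> intg (fun y => h y * e y) = 0) -> ~ 0 < e y.
    move=> ce ke ey; pose W := setT `&` e @^-1` [set r | 0 < r].
    have oW : open W by apply: open_preimage_on; [exact: openT|move=> x _; exact: ce|exact: open_gt].
    have Wy : W y by split.
    have [h [D [[sh hp] hy cD DW hD]]] := bump_exists hG oW Wy.
    have ch : continuous h := smooth_fun_cont hG sh.
    have := ke h D ch cD hD hp; apply/eqP; rewrite gt_eqF //.
    apply: (intg_gt0 (C := D) (x0 := y)) => //.
    - by move=> x; apply: cvgM; [exact: ch|exact: ce].
    - by move=> x /hD ->; rewrite mul0r.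
    - move=> x; have [/DW[_ /= /ltW ex]|/hD ->] := pselect (D x); last by rewrite mul0r.
      exact: mulr_ge0.
    - exact: mulr_gt0.
  have n1 := sgn d cd key.
  have n2 : ~ 0 < - d y.
    apply: (sgn (fun y => - d y)) => [x|h D ch cD hD hp]; first by apply: cvgN; exact: cd.
    have -> : (fun y => h y * - d y) = fun y => -1 * (h y * d y) by apply/funext => z; ring.
    rewrite (intgZ hG hmu) ?(key h D) ?mulr0 //.
    by apply: bmcM => //; exact: bmc_cont ch cD hD.
  apply/eqP; rewrite eq_le !leNgt; apply/andP; split; apply/negP => //.
  by move: n2; rewrite oppr_gt0.
pose m y := Rt f0 y / c0; exists m; split.
- by move=> y; apply: cvgM; [exact: (rtrans_intg_cont cf0 cC0 fC0)|exact: cvg_cst].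
- move=> y; rewrite divr_gt0 //; apply: (intg_gt0 (C := [set x | C0 (x * y)%g]) (x0 := y^-1%g)).
  + exact: rtrans_cont.
  + exact: rtrans_compact.
  + by move=> x; exact: fC0.
  + by move=> x; exact: f00.
  + by rewrite mulVg.
- move=> x y; rewrite {1}/m.
  have -> : Rt f0 (x * y)%g = Rt (fun z => f0 (z * y)%g) x.
    by apply: eq_Rintegral => z _; rewrite mulgA.
  rewrite (pos _ [set x | C0 (x * y)%g]).
  + by rewrite -/(Rt f0 y) /m mulrA.
  + exact: rtrans_cont.
  + exact: rtrans_compact.
  + by move=> z; exact: fC0.
  + by move=> z; exact: f00.
- move=> f C y cf cC fC.
  pose fp (x : G) : R := Num.max (f x) 0; pose fm (x : G) : R := Num.max (- f x) 0.
  have fE x : f x = fp x - fm x.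
    rewrite /fp /fm; case: (lerP 0 (f x)) => h.
      by rewrite max_r ?oppr_le0 ?subr0.
    by rewrite max_l ?sub0r ?opprK // oppr_ge0 ltW.
  have cfp : continuous fp by move=> x; apply: continuous_max; [exact: cf|exact: cvg_cst].
  have cfm : continuous fm.
    move=> x; have c1 : {for x, continuous (fun x => - f x)} by apply: cvgN; exact: cf.
    exact: (continuous_max c1 (cvg_cst (0 : R))).
  have fpC x : ~ C x -> fp x = 0 by move=> /fC h; rewrite /fp h maxxx.
  have fmC x : ~ C x -> fm x = 0 by move=> /fC h; rewrite /fm h oppr0 maxxx.
  have fp0 x : 0 <= fp x by rewrite /fp le_max lexx orbT.
  have fm0 x : 0 <= fm x by rewrite /fm le_max lexx orbT.
  under eq_Rintegral do rewrite fE.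
  rewrite (intgB hG hmu (rtrans_bmc y cfp cC fpC) (rtrans_bmc y cfm cC fmC)).
  rewrite -/(Rt fp y) -/(Rt fm y) (pos fp C) // (pos fm C) // -mulrBr; congr (_ * _).
  rewrite -(intgB hG hmu (bmc_cont cfp cC fpC) (bmc_cont cfm cC fmC)).
  by apply: eq_Rintegral => x _; rewrite -fE.
Qed.

End Modular.

(** * The modular function on one-parameter subgroups and on K *)

Section Unimodular.
Variables (R : realType) (G : topGroupType) (n : nat) (A : set (chart R G n)).
Hypothesis hG : is_lie_group A.
Hypothesis Gc : connected [set: G].
Variable mu : {measure set (borel G) -> \bar R}.
Hypothesis hmu : is_haar mu.
Variables (g : vectType R) (exp : g -> G) (br : g -> g -> g).
Hypothesis hg : is_lie_algebra A exp br.
Implicit Types (f w : G -> R) (x y : G) (C : set G) (X Y : g).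

Local Notation intg f := (\int[mu]_x f x).
Local Notation linv := (lie_der exp).

Lemma exp_segment_compact X : compact [set x | exists2 s : R, `|s| <= 1 & x = exp (s *: X)].
Proof.
have -> : [set x | exists2 s : R, `|s| <= 1 & x = exp (s *: X)] = (fun s : R => exp (s *: X)) @` `[-1, 1]%classic.
  apply/seteqP; split=> [x [s s1 ->]|_ [s + <-]].
    by exists s => //=; rewrite in_itv /= -ler_norml.
  by rewrite /= in_itv /= -ler_norml => s1; exists s.
apply: continuous_compact; last exact: segment_compact.
by apply: continuous_subspaceT; exact: (exp_line_continuous hg).
Qed.

Lemma rtrans_derive (f f' : G -> R) X C : continuous f -> continuous f' -> compact C ->
  (forall x, ~ C x -> f x = 0) -> (forall x, ~ C x -> f' x = 0) ->
  (forall x s, is_derive s (1 : R) (fun s : R => f (x * exp (s *: X))%g) (f' (x * exp (s *: X))%g)) ->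
  is_derive (0 : R) (1 : R) (fun s : R => intg (fun x => f (x * exp (s *: X))%g)) (intg f').
Proof.
move=> cf cf' cC fC fC' hd.
pose N := [set z | exists x y, [/\ C x, [set x | exists2 s : R, `|s| <= 1 & x = exp (s *: X)] y & z = (x * y)%g]].
have cN : compact N by apply: compact_mul => //; exact: exp_segment_compact.
have bN := indic_bmc R (compact_borel hG cN) cN (fun x => id).
have inN (h : G -> R) (s : R) : (forall x, ~ C x -> h x = 0) -> `|s| <= 1 ->
    intg (fun x => \1_N x * h (x * exp (s *: X))%g) = intg (fun x => h (x * exp (s *: X))%g).
  move=> hC s1; apply: eq_Rintegral => x _; rewrite indicE.
  have [_|xN] := boolP (x \in N); first by rewrite mul1r.
  rewrite mul0r hC // => Cxy; move: xN; rewrite notin_setE; apply.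
  exists (x * exp (s *: X))%g, (exp (- s *: X)); split=> //; first by exists (- s); rewrite ?normrN.
  by rewrite scaleNr (expN hg) mulgK.
have cc (h : G -> R) : continuous h -> forall y, {for ((0 : R), y), continuous (fun z : R * G => h (z.2 * exp (z.1 *: X))%g)}.
  move=> ch y; apply: (@continuous_comp _ _ _ (fun z : R * G => z.2 * exp (z.1 *: X))%g h); last exact: ch.
  apply: mulg_cont; first exact: cvg_snd.
  apply: (@continuous_comp _ _ _ (fun z : R * G => z.1) (fun s : R => exp (s *: X))); first exact: cvg_fst.
  exact: (exp_line_continuous hg).
have := @param_derive R G n A hG mu hmu 0 1 (fun s x => f (x * exp (s *: X))%g) (fun s x => f' (x * exp (s *: X))%g) _ bN ltr01
  (fun s y _ => hd y s) (fun s _ => conj (@rtrans_cont _ _ f (exp (s *: X)) cf) (@rtrans_cont _ _ f' (exp (s *: X)) cf')) (cc _ cf').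
rewrite (inN f' 0) ?normr0 //.
under eq_Rintegral do rewrite scale0r (exp0 hg) mulg1.
move=> D; apply: near_eq_is_derive D => //.
have : nbhs (0 : R) (ball (0 : R) 1) by exact: nbhsx_ballx.
by apply: filterS => s; rewrite /ball /= sub0r normrN => /ltW s1; rewrite inN.
Qed.

Variable theta : 'End(g).
Hypothesis htheta : is_cartan_involution br theta.
Let br_r := br_linear_r hG hg.
Let br_l := br_linear_l hG hg.
Let br_a := br_anti hG hg.
Let br_jac := br_jacobi hG hg.
Local Notation ip := (cip br theta).
Let ipC := cipC br_r htheta.
Let ipl := cip_l br_r br_l theta.
Let ipp := cip_gt0 htheta.
Let adj := cip_adj br_r br_l br_a br_jac htheta.

(** Write l = <., W>. Vanishing on brackets makes W central through [cip_adj], so ad W = 0, the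
    Killing form kills W, and W = 0. *)
Lemma perfect (l : g -> R) : (forall a X Y, l (a *: X + Y) = a * l X + l Y) ->
  (forall X Y, l (br X Y) = 0) -> forall X, l X = 0.
Proof.
move=> ll lb; have [F [fF _ _]] := frame_exists ipC ipl ipp fullv.
have l0 : l 0 = 0 by have := ll (-1) 0 0; rewrite scaler0 addr0 mulN1r addNr.
pose W := \sum_(z <- F) l z *: z.
have lW X : l X = ip X W.
  rewrite {1}(fF.2 X (memvf _)) /W (ip_sumr ipC ipl).
  by elim: (F) => [|z r IH]; rewrite ?big_nil // !big_cons ll IH (ipZr ipC ipl) mulrC.
have Wc X : br X W = 0.
  rewrite -(thetaK htheta X); apply: (ip_inj ipl ipp) => Y.
  by rewrite (ip0l ipl) ipC -[LHS]opprK -adj -lW lb oppr0.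
have W0 : W = 0.
  apply: (ip_eq0 ipp); rewrite /cip /killing.
  have -> : ad br W = 0.
    by apply/lfunP => X; rewrite (adE br_r) br_a Wc oppr0 zero_lfunE.
  by rewrite comp_lfun0l /lftrace big1 ?oppr0 // => i _; rewrite zero_lfunE linear0.
by move=> X; rewrite lW W0 (ip0r ipC ipl).
Qed.

(** The derivative [delta X] of m at 1 along X is linear in X, and on [X, Y] it is delta X delta Y -
    delta Y delta X = 0, so it vanishes by [perfect]; then m is constant along exp(sX). *)
Lemma modular_exp (m : G -> R) : (forall x, 0 < m x) -> (forall x y, m (x * y)%g = m x * m y) ->
  (forall f C y, continuous f -> compact C -> (forall x, ~ C x -> f x = 0) ->
    intg (fun x => f (x * y)%g) = m y * intg f) ->
  forall X, m (exp X) = 1.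
Proof.
move=> m0 mM hm.
have m1 : m 1%g = 1.
  by apply: (mulfI (lt0r_neq0 (m0 1%g))); rewrite mulr1 -mM mul1g.
have [f0 [C0 [[sf0 f00] f01 cC0 _ fC0]]] := bump_exists hG (@openT G) (I : [set: G] 1%g).
have cf0 : continuous f0 := smooth_fun_cont hG sf0.
pose c0 := intg f0.
have c00 : 0 < c0 by exact: (intg_gt0 hG hmu cf0 cC0 fC0 f00 f01).
have cl := compact_closedG hG cC0.
have suppL (f : G -> R) X : (forall x, ~ C0 x -> f x = 0) -> forall x, ~ C0 x -> linv X f x = 0.
  by move=> fC x Cx; exact: (linv_supp hg X cl fC Cx).
have der (f : G -> R) X : smooth_fun A f -> (forall x, ~ C0 x -> f x = 0) ->
    is_derive (0 : R) (1 : R) (fun s : R => m (exp (s *: X)) * intg f) (intg (linv X f)).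
  move=> sf fC; have cf := smooth_fun_cont hG sf.
  have -> : (fun s : R => m (exp (s *: X)) * intg f) = fun s => intg (fun x => f (x * exp (s *: X))%g).
    by apply/funext => s; rewrite (hm f C0).
  apply: (rtrans_derive (C := C0)) => //.
  - exact: (smooth_fun_cont hG (smooth_fun_linv hG hg X sf)).
  - exact: suppL.
  - by move=> x s; exact: (linv_is_derive hG hg).
pose delta X := intg (linv X f0) / c0.
have dm X : is_derive (0 : R) (1 : R) (fun s : R => m (exp (s *: X))) (delta X).
  have -> : (fun s : R => m (exp (s *: X))) = fun s : R => c0^-1 * (m (exp (s *: X)) * intg f0).
    by apply/funext => s; rewrite mulrCA mulVf ?mulr1 // gt_eqF.
  rewrite /delta mulrC; have := is_deriveZ c0^-1 (der f0 X sf0 fC0).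
  by [].
have dE (f : G -> R) X : smooth_fun A f -> (forall x, ~ C0 x -> f x = 0) -> intg (linv X f) = delta X * intg f.
  move=> sf fC; have [_ <-] := der f X sf fC.
  have [_ h] := is_deriveZ (intg f) (dm X).
  rewrite mulrC -[RHS]h.
  by apply: derive_congr => e; rewrite [RHS]mulrC.
have bL (f : G -> R) X : smooth_fun A f -> (forall x, ~ C0 x -> f x = 0) -> bmc (linv X f).
  move=> sf fC; apply: (bmc_cont (C := C0)) => //; last exact: suppL.
  exact: (smooth_fun_cont hG (smooth_fun_linv hG hg X sf)).
have d0 : forall X, delta X = 0.
  apply: perfect => [a X Y|X Y].
    rewrite /delta; have -> : linv (a *: X + Y) f0 = fun x => a * linv X f0 x + linv Y f0 x.
      by apply/funext => x; exact: (linvP hg).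
    rewrite (intgD hG hmu) ?(intgZ hG hmu) ?mulrDl ?mulrA //; try apply: bmcZ; exact: bL.
  rewrite /delta; have -> : linv (br X Y) f0 = fun x => linv X (linv Y f0) x - linv Y (linv X f0) x.
    by apply/funext => x; exact: (linv_br hg).
  have sL Z := smooth_fun_linv hG hg Z sf0.
  rewrite (intgB hG hmu) ?dE //; try exact: suppL; try exact: sL.
  - by rewrite mulrCA subrr mul0r.
  - by apply: bL => //; exact: suppL.
  - by apply: bL => //; exact: suppL.
move=> X; have dd (s : R) : is_derive s (1 : R) (fun s : R => m (exp (s *: X))) 0.
  apply/is_derive_quot; have /is_derive_quot := dm X.
  rewrite d0 => h.
  have -> : (fun h : R => h^-1 * (m (exp ((s + h) *: X)) - m (exp (s *: X)))) =
      fun h => m (exp (s *: X)) * (h^-1 * (m (exp ((0 + h) *: X)) - m (exp (0 *: X)))).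
    by apply/funext => e; rewrite add0r scale0r (exp0 hg) m1 (exp_add hg) mM; ring.
  exact: (@cvg0_bounded _ _ _ _ (fun=> m (exp (s *: X))) _ `|m (exp (s *: X))|).
by have := is_derive_0_is_cst 1 0 dd; rewrite scale1r scale0r (exp0 hg) m1.
Qed.

(** If m k > 1, the powers of k stay in K while m grows at least linearly along them by Bernoulli's
    inequality, against boundedness on K; for m k < 1 take the inverse. *)
Lemma modular_compact (m : G -> R) (K : set G) : continuous m -> (forall x, 0 < m x) ->
  (forall x y, m (x * y)%g = m x * m y) -> is_subgroup K -> compact K -> forall k, K k -> m k = 1.
Proof.
move=> cm m0 mM [K1 KM KV] cK.
have m1 : m 1%g = 1.
  by apply: (mulfI (lt0r_neq0 (m0 1%g))); rewrite mulr1 -mM mul1g.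
have [M M0 hM] := continuous_compact_bounded cK (fun x _ => cm x).
have le1 k : K k -> m k <= 1.
  move=> Kk; rewrite leNgt; apply/negP => k1.
  have pw j : K (iter j (fun z => z * k)%g 1%g) /\ 1 + (m k - 1) *+ j <= m (iter j (fun z => z * k)%g 1%g).
    elim: j => [|j [IH1 IH2]] /=; first by rewrite m1 mulr0n addr0.
    split; first exact: KM.
    rewrite mM mulrS; set q := m (iter _ _ _) in IH2 *; have q1 : 1 <= q.
      by apply: le_trans IH2; rewrite lerDl mulrn_wge0 // subr_ge0 ltW.
    move: IH2 q1 k1; move: ((m k - 1) *+ j) (m k) => u v; nra.
  have [j hj] : exists j : nat, M < (m k - 1) *+ j.
    exists (Num.bound (M / (m k - 1))); rewrite -mulr_natr mulrC -ltr_pdivrMr ?subr_gt0 //.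
    by apply: archi_boundP; rewrite divr_ge0 ?ltW // subr_gt0.
  have [Kj] := pw j; have := hM _ Kj; rewrite gtr0_norm // => h1 h2.
  by have := le_trans h2 h1; rewrite leNgt => /negP; apply; apply: lt_le_trans hj _; rewrite lerDr.
move=> k Kk; apply/eqP; rewrite eq_le le1 //=.
have := le1 _ (KV _ Kk); have := mM k^-1%g k; rewrite mulVg m1.
by have := m0 k^-1%g; move: (m k^-1%g) (m k) => u v; nra.
Qed.

End Unimodular.

(** * Positivity of the volume of the unit ball *)

Section GammaPositive.
Variable R : realType.

Lemma integrable_expN (c : R) : 0 < c ->
  lebesgue_measure.-integrable `]0, +oo[ (fun x : R => (expR (- (c * x)))%:E).
Proof.
move=> c0; have mpdf : measurable_fun setT (exponential_pdf c) by exact: measurable_exponential_pdf.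
have ipdf : lebesgue_measure.-integrable setT (fun x : R => (exponential_pdf c x)%:E).
  apply/integrableP; split; first exact/measurable_EFinP.
  under eq_integral => x _ do rewrite gee0_abs ?lee_fin ?exponential_pdf_ge0 ?ltW //.
  by rewrite integral_exponential_pdf // ltry.
have mD : measurable (`]0, +oo[%classic : set (measurableTypeR R)) by exact: measurable_itv.
have i1 := integrableS (@measurableT _ (measurableTypeR R)) mD (@subsetT _ _) ipdf.
have i2 := integrableZl mD c^-1 i1.
apply: eq_integrable i2 => // x; rewrite inE /= in_itv /= andbT => x0.
rewrite -EFinM /exponential_pdf patchE mem_set ?in_itv /= ?in_itv /= ?ltW //.
by rewrite mulrA mulVf ?gt_eqF // mul1r mulNr.
Qed.

(** From ln y <= y - 1 at y = x / (2 a): a ln x <= a ln (2 a) + x / 2 - a, which is the origin of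
    the constant. *)
Lemma powR_expN_le (a : R) : 0 <= a -> exists2 C, 0 <= C &
  forall x, 0 < x -> x `^ a * expR (- x) <= C * expR (- (2^-1 * x)).
Proof.
move=> a0; have [->|an0] := eqVneq a 0.
  exists 1 => // x x0; rewrite powRr0 !mul1r ler_expR lerN2 ler_piMl ?ltW //.
  by lra.
have ap : 0 < a by rewrite lt_def an0.
exists (expR (a * ln (2 * a))) => [|x x0]; first exact: expR_ge0.
have xE : x = (2 * a) * (x / (2 * a)) by rewrite mulrCA divff ?mulr1 // mulf_neq0.
have y0 : 0 < x / (2 * a) by rewrite divr_gt0 // mulr_gt0.
rewrite /powR gt_eqF // -!expRD ler_expR.
have lx : ln x = ln (2 * a) + ln (x / (2 * a)) by rewrite {1}xE lnM // posrE mulr_gt0.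
have h : ln (x / (2 * a)) <= x / (2 * a) - 1.
  have := @le_ln1Dx R (x / (2 * a) - 1); rewrite addrCA subrr addr0; apply.
  by rewrite ltrBrDl subrr.
have e : a * (x / (2 * a)) = 2^-1 * x by field.
have := ler_wpM2l a0 h; rewrite mulrBr e lx mulrDr; move: (a * ln (x / _)) (a * ln (2 * a)) => u w; lra.
Qed.

Lemma Gamma_gt0 (z : R) : 1 <= z -> 0 < Gamma z.
Proof.
move=> z1; have a0 : 0 <= z - 1 by rewrite subr_ge0.
have [C C0 hC] := powR_expN_le a0.
have mD : measurable (`]0, +oo[%classic : set (measurableTypeR R)) by exact: measurable_itv.
have mf : measurable_fun (`]0, +oo[%classic : set (measurableTypeR R)) (fun x : R => x `^ (z - 1) * expR (- x)).
  apply: measurable_funM; first by apply: measurable_funTS; exact: measurable_powR.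
  by apply: measurable_funTS; apply: measurableT_comp => //; exact: measurable_expR.
have h2 : 0 < 2^-1 :> R by lra.
have intf : lebesgue_measure.-integrable `]0, +oo[ (EFin \o (fun x : R => x `^ (z - 1) * expR (- x))).
  apply: le_integrable (integrableZl mD C (integrable_expN h2)) => //.
    exact/measurable_EFinP.
  move=> x; rewrite /= in_itv /= andbT => x0; rewrite lee_fin.
  rewrite ger0_norm ?mulr_ge0 ?powR_ge0 ?expR_ge0 //.
  by rewrite ger0_norm ?mulr_ge0 ?expR_ge0 //; exact: hC.
have mI : measurable (`]1, 2[%classic : set (measurableTypeR R)) by exact: measurable_itv.
have sub : `]1, 2[%classic `<=` (`]0, +oo[%classic : set R).
  by move=> x; rewrite /= !in_itv /= andbT => /andP[x1 _]; exact: lt_trans x1.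
have e2 : 0 < expR (- 2 : R) by exact: expR_gt0.
apply: lt_le_trans e2 _.
have l12 : (@lebesgue_measure R) (`]1, 2[%classic : set (measurableTypeR R)) = 1%E.
  apply: (etrans (lebesgue_measure_itv `]1, 2[)).
  by rewrite /= lte_fin ltr1n -EFinB; congr EFin; ring.
have ge x : `]1, 2[%classic x -> expR (- 2) <= x `^ (z - 1) * expR (- x).
  rewrite /= in_itv /= => /andP[x1 x2].
  apply: (@le_trans _ _ (expR (- x))); first by rewrite ler_expR lerN2 ltW.
  rewrite ler_peMl ?expR_ge0 //.
  by have := ler_powR (ltW x1) a0; rewrite powRr0.
have intI := integrableS mD mI sub intf.
have -> : expR (- 2) = \int[lebesgue_measure]_(x in `]1, 2[) expR (- 2) :> R.
  by rewrite Rintegral_cst // [X in _ * fine X](_ : _ = 1%E) ?mulr1.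
apply: (@le_trans _ _ (\int[lebesgue_measure]_(x in `]1, 2[) (x `^ (z - 1) * expR (- x)))).
  apply: le_Rintegral => //.
  apply: le_integrable intI => //; first exact: measurable_cst.
  move=> x Ix; rewrite /= lee_fin.
  by rewrite !ger0_norm ?mulr_ge0 ?powR_ge0 ?expR_ge0 //; exact: ge.
apply: (@fine_le R); [exact/integrable_fin_num/(integrableS mD mI sub intf)|exact: integrable_fin_num|].
apply: ge0_subset_integral => //; first exact/measurable_EFinP.
by move=> x _; rewrite lee_fin mulr_ge0 ?powR_ge0 ?expR_ge0.
Qed.

Lemma unit_ball_volume_gt0 d : 0 < unit_ball_volume R d.
Proof.
rewrite /unit_ball_volume divr_gt0 ?powR_gt0 ?pi_gt0 // Gamma_gt0 //.
by rewrite lerDr divr_ge0.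
Qed.

End GammaPositive.

(** * Geodesic balls and unimodularity *)

Section GeodesicBalls.
Variables (R : realType) (G : topGroupType) (n : nat) (A : set (chart R G n)).
Hypothesis hG : is_lie_group A.
Hypothesis Gc : connected [set: G].
Variable mu : {measure set (borel G) -> \bar R}.
Hypothesis hmu : is_haar mu.
Variables (g : vectType R) (exp : g -> G) (br : g -> g -> g).
Hypothesis hg : is_lie_algebra A exp br.
Variable theta : 'End(g).
Hypothesis htheta : is_cartan_involution br theta.
Variable E : seq g.
Hypothesis hE : orthonormal_basis br (cartan_p theta) E.
Variable K : set G.
Hypothesis hK : maximal_compact_subgroup K.
Implicit Types (f w : G -> R) (x y : G) (C : set G) (X Y : g).

Let br_r := br_linear_r hG hg.
Let br_l := br_linear_l hG hg.
Let br_a := br_anti hG hg.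
Let br_jac := br_jacobi hG hg.
Local Notation ip := (cip br theta).
Let ipC := cipC br_r htheta.
Let ipl := cip_l br_r br_l theta.
Let ipp := cip_gt0 htheta.
Local Notation p := (cartan_p theta).
Let fE : frame ip p E := pframe hG hg hE.

Lemma killing_p X : X \in p -> killing br X X = ip X X.
Proof. by rewrite memp => /eqP tX; rewrite /cip tX killingC (killingNl br_r br_l) opprK. Qed.

Lemma knorm_p X : X \in p -> knorm br X ^+ 2 = ip X X.
Proof. by move=> Xp; rewrite /knorm killing_p // sqr_sqrtr // (ip_ge0 ipl ipp). Qed.

Lemma knorm_coord X : X \in p -> ip X X = \sum_(Y <- E) ip X Y ^+ 2.
Proof. by move=> Xp; rewrite -(proj_norm ipC ipl X fE) !(proj_id fE Xp). Qed.

Lemma orthonormal_ip i j : (i < size E)%N -> (j < size E)%N -> ip E`_i E`_j = (i == j)%:R.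
Proof.
move=> iE jE; case: hE => _ <- //; rewrite /cip.
have := fE.1 E`_j (mem_nth 0 jE); rewrite memp => /eqP ->.
by rewrite killingC (killingNl br_r br_l) opprK killingC.
Qed.

Definition closed_geodesic_ball (r : R) : set G :=
  [set x | exists X k, [/\ X \in p, knorm br X <= r, K k & x = (exp X * k)%g]].

Let pvec (y : 'rV[R]_(size E)) : g := \sum_(i < size E) y ord0 i *: E`_i.

Let pvec_p (y : 'rV[R]_(size E)) : pvec y \in p.
Proof. by apply: memv_suml => i _; rewrite memvZ // fE.1 // mem_nth. Qed.

Let pvec_ip (y : 'rV[R]_(size E)) : ip (pvec y) (pvec y) = \sum_(i < size E) y ord0 i ^+ 2.
Proof.
rewrite knorm_coord // (big_nth 0) big_mkord; apply: eq_bigr => i _; congr (_ ^+ 2).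
rewrite /pvec (ip_suml ipl) (bigD1 i) //= (ipZl ipl) orthonormal_ip // eqxx mulr1 big1 ?addr0 //.
by move=> j ji; rewrite (ipZl ipl) orthonormal_ip // -val_eqE in ji *; rewrite (negPf ji) mulr0.
Qed.

(** In orthonormal coordinates of p, the product of the image under the continuous [exp] of a
    compact Euclidean ball with the compact group K. *)
Lemma closed_geodesic_ball_compact r : 0 <= r -> compact (closed_geodesic_ball r).
Proof.
move=> r0; have [Kg cK _] := hK.
pose S := [set y : 'rV[R]_(size E) | forall j, `[- r, r]%classic (y ord0 j)] `&`
  (fun y : 'rV[R]_(size E) => \sum_(i < size E) y ord0 i ^+ 2) @^-1` [set t | t <= r ^+ 2].
have cS : compact S.
  apply: compact_closedI.
    by apply: (@rV_compact R (size E) (fun=> `[- r, r]%classic)) => j; exact: segment_compact.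
  apply: preimage_closed; last exact: closed_le.
  suff cs : continuous (fun y : 'rV[R]_(size E) => \sum_(i < size E) y ord0 i ^+ 2) by move=> y _; exact: cs.
  apply: sum_cont => i y.
  apply: (@continuous_comp _ _ _ (fun M : 'rV[R]_(size E) => M ord0 i) (fun t : R => t ^+ 2)).
    exact: coord_continuous.
  exact: exprn_continuous.
have -> : closed_geodesic_ball r = [set z | exists x k, [/\ ((fun y : 'rV[R]_(size E) => exp (pvec y)) @` S) x, K k & z = (x * k)%g]].
  apply/seteqP; split=> [_ [X [k [Xp Xr Kk ->]]]|_ [_ [k [[y [yr ys] <-] Kk ->]]]]; last first.
    exists (pvec y), k; split=> //; rewrite -(@ler_pXn2r _ 2) ?nnegrE ?sqrtr_ge0 //.
    by rewrite knorm_p // pvec_ip.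
  exists (exp X), k; split=> //; exists (\row_j ip X E`_j); last first.
    congr exp; rewrite [RHS](fE.2 X Xp) (big_nth 0) big_mkord; apply: eq_bigr => i _.
    by rewrite mxE.
  have le2 : \sum_(i < size E) ip X E`_i ^+ 2 <= r ^+ 2.
    have := knorm_coord Xp; rewrite (big_nth 0) big_mkord => <-.
    by rewrite -knorm_p // ler_pXn2r ?nnegrE ?sqrtr_ge0.
  split=> [j|/=]; last by under eq_bigr do rewrite mxE.
  rewrite /= mxE in_itv /= -ler_norml -(@ler_pXn2r _ 2) ?nnegrE // real_normK ?num_real //.
  by apply: le_trans le2; rewrite (bigD1 j) //= lerDl sumr_ge0 // => i _; exact: sqr_ge0.
apply: compact_mul => //; apply: continuous_compact cS.
by apply: continuous_subspaceT => y; exact: (exp_continuous hG hg).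
Qed.

Lemma geodesic_ball_sub r : geodesic_ball K exp br p r `<=` closed_geodesic_ball r.
Proof. by move=> x [X [k [Xp Xr Kk ->]]]; exists X, k; split=> //; exact: ltW. Qed.

(** The balls are not known to be open, since [exp] is not known to be open on p; they are countable
    unions of compact balls of smaller radius. *)
Lemma geodesic_ball_borel r : measurable (geodesic_ball K exp br p r : set (borel G)).
Proof.
have -> : geodesic_ball K exp br p r =
    \bigcup_(j in [set j : nat | 0 <= r - j.+1%:R^-1]) closed_geodesic_ball (r - j.+1%:R^-1).
  apply/seteqP; split=> [_ [X [k [Xp Xr Kk ->]]]|_ [j /= j0 [X [k [Xp Xr Kk ->]]]]]; last first.
    by exists X, k; split=> //; apply: le_lt_trans Xr _; rewrite ltrBlDr ltrDl invr_gt0.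
  have d0 : 0 < r - knorm br X by rewrite subr_gt0.
  have h : (Num.bound (r - knorm br X)^-1).+1%:R^-1 <= r - knorm br X.
    rewrite -[leRHS]invrK lef_pV2 ?posrE ?invr_gt0 //.
    by apply: le_trans (ltW (archi_boundP _)) _; rewrite ?invr_ge0 ?(ltW d0) // ler_nat.
  have h' : knorm br X <= r - (Num.bound (r - knorm br X)^-1).+1%:R^-1 by rewrite lerBrDr addrC -lerBrDr.
  exists (Num.bound (r - knorm br X)^-1); first by apply: le_trans h'; exact: sqrtr_ge0.
  by exists X, k.
apply: bigcup_measurable => j /= j0; apply: (compact_borel hG).
exact: closed_geodesic_ball_compact.
Qed.

Lemma geodesic_ball_fin r : (mu (geodesic_ball K exp br p r) < +oo)%E.
Proof.
have [r0|r0] := leP 0 r; last first.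
  have -> : geodesic_ball K exp br p r = set0.
    apply/seteqP; split=> // x [X [k [_ Xr _ _]]]; move: Xr; rewrite ltNge.
    by rewrite (le_trans (ltW r0)) ?sqrtr_ge0.
  by rewrite measure0.
apply: le_lt_trans (haar_compact_fin hmu (closed_geodesic_ball_compact r0)).
apply: le_measure; rewrite ?inE; [exact: geodesic_ball_borel| |exact: geodesic_ball_sub].
exact: (compact_borel hG (closed_geodesic_ball_compact r0)).
Qed.

Hypothesis hmu_riem : riemannian_normalized K exp br p mu.

Lemma geodesic_ball_volume : exists c s0 : R, [/\ 0 < c, 0 < s0 & forall s, 0 < s -> s <= s0 ->
  c * s ^+ \dim p <= fine (mu (geodesic_ball K exp br p s))].
Proof.
have w0 := unit_ball_volume_gt0 R (\dim p).
have /cvgrPdist_lt/(_ _ (divr_gt0 w0 (ltr0n R 2))) := hmu_riem.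
move=> [e /= e0 he]; exists (unit_ball_volume R (\dim p) / 2), (e / 2); split=> //.
- by rewrite divr_gt0.
- by rewrite divr_gt0.
move=> s s0 se; have := he s; rewrite /= sub0r normrN gtr0_norm //.
have -> : s < e by apply: le_lt_trans se _; rewrite ltr_pdivrMr // ltr_pMr // ltr1n.
move=> /(_ isT s0); rewrite ltr_distlC => /andP[h _].
have sd : 0 < s ^+ \dim p by rewrite exprn_gt0.
rewrite -ler_pdivlMr //; apply: le_trans (ltW h).
by rewrite [X in _ <= X - _]splitr addrK.
Qed.

(** m = 1 on the closed geodesic ball [Bs], of positive measure. If m took infinitely many values on
    a relatively compact neighbourhood of 1, the translates of [Bs] by points with distinct values
    would be disjoint, of equal measure, inside one compact set. So m takes finitely many values
    there, is locally constant, and is 1 by connectedness. *)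
Lemma modular_trivial (m : G -> R) : continuous m -> (forall x, 0 < m x) ->
  (forall x y, m (x * y)%g = m x * m y) -> (forall X, m (exp X) = 1) -> forall x, m x = 1.
Proof.
move=> cm m0 mM me; have [Kg cK _] := hK.
have mk := modular_compact cm m0 mM Kg cK.
have m1 : m 1%g = 1 by apply: mk; case: Kg.
have [c [s0 [c0 s00 hc]]] := geodesic_ball_volume.
pose Bs := closed_geodesic_ball s0.
have cB : compact Bs by apply: closed_geodesic_ball_compact; exact: ltW.
have mBs : measurable (Bs : set (borel G)) by exact: (compact_borel hG).
have mB1 x : Bs x -> m x = 1 by move=> [X [k [_ _ Kk ->]]]; rewrite mM me mk // mulr1.
have mu0 : (0 < mu Bs)%E.
  have h : (0 < mu (geodesic_ball K exp br p s0))%E.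
    rewrite lt_neqAle measure_ge0 andbT; apply/eqP => h.
    by have := hc s0 s00 (lexx _); rewrite -h /= leNgt => /negP; apply; rewrite mulr_gt0 // exprn_gt0.
  apply: lt_le_trans h _; apply: le_measure; rewrite ?inE //; [exact: geodesic_ball_borel|exact: geodesic_ball_sub].
have [U [D [oU U1 cD UD]]] := nbhs1_compact hG.
have fin : finite_set (m @` U).
  apply: contrapT => /infiniteP/pcard_leP/unsquash f.
  have /choice[x hx] : forall i : nat, exists x, U x /\ m x = f i.
    by move=> i; have [x Ux fx] := @funS _ _ _ _ f i I; exists x.
  pose F i : set G := [set y | Bs ((x i)^-1 * y)%g].
  have mF i : measurable (F i : set (borel G)).
    by rewrite -[F i]setTI; exact: (lmul_borel (x i)^-1%g).
  have tF : trivIset setT F.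
    apply/trivIsetP => i j _ _ ij; apply/seteqP; split=> // y [/mB1 h1 /mB1 h2].
    have e k : m ((x k)^-1 * y)%g = 1 -> m y = f k.
      by move=> h; rewrite -(hx k).2 -[RHS]mulr1 -h -mM; congr m; rewrite mulgA mulgV mul1g.
    have : f i = f j :> R by rewrite -(e i h1) -(e j h2).
    move=> /(@inj _ _ _ f); rewrite !inE => /(_ I I) /eqP; exact/negP.
  pose W := [set z | exists x y, [/\ D x, Bs y & z = (x * y)%g]].
  have cW : compact W by exact: compact_mul.
  have mW := compact_borel hG cW.
  have FW i : F i `<=` W.
    move=> y Fy; exists (x i), ((x i)^-1 * y)%g; split=> //; first by apply: UD; exact: (hx i).1.
    by rewrite mulgA mulgV mul1g.
  have fB : mu Bs \is a fin_num by rewrite ge0_fin_numE ?measure_ge0 // (haar_compact_fin hmu).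
  have le N : (N%:R%:E * mu Bs <= mu W)%E.
    have -> : (N%:R%:E * mu Bs = mu (\big[setU/set0]_(i < N) F i))%E.
      rewrite measure_bigsetU // (eq_bigr (fun=> mu Bs)).
        by rewrite -(fineK fB) sumEFin -EFinM sumr_const card_ord mulr_natl.
      by move=> i _; have [hl _ _] := hmu; exact: hl.
    apply: le_measure; rewrite ?inE //; first exact: bigsetU_measurable.
    by move=> y; rewrite -bigcup_mkord => -[i _ /FW].
  have fW : mu W \is a fin_num by rewrite ge0_fin_numE ?measure_ge0 // (haar_compact_fin hmu).
  have fB0 : 0 < fine (mu Bs) by rewrite fine_gt0 // mu0 ltey_eq fB.
  have := le (Num.bound (fine (mu W) / fine (mu Bs))).
  rewrite -(fineK fB) -(fineK fW) -EFinM lee_fin leNgt => /negP; apply.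
  rewrite -ltr_pdivrMr //; apply: archi_boundP; apply: divr_ge0; last exact: ltW.
  by rewrite fine_ge0.
pose H := [set x | m x = 1].
have clF : closed (m @` U `\ 1).
  by apply: (@accessible_finite_set_closed R).1 => //; [exact: hausdorff_accessible|exact: finite_setD].
have HT : H = setT.
  apply: Gc; first by exists 1%g.
    exists H; last by rewrite setTI.
    rewrite openE => x Hx.
    have : nbhs x [set y | (U `&` (m @^-1` (~` (m @` U `\ 1)))) (x^-1 * y)%g].
      apply: open_nbhs_nbhs; split; last by rewrite /= mulVg; split=> //=; rewrite m1 => -[_]; apply.
      apply: lmul_open; apply: open_preimage_on => //; first by move=> z _; exact: cm.
      exact: closed_openC.
    apply: filterS => y [Uy /= h]; have h1 : m (x^-1 * y)%g = 1.
      by apply: contrapT => h1; apply: h; split=> //; exists (x^-1 * y)%g.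
    have : m (x * (x^-1 * y))%g = 1 by rewrite mM h1 mulr1.
    by rewrite mulgA mulgV mul1g.
  exists H; last by rewrite setTI.
  have -> : H = m @^-1` [set 1] by [].
  by apply: preimage_closed; [move=> x _; exact: cm|exact: closed_eq].
by move=> x; have : H x by rewrite HT.
Qed.

Lemma haar_inv (h : G -> \bar R) : measurable_fun setT (h : borel G -> \bar R) -> (forall x, 0 <= h x)%E ->
  (\int[mu]_x h x^-1%g = \int[mu]_x h x)%E.
Proof.
move=> mh h0; have [m [cm m0 mM hm]] := modular_exists hG Gc hmu.
have mE := modular_trivial cm m0 mM (modular_exp hG hmu hg htheta m0 mM hm).
have [f0 [C0 [[sf0 f00] f01 cC0 _ fC0]]] := bump_exists hG (@openT G) (I : [set: G] 1%g).
have cf0 : continuous f0 := smooth_fun_cont hG sf0.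
have b0 := bmc_cont cf0 cC0 fC0.
have c00 := intg_gt0 hG hmu cf0 cC0 fC0 f00 f01.
have mf0 : measurable_fun setT (EFin \o f0 : borel G -> \bar R).
  by apply: measurable_EFinG; exact: continuous_borel.
have := haar_inv_formula hG Gc hmu mf0 (fun x => ltac:(by rewrite lee_fin)) mh h0.
rewrite (EFin_intg hG hmu b0).
have -> : (\int[mu]_y (h y * \int[mu]_x (EFin \o f0) (x * y)%g) = (\int[mu]_x f0 x)%:E * \int[mu]_y h y)%E.
  rewrite -ge0_integralZl //; last by rewrite lee_fin ltW.
  apply: eq_integral => y _; rewrite muleC; congr (_ * _)%E.
  rewrite (EFin_intg hG hmu (rtrans_bmc y cf0 cC0 fC0)) (hm f0 C0) // mE mul1r //.
set c := \int[mu]_x f0 x => eq1.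
rewrite -[LHS]mul1e -[RHS]mul1e -(mulVf (lt0r_neq0 c00)) -/c !EFinM -!muleA.
by rewrite eq1.
Qed.

Lemma haar_right x (h : G -> \bar R) : measurable_fun setT (h : borel G -> \bar R) -> (forall x, 0 <= h x)%E ->
  (\int[mu]_y h (y * x)%g = \int[mu]_y h y)%E.
Proof.
move=> mh h0.
have mr : measurable_fun setT ((fun y => h (y * x)%g) : borel G -> \bar R).
  by apply: measurableT_comp mh _; exact: rmul_borel.
have mi : measurable_fun setT ((fun y => h y^-1%g) : borel G -> \bar R).
  by apply: measurableT_comp mh _; exact: inv_borel.
rewrite -(haar_inv mr) // -(haar_inv mh) // -(haar_left hmu x^-1%g mi) //.
by apply: eq_integral => y _; rewrite invgM invgK.
Qed.

End GeodesicBalls.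

(** * The L^2 gap and Nash's inequality *)

Section Dirichlet.
Variables (R : realType) (G : topGroupType) (n : nat) (A : set (chart R G n)).
Hypothesis hG : is_lie_group A.
Hypothesis Gc : connected [set: G].
Variable mu : {measure set (borel G) -> \bar R}.
Hypothesis hmu : is_haar mu.
Variables (g : vectType R) (exp : g -> G) (br : g -> g -> g).
Hypothesis hg : is_lie_algebra A exp br.
Hypothesis rinv : forall x (h : G -> \bar R), measurable_fun setT (h : borel G -> \bar R) ->
  (forall x, 0 <= h x)%E -> (\int[mu]_y h (y * x)%g = \int[mu]_y h y)%E.
Implicit Types (f w v : G -> R) (x y : G) (C : set G) (X Y : g).

Local Notation intg f := (\int[mu]_x f x).

Lemma rintg_right x w : measurable_fun setT (w : borel G -> R) ->
  \int[mu]_y w (y * x)%g = \int[mu]_y w y.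
Proof.
move=> mw; have mE := measurable_EFinG mw; rewrite /Rintegral; congr fine.
rewrite integralE [RHS]integralE; congr (_ - _)%E.
  have := rinv x (measurable_funepos mE) (fun y => funepos_ge0 _ y).
  by rewrite !unlock.
have := rinv x (measurable_funeneg mE) (fun y => funeneg_ge0 _ y).
by rewrite !unlock.
Qed.

Lemma rtrans_bmc_gen x w : bmc w -> bmc (fun y => w (y * x)%g).
Proof.
move=> [mw [M hM] [C cC wC]]; split; [|by exists M => y|].
  by apply: (measurableT_comp mw); exact: rmul_borel.
exists [set y | C (y * x)%g]; first exact: rtrans_compact.
by move=> y /= /wC.
Qed.

(** Weaker than smoothness, because it has to hold for the drift, of which only one continuous
    derivative is established. *)
Definition der X f f' := [/\ continuous f, continuous f' &
  forall x (s : R), is_derive s (1 : R) (fun s : R => f (x * exp (s *: X))%g) (f' (x * exp (s *: X))%g)].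

Lemma derM X f f' h h' : der X f f' -> der X h h' ->
  der X (fun x => f x * h x) (fun x => f' x * h x + f x * h' x).
Proof.
move=> [cf cf' df] [ch ch' dh]; split.
- by move=> x; apply: cvgM; [exact: cf|exact: ch].
- by move=> x; apply: cvgD; apply: cvgM; [exact: cf'|exact: ch|exact: cf|exact: ch'].
move=> x s; have D1 := df x s; have D2 := dh x s.
apply: is_derive_eq (is_deriveM D1 D2) _.
by rewrite /GRing.scale /=; ring.
Qed.

Lemma derZ X f f' (a : R) : der X f f' -> der X (fun x => a * f x) (fun x => a * f' x).
Proof.
move=> [cf cf' df]; split.
- by move=> x; apply: cvgM; [exact: cvg_cst|exact: cf].
- by move=> x; apply: cvgM; [exact: cvg_cst|exact: cf'].
by move=> x s; have D := df x s; exact: is_deriveZ.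
Qed.

Lemma der_supp X f f' C : der X f f' -> compact C -> (forall x, ~ C x -> f x = 0) ->
  forall x, ~ C x -> f' x = 0.
Proof.
move=> [cf cf' df] cC fC x Cx.
have cl := compact_closedG hG cC.
have [_ D] := df x 0; rewrite scale0r (exp0 hg) mulg1 in D; rewrite -D.
have cx : continuous (fun s : R => (x * exp (s *: X))%g).
  move=> s; apply: mulg_cont; [exact: cvg_cst|exact: (exp_line_continuous hg)].
transitivity ('D_1 (cst (0 : R)) (0 : R)); last exact: derive_cst.
apply: near_eq_derive.
have : nbhs (x * exp (0 *: X))%g (~` C).
  by apply: open_nbhs_nbhs; split; [exact: closed_openC|rewrite scale0r (exp0 hg) mulg1].
move=> /(cx 0); apply: (@filterS _ (nbhs (0 : R)) _ _ _) => s /= /fC -> //.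
Qed.

(** Right invariance makes the integral of x |-> f (x exp(sX)) independent of s. Together with
    [derM] this is integration by parts. *)
Lemma der_intg0 X f f' C : der X f f' -> compact C -> (forall x, ~ C x -> f x = 0) -> intg f' = 0.
Proof.
move=> hd cC fC; have f'C := der_supp hd cC fC; have [cf cf' df] := hd.
have D := rtrans_derive hG hmu hg cf cf' cC fC f'C df.
have E : (fun s : R => \int[mu]_x f (x * exp (s *: X))%g) = fun=> intg f.
  by apply/funext => s; rewrite rintg_right //; exact: continuous_borel.
rewrite E in D; have [_ <-] := D; by rewrite derive_cst.
Qed.

(* Integrate the derivatives of v ^ 2 b_X by parts and apply Cauchy-Schwarz. *)
Lemma dirichlet_gap (E : seq g) (b q v_ : g -> G -> R) v C (N : R) : compact C -> (forall x, ~ C x -> v x = 0) ->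
  (forall X, X \in E -> der X v (v_ X)) ->
  (forall X, X \in E -> der X (b X) (fun x => - q X x)) ->
  (forall x, \sum_(X <- E) b X x ^+ 2 = N) -> (forall x, N <= \sum_(X <- E) q X x) ->
  N / 4 * intg (fun x => v x ^+ 2) <= intg (fun x => \sum_(X <- E) v_ X x ^+ 2).
Proof.
move=> cC vC dv db bN qN.
have i0 X : X \in E -> intg (fun x => 2 * v x * v_ X x * b X x - v x ^+ 2 * q X x) = 0.
  move=> XE; have D := derM (derM (dv X XE) (dv X XE)) (db X XE).
  rewrite -(der_intg0 D cC); last by move=> x /vC ->; rewrite !mul0r.
  by apply: eq_Rintegral => x _; ring.
have cv X : X \in E -> continuous (v_ X) by move=> /dv[].
have [En|[X0 X0E]] : E = [::] \/ exists X, X \in E.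
- by case: (E) => [|X E']; [left|right; exists X; rewrite mem_head].
- have N0 : N = 0 by have := bN 1%g; rewrite En big_nil.
  rewrite N0 mul0r mul0r; apply: intg_ge0 => x; rewrite En big_nil //.
have cv0 : continuous v by have [] := dv X0 X0E.
have b_v2 : bmc (fun x => v x ^+ 2).
  apply: (bmc_cont _ cC); last by move=> x /vC ->; rewrite expr0n.
  by move=> x; apply: cvgM; exact: cv0.
pose u x := \sum_(X <- E) (2 * v x * v_ X x * b X x - v x ^+ 2 * q X x).
(* The hypotheses hold for X in E only, whereas [bmc_sum] asks for all indices; the other terms are
   replaced by 0. *)
have bi X : bmc (if X \in E then fun x => 2 * v x * v_ X x * b X x - v x ^+ 2 * q X x else fun=> 0).
  case: ifP => [XE|_]; last first.
    by apply: (@bmc_cont _ _ _ set0) => //; [move=> x; exact: cvg_cst|exact: compact0].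
  apply: (bmc_cont _ cC); last by move=> x /vC ->; rewrite mulr0 !mul0r expr0n mul0r subrr.
  have [cb cq _] := db X XE.
  move=> x; apply: cvgB.
    by apply: cvgM; [apply: cvgM; [apply: cvgM; [exact: cvg_cst|exact: cv0]|exact: cv]|exact: cb].
  apply: cvgM; first by apply: cvgM; exact: cv0.
  suff -> : q X = fun x => - - q X x by apply: cvgN; exact: cq.
  by apply/funext => z; rewrite opprK.
have u_sum : u = fun x => \sum_(X <- E) (if X \in E then fun x => 2 * v x * v_ X x * b X x - v x ^+ 2 * q X x else fun=> 0) x.
  by apply/funext => x; apply: eq_big_seq => X XE; rewrite XE.
have bu : bmc u by rewrite u_sum; exact: bmc_sum.
have iu : intg u = 0.
  rewrite u_sum (intg_sum hG hmu) // big_seq big1 // => X XE; rewrite XE; exact: i0.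
have bs : bmc (fun x => \sum_(X <- E) v_ X x ^+ 2).
  apply: (bmc_cont _ cC); last first.
    move=> x Cx; rewrite big_seq big1 // => X XE.
    by rewrite (der_supp (dv X XE) cC vC Cx) expr0n.
  have -> : (fun x => \sum_(X <- E) v_ X x ^+ 2) =
    fun x => \sum_(X <- E) (if X \in E then fun x => v_ X x ^+ 2 else fun=> 0) x.
    by apply/funext => z; apply: eq_big_seq => X ->.
  move=> x; apply: cvg_bigsum => X; case: ifP => XE; last exact: cvg_cst.
  by apply: cvgM; exact: cv.
(* Weights 1/2 and 2 in 2 (v b_X) v_X: half of N v^2 pays for the b_X^2, and the other half, divided
   by the remaining factor 2, is the constant N / 4. *)
have key x : u x <= - (N / 2) * v x ^+ 2 + 2 * \sum_(X <- E) v_ X x ^+ 2.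
  rewrite /u sumrB -mulr_sumr.
  have : \sum_(X <- E) (2 * v x * v_ X x * b X x) <= \sum_(X <- E) (2^-1 * v x ^+ 2 * b X x ^+ 2 + 2 * v_ X x ^+ 2).
    apply: ler_sum => X _; have := sqr_ge0 (v x * b X x - 2 * v_ X x).
    by move: (v x) (v_ X x) (b X x) => r s t; nra.
  rewrite big_split /= -!mulr_sumr bN => h1.
  have h2 : N * v x ^+ 2 <= v x ^+ 2 * \sum_(X <- E) q X x by rewrite mulrC; apply: ler_wpM2l; [exact: sqr_ge0|].
  by move: h1 h2; set S1 := \sum_(_ <- _) _; set S2 := v x ^+ 2 * _; set S3 := \sum_(_ <- _) _; nra.
have := le_intg hG hmu bu (bmcD (bmcZ (- (N / 2)) b_v2) (bmcZ 2 bs)) key.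
rewrite iu (intgD hG hmu) ?(intgZ hG hmu) //; [by move=> ?; nra|exact: bmcZ|exact: bmcZ].
Qed.

(** Derivatives in all directions at once, linear in the direction: in Nash's argument the direction
    depends on the point of the ball. *)
Definition dif v (v_ : g -> G -> R) := (forall X, der X v (v_ X)) /\
  forall a X Y x, v_ (a *: X + Y) x = a * v_ X x + v_ Y x.

Lemma difM v (v_ : g -> G -> R) w (w_ : g -> G -> R) : dif v v_ -> dif w w_ ->
  dif (fun x => v x * w x) (fun X x => v_ X x * w x + v x * w_ X x).
Proof.
move=> [dv lv] [dw lw]; split=> [X|a X Y x]; first exact: derM.
by rewrite lv lw; ring.
Qed.

(** Let a and D be the squared norms of v and v_X, and c(s) the pairing of v with its translate by
    exp(sX). As the translate is orthogonal to its own derivative, - 2 c' <= 2 a - 2 c + D, so that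
    e^(-s) (2 a - 2 c + D) decreases from D; this is where [expR 1] comes from. *)
Lemma displacement v (v_ : g -> G -> R) C X : dif v v_ -> compact C -> (forall x, ~ C x -> v x = 0) ->
  intg (fun x => v x * v (x * exp X)%g) >= intg (fun x => v x ^+ 2) - expR 1 * intg (fun x => v_ X x ^+ 2).
Proof.
move=> [dv _] cC vC; have dX' := dv X; have [cv cv' dX] := dX'.
have v'C := der_supp (dv X) cC vC.
have bv := bmc_cont cv cC vC.
have bv2 : bmc (fun x => v x ^+ 2) by have := bmcM bv cv; congr bmc.
have bw2 : bmc (fun x => v_ X x ^+ 2) by have := bmcM (bmc_cont cv' cC v'C) cv'; congr bmc.
pose a := intg (fun x => v x ^+ 2); pose D := intg (fun x => v_ X x ^+ 2).
pose c (s : R) := intg (fun x => v x * v (x * exp (s *: X))%g).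
pose c' (s : R) := intg (fun x => v x * v_ X (x * exp (s *: X))%g).
have tc (h : G -> R) : continuous h -> forall (z : R * G), {for z, continuous (fun z : R * G => h (z.2 * exp (z.1 *: X))%g)}.
  move=> ch z; apply: (@continuous_comp _ _ _ (fun z : R * G => z.2 * exp (z.1 *: X))%g h); last exact: ch.
  apply: mulg_cont; first exact: cvg_snd.
  apply: (@continuous_comp _ _ _ (fun z : R * G => z.1) (fun s : R => exp (s *: X))); first exact: cvg_fst.
  exact: (exp_line_continuous hg).
have dc (s : R) : is_derive s (1 : R) c (c' s).
  apply: (@param_derive R G n A hG mu hmu s 1 (fun s x => v (x * exp (s *: X))%g) (fun s x => v_ X (x * exp (s *: X))%g) v bv ltr01).
  - by move=> t _; split; exact: rtrans_cont.
  - by move=> y; exact: tc.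
have ae (s : R) : intg (fun x => v (x * exp (s *: X))%g ^+ 2) = a.
  rewrite (rintg_right _ (w := fun x => v x ^+ 2)) //; by case: bv2.
have De (s : R) : intg (fun x => v_ X (x * exp (s *: X))%g ^+ 2) = D.
  rewrite (rintg_right _ (w := fun x => v_ X x ^+ 2)) //; by case: bw2.
have i0 (s : R) : intg (fun x => v (x * exp (s *: X))%g * v_ X (x * exp (s *: X))%g) = 0.
  rewrite (rintg_right _ (w := fun x => v x * v_ X x)); last by case: (bmcM bv cv').
  have := der_intg0 (derM (dX' ) (dX')) cC.
  have -> : (fun x => v_ X x * v x + v x * v_ X x) = (fun x => 2 * (v x * v_ X x)) by apply/funext => x; ring.
  rewrite (intgZ hG hmu); last exact: bmcM.
  by move=> H; have := H (fun x h => ltac:(by rewrite /= vC // mul0r)); lra.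
have bT (s : R) : bmc (fun x => v (x * exp (s *: X))%g) by exact: rtrans_bmc_gen.
have b1 (s : R) : bmc (fun x => v x * v (x * exp (s *: X))%g) by apply: bmcM => //; exact: rtrans_cont.
have b2 (s : R) : bmc (fun x => v x * v_ X (x * exp (s *: X))%g) by apply: bmcM => //; exact: rtrans_cont.
have b3 (s : R) : bmc (fun x => v (x * exp (s *: X))%g * v_ X (x * exp (s *: X))%g) by apply: bmcM => //; exact: rtrans_cont.
have b4 (s : R) : bmc (fun x => v (x * exp (s *: X))%g ^+ 2) by apply: (@rtrans_bmc_gen _ (fun x => v x ^+ 2)).
have b5 (s : R) : bmc (fun x => v_ X (x * exp (s *: X))%g ^+ 2) by apply: (@rtrans_bmc_gen _ (fun x => v_ X x ^+ 2)).
have ineq (s : R) : - 2 * c' s <= (2 * a - 2 * c s) + D.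
  have -> : - 2 * c' s = intg (fun x => 2 * (v (x * exp (s *: X))%g * v_ X (x * exp (s *: X))%g) - 2 * (v x * v_ X (x * exp (s *: X))%g)).
    by rewrite (intgB hG hmu) ?(intgZ hG hmu) // ?i0; [rewrite mulr0 sub0r mulNr|exact: bmcZ|exact: bmcZ].
  have -> : 2 * a - 2 * c s + D = intg (fun x => (v (x * exp (s *: X))%g ^+ 2 + v x ^+ 2 - 2 * (v x * v (x * exp (s *: X))%g)) + v_ X (x * exp (s *: X))%g ^+ 2).
    rewrite (intgD hG hmu) ?(intgB hG hmu) ?(intgD hG hmu) ?(intgZ hG hmu) ?De ?ae //; [by rewrite mulr_natl mulr2n|exact: bmcD|exact: bmcZ|].
    by apply: bmcB; [exact: bmcD|exact: bmcZ].
  apply: (le_intg hG hmu).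
  - by apply: bmcB; exact: bmcZ.
  - by apply: bmcD => //; apply: bmcB; [exact: bmcD|exact: bmcZ].
  move=> x; have := sqr_ge0 (v (x * exp (s *: X))%g - v x - v_ X (x * exp (s *: X))%g).
  by move: (v _) (v x) (v_ X _) => r t q; nra.
have D0 : 0 <= D by apply: intg_ge0 => x; exact: sqr_ge0.
pose psi (s : R) := expR (- s) * ((2 * a - 2 * c s) + D).
have dpsi (s : R) : is_derive s (1 : R) psi (expR (- s) * (- 2 * c' s - ((2 * a - 2 * c s) + D))).
  have d1 : is_derive s (1 : R) (fun s : R => expR (- s)) (- expR (- s)).
    by apply: is_derive_eq; rewrite mulrN1.
  have d2 : is_derive s (1 : R) (fun s => (2 * a - 2 * c s) + D) (- 2 * c' s).
    have hc := dc s; apply: is_derive_eq; rewrite /GRing.scale /=; ring.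
  apply: is_derive_eq (is_deriveM d1 d2) _; by rewrite /GRing.scale /=; ring.
have cpsi : {within `[0, 1], continuous psi}.
  apply: continuous_subspaceT => s; have [d _] := dpsi s.
  exact/differentiable_continuous/derivable1_diffP.
have [s _] := MVT (ltr01 : (0 : R) < 1) (fun s _ => dpsi s) cpsi.
rewrite subr0 mulr1 => eq1.
have : psi 1 <= psi 0.
  by rewrite -subr_le0 eq1; apply: mulr_ge0_le0; [exact: expR_ge0|rewrite subr_le0].
have c0 : c 0 = a by apply: eq_Rintegral => x _; rewrite scale0r (exp0 hg) mulg1.
rewrite /psi oppr0 expR0 mul1r c0 subrr add0r expRN.
rewrite mulrC ler_pdivrMr ?expR_gt0 //.
have -> : intg (fun x => v x * v (x * exp X)%g) = c 1 by rewrite /c scale1r.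
rewrite -/a -/D; have := expR_gt0 (1 : R); move: (expR 1) => e; nra.
Qed.

(** Integrate the lower bound of [displacement] over y in B; by Tonelli and left invariance the
    integral of v(x) v(x y) over all x, y is the square of the integral of v. *)
Lemma nash_ball v (v_ : g -> G -> R) C (B : set G) (D : R) : dif v v_ -> compact C -> (forall x, ~ C x -> v x = 0) ->
  (forall x, 0 <= v x) -> measurable (B : set (borel G)) -> (mu B < +oo)%E ->
  (forall y, B y -> exists X, (forall x, v (x * y)%g = v (x * exp X)%g) /\ intg (fun x => v_ X x ^+ 2) <= D) ->
  fine (mu B) * (intg (fun x => v x ^+ 2) - expR 1 * D) <= intg v ^+ 2.
Proof.
move=> [dv lv] cC vC v0 mB fB hB; set c := _ - _.
have [cv _ _] := dv 0.
have bv := bmc_cont cv cC vC.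
have [c0|c0] := leP c 0.
  by apply: le_trans (sqr_ge0 _); rewrite mulr_ge0_le0 // fine_ge0.
have cF : continuous (fun z : G * G => v z.1 * v (z.1 * z.2)%g).
  move=> z; apply: cvgM.
    by apply: (@continuous_comp _ _ _ (fun z : G * G => z.1) v); [exact: cvg_fst|exact: cv].
  apply: (@continuous_comp _ _ _ (fun z : G * G => (z.1 * z.2)%g) v); last exact: cv.
  by apply: mulg_cont; [exact: cvg_fst|exact: cvg_snd].
have mF := continuous2_borel hG Gc cF.
have F0 (z : G * G) : (0 <= (v z.1 * v (z.1 * z.2)%g)%:E)%E by rewrite lee_fin mulr_ge0.
have T := tonelli hG Gc hmu (F := fun z => (v z.1 * v (z.1 * z.2)%g)%:E) (ltac:(exact/measurable_EFinP)) F0.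
have bxy y : bmc (fun x => v x * v (x * y)%g) by apply: bmcM => //; exact: rtrans_cont.
have L : (\int[mu]_x \int[mu]_y (v x * v (x * y)%g)%:E)%E = (intg v ^+ 2)%:E.
  transitivity (\int[mu]_x (intg v * v x)%:E)%E.
    apply: eq_integral => x _.
    transitivity (\int[mu]_y ((v x)%:E * (v (x * y)%g)%:E))%E; first by apply: eq_integral => y _; rewrite EFinM.
    have mv : measurable_fun setT (fun y : borel G => (v y)%:E) by apply: measurable_EFinG; case: bv.
    have mvx : measurable_fun setT (fun y : borel G => (v (x * y)%g)%:E).
      apply: measurable_EFinG; apply: continuous_borel => y.
      by apply: (@continuous_comp _ _ _ (fun y => x * y)%g v); [apply: mulg_cont; [exact: cvg_cst|exact: cvg_id]|exact: cv].
    have vE y : (0 <= (v y)%:E)%E by rewrite lee_fin.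
    rewrite (ge0_integralZl mu measurableT mvx (fun y _ => vE _)) ?vE //.
    by rewrite (haar_left hmu x mv vE) (EFin_intg hG hmu bv) -EFinM mulrC.
  by rewrite (EFin_intg hG hmu (bmcZ (intg v) bv)) (intgZ hG hmu) // expr2.
rewrite -lee_fin -L T EFinM fineK; last by rewrite ge0_fin_numE.
rewrite muleC -integral_cst // [X in (X <= _)%E]integral_mkcond.
apply: ge0_le_integral => //.
- by move=> y _; rewrite patchE; case: ifP => // _; rewrite lee_fin ltW.
- by apply/(measurable_restrictT _ _).1 => //; exact: measurable_cst.
- have -> : (fun y : borel G => \int[mu]_x (v (x, y).1 * v ((x, y).1 * (x, y).2)%g)%:E)%E =
    EFin \o (fun y => intg (fun x => v x * v (x * y)%g)) by apply/funext => y; exact: (EFin_intg hG hmu (bxy y)).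
  apply: measurable_EFinG; apply: continuous_borel => y.
  apply: (@param_cont R G n A hG mu hmu G y (fun y x => v (x * y)%g) v bv).
    by apply: nearW => z; exact: rtrans_cont.
  move=> x; apply: (@continuous_comp _ _ _ (fun z : G * G => (z.2 * z.1)%g) v); last exact: cv.
  by apply: mulg_cont; [exact: cvg_snd|exact: cvg_fst].
move=> y _; rewrite patchE; case: ifPn => [/set_mem/hB[X [vX hX]]|_]; last by apply: integral_ge0 => x _.
rewrite (EFin_intg hG hmu (bxy y)) lee_fin.
under eq_Rintegral do rewrite vX.
apply: le_trans (displacement X (conj dv lv) cC vC); rewrite lerD2l lerN2 ler_wpM2l ?expR_ge0 //.
Qed.

End Dirichlet.

(** * Heat flow and energy estimates *)

Section Convolutions.
Variables (R : realType) (G : topGroupType) (n : nat) (A : set (chart R G n)).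
Hypothesis hG : is_lie_group A.
Hypothesis Gc : connected [set: G].
Variable mu : {measure set (borel G) -> \bar R}.
Hypothesis hmu : is_haar mu.
Variables (g : vectType R) (exp : g -> G) (br : g -> g -> g).
Hypothesis hg : is_lie_algebra A exp br.
Implicit Types (f w v k : G -> R) (x y : G) (C : set G) (X Y : g).

Local Notation intg f := (\int[mu]_x f x).
Local Notation linv := (lie_der exp).
Local Notation der := (der exp).
Local Notation dif := (dif exp).

Lemma smooth_dif f : smooth_fun A f -> dif f (fun X => linv X f).
Proof.
move=> sf; split=> [X|a X Y x]; last exact: (linvP hg).
split; [exact: (smooth_fun_cont hG)|exact: (smooth_fun_cont hG (smooth_fun_linv hG hg X sf))|].
by move=> x s; exact: (linv_is_derive hG hg).
Qed.

Lemma ldiv_cont k : continuous k -> continuous (fun z : G * G => k (z.2^-1 * z.1)%g).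
Proof.
move=> ck z; apply: (@continuous_comp _ _ _ (fun z : G * G => (z.2^-1 * z.1)%g) k); last exact: ck.
apply: mulg_cont; last exact: cvg_fst.
by apply: invg_cont; exact: cvg_snd.
Qed.

Lemma ldiv_cont1 k x : continuous k -> continuous (fun y => k (y^-1 * x)%g).
Proof.
move=> ck y; apply: (@continuous_comp _ _ _ (fun y => (x, y)) (fun z : G * G => k (z.2^-1 * z.1)%g)); last exact: ldiv_cont.
by apply: continuous_pair; [exact: cvg_cst|exact: cvg_id].
Qed.

Lemma conv_cont w k : bmc w -> continuous k -> continuous (convolution mu w k).
Proof.
move=> bw ck x.
apply: (@param_cont R G n A hG mu hmu G x (fun x y => k (y^-1 * x)%g) w bw).
  by apply: nearW => z; exact: ldiv_cont1.
by move=> y; exact: ldiv_cont.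
Qed.

Lemma conv_der X w k k' : bmc w -> der X k k' -> der X (convolution mu w k) (convolution mu w k').
Proof.
move=> bw [ck ck' dk]; split; [exact: conv_cont|exact: conv_cont|move=> x s].
apply: (@param_derive R G n A hG mu hmu s 1 (fun s y => k (y^-1 * (x * exp (s *: X)))%g)
  (fun s y => k' (y^-1 * (x * exp (s *: X)))%g) w bw ltr01).
- move=> t y _; have := dk (y^-1 * x)%g t; rewrite -!mulgA.
  by congr is_derive; apply/funext => r; rewrite -mulgA.
- by move=> t _; split; exact: ldiv_cont1.
move=> y; apply: (@continuous_comp _ _ _ (fun z : R * G => (x * exp (z.1 *: X), z.2)%g) (fun z : G * G => k' (z.2^-1 * z.1)%g)); last exact: ldiv_cont.
apply: continuous_pair; last exact: cvg_snd.
apply: mulg_cont; first exact: cvg_cst.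
apply: (@continuous_comp _ _ _ (fun z : R * G => z.1) (fun s : R => exp (s *: X))); first exact: cvg_fst.
exact: (exp_line_continuous hg).
Qed.

Lemma conv_dif w k (k_ : g -> G -> R) : bmc w -> dif k k_ -> dif (convolution mu w k) (fun X => convolution mu w (k_ X)).
Proof.
move=> bw [dk lk]; split=> [X|a X Y x]; first exact: conv_der.
have ck Z : continuous (k_ Z) by have [] := dk Z.
have bk Z : bmc (fun y => w y * k_ Z (y^-1 * x)%g) by apply: bmcM => //; exact: ldiv_cont1.
rewrite /convolution -(intgZ hG hmu) // -(intgD hG hmu) //; last exact: bmcZ.
by apply: eq_Rintegral => y _; rewrite lk; ring.
Qed.

Section Time.
Variable H : R -> G -> R.
Hypothesis sH : smooth_pos_time A H.

Lemma conv_time_cont w (u : R) x : bmc w -> 0 < u ->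
  {for (u, x), continuous (fun z => convolution mu w (H z.1) z.2)}.
Proof.
move=> bw u0.
apply: (@param_cont R G n A hG mu hmu (R * G)%type (u, x) (fun z y => H z.1 (y^-1 * z.2)%g) w bw).
  have : \forall z \near (u, x), 0 < z.1.
    have : {for (u, x), continuous (fun z : R * G => z.1)} by exact: cvg_fst.
    by move=> c; apply: (c [set r : R | 0 < r]); exact: lt_nbhsr.
  apply: filterS => z z0; apply: ldiv_cont1; exact: (smooth_fun_cont hG (smooth_fun_of_pos hG sH z0)).
move=> y.
apply: (@continuous_comp _ _ _ (fun z : (R * G) * G => (z.1.1, (z.2^-1 * z.1.2)%g)) (fun z : R * G => H z.1 z.2)); last exact: (smooth_pos_cont hG sH).
have c1 : {for ((u, x), y), continuous (fun z : (R * G) * G => z.1)} by exact: cvg_fst.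
have f1 : {for (u, x), continuous (fst : R * G -> R)} by exact: cvg_fst.
have f2 : {for (u, x), continuous (snd : R * G -> G)} by exact: cvg_snd.
apply: continuous_pair; first exact: (continuous_comp c1 f1).
apply: mulg_cont; first by apply: invg_cont; exact: cvg_snd.
exact: (continuous_comp c1 f2).
Qed.

Lemma conv_time_der w (u : R) x : bmc w -> 0 < u ->
  is_derive u (1 : R) (fun u => convolution mu w (H u) x) (convolution mu w (fun x => (H^~ x)^`()%classic u) x).
Proof.
move=> bw u0; have sD := smooth_pos_dt sH.
have pos (t : R) : `|t - u| < u -> 0 < t by rewrite ltr_distl subrr => /andP[].
apply: (@param_derive R G n A hG mu hmu u u (fun u y => H u (y^-1 * x)%g)
  (fun u y => (H^~ (y^-1 * x)%g)^`()%classic u) w bw u0).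
- move=> t y /pos t0; rewrite derive1E; apply/derivableP; exact: (smooth_pos_derivable hG).
- move=> t /pos t0; split.
    exact: (ldiv_cont1 (smooth_fun_cont hG (smooth_fun_of_pos hG sH t0))).
  exact: (ldiv_cont1 (smooth_fun_cont hG (smooth_fun_of_pos hG sD t0))).
move=> y; apply: (@continuous_comp _ _ _ (fun z : R * G => (z.1, (z.2^-1 * x)%g)) (fun z : R * G => (H^~ z.2)^`()%classic z.1)).
  apply: continuous_pair; first exact: cvg_fst.
  by apply: mulg_cont; [apply: invg_cont; exact: cvg_snd|exact: cvg_cst].
exact: (smooth_pos_cont hG sD).
Qed.

End Time.

(** The derivatives are part of the data. For w convolved with h_u they are the convolutions of w
    with the derivatives of h_u, so that the convolution never has to be smooth in charts. *)
Record caloric (E : seq g) (F : R -> G -> R) (F_ F__ : g -> R -> G -> R) : Prop := Caloric {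
  caloric_dif : forall u : R, 0 < u -> dif (F u) (fun X => F_ X u) ;
  caloric_dif2 : forall (u : R) X, 0 < u -> der X (F_ X u) (F__ X u) ;
  caloric_dt : forall (u : R) x, 0 < u -> is_derive u (1 : R) (F^~ x) (\sum_(X <- E) F__ X u x) ;
  caloric_cont : forall (u : R) x, 0 < u -> {for (u, x), continuous (fun z => F z.1 z.2)} ;
  caloric_cont1 : forall (u : R) x X, 0 < u -> {for (u, x), continuous (fun z => F_ X z.1 z.2)} ;
  caloric_cont2 : forall (u : R) x X, 0 < u -> {for (u, x), continuous (fun z => F__ X z.1 z.2)} }.

Lemma laplacianE (E : seq g) f x : smooth_fun A f ->
  laplacian exp E f x = \sum_(X <- E) linv X (linv X f) x.
Proof.
move=> sf; apply: eq_bigr => X _; rewrite [RHS]linvE /= !derive1E.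
have -> // : (fun s : R => f (x * exp (s *: X))%g)^`()%classic = (fun s : R => linv X f (x * exp (s *: X))%g).
apply/funext => s; rewrite derive1E.
by have [_ ->] := linv_is_derive hG hg X x s sf.
Qed.

Lemma conv_caloric (E : seq g) h w : smooth_pos_time A h ->
  (forall (u : R) x, 0 < u -> derive1 (h^~ x) u = laplacian exp E (h u) x) -> bmc w ->
  caloric E (fun u => convolution mu w (h u)) (fun X u => convolution mu w (linv X (h u)))
    (fun X u => convolution mu w (linv X (linv X (h u)))).
Proof.
move=> sh heat bw.
have s1 X := smooth_pos_linv hG hg X sh.
have s2 X := smooth_pos_linv hG hg X (s1 X).
have sf (u : R) : 0 < u -> smooth_fun A (h u) by move=> u0; exact: (smooth_fun_of_pos hG sh u0).
split.
- by move=> u u0; apply: conv_dif bw (smooth_dif (sf u u0)).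
- by move=> u X u0; apply: conv_der bw _; have [+ _] := smooth_dif (smooth_fun_linv hG hg X (sf u u0)); apply.
- move=> u x u0; apply: is_derive_eq (conv_time_der sh x bw u0) _.
  have bk X : bmc (fun y => w y * linv X (linv X (h u)) (y^-1 * x)%g).
    apply: bmcM => //; apply: ldiv_cont1; exact: (smooth_fun_cont hG (smooth_fun_of_pos hG (s2 X) u0)).
  rewrite /convolution -(intg_sum hG hmu) //; apply: eq_Rintegral => y _.
  by rewrite heat // (laplacianE E _ (sf u u0)) mulr_sumr.
- by move=> u x u0; exact: conv_time_cont.
- by move=> u x X u0; exact: (conv_time_cont (s1 X)).
- by move=> u x X u0; exact: (conv_time_cont (s2 X)).
Qed.

Lemma conv_right_inv (K : set G) w k : right_invariant K k -> right_invariant K (convolution mu w k).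
Proof. by move=> hk x z Kz; apply: eq_Rintegral => y _; rewrite mulgA hk. Qed.

Lemma conv_ge0 w k x : (forall y, 0 <= w y) -> (forall y, 0 <= k y) -> 0 <= convolution mu w k x.
Proof. by move=> w0 k0; apply: intg_ge0 => y; rewrite mulr_ge0. Qed.

Lemma conv_EFin w k x : bmc w -> continuous k ->
  (convolution mu w k x)%:E = (\int[mu]_y (w y * k (y^-1 * x)%g)%:E)%E.
Proof. by move=> bw ck; rewrite (EFin_intg hG hmu) //; apply: bmcM => //; exact: ldiv_cont1. Qed.

Lemma conv_mass w k (m : R) : bmc w -> continuous k -> (forall y, 0 <= w y) -> (forall y, 0 <= k y) ->
  (\int[mu]_x (k x)%:E = m%:E)%E -> (\int[mu]_x (convolution mu w k x)%:E = (m * intg w)%:E)%E.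
Proof.
move=> bw ck w0 k0 km.
have mw : measurable_fun setT (w : borel G -> R) by case: bw.
have mF : measurable_fun setT ((fun z => w z.2 * k (z.2^-1 * z.1)%g) : (borel G * borel G)%type -> R).
  apply: measurable_funM; first by apply: (measurableT_comp mw); exact: measurable_snd.
  exact: (continuous2_borel hG Gc (ldiv_cont ck)).
transitivity (\int[mu]_x \int[mu]_y (w y * k (y^-1 * x)%g)%:E)%E.
  by apply: eq_integral => x _; exact: conv_EFin.
rewrite (tonelli hG Gc hmu (F := fun z => (w z.2 * k (z.2^-1 * z.1)%g)%:E)); last 2 first.
- exact/measurable_EFinP.
- by move=> z; rewrite lee_fin mulr_ge0.
transitivity (\int[mu]_y (m * w y)%:E)%E; last first.
  by rewrite (EFin_intg hG hmu (bmcZ m bw)) (intgZ hG hmu).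
apply: eq_integral => y _.
have mk : measurable_fun setT (fun x : borel G => (k x)%:E) by apply: measurable_EFinG; exact: continuous_borel.
have kE x : (0 <= (k x)%:E)%E by rewrite lee_fin.
transitivity ((w y)%:E * \int[mu]_x (k (y^-1 * x)%g)%:E)%E; last first.
  by rewrite (haar_left hmu y^-1%g mk kE) km -EFinM mulrC.
rewrite -ge0_integralZl ?lee_fin //.
by apply: (measurableT_comp mk); exact: lmul_borel.
Qed.

Section Symmetric.
Hypothesis rinv : forall x (h : G -> \bar R), measurable_fun setT (h : borel G -> \bar R) ->
  (forall x, 0 <= h x)%E -> (\int[mu]_y h (y * x)%g = \int[mu]_y h y)%E.
Hypothesis iinv : forall h : G -> \bar R, measurable_fun setT (h : borel G -> \bar R) ->
  (forall x, 0 <= h x)%E -> (\int[mu]_y h y^-1%g = \int[mu]_y h y)%E.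

Lemma haar_ldiv x (h : G -> \bar R) : measurable_fun setT (h : borel G -> \bar R) ->
  (forall x, 0 <= h x)%E -> (\int[mu]_y h (y^-1 * x)%g = \int[mu]_y h y)%E.
Proof.
move=> mh h0; rewrite -[RHS](rinv x) // -[RHS](iinv (h := fun y => h (y * x)%g)) //.
by apply: (measurableT_comp mh); exact: rmul_borel.
Qed.

Lemma conv_bound w k (m M : R) x : bmc w -> continuous k -> (forall y, 0 <= k y) -> 0 <= M -> (forall y, `|w y| <= M) ->
  (\int[mu]_x (k x)%:E = m%:E)%E -> `|convolution mu w k x| <= M * m.
Proof.
move=> bw ck k0 M0 wM km.
have bwk : bmc (fun y => w y * k (y^-1 * x)%g) by apply: bmcM => //; exact: ldiv_cont1.
apply: le_trans (le_normr_Rintegral measurableT (bmc_integrable hG hmu bwk)) _.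
have baw : bmc (fun y => `|w y * k (y^-1 * x)%g|).
  case: bwk => mw [B hB] [C cC hC]; split; [exact: measurableT_comp|by exists B => y; rewrite normr_id|].
  by exists C => // y /hC ->; rewrite normr0.
rewrite -lee_fin -(EFin_intg hG hmu baw).
have mk : measurable_fun setT (fun x : borel G => (k x)%:E) by apply: measurable_EFinG; exact: continuous_borel.
have kE y : (0 <= (k y)%:E)%E by rewrite lee_fin.
have mkx : measurable_fun setT (fun y : borel G => (k (y^-1 * x)%g)%:E).
  by apply: measurable_EFinG; apply: continuous_borel; exact: ldiv_cont1.
rewrite EFinM -km -(haar_ldiv x mk kE) -(ge0_integralZl mu measurableT mkx (fun y _ => kE _)) ?lee_fin //.
apply: ge0_le_integral => //.
- by apply: measurable_EFinG; case: baw.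
- by apply: measurable_funeM.
by move=> y _; rewrite -EFinM lee_fin normrM (ger0_norm (k0 _)) ler_wpM2r.
Qed.

End Symmetric.
End Convolutions.

(** * Cutoff functions with small gradient *)

Section Cutoffs.
Variables (R : realType) (G : topGroupType) (n : nat) (A : set (chart R G n)).
Hypothesis hG : is_lie_group A.
Hypothesis Gc : connected [set: G].
Variable mu : {measure set (borel G) -> \bar R}.
Hypothesis hmu : is_haar mu.
Variables (g : vectType R) (exp : g -> G) (br : g -> g -> g).
Hypothesis hg : is_lie_algebra A exp br.
Variable K : set G.
Hypothesis Kg : is_subgroup K.
Hypothesis cK : compact K.
Implicit Types (f w v : G -> R) (x y : G) (C L S : set G) (X Y : g).

Local Notation intg f := (\int[mu]_x f x).
Local Notation linv := (lie_der exp).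
Local Notation der := (der exp).
Local Notation dif := (dif exp).

(** In place of a Haar measure on K, a bump phi is averaged over y in [N] = K C with the measure of
    G: eta(x) is the integral of 1_N(y) phi(x y), and left invariance of the measure together with K
    N = N makes it right K-invariant. Its support lies in C C^-1 K. *)
Lemma bump_right_inv (U : set G) : nbhs 1%g U -> exists eta (eta_ : g -> G -> R) S,
  [/\ dif eta eta_, right_invariant K eta, forall x, 0 <= eta x, 0 < eta 1%g &
  [/\ compact S, forall x, ~ S x -> eta x = 0 & forall x, S x -> exists u k, [/\ U u, K k & x = (u * k)%g]]].
Proof.
move=> /nbhs1_div[V [oV V1 VU]]; case: Kg => K1 KM KV.
pose W := [set x | V x^-1%g].
have oW : open W by exact: inv_open.
have W1 : W 1%g by rewrite /W /= invg1.
have [phi [C [[sphi phi0] phi1 cC CW phiC]]] := bump_exists hG oW W1.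
pose N := [set z | exists x y, [/\ K x, C y & z = (x * y)%g]].
have cN : compact N by exact: compact_mul.
have mN := compact_borel hG cN.
have bN := indic_bmc R mN cN (fun x => id).
have C1 : C 1%g by apply: contrapT => /phiC E; move: phi1; rewrite E ltxx.
have cphi := smooth_fun_cont hG sphi.
pose S := [set z | exists x y, [/\ C x, [set y | N y^-1%g] y & z = (x * y)%g]].
have cS : compact S by apply: compact_mul => //; exact: compact_inv.
have sR y : smooth_fun A (fun x => phi (x * y)%g).
  by have := smooth_fun_translate hG 1%g y sphi; congr smooth_fun; apply/funext => x; rewrite mul1g.
pose eta x := intg (fun y => \1_N y * phi (x * y)%g).
pose eta_ X x := intg (fun y => \1_N y * linv X (fun z => phi (z * y)%g) x).
have cphi2 : continuous (fun z : G * G => phi (z.1 * z.2)%g).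
  move=> z; apply: (@continuous_comp _ _ _ (fun z : G * G => z.1 * z.2)%g phi); last exact: cphi.
  by apply: mulg_cont; [exact: cvg_fst|exact: cvg_snd].
have clinv2 X := linv_R_cont hG hg (Y := X) sphi.
have sl (h : G * G -> R) : continuous h -> forall x, continuous (fun y => h (x, y)).
  move=> ch x y; apply: (@continuous_comp _ _ _ (fun y => (x, y)) h); last exact: ch.
  by apply: continuous_pair; [exact: cvg_cst|exact: cvg_id].
have d2 X : der X eta (eta_ X).
  split.
  - move=> x; apply: (@param_cont R G n A hG mu hmu G x (fun x y => phi (x * y)%g) _ bN).
      by apply: nearW => z; exact: (sl _ cphi2).
    by move=> y; exact: cphi2.
  - move=> x; apply: (@param_cont R G n A hG mu hmu G x (fun x y => linv X (fun z => phi (z * y)%g) x) _ bN).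
      by apply: nearW => z; exact: (sl _ (clinv2 X)).
    by move=> y; exact: clinv2.
  move=> x s.
  apply: (@param_derive R G n A hG mu hmu s 1 (fun s y => phi (x * exp (s *: X) * y)%g)
    (fun s y => linv X (fun z => phi (z * y)%g) (x * exp (s *: X))%g) _ bN ltr01).
  - by move=> t y _; exact: (linv_is_derive hG hg).
  - by move=> t _; split; [exact: (sl _ cphi2)|exact: (sl _ (clinv2 X))].
  move=> y; apply: (@continuous_comp _ _ _ (fun z : R * G => (x * exp (z.1 *: X), z.2)%g) (fun z : G * G => linv X (fun x0 => phi (x0 * z.2)%g) z.1)); last exact: clinv2.
  apply: continuous_pair; last exact: cvg_snd.
  apply: mulg_cont; first exact: cvg_cst.
  apply: (@continuous_comp _ _ _ (fun z : R * G => z.1) (fun s : R => exp (s *: X))); first exact: cvg_fst.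
  exact: (exp_line_continuous hg).
exists eta, eta_, S; split.
- split=> // a X Y x.
  have bk Z : bmc (fun y => \1_N y * linv Z (fun z => phi (z * y)%g) x) by apply: bmcM => //; exact: (sl _ (clinv2 Z)).
  rewrite /eta_ -(intgZ hG hmu) // -(intgD hG hmu) //; last exact: bmcZ.
  by apply: eq_Rintegral => y _; rewrite (linvP hg) //; ring.
- move=> x k Kk; rewrite /eta.
  have bx z : bmc (fun y => \1_N y * phi (z * y)%g) by apply: bmcM => //; exact: (sl _ cphi2).
  have E0 z y : (0 <= (\1_N y * phi (z * y)%g)%:E)%E by rewrite lee_fin mulr_ge0 // indicE.
  have mE z : measurable_fun setT (fun y : borel G => (\1_N y * phi (z * y)%g)%:E).
    by apply: measurable_EFinG; case: (bx z).
  have := haar_left hmu k (mE x) (E0 x).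
  suff -> : (\int[mu]_y (\1_N (k * y)%g * phi (x * (k * y))%g)%:E = \int[mu]_y (\1_N y * phi (x * k * y)%g)%:E)%E.
    by rewrite !(EFin_intg hG hmu) // => -[].
  apply: eq_integral => y _; rewrite mulgA; congr (_ * _)%:E.
  rewrite !indicE; congr ((_ : bool)%:R); apply/idP/idP => /set_mem[a [b [Ka Cb e]]]; apply/mem_set.
    by exists (k^-1 * a)%g, b; split=> //; [apply: KM => //; exact: KV|rewrite -mulgA -e mulKg].
  by exists (k * a)%g, b; split=> //; [exact: KM|rewrite e mulgA].
- by move=> x; apply: intg_ge0 => y; rewrite mulr_ge0 // indicE.
- have -> : eta 1%g = intg phi; last exact: (intg_gt0 hG hmu cphi cC phiC phi0 phi1).
  apply: eq_Rintegral => y _; rewrite mul1g indicE.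
  have [yN|yN] := boolP (y \in N); first by rewrite mul1r.
  rewrite mul0r phiC // => Cy; move: yN; rewrite notin_setE; apply.
  by exists 1%g, y; rewrite mul1g.
split=> //.
- move=> x Sx; rewrite /eta -[RHS](intg0 mu); apply: eq_Rintegral => y _.
  rewrite indicE; have [/set_mem yN|yN] := boolP (y \in N); last by rewrite mul0r.
  rewrite mul1r phiC // => Cxy; apply: Sx; exists (x * y)%g, y^-1%g; split=> //; first by rewrite /= invgK.
  by rewrite mulgK.
move=> x [a [b [Ca [k [c [Kk Cc e]]] ->]]].
exists (a * c^-1)%g, k^-1%g; split; [by have := VU _ _ (CW _ Ca) (CW _ Cc); rewrite invgK|exact: KV|].
by rewrite -mulgA -invgM -e invgK.
Qed.

(** S need not generate G; adding the sets of [exhaustion] at each stage makes the sequence swallow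
    every compact set all the same. *)
Lemma exhaustion_by S : compact S -> S 1%g -> exists D : nat -> set G,
  [/\ forall k, compact (D k), forall k x s, D k x -> S s -> D k.+1 (x * s)%g,
      forall k l, (k <= l)%N -> D k `<=` D l & forall L, compact L -> exists m, L `<=` D m].
Proof.
move=> cS S1; have [U [C [[oU U1 UV] [cC CU Cinc Cex _]]]] := exhaustion hG Gc.
pose D := fix D k := if k is k'.+1 then
  [set z | exists x y, [/\ D k' x, S y & z = (x * y)%g]] `|` C k else C 0%N.
have DS k : D k `<=` D k.+1 by move=> x Dx; left; exists x, 1%g; rewrite mulg1.
have Dle k l : (k <= l)%N -> D k `<=` D l.
  elim: l => [|l IH]; first by rewrite leqn0 => /eqP ->.
  by rewrite leq_eqVlt => /predU1P[->//|/IH h] x /h /DS.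
have CD k : C k `<=` D k by case: k => [//|k] x Cx; right.
exists D; split=> //.
- by elim=> [|k IH]; [exact: cC|apply: compactU => //; exact: compact_mul].
- by move=> k x s Dx Ss; left; exists x, s.
move=> L cL.
have : \forall k \near \oo, L `<=` (fun x => D k x).
  have := (compact_near_coveringP L).1 cL nat \oo (fun k x => D k x) _; apply => x _.
  have [k Ckx] := Cex x.
  have nx : nbhs x [set y | U (x^-1 * y)%g].
    have c : {for x, continuous (fun y => x^-1 * y)%g} by apply: mulg_cont; [exact: cvg_cst|exact: cvg_id].
    by apply: c; rewrite mulVg; apply: open_nbhs_nbhs.
  exists ([set y | U (x^-1 * y)%g], [set m | (k.+1 <= m)%N]); first by split=> //=; exists k.+1.
  move=> [y m] [/= Uy km]; apply: (Dle k.+1) => //; apply: CD.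
  by have := CU _ _ _ Ckx Uy; rewrite mulgA mulgV mul1g.
by move=> [m _ hm]; exists m; apply: hm => /=.
Qed.

Hypothesis rinv : forall x (h : G -> \bar R), measurable_fun setT (h : borel G -> \bar R) ->
  (forall x, 0 <= h x)%E -> (\int[mu]_y h (y * x)%g = \int[mu]_y h y)%E.
Hypothesis iinv : forall h : G -> \bar R, measurable_fun setT (h : borel G -> \bar R) ->
  (forall x, 0 <= h x)%E -> (\int[mu]_y h y^-1%g = \int[mu]_y h y)%E.

Lemma rintg_ldiv x w : measurable_fun setT (w : borel G -> R) ->
  \int[mu]_y w (y^-1 * x)%g = \int[mu]_y w y.
Proof.
move=> mw; have mE := measurable_EFinG mw; rewrite /Rintegral; congr fine.
rewrite integralE [RHS]integralE; congr (_ - _)%E.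
  have := haar_ldiv rinv iinv x (measurable_funepos mE) (fun y => funepos_ge0 _ y).
  by rewrite !unlock.
have := haar_ldiv rinv iinv x (measurable_funeneg mE) (fun y => funeneg_ge0 _ y).
by rewrite !unlock.
Qed.

(** [zeta m] averages the indicators of D_m, ..., D_(2m), so it varies by at most 1/(m+1) under
    right translation by S. It is then smoothed by convolution with [eta], supported in S: as the
    derivatives of [eta] have integral 0, they only see this variation. *)
Lemma cutoff_exists (E : seq g) : exists (c : R) (chi : nat -> G -> R) (chi_ : nat -> g -> G -> R) (D : nat -> set G),
  [/\ 0 <= c, forall m, [/\ dif (chi m) (chi_ m), right_invariant K (chi m), compact (D m) & forall x, ~ D m x -> chi m x = 0],
    forall m x, 0 <= chi m x <= 1,
    forall m X x, X \in E -> `|chi_ m X x| <= c / m.+1%:R &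
    forall L, compact L -> \forall m \near \oo, forall x, L x -> chi m x = 1].
Proof.
have [eta [eta_ [S0 [deta eta_K eta0 eta1 [cS0 etaS0 _]]]]] := bump_right_inv (@filterT G (nbhs 1%g) _).
pose S := (S0 `|` [set x | S0 x^-1%g]) `|` [set 1%g].
have cS : compact S by apply: compactU; [apply: compactU => //; exact: compact_inv|exact: compact_set1].
have SV x : S x -> S x^-1%g.
  by move=> [[h|h]|->]; [left; right; rewrite /= invgK|left; left|right; rewrite /= invg1].
have etaS x : ~ S x -> eta x = 0 by move=> h; apply: etaS0 => h'; apply: h; left; left.
have [D [cD DS Dle DL]] := exhaustion_by cS (or_intror erefl : S 1%g).
have mD k := compact_borel hG (cD k).
pose zeta m x : R := m.+1%:R^-1 * \sum_(k < m.+1) \1_(D (m + k)%N) x.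
have bz m : bmc (zeta m).
  by apply: bmcZ; apply: bmc_sum => k; exact: (indic_bmc R (mD _) (cD _) (fun x => id)).
have z01 m x : 0 <= zeta m x <= 1.
  apply/andP; split.
    by rewrite /zeta mulr_ge0 ?invr_ge0 ?ler0n ?sumr_ge0 // => k _; rewrite indicE.
  rewrite ler_pdivrMl ?ltr0n // mulr1.
  have -> : m.+1%:R = \sum_(k < m.+1) 1 :> R by rewrite sumr_const card_ord.
  by apply: ler_sum => k _; rewrite indicE; case: (_ \in _).
have z1 m k x : (k <= m)%N -> D k x -> zeta m x = 1.
  move=> km Dx; rewrite /zeta (eq_bigr (fun=> 1)); last first.
    by move=> i _; rewrite indicE mem_set //; apply: Dle Dx; exact: leq_trans km (leq_addr _ _).
  by rewrite sumr_const card_ord mulVf // pnatr_eq0.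
have z0 m x : ~ D (m + m)%N x -> zeta m x = 0.
  move=> Dx; rewrite /zeta big1 ?mulr0 // => i _; rewrite indicE memNset // => Di.
  by apply: Dx; apply: Dle Di; rewrite leq_add2l -ltnS.
(* Right translation by an element of S shifts the index by at most one, and the two shifted sums
   differ only by their end terms. *)
have zle m x s : S s -> zeta m x <= zeta m (x * s)%g + m.+1%:R^-1.
  move=> Ss; rewrite /zeta -[X in _ + X]mulr1 -mulrDr ler_wpM2l ?invr_ge0 ?ler0n //.
  pose f k : R := \1_(D (m + k)%N) (x * s)%g.
  have f01 k : 0 <= f k <= 1 by rewrite /f indicE; case: (_ \in _); rewrite ?lexx ler01.
  have -> : \sum_(k < m.+1) \1_(D (m + k)%N) (x * s)%g = \sum_(k < m.+1) f k by [].
  apply: (@le_trans _ _ (\sum_(k < m.+1) f k.+1)).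
    apply: ler_sum => k _; rewrite /f !indicE; have [/set_mem Dx|_] := boolP (x \in _); last exact: ler0n.
    by rewrite mem_set // addnS; exact: DS.
  have e1 : \sum_(k < m.+2) f k = f 0%N + \sum_(i < m.+1) f i.+1 by rewrite big_ord_recl.
  have e2 : \sum_(k < m.+2) f k = \sum_(i < m.+1) f i + f m.+1 by rewrite big_ord_recr.
  by have /andP[_ k1] := f01 m.+1; have /andP[k2 _] := f01 0%N; lra.
have zd m x y : S (y^-1 * x)%g -> `|zeta m y - zeta m x| <= m.+1%:R^-1.
  move=> Sz; have h1 := zle m y _ Sz; have h2 := zle m x _ (SV _ Sz).
  have e1 : (y * (y^-1 * x) = x)%g by rewrite mulgA mulgV mul1g.
  have e2 : (x * (y^-1 * x)^-1 = y)%g by rewrite invgM invgK mulgA mulgV mul1g.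
  rewrite e1 in h1; rewrite e2 in h2.
  by rewrite ler_norml; move: h1 h2; move: (m.+1%:R^-1) => t h1 h2; apply/andP; split; lra.
have [ceta _ _] := deta.1 0.
pose c0 := intg eta.
have c00 : 0 < c0 by exact: (intg_gt0 hG hmu ceta cS etaS eta0 eta1).
have c0V : 0 <= c0^-1 by rewrite invr_ge0 ltW.
have bl (k : G -> R) x : continuous k -> (forall z, ~ S z -> k z = 0) -> bmc (fun y => k (y^-1 * x)%g).
  move=> ck kS; apply: (@bmc_cont _ _ _ ((fun s => x * s^-1)%g @` S)); first exact: ldiv_cont1.
    apply: continuous_compact cS; apply: continuous_subspaceT => y.
    by apply: mulg_cont; [exact: cvg_cst|apply: invg_cont; exact: cvg_id].
  move=> y h; apply: kS => Sz; apply: h; exists (y^-1 * x)%g => //.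
  by rewrite invgM invgK mulgA mulgV mul1g.
have ceta_ X : continuous (eta_ X) by have [] := deta.1 X.
have etaS_ X := der_supp hG hg (deta.1 X) cS etaS.
have i0 X : intg (eta_ X) = 0 by exact: (der_intg0 hG hmu hg rinv (deta.1 X) cS etaS).
pose c := \sum_(X <- E) c0^-1 * intg (fun y => `|eta_ X y|).
have cX0 X : 0 <= c0^-1 * intg (fun y => `|eta_ X y|) by rewrite mulr_ge0 //; apply: intg_ge0 => y.
exists c, (fun m x => c0^-1 * convolution mu (zeta m) eta x),
  (fun m X x => c0^-1 * convolution mu (zeta m) (eta_ X) x), (fun m => D (m + m).+1).
have b1 m (k : G -> R) x : continuous k -> bmc (fun y => zeta m y * k (y^-1 * x)%g).
  by move=> ck; apply: bmcM => //; exact: ldiv_cont1.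
split.
- by apply: sumr_ge0 => X _.
- move=> m; split=> //.
  + have [d1 l1] := conv_dif hG hmu hg (bz m) deta.
    by split=> [X|a X Y x]; [exact: derZ|rewrite l1; ring].
  + by move=> x k Kk; rewrite (conv_right_inv _ _ eta_K).
  move=> x Dx; suff -> : convolution mu (zeta m) eta x = 0 by rewrite mulr0.
  rewrite -[RHS](intg0 mu); apply: eq_Rintegral => y _.
  have [Sz|/etaS ->] := pselect (S (y^-1 * x)%g); last by rewrite mulr0.
  rewrite z0 ?mul0r // => Dy; apply: Dx; have := DS _ _ _ Dy Sz.
  by rewrite mulgA mulgV mul1g.
- move=> m x; rewrite mulr_ge0 //=; last first.
    by apply: conv_ge0 => // y; have /andP[] := z01 m y.
  rewrite ler_pdivrMl // mulr1 -[X in _ <= X](rintg_ldiv x); last exact: continuous_borel.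
  apply: (le_intg hG hmu); [exact: b1|exact: bl|move=> y].
  by rewrite ler_piMl //; have /andP[] := z01 m y.
- move=> m X x XE; apply: (@le_trans _ _ (c0^-1 * intg (fun y => `|eta_ X y|) / m.+1%:R)); last first.
    rewrite ler_wpM2r ?invr_ge0 ?ler0n // /c (big_rem X XE) /= lerDl; exact: sumr_ge0.
  rewrite normrM (ger0_norm c0V) -mulrA ler_wpM2l // mulrC.
  have bx := bl _ x (ceta_ X) (etaS_ X).
  have -> : convolution mu (zeta m) (eta_ X) x = intg (fun y => (zeta m y - zeta m x) * eta_ X (y^-1 * x)%g).
    transitivity (convolution mu (zeta m) (eta_ X) x - zeta m x * intg (fun y => eta_ X (y^-1 * x)%g)).
      by rewrite rintg_ldiv ?i0 ?mulr0 ?subr0 //; exact: continuous_borel.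
    rewrite -(intgZ hG hmu) // -(intgB hG hmu) //; [|exact: b1|exact: bmcZ].
    by apply: eq_Rintegral => y _; ring.
  have bb : bmc (fun y => (zeta m y - zeta m x) * eta_ X (y^-1 * x)%g).
    have := bmcB (b1 m _ x (ceta_ X)) (bmcZ (zeta m x) bx); congr bmc.
    by apply/funext => y; ring.
  have bn : bmc (fun y => `|eta_ X (y^-1 * x)%g|).
    apply: (bl (fun z => `|eta_ X z|)) => [y|z Sz]; [apply: continuous_comp; [exact: ceta_|exact: norm_continuous]|by rewrite (etaS_ X _ Sz) normr0].
  apply: le_trans (le_normr_Rintegral measurableT (bmc_integrable hG hmu bb)) _.
  rewrite -[X in _ <= _ * X](rintg_ldiv x (w := fun y => `|eta_ X y|)); last first.
    by apply: measurableT_comp => //; exact: continuous_borel.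
  rewrite -(intgZ hG hmu) //; apply: le_Rintegral => //.
  + exact: (integrable_norm (bmc_integrable hG hmu bb)).
  + by apply: (bmc_integrable hG hmu); exact: bmcZ.
  move=> y _; rewrite normrM; have [Sz|/etaS_ ->] := pselect (S (y^-1 * x)%g); last by rewrite normr0 !mulr0.
  by rewrite ler_wpM2r //; exact: zd.
move=> L /DL[m0 Lm0]; exists m0.+1 => // m /= m0m x Lx.
have -> : convolution mu (zeta m) eta x = c0; last by rewrite mulVf // gt_eqF.
rewrite -[RHS](rintg_ldiv x); last exact: continuous_borel.
apply: eq_Rintegral => y _.
have [Sz|/etaS ->] := pselect (S (y^-1 * x)%g); last by rewrite mulr0.
rewrite (z1 m m0.+1) ?mul1r //; have := DS _ _ _ (Lm0 _ Lx) (SV _ Sz).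
by rewrite invgM invgK mulgA mulgV mul1g.
Qed.

End Cutoffs.

(** * Energy identities for a fixed cutoff *)

Section Energy.
Variables (R : realType) (G : topGroupType) (n : nat) (A : set (chart R G n)).
Hypothesis hG : is_lie_group A.
Hypothesis Gc : connected [set: G].
Variable mu : {measure set (borel G) -> \bar R}.
Hypothesis hmu : is_haar mu.
Variables (g : vectType R) (exp : g -> G) (br : g -> g -> g).
Hypothesis hg : is_lie_algebra A exp br.
Hypothesis rinv : forall x (h : G -> \bar R), measurable_fun setT (h : borel G -> \bar R) ->
  (forall x, 0 <= h x)%E -> (\int[mu]_y h (y * x)%g = \int[mu]_y h y)%E.
Variable E : seq g.
Implicit Types (f w v : G -> R) (x y : G) (C : set G) (X Y : g) (F H : R -> G -> R).

Local Notation intg f := (\int[mu]_x f x).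
Local Notation der := (der exp).
Local Notation dif := (dif exp).

Lemma sum_le_size (I : eqType) (r : seq I) (f : I -> R) (c : R) :
  (forall i, i \in r -> f i <= c) -> \sum_(i <- r) f i <= (size r)%:R * c.
Proof.
elim: r => [|i r IH] h; first by rewrite big_nil mul0r.
rewrite big_cons /= -natr1 mulrDl mul1r addrC lerD ?h ?mem_head // IH // => j jr.
by rewrite h // in_cons jr orbT.
Qed.

Lemma cauchy_schwarz_seq (I : Type) (r : seq I) (a b : I -> R) :
  (\sum_(i <- r) a i * b i) ^+ 2 <= (\sum_(i <- r) a i ^+ 2) * (\sum_(i <- r) b i ^+ 2).
Proof.
elim: r => [|i r IH]; first by rewrite !big_nil mul0r expr0n.
rewrite !big_cons; set S := bigop.body _ _ _ in IH *; set P := bigop.body _ _ _ in IH *; set Q := bigop.body _ _ _ in IH *.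
have P0 : 0 <= P by apply: sumr_ge0 => j _; exact: sqr_ge0.
have Q0 : 0 <= Q by apply: sumr_ge0 => j _; exact: sqr_ge0.
suff : 2 * (a i * b i) * S <= a i ^+ 2 * Q + b i ^+ 2 * P by nra.
have r0 : 0 <= a i ^+ 2 * Q + b i ^+ 2 * P by rewrite addr_ge0 // mulr_ge0 ?sqr_ge0.
apply: le_trans (ler_norm _) _; rewrite -ler_sqr ?nnegrE // real_normK ?num_real //.
have h1 : (2 * (a i * b i) * S) ^+ 2 <= 4 * ((a i ^+ 2 * Q) * (b i ^+ 2 * P)).
  have -> : (2 * (a i * b i) * S) ^+ 2 = 4 * (a i ^+ 2 * b i ^+ 2) * S ^+ 2 by ring.
  have -> : 4 * ((a i ^+ 2 * Q) * (b i ^+ 2 * P)) = 4 * (a i ^+ 2 * b i ^+ 2) * (P * Q) by ring.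
  by rewrite ler_wpM2l // mulr_ge0 // mulr_ge0 ?sqr_ge0.
apply: le_trans h1 _; move: (a i ^+ 2 * Q) (b i ^+ 2 * P) => s t.
by have := sqr_ge0 (s - t); nra.
Qed.

Lemma dif_sum v (v_ : g -> G -> R) (I : Type) (r : seq I) (c : I -> R) (Y : I -> g) x : dif v v_ ->
  v_ (\sum_(i <- r) c i *: Y i) x = \sum_(i <- r) c i * v_ (Y i) x.
Proof.
move=> [_ lv]; have v0 : v_ 0 x = 0.
  by have := lv 0 0 0 x; rewrite scale0r addr0 mul0r add0r => h; have := lv 1 0 0 x; rewrite scale1r addr0 mul1r; lra.
by elim: r => [|i r IH]; rewrite ?big_nil // !big_cons lv IH.
Qed.

Lemma time_slice (Phi : R -> G -> R) (u : R) : 0 < u ->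
  (forall x, {for (u, x), continuous (fun z => Phi z.1 z.2)}) -> continuous (Phi u).
Proof.
move=> u0 c x; apply: (@continuous_comp _ _ _ (fun x => (u, x)) (fun z : R * G => Phi z.1 z.2)); last exact: c.
by apply: continuous_pair; [exact: cvg_cst|exact: cvg_id].
Qed.

Section OneCutoff.
Variables (chi : G -> R) (chi_ : g -> G -> R) (D : set G) (e : R).
Hypothesis dchi : dif chi chi_.
Hypothesis cD : compact D.
Hypothesis chiD : forall x, ~ D x -> chi x = 0.
Hypothesis chi01 : forall x, 0 <= chi x <= 1.
Hypothesis chi_e : forall X x, X \in E -> `|chi_ X x| <= e.

Let cchi : continuous chi. Proof. by have [] := dchi.1 0. Qed.
Let cchi_ X : continuous (chi_ X). Proof. by have [] := dchi.1 X. Qed.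
Let chi_D X : forall x, ~ D x -> chi_ X x = 0. Proof. exact: (der_supp hG hg (dchi.1 X) cD chiD). Qed.
Let bchi f : continuous f -> bmc (fun x => chi x * f x).
Proof. by move=> cf; apply: bmcM cf; exact: (bmc_cont cchi cD chiD). Qed.
Let bchi_ X f : continuous f -> bmc (fun x => chi_ X x * f x).
Proof. by move=> cf; exact: (bmcM (bmc_cont (@cchi_ X) cD (@chi_D X)) cf). Qed.
Let bD : bmc (\1_D : G -> R).
Proof. exact: (indic_bmc R (compact_borel hG cD) cD (fun x => id)). Qed.

Let cM f w : continuous f -> continuous w -> continuous (fun x => f x * w x).
Proof. by move=> cf cw x; apply: cvgM; [exact: cf|exact: cw]. Qed.
Let cA f w : continuous f -> continuous w -> continuous (fun x => f x + w x).
Proof. by move=> cf cw x; apply: cvgD; [exact: cf|exact: cw]. Qed.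

Definition energy F (u : R) := intg (fun x => chi x ^+ 2 * F u x ^+ 2).
(** The gradient is that of the product chi F, a compactly supported function to which the gap and
    Nash's inequality apply as they are; the whole effect of the cutoff is left to [energy_err]. *)
Definition energy_grad F (F_ : g -> R -> G -> R) (u : R) :=
  intg (fun x => \sum_(X <- E) (chi_ X x * F u x + chi x * F_ X u x) ^+ 2).
Definition energy_err F (u : R) := intg (fun x => \sum_(X <- E) chi_ X x ^+ 2 * F u x ^+ 2).

Section OneSolution.
Variables (F : R -> G -> R) (F_ F__ : g -> R -> G -> R).
Hypothesis cal : caloric exp E F F_ F__.

Let cF (u : R) : 0 < u -> continuous (F u).
Proof. by move=> u0; apply: time_slice => // x; exact: (caloric_cont cal). Qed.
Let cF_ X (u : R) : 0 < u -> continuous (F_ X u).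
Proof. by move=> u0; apply: time_slice => // x; exact: (caloric_cont1 cal). Qed.
Let cF__ X (u : R) : 0 < u -> continuous (F__ X u).
Proof. by move=> u0; apply: time_slice => // x; exact: (caloric_cont2 cal). Qed.

(** Pointwise, 2 chi^2 F (Laplacian F) is - 2 |grad(chi F)|^2 + 2 |grad chi|^2 F^2 plus twice the
    divergence of chi^2 F grad F, whose components [T X] integrate to 0. *)
Lemma energy_derive (u : R) : 0 < u ->
  is_derive u (1 : R) (energy F) (- 2 * energy_grad F F_ u + 2 * energy_err F u).
Proof.
move=> u0; have bchi2 : bmc (fun x => chi x ^+ 2) by have := bchi cchi; congr bmc.
have pos (t : R) : `|t - u| < u -> 0 < t by rewrite ltr_distl subrr => /andP[].
pose Dt u x := 2 * F u x * \sum_(X <- E) F__ X u x.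
have cS (t : R) : 0 < t -> continuous (fun x => \sum_(X <- E) F__ X t x).
  by move=> t0 x; apply: cvg_bigsum => X; have := @cF__ X t t0 x; exact.
have := @param_derive R G n A hG mu hmu u u (fun u y => F u y ^+ 2) Dt _ bchi2 u0 _ _ _.
have -> : - 2 * energy_grad F F_ u + 2 * energy_err F u = intg (fun y => chi y ^+ 2 * Dt u y).
  pose T X x := (2 * (chi_ X x * chi x)) * (F u x * F_ X u x) + chi x ^+ 2 * (F_ X u x * F_ X u x + F u x * F__ X u x).
  have iT X : intg (T X) = 0.
    have dF := (caloric_dif cal u0).1 X.
    have := derM (derM (dchi.1 X) (dchi.1 X)) (derM dF (caloric_dif2 cal X u0)).
    move=> /(der_intg0 hG hmu hg rinv)/(_ cD) <-; last by move=> x /chiD ->; rewrite !mul0r.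
    by apply: eq_Rintegral => x _; rewrite /T; ring.
  have b0 X : bmc (T X).
    have b1 : bmc (fun x => chi x * ((2 * chi_ X x) * (F u x * F_ X u x))).
      by apply: bchi; apply: cM; [apply: cM => // x; exact: cvg_cst|apply: cM; [exact: cF|exact: cF_]].
    have b2 : bmc (fun x => chi x * (chi x * (F_ X u x * F_ X u x + F u x * F__ X u x))).
      by apply: bchi; apply: cM => //; apply: cA; apply: cM; [exact: cF_|exact: cF_|exact: cF|exact: cF__].
    by have := bmcD b1 b2; congr bmc; apply/funext => x; rewrite /T; ring.
  have bg : bmc (fun x => \sum_(X <- E) (chi_ X x * F u x + chi x * F_ X u x) ^+ 2).
    apply: bmc_sum => X; have b1 := bchi_ X (cM (cF u0) (cA (cM (@cchi_ X) (cF u0)) (cM cchi (@cF_ X u u0)))).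
    have b2 := bchi (cM (@cF_ X u u0) (cA (cM (@cchi_ X) (cF u0)) (cM cchi (@cF_ X u u0)))).
    by have := bmcD b1 b2; congr bmc; apply/funext => x; ring.
  have be : bmc (fun x => \sum_(X <- E) chi_ X x ^+ 2 * F u x ^+ 2).
    apply: bmc_sum => X; have := bchi_ X (cM (@cchi_ X) (cM (cF u0) (cF u0))); congr bmc.
    by apply/funext => x; ring.
  have bT : bmc (fun x => \sum_(X <- E) T X x) by exact: bmc_sum.
  have iT0 : intg (fun x => 2 * \sum_(X <- E) T X x) = 0.
    by rewrite (intgZ hG hmu) // (intg_sum hG hmu) // big1 ?mulr0 // => X _.
  rewrite -[RHS]subr0 -iT0 -(intgB hG hmu); last 2 first.
  - have b3 : bmc (fun x => chi x * (chi x * (2 * F u x * \sum_(X <- E) F__ X u x))).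
      by apply: bchi; apply: cM => //; apply: cM (cS u u0); apply: cM (cF u0) => x; exact: cvg_cst.
    by have := b3; congr bmc; apply/funext => x; rewrite /Dt; ring.
  - exact: bmcZ.
  rewrite /energy_grad /energy_err -!(intgZ hG hmu) // -(intgD hG hmu) //; [|exact: bmcZ|exact: bmcZ].
  apply: eq_Rintegral => x _; rewrite /Dt !mulr_sumr -big_split /= -sumrB.
  by apply: eq_bigr => X _; rewrite /T; ring.
apply.
- move=> t y /pos t0; have d := caloric_dt cal y t0.
  have -> : (fun t => F t y ^+ 2) = (F^~ y) * (F^~ y) by apply/funext => z; rewrite expr2.
  by apply: is_derive_eq (is_deriveM d d) _; rewrite /Dt /GRing.scale /=; ring.
- move=> t /pos t0; split; first by have := cM (cF t0) (cF t0).
  by apply: cM (cS t t0); apply: cM (cF t0) => x; exact: cvg_cst.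
move=> y; apply: cvgM; first by apply: cvgM; [exact: cvg_cst|exact: (caloric_cont cal)].
by apply: cvg_bigsum => X; exact: (caloric_cont2 cal).
Qed.

Lemma energy_err_le (u m : R) : 0 < u -> intg (fun x => \1_D x * F u x ^+ 2) <= m ->
  energy_err F u <= (size E)%:R * e ^+ 2 * m.
Proof.
move=> u0 hm; have bDF : bmc (fun x => \1_D x * F u x ^+ 2) by apply: bmcM => //; exact: (cM (cF u0) (cF u0)).
apply: (@le_trans _ _ (intg (fun x => (size E)%:R * e ^+ 2 * (\1_D x * F u x ^+ 2)))); last first.
  by rewrite (intgZ hG hmu) // ler_wpM2l // mulr_ge0 ?sqr_ge0.
apply: (le_intg hG hmu); last 1 first.
- move=> x; rewrite indicE; have [xD|/negP xD] := boolP (x \in D); last first.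
    rewrite mul0r mulr0 big1 // => X _; rewrite chi_D ?expr0n ?mul0r // => Dx; apply: xD; exact/mem_set.
  rewrite -mulr_suml mul1r ler_wpM2r ?sqr_ge0 //; apply: sum_le_size => X XE.
  by rewrite -[X in X <= _]real_normK ?num_real // ler_sqr ?nnegrE ?chi_e // (le_trans (normr_ge0 _) (chi_e x XE)).
- apply: bmc_sum => X; have := bchi_ X (cM (@cchi_ X) (cM (cF u0) (cF u0))); congr bmc.
  by apply/funext => x; ring.
- exact: bmcZ.
Qed.

Lemma energy_nash (K B : set G) (s u : R) : 0 < u -> right_invariant K chi -> right_invariant K (F u) ->
  (forall x, 0 <= F u x) -> measurable (B : set (borel G)) -> (mu B < +oo)%E ->
  (forall y, B y -> exists (c : g -> R) k, [/\ K k, y = (exp (\sum_(Y <- E) c Y *: Y) * k)%g & \sum_(Y <- E) c Y ^+ 2 <= s ^+ 2]) ->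
  fine (mu B) * (energy F u - expR 1 * (s ^+ 2 * energy_grad F F_ u)) <= intg (fun x => chi x * F u x) ^+ 2.
Proof.
move=> u0 chiK FK F0 mB fB hB; have dv := difM dchi (caloric_dif cal u0).
have vD x : ~ D x -> chi x * F u x = 0 by move=> /chiD ->; rewrite mul0r.
have -> : energy F u = intg (fun x => (chi x * F u x) ^+ 2) by apply: eq_Rintegral => x _; rewrite exprMn.
apply: (nash_ball hG Gc hmu hg rinv dv cD vD) => //.
  by move=> x; rewrite mulr_ge0 //; have /andP[] := chi01 x.
move=> y /hB[c [k [Kk -> cs]]]; exists (\sum_(Y <- E) c Y *: Y); split.
  by move=> x; rewrite !mulgA (chiK _ _ Kk) (FK _ _ Kk).
have cw X : continuous (fun x => chi_ X x * F u x + chi x * F_ X u x).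
  by apply: cA; apply: cM => //; [exact: cF|exact: cF_].
have b2 X : bmc (fun x => (chi_ X x * F u x + chi x * F_ X u x) ^+ 2).
  have b1 := bchi_ X (cM (cF u0) (cw X)).
  by have := bmcD b1 (bchi (cM (@cF_ X u u0) (cw X))); congr bmc; apply/funext => x; ring.
have bg : bmc (fun x => \sum_(X <- E) (chi_ X x * F u x + chi x * F_ X u x) ^+ 2) by exact: bmc_sum.
rewrite /energy_grad -(intgZ hG hmu) //; apply: (le_intg hG hmu) => //; first exact: bmcZ.
move=> x; have := dif_sum E c id x dv => /= ->.
by apply: le_trans (cauchy_schwarz_seq _ _ _) _; rewrite ler_wpM2r // sumr_ge0 // => X _; exact: sqr_ge0.
Qed.

Lemma grad_le (u : R) : 0 < u ->
  intg (fun x => \sum_(X <- E) chi x ^+ 2 * F_ X u x ^+ 2) <= 2 * energy_grad F F_ u + 2 * energy_err F u.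
Proof.
move=> u0.
have cw X : continuous (fun x => chi_ X x * F u x + chi x * F_ X u x).
  by apply: cA; apply: cM => //; [exact: cF|exact: cF_].
have bg : bmc (fun x => \sum_(X <- E) (chi_ X x * F u x + chi x * F_ X u x) ^+ 2).
  apply: bmc_sum => X; have b1 := bchi_ X (cM (cF u0) (cw X)).
  by have := bmcD b1 (bchi (cM (@cF_ X u u0) (cw X))); congr bmc; apply/funext => x; ring.
have be : bmc (fun x => \sum_(X <- E) chi_ X x ^+ 2 * F u x ^+ 2).
  apply: bmc_sum => X; have := bchi_ X (cM (@cchi_ X) (cM (cF u0) (cF u0))); congr bmc.
  by apply/funext => x; ring.
rewrite -!(intgZ hG hmu) // -(intgD hG hmu); [|exact: bmcZ|exact: bmcZ].
apply: (le_intg hG hmu); last 1 first.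
- move=> x; rewrite !mulr_sumr -big_split /=; apply: ler_sum => X _.
  have := sqr_ge0 (2 * (chi_ X x * F u x) + chi x * F_ X u x).
  by rewrite -exprMn -[chi_ X x ^+ 2 * _]exprMn; move: (chi_ X x * _) (chi x * _) => r t; nra.
- apply: bmc_sum => X; have := bchi (cM cchi (cM (@cF_ X u u0) (@cF_ X u u0))); congr bmc.
  by apply/funext => x; ring.
- by apply: bmcD; exact: bmcZ.
Qed.

End OneSolution.

Section TwoSolutions.
Variables (F H : R -> G -> R) (F_ F__ H_ H__ : g -> R -> G -> R).
Hypothesis calF : caloric exp E F F_ F__.
Hypothesis calH : caloric exp E H H_ H__.

Let cF (u : R) : 0 < u -> continuous (F u).
Proof. by move=> u0; apply: time_slice => // x; exact: (caloric_cont calF). Qed.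
Let cF_ X (u : R) : 0 < u -> continuous (F_ X u).
Proof. by move=> u0; apply: time_slice => // x; exact: (caloric_cont1 calF). Qed.
Let cF__ X (u : R) : 0 < u -> continuous (F__ X u).
Proof. by move=> u0; apply: time_slice => // x; exact: (caloric_cont2 calF). Qed.
Let cH (u : R) : 0 < u -> continuous (H u).
Proof. by move=> u0; apply: time_slice => // x; exact: (caloric_cont calH). Qed.
Let cH_ X (u : R) : 0 < u -> continuous (H_ X u).
Proof. by move=> u0; apply: time_slice => // x; exact: (caloric_cont1 calH). Qed.
Let cH__ X (u : R) : 0 < u -> continuous (H__ X u).
Proof. by move=> u0; apply: time_slice => // x; exact: (caloric_cont2 calH). Qed.

(** Without the cutoff it would not depend on s, the Laplacian being symmetric. It stands in for the
    semigroup law and the symmetry of the kernel. *)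
Definition cross (w s : R) := intg (fun x => chi x ^+ 2 * (F s x * H (w - s) x)).
Definition cross_d (w s : R) := intg (fun x => \sum_(X <- E) 2 * (chi_ X x * chi x) *
   (F s x * H_ X (w - s) x - H (w - s) x * F_ X s x)).

Let bcross X (s t : R) : 0 < s -> 0 < t ->
  bmc (fun x => 2 * (chi_ X x * chi x) * (F s x * H_ X t x - H t x * F_ X s x)).
Proof.
move=> s0 t0; have b1 := bchi (cM (@cchi_ X) (cM (cF s0) (@cH_ X t t0))).
have b2 := bchi (cM (@cchi_ X) (cM (cH t0) (@cF_ X s s0))).
by have := bmcZ 2 (bmcB b1 b2); congr bmc; apply/funext => x; ring.
Qed.

(** Green's formula: the derivatives of chi^2 F H_X and of chi^2 H F_X integrate to 0, and in their
    difference only the terms carrying a derivative of chi survive besides the time derivative. *)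
Lemma cross_derive (w s : R) : 0 < s -> s < w -> is_derive s (1 : R) (cross w) (cross_d w s).
Proof.
move=> s0 sw; have bchi2 : bmc (fun x => chi x ^+ 2) by have := bchi cchi; congr bmc.
have ws0 : 0 < w - s by rewrite subr_gt0.
pose r := Num.min s (w - s); have r0 : 0 < r by rewrite lt_min s0.
have pos (t : R) : `|t - s| < r -> 0 < t /\ 0 < w - t.
  have r1 : r <= s by rewrite ge_min lexx.
  have r2 : r <= w - s by rewrite ge_min lexx orbT.
  by rewrite ltr_distl => /andP[h1 h2]; split; lra.
pose Dt t x := (\sum_(X <- E) F__ X t x) * H (w - t) x - F t x * \sum_(X <- E) H__ X (w - t) x.
have cS (t : R) : 0 < t -> continuous (fun x => \sum_(X <- E) F__ X t x).
  by move=> t0 x; apply: cvg_bigsum => X; have := @cF__ X t t0 x; exact.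
have cS' (t : R) : 0 < t -> continuous (fun x => \sum_(X <- E) H__ X t x).
  by move=> t0 x; apply: cvg_bigsum => X; have := @cH__ X t t0 x; exact.
have cDt (t : R) : 0 < t -> 0 < w - t -> continuous (Dt t).
  move=> t0 wt0 x; apply: cvgB.
    by have := cM (cS t t0) (cH wt0) (x := x); exact.
  by have := cM (cF t0) (cS' _ wt0) (x := x); exact.
have := @param_derive R G n A hG mu hmu s r (fun t y => F t y * H (w - t) y) Dt _ bchi2 r0 _ _ _.
have -> : cross_d w s = intg (fun y => chi y ^+ 2 * Dt s y).
  pose T1 X x := 2 * (chi_ X x * chi x) * (F s x * H_ X (w - s) x) + chi x ^+ 2 * (F_ X s x * H_ X (w - s) x + F s x * H__ X (w - s) x).
  pose T2 X x := 2 * (chi_ X x * chi x) * (H (w - s) x * F_ X s x) + chi x ^+ 2 * (H_ X (w - s) x * F_ X s x + H (w - s) x * F__ X s x).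
  have dF X := (caloric_dif calF s0).1 X.
  have dH X := (caloric_dif calH ws0).1 X.
  have i1 X : intg (T1 X) = 0.
    have := derM (derM (dchi.1 X) (dchi.1 X)) (derM (dF X) (caloric_dif2 calH X ws0)).
    move=> /(der_intg0 hG hmu hg rinv)/(_ cD) <-; last by move=> x /chiD ->; rewrite !mul0r.
    by apply: eq_Rintegral => x _; rewrite /T1; ring.
  have i2 X : intg (T2 X) = 0.
    have := derM (derM (dchi.1 X) (dchi.1 X)) (derM (dH X) (caloric_dif2 calF X s0)).
    move=> /(der_intg0 hG hmu hg rinv)/(_ cD) <-; last by move=> x /chiD ->; rewrite !mul0r.
    by apply: eq_Rintegral => x _; rewrite /T2; ring.
  have bb X k l : continuous k -> continuous l -> bmc (fun x => 2 * (chi_ X x * chi x) * k x + chi x ^+ 2 * l x).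
    move=> ck cl; have := bmcD (bmcZ 2 (bchi (cM (@cchi_ X) ck))) (bchi (cM cchi cl)).
    by congr bmc; apply/funext => x; ring.
  have bT1 X : bmc (T1 X).
    by apply: bb; [apply: cM; [exact: cF|exact: cH_]|apply: cA; apply: cM; [exact: cF_|exact: cH_|exact: cF|exact: cH__]].
  have bT2 X : bmc (T2 X).
    by apply: bb; [apply: cM; [exact: cH|exact: cF_]|apply: cA; apply: cM; [exact: cH_|exact: cF_|exact: cH|exact: cF__]].
  have iT0 : intg (fun x => \sum_(X <- E) (T1 X x - T2 X x)) = 0.
    rewrite (intg_sum hG hmu) => [|X]; last exact: bmcB.
    by rewrite big1 // => X _; rewrite (intgB hG hmu) // i1 i2 subrr.
  rewrite -[LHS]subr0 -iT0 -(intgB hG hmu); last 2 first.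
  - by apply: bmc_sum => X; exact: bcross.
  - by apply: bmc_sum => X; exact: bmcB.
  apply: eq_Rintegral => x _; rewrite /Dt mulr_suml mulr_sumr -!sumrB mulr_sumr.
  by apply: eq_bigr => X _; rewrite /T1 /T2; ring.
apply.
- move=> t y /pos[t0 wt0]; have d := caloric_dt calF y t0.
  have d1 := caloric_dt calH y wt0.
  have d2 : is_derive t (1 : R) (fun t => w - t) (- 1).
    by apply: is_derive_eq (is_deriveB (is_derive_cst w t 1) (is_derive_id t 1)) _; rewrite sub0r.
  have d3 := @is_derive1_comp R (H^~ y) (fun t => w - t) t _ _ d1 d2.
  by apply: is_derive_eq (is_deriveM d d3) _; rewrite /Dt /GRing.scale /=; ring.
- by move=> t /pos[t0 wt0]; split; [have := cM (cF t0) (cH wt0)|exact: cDt].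
move=> y.
have cw (k : R -> G -> R) : (forall (u : R) x, 0 < u -> {for (u, x), continuous (fun z => k z.1 z.2)}) ->
  {for (s, y), continuous (fun z : R * G => k (w - z.1) z.2)}.
  move=> ck; apply: (@continuous_comp _ _ _ (fun z : R * G => (w - z.1, z.2)) (fun z : R * G => k z.1 z.2)); last exact: ck.
  by apply: continuous_pair; [apply: cvgB; [exact: cvg_cst|exact: cvg_fst]|exact: cvg_snd].
apply: cvgB; apply: cvgM.
- by apply: cvg_bigsum => X; exact: (caloric_cont2 calF).
- exact: (cw _ (caloric_cont calH)).
- exact: (caloric_cont calF).
by apply: cvg_bigsum => X; apply: (cw (H__ X)) => u x u0; exact: (caloric_cont2 calH).
Qed.

(** The gradients on the right have no bound at a single time; it is their integral over time that
    the decay of the energies controls, in [flow_pairing]. *)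
Lemma cross_d_le (w s mF mH : R) : 0 < s -> s < w -> 0 <= e ->
  intg (fun x => \1_D x * F s x ^+ 2) <= mF -> intg (fun x => \1_D x * H (w - s) x ^+ 2) <= mH ->
  `|cross_d w s| <= e * (intg (fun x => \sum_(X <- E) chi x ^+ 2 * F_ X s x ^+ 2) +
     intg (fun x => \sum_(X <- E) chi x ^+ 2 * H_ X (w - s) x ^+ 2) + (size E)%:R * (mF + mH)).
Proof.
move=> s0 sw e0 hF hH; have ws0 : 0 < w - s by rewrite subr_gt0.
have bg (k : g -> G -> R) : (forall X, continuous (k X)) -> bmc (fun x => \sum_(X <- E) chi x ^+ 2 * k X x ^+ 2).
  move=> ck; apply: bmc_sum => X; have := bchi (cM cchi (cM (ck X) (ck X))); congr bmc.
  by apply/funext => x; ring.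
have b1 := bg _ (fun X => @cF_ X s s0); have b2 := bg _ (fun X => @cH_ X _ ws0).
have b3 : bmc (fun x => \1_D x * F s x ^+ 2) by apply: bmcM => //; exact: (cM (cF s0) (cF s0)).
have b4 : bmc (fun x => \1_D x * H (w - s) x ^+ 2) by apply: bmcM => //; exact: (cM (cH ws0) (cH ws0)).
have b5 : bmc (fun x => \sum_(X <- E) 2 * (chi_ X x * chi x) * (F s x * H_ X (w - s) x - H (w - s) x * F_ X s x)).
  by apply: bmc_sum => X; exact: bcross.
pose k x := e * ((\sum_(X <- E) chi x ^+ 2 * F_ X s x ^+ 2 + \sum_(X <- E) chi x ^+ 2 * H_ X (w - s) x ^+ 2) +
  (size E)%:R * (\1_D x * F s x ^+ 2 + \1_D x * H (w - s) x ^+ 2)).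
have bk : bmc k by apply: bmcZ; apply: bmcD; [exact: bmcD|apply: bmcZ; exact: bmcD].
apply: (@le_trans _ _ (intg k)); last first.
  rewrite /k !(intgZ hG hmu, intgD hG hmu) //; try by [apply: bmcD|apply: bmcZ; apply: bmcD|apply: bmcD; [exact: bmcD|apply: bmcZ; exact: bmcD]].
  by rewrite ler_wpM2l // lerD2l ler_wpM2l // lerD.
have key x : `|\sum_(X <- E) 2 * (chi_ X x * chi x) * (F s x * H_ X (w - s) x - H (w - s) x * F_ X s x)| <= k x.
  apply: le_trans (ler_norm_sum _ _ _) _.
  have -> : k x = e * ((\sum_(X <- E) (chi x ^+ 2 * F_ X s x ^+ 2 + chi x ^+ 2 * H_ X (w - s) x ^+ 2)) +
     \sum_(X <- E) (\1_D x * F s x ^+ 2 + \1_D x * H (w - s) x ^+ 2)).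
    by rewrite /k big_split /= [\sum_(X <- E) (\1_D x * _ + _)]big_const_seq count_predT iter_addr_0 mulr_natl.
  rewrite -big_split /= mulr_sumr big_seq [leRHS]big_seq; apply: ler_sum => X XE.
  have := chi_e x XE; have [xD|xD] := pselect (D x); last first.
    rewrite chiD // !mulr0 mul0r normr0 expr0n !mul0r => _.
    by rewrite mulr_ge0 // !addr_ge0 // mulr_ge0 ?sqr_ge0 // indicE.
  rewrite indicE mem_set // !mul1r !normrM ger0_norm //.
  have -> : 2 * (`|chi_ X x| * `|chi x|) * `|F s x * H_ X (w - s) x - H (w - s) x * F_ X s x| =
    `|chi_ X x| * `|2 * (F s x * (chi x * H_ X (w - s) x) - H (w - s) x * (chi x * F_ X s x))|.
    rewrite [in RHS]normrM ger0_norm //.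
    have -> : F s x * (chi x * H_ X (w - s) x) - H (w - s) x * (chi x * F_ X s x) = chi x * (F s x * H_ X (w - s) x - H (w - s) x * F_ X s x) by ring.
    by rewrite normrM; ring.
  move=> he; apply: ler_pM => //; rewrite -!exprMn.
  move: (chi x * H_ X _ x) (chi x * F_ X s x) (F s x) (H (w - s) x) => a b c d.
  have h1 := sqr_ge0 (a - c); have h2 := sqr_ge0 (a + c); have h3 := sqr_ge0 (b - d); have h4 := sqr_ge0 (b + d).
  by rewrite ler_norml; apply/andP; split; nra.
have h1 := le_intg hG hmu b5 bk (fun x => le_trans (ler_norm _) (key x)).
have h2 := le_intg hG hmu (bmcZ (-1) bk) b5 (fun x => ltac:(
  by have := key x; rewrite ler_norml mulN1r => /andP[])).
by move: h2; rewrite (intgZ hG hmu) // mulN1r => h2; rewrite ler_norml h2.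
Qed.

End TwoSolutions.
End OneCutoff.
End Energy.

(** * Differential inequalities *)

Section RealLemmas.
Variable R : realType.
Implicit Types (J : R -> R).

Lemma nonincr_of_derive J (J' : R -> R) (a b : R) : a <= b ->
  (forall u, a <= u <= b -> is_derive u (1 : R) J (J' u)) -> (forall u, a <= u <= b -> J' u <= 0) -> J b <= J a.
Proof.
rewrite le_eqVlt => /predU1P[-> //|ab] dJ J0.
have cJ : {within `[a, b], continuous J}.
  apply: derivable_within_continuous => u; rewrite in_itv /= => /dJ[]//.
have sub u : u \in `]a, b[ -> a <= u <= b by rewrite in_itv /= => /andP[h1 h2]; rewrite !ltW.
have [u uab e] := MVT ab (fun u h => dJ u (sub u h)) cJ.
by rewrite -subr_le0 e mulr_le0_ge0 ?J0 ?sub // subr_ge0 ltW.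
Qed.

(** The function e^(c (u - b)) J(u) - eps u is nonincreasing on [a, b], as its exponential factor is
    at most 1 there. *)
Lemma gronwall J (J' : R -> R) (c eps a b : R) : 0 <= c -> 0 <= eps -> a <= b ->
  (forall u, a <= u <= b -> is_derive u (1 : R) J (J' u)) ->
  (forall u, a <= u <= b -> J' u <= - c * J u + eps) ->
  J b <= expR (- (c * (b - a))) * J a + eps * (b - a).
Proof.
move=> c0 e0 ab dJ hJ.
have := @nonincr_of_derive (fun u => expR (c * (u - b)) * J u - eps * u)
  (fun u => expR (c * (u - b)) * (J' u + c * J u) - eps) a b ab _ _.
rewrite subrr mulr0 expR0 mul1r.
have -> : c * (a - b) = - (c * (b - a)) by ring.
move=> h; have {}h := h _ _; suff : J b - eps * b <= expR (- (c * (b - a))) * J a - eps * a.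
  by rewrite mulrBr; lra.
apply: h => u uab.
  have d := dJ u uab.
  have d0 : is_derive u (1 : R) (fun u => c * (u - b)) c.
    by apply: is_derive_eq (is_deriveZ c (is_deriveB (is_derive_id u 1) (is_derive_cst b u 1))) _; rewrite subr0 /GRing.scale /= mulr1.
  have d1 := @is_derive1_comp R expR (fun u => c * (u - b)) u _ _ (is_derive_expR _) d0.
  have d2 := is_deriveB (is_deriveM d1 d) (is_deriveZ eps (is_derive_id u 1)).
  by apply: is_derive_eq d2 _; rewrite /GRing.scale /=; ring.
have h1 := hJ u uab; have h2 : expR (c * (u - b)) <= 1.
  rewrite -expR0 ler_expR; have /andP[_ ub] := uab; nra.
have h3 := expR_gt0 (c * (u - b)); move: (expR _) h2 h3 => t h2 h3.
by have : t * (J' u + c * J u) <= t * eps; [rewrite ler_pM2l //; lra|nra].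
Qed.

Lemma near_div_small (K e : R) : 0 < e -> \forall m \near \oo, K / m.+1%:R <= e.
Proof.
move=> e0; have K0 : 0 < `|K| + 1 by rewrite ltr_wpDl.
have h0 : 0 < e / (`|K| + 1) by rewrite divr_gt0.
have := @near_infty_natSinv_lt R (PosNum h0); apply: filterS => m /= hm.
apply: (@le_trans _ _ ((`|K| + 1) * m.+1%:R^-1)).
  by rewrite ler_wpM2r ?invr_ge0 //; apply: le_trans (ler_norm K) _; rewrite lerDl.
by rewrite mulrC -ler_pdivlMr // ltW.
Qed.

End RealLemmas.

(** * Decay of the energy and duality *)

Section HeatFlow.
Variables (R : realType) (G : topGroupType) (n : nat) (A : set (chart R G n)).
Hypothesis hG : is_lie_group A.
Hypothesis Gc : connected [set: G].
Variable mu : {measure set (borel G) -> \bar R}.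
Hypothesis hmu : is_haar mu.
Variables (g : vectType R) (exp : g -> G) (br : g -> g -> g).
Hypothesis hg : is_lie_algebra A exp br.
Hypothesis rinv : forall x (h : G -> \bar R), measurable_fun setT (h : borel G -> \bar R) ->
  (forall x, 0 <= h x)%E -> (\int[mu]_y h (y * x)%g = \int[mu]_y h y)%E.
Variable E : seq g.
Variable K : set G.
Implicit Types (f w v : G -> R) (x y : G) (C : set G) (X Y : g) (F H : R -> G -> R).

Local Notation intg f := (\int[mu]_x f x).
Local Notation dif := (dif exp).

(** The sup bound M and the mass m serve together: M m bounds the squared L^2 norm at all times, so
    that the cutoff errors tend to 0. The final bounds depend on m alone. *)
Definition heat_flow F (M m : R) := exists (F_ F__ : g -> R -> G -> R), [/\ caloric exp E F F_ F__,
  forall u, 0 < u -> right_invariant K (F u), forall u x, 0 < u -> 0 <= F u x <= M,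
  0 <= M /\ 0 <= m & forall u, 0 < u -> (\int[mu]_x (F u x)%:E = m%:E)%E].

Lemma flow_cont F (M m : R) (u : R) : heat_flow F M m -> 0 < u -> continuous (F u).
Proof. by move=> [F_ [F__ [cal _ _ _ _]]] u0; apply: time_slice => // x; exact: (caloric_cont cal). Qed.

Lemma flow_mass F (M m : R) w (u : R) : heat_flow F M m -> 0 < u -> bmc w -> (forall x, w x <= 1) ->
  intg (fun x => w x * F u x) <= m.
Proof.
move=> hF u0 bw w1; have cF := flow_cont hF u0; have [F_ [F__ [_ _ FM _ Fm]]] := hF.
have F0 x : 0 <= F u x by have /andP[] := FM u x u0.
rewrite -lee_fin -(Fm u u0) -(EFin_intg hG hmu (bmcM bw cF)).
have mF : measurable_fun setT (fun x : borel G => (F u x)%:E) by apply: measurable_EFinG; exact: continuous_borel.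
have iF : mu.-integrable setT (fun x : borel G => (F u x)%:E).
  apply/integrableP; split=> //.
  by under eq_integral => x _ do rewrite gee0_abs ?lee_fin //; rewrite (Fm u u0) ltry.
apply: le_integral => //; first exact: (bmc_integrable hG hmu (bmcM bw cF)).
by move=> x _; rewrite lee_fin ler_piMl.
Qed.

Lemma flow_sqr F (M m : R) w (u : R) : heat_flow F M m -> 0 < u -> bmc w -> (forall x, 0 <= w x <= 1) ->
  intg (fun x => w x * F u x ^+ 2) <= M * m.
Proof.
move=> hF u0 bw w01; have cF := flow_cont hF u0; have [F_ [F__ [_ _ FM [M0 m0] Fm]]] := hF.
apply: (@le_trans _ _ (M * intg (fun x => w x * F u x))); last first.
  by rewrite ler_wpM2l // (flow_mass hF) // => x; have /andP[] := w01 x.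
have b1 := bmcM bw cF; rewrite -(intgZ hG hmu) //; apply: (le_intg hG hmu).
- by have := bmcM b1 cF; congr bmc; apply/funext => x; rewrite -mulrA.
- exact: bmcZ.
move=> x; have /andP[h1 h2] := FM u x u0; have /andP[h3 _] := w01 x.
by rewrite [leRHS]mulrCA expr2 ler_wpM2l // ler_wpM2r.
Qed.

Variables (c : R) (chi : nat -> G -> R) (chi_ : nat -> g -> G -> R) (D : nat -> set G).
Hypothesis c0 : 0 <= c.
Hypothesis hchi : forall m, [/\ dif (chi m) (chi_ m), right_invariant K (chi m), compact (D m) & forall x, ~ D m x -> chi m x = 0].
Hypothesis chi01 : forall m x, 0 <= chi m x <= 1.
Hypothesis chi_le : forall m X x, X \in E -> `|chi_ m X x| <= c / m.+1%:R.
Hypothesis chi1 : forall L, compact L -> \forall m \near \oo, forall x, L x -> chi m x = 1.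

Let e m : R := c / m.+1%:R.
Let e0 m : 0 <= e m. Proof. by rewrite divr_ge0. Qed.
Let ec m : e m <= c. Proof. by rewrite ler_pdivrMr // ler_peMr // ler1n. Qed.
Let bchi m : bmc (chi m).
Proof. by have [[dc _] _ cD chiD] := hchi m; have [cc _ _] := dc 0; exact: bmc_cont cc cD chiD. Qed.
Let cchi m : continuous (chi m). Proof. by have [[dc _] _ _ _] := hchi m; have [] := dc 0. Qed.
Let bD m : bmc (\1_(D m) : G -> R).
Proof. by have [_ _ cD _] := hchi m; exact: (indic_bmc R (compact_borel hG cD) cD (fun x => id)). Qed.
Let i01 m x : 0 <= (\1_(D m) x : R) <= 1.
Proof. by rewrite indicE; case: (_ \in _); rewrite ?lexx ler01. Qed.

Let err_le m F (F_ F__ : g -> R -> G -> R) (u M k : R) : caloric exp E F F_ F__ -> heat_flow F M k -> 0 < u ->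
  energy_err mu E (chi_ m) F u <= (size E)%:R * e m ^+ 2 * (M * k).
Proof.
move=> cal hF u0; have [dc cK cD chiD] := hchi m.
by apply: (energy_err_le hG hmu hg dc cD chiD (@chi_le m) cal u0); exact: (flow_sqr hF u0 (bD m) (@i01 m)).
Qed.

Let bchi2 m : bmc (fun x => chi m x ^+ 2).
Proof. by have := bmcM (bchi m) (@cchi m); congr bmc. Qed.

Lemma energy_le m F (M k u : R) : heat_flow F M k -> 0 < u -> energy mu (chi m) F u <= M * k.
Proof.
move=> hF u0; apply: (flow_sqr hF u0) => // x; have /andP[h1 h2] := chi01 m x.
by rewrite sqr_ge0 expr_le1.
Qed.

(* The cutoffs [chi m] tend to 1, so that [a] bounds the squared L^2 norm of [F u]. *)
Definition energy_bound F (u a : R) := forall eps, 0 < eps -> \forall m \near \oo, energy mu (chi m) F u <= a + eps.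

(** The common form J' <= - q (J - b) + O(1/m) of the two decay mechanisms: b = 0 and q twice the
    gap, or b = k^2 / V and q = 1 / (e s^2) from a ball of radius s and volume at least V. *)
Lemma energy_bound_step F (M k u1 u2 q b a : R) : heat_flow F M k -> 0 < u1 -> u1 <= u2 -> 0 <= q ->
  (forall m (F_ F__ : g -> R -> G -> R) u, caloric exp E F F_ F__ -> 0 < u -> q * (energy mu (chi m) F u - b) <= 2 * energy_grad mu E (chi m) (chi_ m) F F_ u) ->
  0 <= b -> energy_bound F u1 a -> energy_bound F u2 (b + expR (- (q * (u2 - u1))) * a).
Proof.
move=> hF u10 u12 q0 hq b0 ha eps eps0; have [F_ [F__ [cal FK FM [M0 k0] Fk]]] := hF.
set t := expR _; have t0 : 0 < t by exact: expR_gt0.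
have t1 : t <= 1 by rewrite -expR0 ler_expR oppr_le0 mulr_ge0 // subr_ge0.
pose C := 2 * (size E)%:R * c * c * (M * k) * (u2 - u1).
have e20 : 0 < eps / 2 by rewrite divr_gt0.
have := ha (eps / 2) e20; apply: filterS2 (near_div_small C e20) => m hC hm.
have [dc cK cD chiD] := hchi m.
have pos u : u1 <= u <= u2 -> 0 < u by move=> /andP[h _]; exact: lt_le_trans u10 h.
pose ep := 2 * ((size E)%:R * e m ^+ 2 * (M * k)).
have ep0 : 0 <= ep by rewrite !mulr_ge0 ?sqr_ge0.
have dJ u : u1 <= u <= u2 -> is_derive u (1 : R) (fun u => energy mu (chi m) F u - b)
   (- 2 * energy_grad mu E (chi m) (chi_ m) F F_ u + 2 * energy_err mu E (chi_ m) F u).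
  move=> /pos u0; have d := energy_derive hG hmu hg rinv dc cD chiD cal u0.
  by apply: is_derive_eq (is_deriveB d (is_derive_cst b u 1)) _; rewrite subr0.
have := gronwall q0 ep0 u12 dJ.
rewrite -/t => h.
have {}h : energy mu (chi m) F u2 - b <= t * (energy mu (chi m) F u1 - b) + ep * (u2 - u1).
  apply: h => u uu; have u0 := pos u uu.
  have := hq m F_ F__ u cal u0; have := err_le m cal hF u0; rewrite /ep; lra.
have hep : ep * (u2 - u1) <= C / m.+1%:R.
  have -> : C / m.+1%:R = 2 * ((size E)%:R * (c * e m) * (M * k)) * (u2 - u1) by rewrite /C /e; ring.
  rewrite ler_wpM2r ?subr_ge0 // /ep ler_wpM2l // ler_wpM2r ?mulr_ge0 // ler_wpM2l // expr2 ler_wpM2r //.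
move: hm hC hep h; move: (energy mu _ F u1) (energy mu _ F u2) (ep * _) (C / _) => j1 j2 x y h1 h2 h3 h4.
have : t * (j1 - b) <= t * a + eps / 2 by nra.
lra.
Qed.

Lemma energy_bound_gap F (lam M k u1 u2 a : R) : heat_flow F M k -> 0 < u1 -> u1 <= u2 -> 0 <= lam ->
  (forall v (v_ : g -> G -> R) C, dif v v_ -> compact C -> (forall x, ~ C x -> v x = 0) ->
     lam * intg (fun x => v x ^+ 2) <= intg (fun x => \sum_(X <- E) v_ X x ^+ 2)) ->
  energy_bound F u1 a -> energy_bound F u2 (expR (- (2 * lam * (u2 - u1))) * a).
Proof.
move=> hF u10 u12 lam0 gap ha; rewrite -[expR _ * a]add0r.
apply: (energy_bound_step hF u10 u12) ha => //; first exact: mulr_ge0.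
move=> m F_ F__ u cal u0; have [dc cK cD chiD] := hchi m; rewrite subr0 -mulrA ler_wpM2l //.
have -> : energy mu (chi m) F u = intg (fun x => (chi m x * F u x) ^+ 2) by apply: eq_Rintegral => x _; rewrite exprMn.
apply: (gap _ _ (D m) (difM dc (caloric_dif cal u0)) cD) => x /chiD ->; by rewrite mul0r.
Qed.

Lemma energy_bound_nash F (B : set G) (s V M k u1 u2 a : R) : heat_flow F M k -> 0 < u1 -> u1 <= u2 -> 0 < s -> 0 < V ->
  measurable (B : set (borel G)) -> (mu B < +oo)%E -> V <= fine (mu B) ->
  (forall y, B y -> exists (c : g -> R) k, [/\ K k, y = (exp (\sum_(Y <- E) c Y *: Y) * k)%g & \sum_(Y <- E) c Y ^+ 2 <= s ^+ 2]) ->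
  energy_bound F u1 a -> energy_bound F u2 (k ^+ 2 / V + expR (- ((u2 - u1) / (expR 1 * s ^+ 2))) * a).
Proof.
move=> hF u10 u12 s0 V0 mB fB VB hB ha; have [_ [_ [_ FK FM [M0 k0] _]]] := hF.
have se0 : 0 < expR 1 * s ^+ 2 by rewrite mulr_gt0 ?expR_gt0 ?exprn_gt0.
rewrite [(u2 - u1) / _]mulrC; apply: (energy_bound_step hF u10 u12) ha.
- by rewrite invr_ge0 ltW.
- move=> m F_ F__ u cal u0; have [dc cK cD chiD] := hchi m.
  have F0 x : 0 <= F u x by have /andP[] := FM u x u0.
  have := energy_nash hG Gc hmu hg rinv dc cD chiD (@chi01 m) cal u0 cK (FK u u0) F0 mB fB hB.
  have : intg (fun x => chi m x * F u x) ^+ 2 <= k ^+ 2.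
    rewrite ler_sqr ?nnegrE //; last by apply: intg_ge0 => x; rewrite mulr_ge0 //; have /andP[] := chi01 m x.
    by apply: (flow_mass hF u0 (bchi m)) => x; have /andP[] := chi01 m x.
  have Dn0 : 0 <= energy_grad mu E (chi m) (chi_ m) F F_ u.
    by apply: intg_ge0 => x; apply: sumr_ge0 => X _; exact: sqr_ge0.
  have := VB; rewrite [(expR 1 * _)^-1 * _]mulrC ler_pdivrMr // [expR 1 * (_ * _)]mulrA; move: se0 Dn0.
  move: (energy mu _ F u) (energy_grad mu E _ _ F F_ u) (fine _) => J Dn W; move: (expR 1 * s ^+ 2) => q q0 Dn0 VW h1 h2.
  have h3 : W * (J - q * Dn) <= k ^+ 2 by exact: le_trans h2 h1.
  have W0 : 0 < W by exact: lt_le_trans V0 VW.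
  have h4 : J - q * Dn <= k ^+ 2 / V.
    have [neg|nneg] := leP (J - q * Dn) 0; first by apply: le_trans neg _; rewrite divr_ge0 ?sqr_ge0 // ltW.
    by rewrite ler_pdivlMr //; apply: le_trans h3; rewrite mulrC ler_wpM2r // ltW.
  have : 0 <= q * Dn by rewrite mulr_ge0 // ltW.
  by move: h4; move: (k ^+ 2 / V) => r; nra.
- by rewrite divr_ge0 ?sqr_ge0 // ltW.
Qed.

Section Balls.
Variables (B : R -> set G) (c1 s0 : R) (d : nat).
Hypothesis c10 : 0 < c1.
Hypothesis s00 : 0 < s0.
Hypothesis hB : forall s, 0 < s -> s <= s0 -> [/\ measurable (B s : set (borel G)), (mu (B s) < +oo)%E,
  c1 * s ^+ d <= fine (mu (B s)) &
  forall y, B s y -> exists (c : g -> R) k, [/\ K k, y = (exp (\sum_(Y <- E) c Y *: Y) * k)%g & \sum_(Y <- E) c Y ^+ 2 <= s ^+ 2]].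

Lemma energy_bound_weaken F (u a b : R) : energy_bound F u a -> a <= b -> energy_bound F u b.
Proof. by move=> ha ab eps e1; apply: filterS (ha eps e1) => m; lra. Qed.

(* Nash's argument: with balls of radius proportional to u, the factor
   contracting the energy from time u/2 to u beats the growth of u ^- d. *)
Lemma energy_bound_small : exists C us : R, [/\ 0 < C, 0 < us & forall F (M k u : R), heat_flow F M k ->
  0 < u -> u <= us -> energy_bound F u (C * k ^+ 2 / u ^+ d)].
Proof.
(* With s = kap u the exponent (u/2) / (e s^2) is at least 2^(d+1) for u <= 1, so the contraction
   factor is at most 2^-(d+1), half of what replacing u by u/2 costs in u^-d. *)
pose kap : R := (2 ^+ d.+1 * expR 1)^-1.
have E1 := expR_gt1 (1 : R); rewrite ltr01 in E1.
have E0 : 0 < expR 1 :> R by exact: expR_gt0.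
have D0 : 0 < 2 ^+ d.+1 :> R by rewrite exprn_gt0.
have kap0 : 0 < kap by rewrite invr_gt0 mulr_gt0.
have kap1 : kap <= 1.
  by rewrite invf_le1 ?mulr_gt0 //; apply: mulr_ege1; [apply: exprn_ege1; rewrite ler1n|exact: ltW].
pose C0 := (c1 * kap ^+ d)^-1; have C00 : 0 < C0 by rewrite invr_gt0 mulr_gt0 // exprn_gt0.
exists (2 * C0), (Num.min 1 s0); split; [by rewrite mulr_gt0|by rewrite lt_min ltr01|].
move=> F M k u hF; move: (hF) => [_ [_ [_ _ _ [M0 k0] _]]].
have Mk0 : 0 <= M * k by exact: mulr_ge0.
(* Start from the trivial bound M k at time u / 2^j; each doubling of the time halves its share
   relative to u^-d. For j large only the term with k^2 remains, free of M. *)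
have step j : forall u, 0 < u -> u <= Num.min 1 s0 ->
  energy_bound F u ((2 * C0 * k ^+ 2 + M * k * (u ^+ d / 2 ^+ j)) / u ^+ d).
  elim: j => [|j IH] {}u u0 us.
    move=> eps e1; apply: nearW => m; apply: le_trans (energy_le m hF u0) _.
    have ud : 0 < u ^+ d by rewrite exprn_gt0.
    rewrite expr0 divr1 mulrDl mulfK ?gt_eqF //.
    have : 0 <= 2 * C0 * k ^+ 2 / u ^+ d.
      by apply: divr_ge0; [rewrite mulr_ge0 ?sqr_ge0 // mulr_ge0 // ltW|exact: ltW].
    lra.
  have u20 : 0 < u / 2 by rewrite divr_gt0.
  have u2u : u / 2 <= u by rewrite ler_pdivrMr // ler_peMr ?ler1n // ltW.
  have {}IH := IH (u / 2) u20 (le_trans u2u us).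
  have [u1 us0] : u <= 1 /\ u <= s0 by move: us; rewrite le_min => /andP[].
  pose s := kap * u; have s_0 : 0 < s by rewrite mulr_gt0.
  have ss0 : s <= s0 by apply: le_trans us0; rewrite ler_piMl // ltW.
  have [mB fB VB discB] := hB s_0 ss0.
  have V0 : 0 < c1 * s ^+ d by rewrite mulr_gt0 // exprn_gt0.
  have ud : 0 < u ^+ d by rewrite exprn_gt0.
  have := energy_bound_nash hF u20 u2u s_0 V0 mB fB VB discB IH.
  move=> h; apply: energy_bound_weaken h _.
  have -> : k ^+ 2 / (c1 * s ^+ d) = C0 * k ^+ 2 / u ^+ d.
    by rewrite /s /C0 exprMn; field; rewrite !gt_eqF // exprn_gt0.
  have ex : expR (- ((u - u / 2) / (expR 1 * s ^+ 2))) <= (2 ^+ d.+1)^-1.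
    set z := _ / (expR 1 * _); rewrite expRN lef_pV2 ?posrE ?expR_gt0 //.
    apply: le_trans (expR_ge1Dx z).
    have -> : z = (2 ^+ d.+1 * expR 1 * 2 ^+ d.+1) / (2 * u).
      by rewrite /z /s /kap; field; rewrite !gt_eqF.
    rewrite -[leLHS]add0r lerD // ler_pdivlMr ?mulr_gt0 // -[leRHS]mulrA ler_wpM2l ?(ltW D0) //.
    apply: (@le_trans _ _ (1 * 2 ^+ d.+1)); last by rewrite ler_wpM2r // ltW.
    rewrite mul1r exprS; apply: (@le_trans _ _ (2 * 1)); first by rewrite ler_wpM2l.
    by rewrite ler_wpM2l // exprn_ege1 // ler1n.
  set X := expR _ in ex *; set Y := (2 * C0 * k ^+ 2 + M * k * ((u / 2) ^+ d / 2 ^+ j)) / (u / 2) ^+ d.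
  have Y0 : 0 <= Y.
    rewrite /Y divr_ge0 ?exprn_ge0 // ?(ltW u20) // addr_ge0 ?mulr_ge0 ?sqr_ge0 ?divr_ge0 ?exprn_ge0 //.
    - exact: ltW.
    - exact: ltW.
  apply: (@le_trans _ _ (C0 * k ^+ 2 / u ^+ d + (2 ^+ d.+1)^-1 * Y)).
    by rewrite lerD2l ler_wpM2r.
  have D1 : 0 < 2 ^+ d :> R by rewrite exprn_gt0.
  have D2 : 0 < 2 ^+ j :> R by rewrite exprn_gt0.
  apply: (@le_trans _ _ (C0 * k ^+ 2 / u ^+ d + (2 ^+ d.+1)^-1 * ((2 * C0 * k ^+ 2 + M * k * (u ^+ d / 2 ^+ j)) / (u / 2) ^+ d))).
    rewrite lerD2l ler_wpM2l ?invr_ge0 ?(ltW D0) // ler_wpM2r ?invr_ge0 ?exprn_ge0 ?(ltW u20) // lerD2l ler_wpM2l //.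
    by rewrite ler_wpM2r ?invr_ge0 ?(ltW D2) // lerXn2r ?nnegrE // ltW.
  rewrite le_eqVlt; apply/orP; left; apply/eqP; rewrite !exprMn !exprVn !(exprS 2).
  by field; rewrite !gt_eqF.
move=> u0 us eps e1; have ud : 0 < u ^+ d by rewrite exprn_gt0.
have [j hj] : exists j : nat, M * k / 2 ^+ j <= eps / 2.
  have e20 : 0 < eps / 2 by rewrite divr_gt0.
  have [j _ hj] := near_div_small (M * k) e20; exists j; apply: le_trans (hj j _) => //=.
  rewrite ler_wpM2l // lef_pV2 ?posrE ?exprn_gt0 // -natrX ler_nat; exact: ltn_expl.
have e20 : 0 < eps / 2 by rewrite divr_gt0.
apply: filterS (step j u u0 us (eps / 2) e20) => m; rewrite mulrDl.
have -> : M * k * (u ^+ d / 2 ^+ j) / u ^+ d = M * k / 2 ^+ j.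
  by field; rewrite !gt_eqF // exprn_gt0.
lra.
Qed.

End Balls.

(** The left side is the limit of [cross] as s tends to 0; [cross] barely changes up to s = w / 2,
    where the energies of F and H bound it. *)
Lemma flow_pairing F H f (MF kF MH kH w a : R) C : heat_flow F MF kF -> heat_flow H MH kH ->
  continuous f -> compact C -> (forall x, ~ C x -> f x = 0) ->
  (forall x, F s x @[s --> 0^'+] --> f x) -> 0 < w -> 0 < kF -> 0 < kH ->
  energy_bound F (w / 2) (a * kF ^+ 2) -> energy_bound H (w / 2) (a * kH ^+ 2) ->
  intg (fun x => f x * H w x) <= a * kF * kH.
Proof.
move=> hF hH cf cC fC F0 w0 kF0 kH0 eF eH.
have [F_ [F__ [calF FK FM [MF0 _] Fk]]] := hF; have [H_ [H__ [calH HK HM [MH0 _] Hk]]] := hH.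
have w20 : 0 < w / 2 by rewrite divr_gt0.
have w2w : w / 2 < w by rewrite ltr_pdivrMr // ltr_pMr // ltr1n.
pose nE : R := (size E)%:R; have nE0 : 0 <= nE by rewrite ler0n.
pose K0 := (4 * nE * c * c + nE) * (MF * kF + MH * kH).
have P0 : 0 <= MF * kF + MH * kH by rewrite addr_ge0 // mulr_ge0 // ltW.
have K00 : 0 <= K0 by rewrite mulr_ge0 // addr_ge0 // !mulr_ge0.
pose K1 := MF * kF + MH * kH + K0 * w.
have mono m s1 : 0 < s1 -> s1 <= w / 2 ->
  cross mu (chi m) F H w s1 <= cross mu (chi m) F H w (w / 2) + e m * K1.
  move=> s10 s1w; have [dc cK cD chiD] := hchi m.
  pose JF := energy mu (chi m) F; pose JH := energy mu (chi m) H.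
  pose JF' u := - 2 * energy_grad mu E (chi m) (chi_ m) F F_ u + 2 * energy_err mu E (chi_ m) F u.
  pose JH' u := - 2 * energy_grad mu E (chi m) (chi_ m) H H_ u + 2 * energy_err mu E (chi_ m) H u.
  have dJF (u : R) : 0 < u -> is_derive u (1 : R) JF (JF' u) by exact: (energy_derive hG hmu hg rinv dc cD chiD calF).
  have dJH (u : R) : 0 < u -> is_derive u (1 : R) JH (JH' u) by exact: (energy_derive hG hmu hg rinv dc cD chiD calH).
  pose N := cross mu (chi m) F H w.
  pose N' := cross_d mu E (chi m) (chi_ m) F H F_ H_ w.
  (* Along s the energy of F falls and that of s |-> H (w - s) rises. Weighted by e m, these changes
     pay for the gradients in [cross_d_le], while K0 covers the remaining bounded terms. *)
  have := @nonincr_of_derive R (fun s => - N s + e m * (JF s - JH (w - s) - K0 * s))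
    (fun s => - N' s + e m * (JF' s + JH' (w - s) - K0)) s1 (w / 2) s1w _ _.
  move=> h; have {}h := h _ _.
  have hJF := energy_le m hF s10; have hJH := energy_le m hH w20.
  have JF2 : 0 <= JF (w / 2) by apply: intg_ge0 => x; rewrite mulr_ge0 ?sqr_ge0.
  have JH1 : 0 <= JH (w - s1) by apply: intg_ge0 => x; rewrite mulr_ge0 ?sqr_ge0.
  have : - N (w / 2) + e m * (JF (w / 2) - JH (w - w / 2) - K0 * (w / 2)) <= - N s1 + e m * (JF s1 - JH (w - s1) - K0 * s1).
    apply: h => s /andP[s1s sw]; have s_0 : 0 < s by exact: lt_le_trans s10 s1s.
      have ws0 : 0 < w - s by rewrite subr_gt0; exact: le_lt_trans sw w2w.
      have dN := cross_derive hG hmu hg rinv dc cD chiD calF calH s_0 (le_lt_trans sw w2w).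
      have d2 : is_derive s (1 : R) (fun t => w - t) (- 1).
        by apply: is_derive_eq (is_deriveB (is_derive_cst w s 1) (is_derive_id s 1)) _; rewrite sub0r.
      have d3 := @is_derive1_comp R JH (fun t => w - t) s _ _ (dJH _ ws0) d2.
      have d4 := is_deriveB (is_deriveB (dJF _ s_0) d3) (is_deriveZ K0 (is_derive_id s 1)).
      apply: is_derive_eq (is_deriveD (is_deriveN dN) (is_deriveZ (e m) d4)) _.
      change (- N' s + e m * (JF' s - JH' (w - s) * -1 - K0 * 1) = - N' s + e m * (JF' s + JH' (w - s) - K0)).
      by ring.
    have sw' := le_lt_trans sw w2w; have ws0 : 0 < w - s by rewrite subr_gt0.
    have := cross_d_le hG hmu dc cD chiD (@chi_le m) calF calH s_0 sw' (e0 m)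
      (flow_sqr hF s_0 (bD m) (@i01 m)) (flow_sqr hH ws0 (bD m) (@i01 m)).
    have := grad_le hG hmu hg dc cD chiD calF s_0; have := grad_le hG hmu hg dc cD chiD calH ws0.
    have := err_le m calF hF s_0; have := err_le m calH hH ws0.
    rewrite -/(N' s) /JF' /JH' ler_norml -/nE.
    rewrite -/(e m); set gF := \int[mu]_x \sum_(X <- E) _ * F_ X s x ^+ 2; set gH := \int[mu]_x _.
    set dF := energy_grad _ _ _ _ F _ _; set dH := energy_grad _ _ _ _ H _ _.
    set rF := energy_err _ _ _ F _; set rH := energy_err _ _ _ H _.
    move=> h1 h2 h3 h4 /andP[h5 _].
    have ee : nE * e m ^+ 2 <= nE * c * c by rewrite -mulrA ler_wpM2l // expr2 ler_pM.
    have h1' : rH <= nE * c * c * (MH * kH) by apply: le_trans h1 _; rewrite ler_wpM2r // mulr_ge0 // ltW.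
    have h2' : rF <= nE * c * c * (MF * kF) by apply: le_trans h2 _; rewrite ler_wpM2r // mulr_ge0 // ltW.
    have : e m * (gF + gH + nE * (MF * kF + MH * kH)) <= e m * (2 * dF - 2 * rF + (2 * dH - 2 * rH) + K0).
      by rewrite ler_wpM2l // /K0; lra.
    by move: h5; lra.
  have -> : w - w / 2 = w / 2 by lra.
  have Kw : K0 * (w / 2) <= K0 * w by rewrite ler_wpM2l // ltW.
  have Ks : 0 <= K0 * s1 by rewrite mulr_ge0 // ltW.
  rewrite -/(JF s1) -/(JH _) -/(N _) in hJF hJH *.
  have : e m * (JF s1 - JH (w - s1) - K0 * s1 - (JF (w / 2) - JH (w / 2) - K0 * (w / 2))) <= e m * K1.
    apply: ler_wpM2l => //; rewrite /K1; lra.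
  by rewrite -/(N (w / 2)) mulrBr; lra.
have lim_cross m : cross mu (chi m) F H w (w / 2 / j.+1%:R) @[j --> \oo] --> intg (fun x => chi m x ^+ 2 * (f x * H w x)).
  pose sq j : R := w / 2 / j.+1%:R.
  have sq0 j : 0 < sq j by rewrite divr_gt0.
  have sqw j : sq j < w.
    by apply: le_lt_trans w2w; rewrite ler_pdivrMr // ler_peMr ?ler1n // ltW.
  have ws0 j : 0 < w - sq j by rewrite subr_gt0.
  have sq_cvg : sq j @[j --> \oo] --> 0^'+.
    move=> P [r /= r0 hP]; have r20 : 0 < r / 2 by rewrite divr_gt0.
    apply: filterS (near_div_small (w / 2) r20) => j hj; apply: hP => /=; last exact: sq0.
    rewrite sub0r normrN gtr0_norm //; apply: le_lt_trans hj _.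
    by rewrite ltr_pdivrMr // ltr_pMr // ltr1n.
  have sq_cvg0 : sq j @[j --> \oo] --> (0 : R).
    by move=> P hP; apply: sq_cvg; exact: cvg_at_right_filter hP.
  pose q j x := chi m x ^+ 2 * (F (sq j) x * H (w - sq j) x).
  pose q0 x := chi m x ^+ 2 * (f x * H w x).
  have cMM (k l : G -> R) : continuous k -> continuous l -> continuous (fun x => k x * l x).
    by move=> ck cl x; apply: cvgM; [exact: ck|exact: cl].
  have bq j : bmc (q j) by apply: bmcM => //; apply: cMM; [exact: (flow_cont hF)|exact: (flow_cont hH)].
  have bq0 : bmc q0 by apply: bmcM => //; apply: cMM => //; exact: (flow_cont hH).
  have := @dominated_cvg _ _ _ mu setT measurableT (fun j x => (q j x)%:E) (fun x => (q0 x)%:E)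
    (fun x => (MF * MH * \1_(D m) x)%:E) _ _ _ _ _.
  move=> h; suff : (\int[mu]_x (q j x)%:E)%E @[j --> \oo] --> (\int[mu]_x (q0 x)%:E)%E.
    rewrite (EFin_intg hG hmu bq0); under eq_cvg => j do rewrite (EFin_intg hG hmu (bq j)).
    by move/fine_cvg.
  apply: h => //.
  - by move=> j; apply: measurable_EFinG; case: (bq j).
  - move=> x _; apply: cvg_EFin; first exact: nearW.
    apply: cvgM; first exact: cvg_cst.
    apply: cvgM; first exact: (cvg_comp _ _ sq_cvg (F0 x)).
    have ch : {for w, continuous (fun s : R => H s x)}.
      apply: (@continuous_comp _ _ _ (fun s : R => (s, x)) (fun z : R * G => H z.1 z.2)); last exact: (caloric_cont calH).
      by apply: continuous_pair; [exact: cvg_id|exact: cvg_cst].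
    apply: (cvg_comp (fun j => w - sq j) (fun s : R => H s x)); last exact: ch.
    have : w - sq j @[j --> \oo] --> w - 0 by apply: cvgB; [exact: cvg_cst|exact: sq_cvg0].
    by rewrite subr0.
  - by apply: (bmc_integrable hG hmu); exact: bmcZ.
  move=> j x _; have [_ _ _ chiD] := hchi m; rewrite /= lee_fin /q indicE.
  have [/set_mem Dx|xD] := boolP (x \in D m); last first.
    by rewrite chiD ?expr0n ?mul0r ?normr0 ?mulr0 // => Dx; move: xD; rewrite notin_setE.
  have /andP[f0 f1] := FM _ x (sq0 j); have /andP[h0 h1] := HM _ x (ws0 j).
  rewrite mulr1 ger0_norm; last by rewrite mulr_ge0 ?sqr_ge0 // mulr_ge0.
  have /andP[x0 x1] := chi01 m x.
  rewrite -[leRHS]mul1r; apply: ler_pM; rewrite ?sqr_ge0 ?mulr_ge0 ?expr_le1 //.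
  exact: ler_pM.
have amgm m (t : R) : 0 < t -> cross mu (chi m) F H w (w / 2) <=
    (t * energy mu (chi m) F (w / 2) + t^-1 * energy mu (chi m) H (w / 2)) / 2.
  move=> t0; have cF := flow_cont hF w20; have cH := flow_cont hH w20.
  have bF : bmc (fun x => chi m x ^+ 2 * F (w / 2) x ^+ 2).
    by have := bmcM (bmcM (bchi2 m) cF) cF; congr bmc; apply/funext => x; ring.
  have bH : bmc (fun x => chi m x ^+ 2 * H (w / 2) x ^+ 2).
    by have := bmcM (bmcM (bchi2 m) cH) cH; congr bmc; apply/funext => x; ring.
  have bFH : bmc (fun x => chi m x ^+ 2 * (F (w / 2) x * H (w / 2) x)).
    by have := bmcM (bmcM (bchi2 m) cF) cH; congr bmc; apply/funext => x; ring.
  have -> : cross mu (chi m) F H w (w / 2) = intg (fun x => chi m x ^+ 2 * (F (w / 2) x * H (w / 2) x)).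
    by rewrite /cross; have -> : w - w / 2 = w / 2 by lra.
  have -> : (t * energy mu (chi m) F (w / 2) + t^-1 * energy mu (chi m) H (w / 2)) / 2 =
    intg (fun x => 2^-1 * (t * (chi m x ^+ 2 * F (w / 2) x ^+ 2) + t^-1 * (chi m x ^+ 2 * H (w / 2) x ^+ 2))).
    rewrite (intgZ hG hmu); last by apply: bmcD; exact: bmcZ.
    by rewrite (intgD hG hmu) ?(intgZ hG hmu) //; [exact: mulrC|exact: bmcZ|exact: bmcZ].
  apply: (le_intg hG hmu) => //; first by apply: bmcZ; apply: bmcD; exact: bmcZ.
  move=> x; move: (F _ x) (H _ x) => p q.
  have -> : 2^-1 * (t * (chi m x ^+ 2 * p ^+ 2) + t^-1 * (chi m x ^+ 2 * q ^+ 2)) = chi m x ^+ 2 * ((t * p ^+ 2 + t^-1 * q ^+ 2) / 2) by ring.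
  rewrite ler_wpM2l ?sqr_ge0 //.
  have := sqr_ge0 (t * p - q); have -> : t * p ^+ 2 + t^-1 * q ^+ 2 = (t ^+ 2 * p ^+ 2 + q ^+ 2) / t by field; rewrite gt_eqF.
  by rewrite mulrAC ler_pdivlMr // => h; nra.
apply/ler_addgt0Pl => eps eps0.
(* The weight that balances the two energies: t kF^2 = kH^2 / t = kF kH. *)
pose t := kH / kF; have t0 : 0 < t by rewrite divr_gt0.
pose d := Num.min (eps / (2 * t)) (eps * t / 2).
have d0 : 0 < d by rewrite lt_min; apply/andP; split; apply: divr_gt0 => //; exact: mulr_gt0.
have e20 : 0 < eps / 2 by rewrite divr_gt0.
have [] := @filter_ex _ \oo _ _ (filterI (filterI (eF d d0) (eH d d0)) (filterI (near_div_small (c * K1) e20) (chi1 cC))).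
move=> m [[h1 h2] [h3 h4]].
have -> : intg (fun x => f x * H w x) = intg (fun x => chi m x ^+ 2 * (f x * H w x)).
  apply: eq_Rintegral => x _; have [Cx|/fC ->] := pselect (C x); last by rewrite !mul0r mulr0.
  by rewrite h4 // expr1n mul1r.
apply: (@le_trans _ _ (cross mu (chi m) F H w (w / 2) + e m * K1)).
  have cl := lim_cross m; rewrite -(cvg_lim (@Rhausdorff R) cl); apply: limr_le; first by apply/cvg_ex; eexists; exact: cl.
  apply: nearW => j; apply: mono; first by rewrite divr_gt0.
  by rewrite ler_pdivrMr // ler_peMr ?ler1n // ltW.
have h5 := amgm m t t0.
have h6 : e m * K1 <= eps / 2 by have -> : e m * K1 = c * K1 / m.+1%:R by rewrite /e; ring.
have d1 : t * d <= eps / 2.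
  apply: (@le_trans _ _ (t * (eps / (2 * t)))); first by rewrite ler_wpM2l ?ge_min ?lexx // ltW.
  by rewrite le_eqVlt; apply/orP; left; apply/eqP; field; rewrite gt_eqF.
have d2 : t^-1 * d <= eps / 2.
  apply: (@le_trans _ _ (t^-1 * (eps * t / 2))); first by rewrite ler_wpM2l ?ge_min ?lexx ?orbT // invr_ge0 ltW.
  by rewrite le_eqVlt; apply/orP; left; apply/eqP; field; rewrite gt_eqF.
have h7 : t * energy mu (chi m) F (w / 2) <= t * (a * kF ^+ 2 + d) by rewrite ler_wpM2l // ltW.
have h8 : t^-1 * energy mu (chi m) H (w / 2) <= t^-1 * (a * kH ^+ 2 + d) by rewrite ler_wpM2l // invr_ge0 ltW.
have e1 : t * (a * kF ^+ 2) = a * kF * kH by rewrite /t; field; rewrite gt_eqF.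
have e2 : t^-1 * (a * kH ^+ 2) = a * kF * kH by rewrite /t; field; rewrite !gt_eqF.
rewrite mulrDr e1 in h7; rewrite mulrDr e2 in h8.
by lra.
Qed.

End HeatFlow.

(** * Bounds for the heat kernel *)

Section HeatKernelBound.
Variables (R : realType) (G : topGroupType) (n : nat) (A : set (chart R G n)).
Hypothesis hG : is_lie_group A.
Hypothesis Gc : connected [set: G].
Variable mu : {measure set (borel G) -> \bar R}.
Hypothesis hmu : is_haar mu.
Variables (g : vectType R) (exp : g -> G) (br : g -> g -> g).
Hypothesis hg : is_lie_algebra A exp br.
Variable theta : 'End(g).
Hypothesis htheta : is_cartan_involution br theta.
Variable E : seq g.
Hypothesis hE : orthonormal_basis br (cartan_p theta) E.
Variable K : set G.
Hypothesis hK : maximal_compact_subgroup K.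
Hypothesis hmu_riem : riemannian_normalized K exp br (cartan_p theta) mu.
Variable h : R -> G -> R.
Hypothesis hh : is_heat_kernel K exp E A mu h.
Implicit Types (f w v : G -> R) (x y : G) (C : set G) (X Y : g).

Local Notation intg f := (\int[mu]_x f x).
Let rinv := haar_right hG Gc hmu hg htheta hE hK hmu_riem.
Let iinv := haar_inv hG Gc hmu hg htheta hE hK hmu_riem.
Let Kg : is_subgroup K. Proof. by case: hK. Qed.
Let cK : compact K. Proof. by case: hK. Qed.

Lemma heat_cont (u : R) : 0 < u -> continuous (h u).
Proof. by move=> u0; case: hh => sh _ _ _ _; exact: (smooth_fun_cont hG (smooth_fun_of_pos hG sh u0)). Qed.

Lemma heat_conv_flow f C (M : R) : continuous f -> compact C -> (forall x, ~ C x -> f x = 0) ->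
  (forall x, 0 <= f x <= M) -> heat_flow mu exp E K (fun u => convolution mu f (h u)) M (intg f).
Proof.
move=> cf cC fC f01; case: hh => sh hbi hpos hheat _.
have bf := bmc_cont cf cC fC.
have f0 x : 0 <= f x by have /andP[] := f01 x.
have M0 : 0 <= M by have /andP[h1 h2] := f01 1%g; exact: le_trans h1 h2.
exists (fun X u => convolution mu f (lie_der exp X (h u))), (fun X u => convolution mu f (lie_der exp X (lie_der exp X (h u)))).
split.
- by apply: (conv_caloric hG hmu hg) => // u x u0; exact: hheat.
- by move=> u u0; apply: conv_right_inv; case: (hbi u u0).
- move=> u x u0; have [h0 h1] := hpos u u0.
  rewrite conv_ge0 //=; apply: le_trans (ler_norm _) _.
  rewrite -[M]mulr1; apply: (conv_bound hG hmu rinv iinv x bf (heat_cont u0)) => // y.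
  by rewrite ger0_norm //; have /andP[] := f01 y.
- by split=> //; apply: intg_ge0.
move=> u u0; have [h0 h1] := hpos u u0.
by rewrite (conv_mass hG Gc hmu bf (heat_cont u0) f0 h0 h1) mul1r.
Qed.

Lemma geodesic_ball_disc (s : R) y : geodesic_ball K exp br (cartan_p theta) s y -> 0 < s ->
  exists (c : g -> R) k, [/\ K k, y = (exp (\sum_(Y <- E) c Y *: Y) * k)%g & \sum_(Y <- E) c Y ^+ 2 <= s ^+ 2].
Proof.
move=> [X [k [Xp Xs Kk ->]]] s0; exists (cip br theta X), k; split=> //.
  by have [_ <-] := pframe hG hg hE.
rewrite -(knorm_coord hG hg htheta hE Xp) -(knorm_p hG hg htheta Xp).
by rewrite ler_sqr ?nnegrE ?(ltW s0) ?(ltW Xs) //; exact: sqrtr_ge0.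
Qed.

Variable a : {vspace g}.
Hypothesis ha : maximal_abelian br (cartan_p theta) a.
Variable Sp : seq g.
Hypothesis hSp : positive_system br a Sp.
Let N := killing br (two_rho br a Sp) (two_rho br a Sp).

Lemma two_rho_killing_ge0 : 0 <= N.
Proof. by rewrite /N -(drift_norm hG hg htheta ha hSp hE 1%g); apply: sumr_ge0 => X _; exact: sqr_ge0. Qed.

Lemma spectral_gap v (v_ : g -> G -> R) C : dif exp v v_ -> compact C -> (forall x, ~ C x -> v x = 0) ->
  N / 4 * intg (fun x => v x ^+ 2) <= intg (fun x => \sum_(X <- E) v_ X x ^+ 2).
Proof.
move=> [dv _] cC vC.
apply: (dirichlet_gap hG hmu hg rinv (b := drift hG hg htheta a Sp) (q := dissip hG hg htheta a Sp) cC vC).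
- by move=> X _; exact: dv.
- move=> X XE; have Xp : X \in cartan_p theta by have [+ _] := pframe hG hg hE; apply.
  split; [exact: drift_cont|move=> x; apply: cvgN; exact: dissip_cont|].
  by move=> x s; exact: drift_derive.
- by move=> x; exact: (drift_norm hG hg htheta ha hSp hE).
by move=> x; exact: (dissip_ge hG hg htheta ha hSp hE).
Qed.

(** Test with a bump [eta] and its translate to x0. The initial condition of the heat kernel
    concerns right K-invariant functions only, so the supports are not small but contained in U K
    and x0 U K; the bi-invariance of h_w absorbs the K factors, and h_w > b' > b on what remains. *)
Lemma heat_kernel_le (b w : R) x0 : 0 < w ->
  (forall f C (M : R), continuous f -> right_invariant K f -> compact C -> (forall x, ~ C x -> f x = 0) -> (forall x, 0 <= f x <= M) ->
     0 < intg f -> forall f' C' M', continuous f' -> right_invariant K f' -> compact C' -> (forall x, ~ C' x -> f' x = 0) ->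
     (forall x, 0 <= f' x <= M') -> 0 < intg f' ->
     intg (fun x => f x * convolution mu f' (h w) x) <= b * intg f * intg f') ->
  h w x0 <= b.
Proof.
move=> w0 hb; rewrite leNgt; apply/negP => bh.
pose b' := (b + h w x0) / 2; have [bb' b'h] : b < b' /\ b' < h w x0 by rewrite /b'; split; lra.
have [_ hbi /(_ w w0)[h0 h1] _ _] := hh; have [hr hl] := hbi w w0.
have cq : {for (1%g, 1%g), continuous (fun z : G * G => h w (z.1^-1 * x0 * z.2)%g)}.
  apply: (@continuous_comp _ _ _ (fun z : G * G => z.1^-1 * x0 * z.2)%g (h w)); last exact: (heat_cont w0).
  apply: mulg_cont; last exact: cvg_snd.
  by apply: mulg_cont; [apply: invg_cont; exact: cvg_fst|exact: cvg_cst].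
have : nbhs ((1%g, 1%g) : G * G) [set z | b' < h w (z.1^-1 * x0 * z.2)%g].
  by apply: (cq [set r : R | b' < r]); rewrite invg1 mul1g mulg1; exact: lt_nbhsr.
move=> [[U1 U2] [/= n1 n2] sub]; pose U := U1 `&` U2.
have nU : nbhs 1%g U by exact: filterI.
have hU u u' : U u -> U u' -> b' < h w (u^-1 * x0 * u')%g.
  by move=> [Uu _] [_ Uu']; apply: (sub (u, u')); split.
have [eta [eta_ [S [[deta _] eta_K eta0 eta1 [cS etaS SU]]]]] := bump_right_inv hG hmu hg Kg cK nU.
have ceta : continuous eta by have [] := deta 0.
pose f x := eta (x0^-1 * x)%g.
have cl z : continuous (fun x => z * x)%g.
  by move=> x; apply: (@mulg_cont G G (fun=> z) id); [exact: cvg_cst|exact: cvg_id].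
have cf : continuous f by move=> x; apply: (@continuous_comp _ _ _ (fun x => x0^-1 * x)%g eta); [exact: cl|exact: ceta].
pose C := (fun x => x0 * x)%g @` S.
have cC : compact C.
  by apply: continuous_compact cS; apply: continuous_subspaceT; exact: cl.
have fC x : ~ C x -> f x = 0.
  move=> Cx; apply: etaS => Sx; apply: Cx; exists (x0^-1 * x)%g => //.
  by rewrite mulgA mulgV mul1g.
have [M M0 hM] := continuous_compact_bounded cS (fun x _ => ceta x).
have etaM x : 0 <= eta x <= M.
  rewrite eta0 /=; have [Sx|/etaS ->] := pselect (S x); last exact: ltW.
  by apply: le_trans (ler_norm _) _; exact: hM.
have k0 := intg_gt0 hG hmu ceta cS etaS eta0 eta1.
have beta := bmc_cont ceta cS etaS; have bf := bmc_cont cf cC fC.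
have fk : intg f = intg eta.
  apply: EFin_inj; rewrite -(EFin_intg hG hmu bf) -(EFin_intg hG hmu beta).
  apply: (haar_left hmu x0^-1%g (F := fun x => (eta x)%:E)) => [|y]; last by rewrite lee_fin.
  by apply: measurable_EFinG; exact: continuous_borel.
have fK : right_invariant K f by move=> x k Kk; rewrite /f mulgA eta_K.
have := hb f C M cf fK cC fC (fun x => etaM _) ltac:(by rewrite fk) eta S M ceta eta_K cS etaS etaM k0.
apply/negP; rewrite -ltNge fk.
have lower x : C x -> b' * intg eta <= convolution mu eta (h w) x.
  move=> [s Ss <-]; have [u' [k' [Uu' Kk' ->]]] := SU _ Ss.
  rewrite -(intgZ hG hmu) //; apply: (le_intg hG hmu); first exact: bmcZ.
    by apply: bmcM => //; apply: ldiv_cont1; exact: heat_cont.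
  move=> y; have [Sy|/etaS ->] := pselect (S y); last by rewrite mulr0 mul0r.
  rewrite mulrC ler_wpM2l //; have [u [k [Uu Kk ->]]] := SU _ Sy.
  have -> : ((u * k)^-1 * (x0 * (u' * k')) = k^-1 * (u^-1 * x0 * u') * k')%g by rewrite invgM !mulgA.
  rewrite hr // hl; last by case: Kg => _ _; apply.
  exact/ltW/hU.
apply: (@lt_le_trans _ _ (b' * intg eta * intg eta)); first by rewrite !ltr_pM2r.
rewrite -[X in _ * X]fk -(intgZ hG hmu) //; apply: (le_intg hG hmu); first exact: bmcZ.
  by apply: bmcM => //; exact: (conv_cont hG hmu beta (heat_cont w0)).
move=> x; have [Cx|/fC ->] := pselect (C x); last by rewrite mulr0 mul0r.
by rewrite mulrC ler_wpM2l ?lower //; exact: eta0.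
Qed.

(** The pairing at time w uses the energies at w / 2, whence 2 us and 2^d. For large w the squared
    norm decays at rate 2 (N / 4) from us to w / 2, which gives e^(- (N/4) w). *)
Lemma heat_kernel_bound : exists (C us : R), [/\ 0 < C, 0 < us,
  forall (u : R) x, 0 < u -> u <= us -> h u x <= C / u ^+ \dim (cartan_p theta) &
  forall (u : R) x, us <= u -> h u x <= C * expR (- (N / 4 * u))].
Proof.
have [c1 [s0 [c10 s00 hB]]] := geodesic_ball_volume hmu_riem.
have [c [chi [chi_ [D [c0 hchi chi01 chi_le chi1]]]]] := cutoff_exists hG Gc hmu hg Kg cK rinv iinv E.
have [C0 [us [C00 us0 small]]] := energy_bound_small hG Gc hmu hg rinv c0 hchi chi01 chi_le
  (B := fun s => geodesic_ball K exp br (cartan_p theta) s) c10 s00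
  (fun s s_0 ss0 => And4 (geodesic_ball_borel hG hg htheta hE hK s) (geodesic_ball_fin hG hmu hg htheta hE hK s)
     (hB s s_0 ss0) (fun y By => geodesic_ball_disc By s_0)).
set d := \dim _ in small *.
pose lam := N / 4; have lam0 : 0 <= lam by rewrite divr_ge0 // two_rho_killing_ge0.
pose C := Num.max (C0 * 2 ^+ d) (C0 / us ^+ d * expR (2 * lam * us)).
have [_ _ _ _ init] := hh.
have pair (b w : R) : 0 < w -> (forall F (M k : R), heat_flow mu exp E K F M k -> energy_bound mu chi F (w / 2) (b * k ^+ 2)) ->
    forall x, h w x <= b.
  move=> w0 hb x; apply: heat_kernel_le => // f Cf M cf fK cCf fC f01 kf f' C' M' cf' fK' cC' fC' f01' kf'.
  have hf := heat_conv_flow cf cCf fC f01; have hf' := heat_conv_flow cf' cC' fC' f01'.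
  apply: (flow_pairing hG hmu hg rinv c0 hchi chi01 chi_le chi1 hf hf' cf cCf fC _ w0 kf kf' (hb _ _ _ hf) (hb _ _ _ hf')).
  by move=> y; apply: init => //; exists Cf.
exists C, (2 * us); split.
- by rewrite lt_max mulr_gt0 // exprn_gt0.
- by rewrite mulr_gt0.
- move=> w x w0 wus; apply: (@le_trans _ _ (C0 * 2 ^+ d / w ^+ d)); last first.
    by rewrite ler_wpM2r ?invr_ge0 ?exprn_ge0 ?(ltW w0) // le_max lexx.
  apply: pair => // F M k hF.
  have w20 : 0 < w / 2 by rewrite divr_gt0.
  have := small F M k _ hF w20 ltac:(by rewrite ler_pdivrMr // mulrC).
  have -> // : C0 * k ^+ 2 / (w / 2) ^+ d = C0 * 2 ^+ d / w ^+ d * k ^+ 2.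
  by rewrite expr_div_n invf_div; move: (2 ^+ d) (w ^+ d)^-1 => r1 r2; ring.
move=> w x wus; have w0 : 0 < w by apply: lt_le_trans wus; rewrite mulr_gt0.
apply: (@le_trans _ _ (C0 / us ^+ d * expR (2 * lam * us) * expR (- (lam * w)))); last first.
  by rewrite ler_wpM2r ?expR_ge0 // le_max lexx orbT.
apply: pair => // F M k hF.
have usw : us <= w / 2 by rewrite ler_pdivlMr // mulrC.
have := energy_bound_gap hG hmu hg rinv c0 hchi chi_le hF us0 usw lam0 spectral_gap (small F M k us hF us0 (lexx _)).
suff -> : expR (- (2 * lam * (w / 2 - us))) * (C0 * k ^+ 2 / us ^+ d) =
  C0 / us ^+ d * expR (2 * lam * us) * expR (- (lam * w)) * k ^+ 2 by [].
have -> : - (2 * lam * (w / 2 - us)) = 2 * lam * us + - (lam * w) by field.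
by rewrite expRD; ring.
Qed.

Lemma heat_stationary (u : R) x : E = [::] -> 0 < u -> h u x = h 1 x.
Proof.
move=> E0 u0; case: hh => sh _ _ hheat _.
have d (t : R) : 0 < t -> is_derive t (1 : R) (h^~ x) 0.
  move=> t0; have : derivable (h^~ x) t 1 by exact: (smooth_pos_derivable hG).
  move=> /derivableP dx; apply: is_derive_eq dx _.
  by rewrite -derive1E hheat // /laplacian E0 big_nil.
have mono (s t : R) : 0 < s -> s <= t -> h s x = h t x.
  move=> s0 st; have pos (r : R) : s <= r <= t -> 0 < r by move=> /andP[+ _]; exact: lt_le_trans.
  apply/eqP; rewrite eq_le; apply/andP; split.
    rewrite -lerN2; apply: (@nonincr_of_derive R (fun r => - h r x) (fun=> 0) s t st) => // r /pos r0.
    by have dr := d r r0; apply: is_derive_eq (is_deriveN dr) _; rewrite oppr0.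
  by apply: (@nonincr_of_derive R (h^~ x) (fun=> 0) s t st) => // r /pos r0; exact: d.
by have [/mono ->|/ltW/mono ->] := leP u 1.
Qed.

(** When p = 0 the kernel does not depend on u, and as an approximate identity it must vanish off K.
    Being continuous of mass 1, it is positive somewhere on K, so K is open, and K = G by
    connectedness. This is how noncompactness gives rho <> 0. *)
Lemma heat_stationary_compact : E = [::] -> compact [set: G].
Proof.
move=> E0; have [K1 KM KV] := Kg; have [_ hbi hpos _ init] := hh.
have [h0 h1] := hpos 1 ltr01; have ch := heat_cont ltr01.
have off x : ~ K x -> h 1 x = 0.
  move=> xK; apply/eqP; rewrite eq_le h0 andbT leNgt; apply/negP => hx.
  pose L := [set z | exists y k, [/\ [set x] y, K k & z = (y * k)%g]].
  have cL : compact L by apply: compact_mul => //; exact: compact_set1.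
  have nU : nbhs 1%g (~` L).
    apply: open_nbhs_nbhs; split; first by apply: closed_openC; exact: (compact_closedG hG).
    move=> [y [k [-> Kk e]]]; apply: xK; have -> : x = k^-1%g by rewrite -[x]mulg1 -(mulgV k) mulgA -e mul1g.
    exact: KV.
  have [eta [eta_ [S [[deta _] eta_K eta0 eta1 [cS etaS SU]]]]] := bump_right_inv hG hmu hg Kg cK nU.
  have ceta : continuous eta by have [] := deta 0.
  have beta := bmc_cont ceta cS etaS.
  have etax : eta x = 0.
    apply: etaS => /SU[u [k [uL Kk e]]]; apply: uL; exists x, k^-1%g; split=> //; first exact: KV.
    by rewrite e mulgK.
  have lim : convolution mu eta (h u) x @[u --> 0^'+] --> eta x by apply: init => //; exists S.
  have eqx : convolution mu eta (h 1) x = eta x.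
    have lim1 : convolution mu eta (h u) x @[u --> 0^'+] --> convolution mu eta (h 1) x.
      apply: cvg_near_cst; near=> u; have u0 : 0 < u by [].
      by apply: eq_Rintegral => y _; rewrite (heat_stationary _ E0 u0).
    exact: (cvg_unique (@Rhausdorff R) lim1 lim).
  have : 0 < convolution mu eta (h 1) x.
    apply: (intg_gt0 hG hmu (C := S) (x0 := 1%g)) => //.
    - by move=> y; apply: cvgM; [exact: ceta|exact: ldiv_cont1].
    - by move=> y /etaS ->; rewrite mul0r.
    - by move=> y; rewrite mulr_ge0.
    by rewrite invg1 mul1g mulr_gt0.
  by rewrite eqx etax ltxx.
have [x hx] : exists x, 0 < h 1 x.
  apply: contrapT => no; have : (\int[mu]_x (h 1 x)%:E = 0)%E.
    apply: integral0_eq => x _; congr EFin; apply/eqP; rewrite eq_le h0 andbT leNgt; apply/negP => hx.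
    by apply: no; exists x.
  by rewrite h1 => /eqP; rewrite eqe oner_eq0.
have Kx : K x by apply: contrapT => /off e; move: hx; rewrite e ltxx.
have oK : open K.
  rewrite openE => k Kk.
  have cl : {for k, continuous (fun y => h 1 (x * (k^-1 * y))%g)}.
    apply: (@continuous_comp _ _ _ (fun y => x * (k^-1 * y))%g (h 1)); last exact: ch.
    apply: mulg_cont; first exact: cvg_cst.
    by apply: mulg_cont; [exact: cvg_cst|exact: cvg_id].
  have : nbhs k [set y | 0 < h 1 (x * (k^-1 * y))%g].
    by apply: (cl [set r : R | 0 < r]); rewrite mulVg mulg1; exact: lt_nbhsr.
  apply: filterS => y /= hy; have : K (x * (k^-1 * y))%g by apply: contrapT => /off e; move: hy; rewrite e ltxx.
  move=> /(KM _ _ (KV _ Kx)) /(KM _ _ Kk); by rewrite mulKg mulgA mulgV mul1g.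
have <- : K = [set: G].
  apply: Gc; first by exists 1%g.
    by exists K; rewrite ?setTI.
  by exists K; rewrite ?setTI //; exact: (compact_closedG hG).
exact: cK.
Unshelve. all: by end_near.
Qed.

Lemma two_rho_killing_gt0 : ~ compact [set: G] -> 0 < N.
Proof.
move=> ncG; apply: (two_rho_norm_gt0 (br_linear_r hG hg) (br_linear_l hG hg) (br_anti hG hg) (br_jacobi hG hg) htheta ha hSp).
apply/eqP => Sp0; apply: ncG; apply: heat_stationary_compact.
have p0 := no_roots_p0 (br_linear_r hG hg) (br_linear_l hG hg) (br_anti hG hg) (br_jacobi hG hg) htheta ha hSp Sp0.
by case: hE => + _; rewrite basisEdim p0 dimv0 leqn0 => /andP[_ /nilP].
Qed.

End HeatKernelBound.

(** * The extension kernel *)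

Section RealAnalysis.
Variable R : realType.

(** The integral of a nonnegative function is a supremum over the simple functions below it, hence
    monotone for arbitrary functions. *)
Lemma ge0_le_integral_gen d (T : measurableType d) (mu : {measure set T -> \bar R}) (f1 f2 : T -> \bar R) :
  (forall x, 0 <= f1 x)%E -> (forall x, f1 x <= f2 x)%E -> (\int[mu]_x f1 x <= \int[mu]_x f2 x)%E.
Proof.
move=> f10 f12; rewrite !ge0_integralTE //; last by move=> x; exact: le_trans (f12 x).
by apply: le_ereal_sup => _ [k /= hk <-]; exists k => // x; exact: le_trans (hk x) (f12 x).
Qed.

Lemma powR_expNV_le (N eta : R) : 0 <= N -> 0 < eta ->
  exists2 C, 0 <= C & forall u : R, 0 < u -> (u `^ N)^-1 * expR (- (eta / u)) <= C.
Proof.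
move=> N0 e0; have [C C0 hC] := powR_expN_le N0.
exists (C * (eta `^ N)^-1) => [|u u0]; first by rewrite mulr_ge0 ?invr_ge0 ?powR_ge0.
have x0 : 0 < eta / u by rewrite divr_gt0.
have iV : u^-1 `^ N = (u `^ N)^-1 by rewrite -powR_inv1 ?(ltW u0) // -powRrM mulN1r powRN.
have uV0 : 0 <= u^-1 by rewrite invr_ge0 ltW.
have := hC _ x0; rewrite powRM ?(ltW e0) // iV => h.
have {}h : eta `^ N / u `^ N * expR (- (eta / u)) <= C.
  apply: le_trans h _; rewrite ler_piMr // -expR0 ler_expR oppr_le0 mulr_ge0 ?(ltW x0) //; lra.
rewrite ler_pdivlMr ?powR_gt0 //; apply: le_trans h.
by rewrite le_eqVlt; apply/orP; left; apply/eqP; ring.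
Qed.

Lemma powR_expN_small (a c e : R) : 0 < c -> 0 < e -> \forall t \near +oo, t `^ a * expR (- (c * t)) <= e.
Proof.
move=> c0 e0; pose b := Num.max a 0; have b0 : 0 <= b by rewrite le_max lexx orbT.
have [C C0 hC] := powR_expN_le b0.
pose D : R := C / c `^ b; have D0 : 0 <= D by rewrite divr_ge0 // powR_ge0.
near=> t; have t1 : 1 <= t by near: t; exact: nbhs_pinfty_ge.
have t0 : 0 < t by exact: lt_le_trans t1.
have ct0 : 0 < c * t by rewrite mulr_gt0.
have h1 : t `^ a <= t `^ b by rewrite ler_powR // le_max lexx.
have := hC _ ct0; rewrite powRM ?(ltW c0) ?(ltW t0) // => h2.
have h3 : t `^ b * expR (- (c * t)) <= D * expR (- (2^-1 * (c * t))).
  rewrite /D mulrAC ler_pdivlMr ?powR_gt0 //; apply: le_trans h2.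
  by rewrite le_eqVlt; apply/orP; left; apply/eqP; ring.
apply: (@le_trans _ _ (D * expR (- (2^-1 * (c * t))))).
  by apply: le_trans h3; rewrite ler_wpM2r ?expR_ge0.
rewrite expRN ler_pdivrMr ?expR_gt0 //.
apply: (@le_trans _ _ (e * (1 + 2^-1 * (c * t)))); last by rewrite ler_wpM2l ?expR_ge1Dx // ltW.
have : 2 * D / (e * c) <= t by near: t; apply: nbhs_pinfty_ge; exact: num_real.
rewrite ler_pdivrMr ?mulr_gt0 //; move: D0 e0 => + + h; nra.
Unshelve. all: by end_near.
Qed.

Lemma integral_powR_tail (sigma : R) : 0 < sigma ->
  (\int[lebesgue_measure]_(u in `[1%R, +oo[) ((u `^ (1 + sigma))^-1)%:E = (sigma^-1)%:E)%E.
Proof.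
move=> s0.
have dF (x : R) : 0 < x -> is_derive x (1 : R) (fun u => - sigma^-1 * u `^ (- sigma)) ((x `^ (1 + sigma))^-1).
  move=> x0; have d := is_derive1_powR (- sigma) x0.
  apply: is_derive_eq (is_deriveZ (- sigma^-1) d) _.
  rewrite /GRing.scale /= mulrA mulrNN mulVf ?gt_eqF // mul1r -powRN; congr (_ `^ _); ring.
rewrite (@ge0_continuous_FTC2y R (fun u => (u `^ (1 + sigma))^-1) (fun u => - sigma^-1 * u `^ (- sigma)) 1 0).
- by rewrite powR1 mulr1 EFinN sub0e oppeK.
- by move=> x _; rewrite invr_ge0 powR_ge0.
- apply: continuous_in_subspaceT => x; rewrite inE /= in_itv /= andbT => x1.
  have x0 : 0 < x by exact: lt_le_trans x1.
  apply: cvgV; first by rewrite gt_eqF // powR_gt0.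
  have [d _] := is_derive1_powR (1 + sigma) x0.
  by move/derivable1_diffP/differentiable_continuous: d; exact.
- rewrite -[0](mulr0 (- sigma^-1)); apply: cvgM; first exact: cvg_cst.
  apply/cvgrPdist_le => e e0; near=> t; rewrite sub0r normrN ger0_norm ?powR_ge0 //.
  have t0 : 0 < t by near: t; exact: nbhs_pinfty_gt.
  rewrite powRN -[e]invrK lef_pV2 ?posrE ?powR_gt0 ?invr_gt0 //.
  have h : e^-1 `^ sigma^-1 <= t by near: t; exact: nbhs_pinfty_ge.
  have -> : e^-1 = (e^-1 `^ sigma^-1) `^ sigma by rewrite -powRrM mulVf ?gt_eqF // powRr1 // invr_ge0 ltW.
  by apply: ge0_ler_powR; rewrite ?nnegrE ?powR_ge0 ?ltW.
- by move=> x x1; have [] := dF x (lt_trans ltr01 x1).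
- have [d _] := dF 1 ltr01; apply: cvg_at_right_filter.
  by move/derivable1_diffP/differentiable_continuous: d; exact.
move=> x; rewrite in_itv /= andbT => x1; rewrite derive1E.
by have [_ ->] := dF x (lt_trans ltr01 x1).
Unshelve. all: by end_near.
Qed.

End RealAnalysis.

(** * Subordination: contributions of parts of the time axis *)

Section Subordination.
Variables (R : realType) (G : topGroupType) (n : nat) (A : set (chart R G n)).
Hypothesis hG : is_lie_group A.
Hypothesis Gc : connected [set: G].
Variable mu : {measure set (borel G) -> \bar R}.
Hypothesis hmu : is_haar mu.
Variable h : R -> G -> R.
Hypothesis h_cont : forall (u : R) x, 0 < u -> {for (u, x), continuous (fun z => h z.1 z.2)}.
Hypothesis h_ge0 : forall (u : R) x, 0 < u -> 0 <= h u x.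
Hypothesis h_mass : forall u : R, 0 < u -> (\int[mu]_x (h u x)%:E = 1)%E.
Variable sigma : R.
Hypothesis sigma_gt0 : 0 < sigma.

Local Notation leb := (@lebesgue_measure R).

Definition subord_weight (t u : R) : R := expR (- (t ^+ 2 / (4 * u))) / u `^ (1 + sigma).

(** Kept in the extended reals, so that Tonelli's theorem applies before any convergence is known;
    the prefactor of [extension_kernel] is left out. *)
Definition subord_part (D : set R) (t : R) (x : G) : \bar R :=
  (\int[leb]_u (\1_D u * (h u x * subord_weight t u))%:E)%E.

Let Dpos (D : set R) := measurable (D : set (measurableTypeR R)) /\ D `<=` [set u | 0 < u].

Lemma subord_weight_ge0 t u : 0 <= subord_weight t u.
Proof. by rewrite divr_ge0 ?expR_ge0 ?powR_ge0. Qed.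

Lemma subord_weight_cont t u : 0 < u -> {for u, continuous (subord_weight t)}.
Proof.
move=> u0; apply: cvgM.
  apply: (@continuous_comp _ _ _ (fun u : R => - (t ^+ 2 / (4 * u))) (@expR R)); last exact: continuous_expR.
  apply: cvgN; apply: cvgM; first exact: cvg_cst.
  apply: cvgV; first by rewrite gt_eqF // mulr_gt0.
  by apply: cvgM; [exact: cvg_cst|exact: cvg_id].
apply: cvgV; first by rewrite gt_eqF // powR_gt0.
have [d _] := is_derive1_powR (1 + sigma) u0.
by move/derivable1_diffP/differentiable_continuous: d; exact.
Qed.

Lemma indic_weight_measurable D t (k : R -> R) : Dpos D -> (forall u, 0 < u -> {for u, continuous k}) ->
  measurable_fun (setT : set (measurableTypeR R)) (fun u : R => \1_D u * (k u * subord_weight t u)).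
Proof.
move=> [mD Dp] ck.
have -> : (fun u : R => \1_D u * (k u * subord_weight t u)) = (fun u : R => k u * subord_weight t u) \_ D.
  by rewrite patch_indic; apply/funext => u; rewrite /= mulrC.
apply/(measurable_restrictT _ _).1 => //.
apply: (@measurable_funS _ _ (measurableTypeR R) R (`]0, +oo[%classic)); first exact: measurable_itv.
  by move=> u /Dp u0; rewrite /= in_itv /= andbT.
apply: open_continuous_measurable_fun; first exact: interval_open.
by move=> u; rewrite inE /= in_itv /= andbT => u0; apply: cvgM; [exact: ck|exact: subord_weight_cont].
Qed.

Let F D t (z : R * G) : R := \1_D z.1 * (h z.1 z.2 * subord_weight t z.1).

Let F_ge0 D t z : Dpos D -> (0 <= (F D t z)%:E)%E.
Proof.
move=> [_ Dp]; rewrite lee_fin /F indicE; have [/set_mem/Dp u0|_] := boolP (_ \in _); last by rewrite mul0r.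
by rewrite mul1r mulr_ge0 ?subord_weight_ge0 // h_ge0.
Qed.

Let F_measurable D t : Dpos D -> measurable_fun setT ((EFin \o F D t) : (R * borel G)%type -> \bar R).
Proof.
move=> [mD Dp]; apply/measurable_EFinP.
have -> : F D t = (fun z => h z.1 z.2 * subord_weight t z.1) \_ (D `*` setT).
  rewrite patch_indic; apply/funext => -[u x]; rewrite /= mulrC /F /=; congr (_ * _).
  by rewrite !indicE; congr ((_ : bool)%:R); apply/idP/idP; rewrite !inE => // -[].
apply/(measurable_restrictT _ _).1; first exact: measurableX.
apply: (@measurable_funS _ _ (R * borel G)%type R ([set u | 0 < u] `*` setT)).
- apply: measurableX => //; rewrite (_ : [set u | 0 < u] = `]0, +oo[%classic); first exact: measurable_itv.
  by apply/seteqP; split=> u /=; rewrite in_itv /= andbT.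
- by move=> [u x] [/= Du _]; split=> //; exact: Dp.
apply: (continuousR_borel hG Gc); first by apply: open_setX; [exact: open_gt|exact: openT].
move=> [u x] [/= u0 _]; apply: cvgM; first exact: h_cont.
apply: (@continuous_comp _ _ _ (fun z : R * G => z.1) (subord_weight t)); first exact: cvg_fst.
exact: subord_weight_cont.
Qed.

Lemma subord_part_ge0 D t x : Dpos D -> (0 <= subord_part D t x)%E.
Proof. by move=> hD; apply: integral_ge0 => u _; exact: (F_ge0 t (u, x) hD). Qed.

Lemma subord_part_measurable D t : Dpos D -> measurable_fun setT (subord_part D t : borel G -> \bar R).
Proof.
move=> hD; have mF : measurable_fun setT ((EFin \o F D t) : (measurableTypeR R * borel G)%type -> \bar R) := F_measurable t hD.
exact: (@measurable_fun_fubini_tonelli_G _ _ (measurableTypeR R) (borel G) R leb _ mF (fun z => F_ge0 t z hD)).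
Qed.

Lemma subord_part_mass D t : Dpos D ->
  (\int[mu]_x subord_part D t x = \int[leb]_u (\1_D u * subord_weight t u)%:E)%E.
Proof.
move=> hD; rewrite -(tonelliR hG Gc hmu (F_measurable t hD) (fun z => F_ge0 t z hD)).
apply: eq_integral => u _; rewrite /F /= indicE; have [/set_mem Du|_] := boolP (u \in D); last first.
  by rewrite mul0r; under eq_integral => x _ do rewrite mul0r; rewrite integral0.
have u0 : 0 < u by exact: hD.2.
rewrite mul1r; under eq_integral => x _ do rewrite mul1r mulrC EFinM.
rewrite ge0_integralZl ?h_mass ?mule1 ?lee_fin ?subord_weight_ge0 //.
- apply: measurable_EFinG; apply: continuous_borel => x.
  apply: (@continuous_comp _ _ _ (fun x => (u, x)) (fun z : R * G => h z.1 z.2)); last exact: h_cont.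
  by apply: continuous_pair; [exact: cvg_cst|exact: cvg_id].
by move=> x _; rewrite lee_fin h_ge0.
Qed.

Lemma subord_part_sup D t (b : R -> R) x : (forall u y, 0 < u -> h u y <= b u) -> Dpos D ->
  (subord_part D t x <= \int[leb]_u (\1_D u * (b u * subord_weight t u))%:E)%E.
Proof.
move=> hb hD; apply: ge0_le_integral_gen => u; first exact: (F_ge0 t (u, x) hD).
rewrite lee_fin indicE; have [/set_mem/hD.2 u0|_] := boolP (u \in D); last by rewrite !mul0r.
by rewrite !mul1r ler_wpM2r ?subord_weight_ge0 // hb.
Qed.

Lemma extension_kernel_le D1 D2 t x : Dpos D1 -> Dpos D2 -> (forall u : R, 0 < u -> D1 u \/ D2 u) ->
  0 <= extension_kernel h sigma t x /\
  ((extension_kernel h sigma t x)%:E <=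
    (t `^ (2 * sigma) / (2 `^ (2 * sigma) * Gamma sigma))%:E * (subord_part D1 t x + subord_part D2 t x))%E.
Proof.
move=> hD1 hD2 D12; rewrite /extension_kernel; set c := t `^ _ / _.
have c0 : 0 <= c.
  rewrite divr_ge0 ?powR_ge0 // mulr_ge0 ?powR_ge0 //; apply: Rintegral_ge0 => u _.
  by rewrite mulr_ge0 ?powR_ge0 ?expR_ge0.
have pos u : (`]0, +oo[%classic : set R) u -> 0 <= h u x * expR (- (t ^+ 2 / (4 * u))) / u `^ (1 + sigma).
  by rewrite /= in_itv /= andbT => u0; rewrite divr_ge0 ?powR_ge0 // mulr_ge0 ?expR_ge0 // h_ge0.
have i0 : 0 <= \int[leb]_(u in `]0, +oo[) (h u x * expR (- (t ^+ 2 / (4 * u))) / u `^ (1 + sigma)).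
  exact: Rintegral_ge0.
split; first exact: mulr_ge0.
rewrite EFinM lee_wpmul2l ?lee_fin //.
apply: (@le_trans _ _ (\int[leb]_(u in `]0%R, +oo[) (h u x * expR (- (t ^+ 2 / (4 * u))) / u `^ (1 + sigma))%:E)%E).
  (* Should the integral be infinite, [fine] replaces it by 0, which only lowers the left side. *)
  rewrite /Rintegral; have : (0 <= \int[leb]_(u in `]0%R, +oo[) (h u x * expR (- (t ^+ 2 / (4 * u))) / u `^ (1 + sigma))%:E)%E.
    by apply: integral_ge0 => u hu; rewrite lee_fin pos.
  by case: (integral _ _ _) => [r _| |] //=.
have mF D : Dpos D -> measurable_fun (setT : set (measurableTypeR R)) (fun u : R => (\1_D u * (h u x * subord_weight t u))%:E).
  move=> hD; apply/measurable_EFinP; apply: indic_weight_measurable => // u u0.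
  apply: (@continuous_comp _ _ _ (fun u : R => (u, x)) (fun z : R * G => h z.1 z.2)); last exact: h_cont.
  by apply: continuous_pair; [exact: cvg_id|exact: cvg_cst].
rewrite /subord_part -ge0_integralD //; last 4 first.
- by move=> u _; exact: (F_ge0 t (u, x) hD1).
- exact: mF.
- by move=> u _; exact: (F_ge0 t (u, x) hD2).
- exact: mF.
rewrite [X in (X <= _)%E]integral_mkcond; apply: (@ge0_le_integral_gen R _ (measurableTypeR R) leb) => u; rewrite patchE.
  by case: ifPn => // /set_mem hu; rewrite lee_fin pos.
have g1 := F_ge0 t (u, x) hD1; have g2 := F_ge0 t (u, x) hD2; rewrite /F /= in g1 g2.
case: ifPn => [/set_mem hu|_]; last exact: adde_ge0.
have u0 : 0 < u by move: hu; rewrite /= in_itv /= andbT.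
rewrite -mulrA -/(subord_weight t u); case: (D12 u u0) => Du.
  by rewrite -[X in (X <= _)%E]adde0; apply: leeD => //; rewrite indicE mem_set // mul1r.
by rewrite -[X in (X <= _)%E]add0e; apply: leeD => //; rewrite indicE mem_set // mul1r.
Qed.

End Subordination.

(** * Early and late times *)

Section WeightBounds.
Variables (R : realType) (sigma r C : R) (d : nat).
Hypothesis sigma_gt0 : 0 < sigma.
Hypothesis r0 : 0 < r.
Hypothesis C0 : 0 <= C.

Local Notation leb := (@lebesgue_measure R).
Local Notation w := (subord_weight sigma).
(** One bound for all u, merging those for small and for large times ([heat_majorant_le]); r stands
    for |rho| and d for dim p. *)
Definition heat_majorant (u : R) : R := C * (1 + (u ^+ d)^-1) * expR (- (r ^+ 2 * u)).
(* Before the time 4 t / r the weight e^(- t^2 / 4u) is at most e^(- r t / 16), after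
   it the factor e^(- r^2 u) of the heat kernel is at most e^(- 4 r t). *)
Definition early (t : R) : set R := `]0, (4 / r * t)]%classic.
Definition late (t : R) : set R := `](4 / r * t), +oo[%classic.
Local Notation b := heat_majorant.

Lemma early_itv t u : early t u <-> 0 < u <= 4 / r * t.
Proof. by rewrite /early /= in_itv. Qed.

Lemma late_itv t u : late t u <-> 4 / r * t < u.
Proof. by rewrite /late /= in_itv /= andbT. Qed.

Lemma early_measurable t : measurable (early t : set (measurableTypeR R)).
Proof. exact: measurable_itv. Qed.

Lemma late_measurable t : measurable (late t : set (measurableTypeR R)).
Proof. exact: measurable_itv. Qed.

Lemma integral_early_le t (k : R -> R) (M : R) : 0 <= t -> 0 <= M -> (forall u, early t u -> 0 <= k u <= M) ->
  (\int[leb]_u (\1_(early t) u * k u)%:E <= (M * (4 / r * t))%:E)%E.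
Proof.
move=> t0 M0 hk; apply: (@le_trans _ _ (\int[leb]_u (M%:E * (\1_(early t) u)%:E))%E).
  apply: (@ge0_le_integral_gen R _ (measurableTypeR R) leb) => u; rewrite ?lee_fin indicE.
    by have [/set_mem/hk/andP[? ?]|_] := boolP (u \in _); rewrite ?mul1r ?mul0r.
  by have [/set_mem/hk/andP[? ?]|_] := boolP (u \in _); rewrite ?mul1r ?mulr1 ?mul0r ?mulr0.
have mD := early_measurable t.
rewrite (ge0_integralZl_EFin leb) //; last by apply/measurable_EFinP; exact: measurable_indic.
have e : leb (early t) = (4 / r * t)%:E.
  have := lebesgue_measure_itv (Interval (BRight 0) (BRight (4 / r * t))); rewrite /= lte_fin => ->.
  have : 0 <= 4 / r * t by rewrite !mulr_ge0 // invr_ge0 ltW.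
  by rewrite le_eqVlt => /predU1P[<-|->]; rewrite ?ltxx // oppr0 adde0.
have -> : (\int[leb]_u (\1_(early t) u)%:E = (4 / r * t)%:E)%E by rewrite integral_indic // setIT; exact: e.
by rewrite EFinM.
Qed.

(** Part of each exponential is spent on the rest of the integrand. Early sup: a fraction delta
    absorbs the powers of 1/u, whence 1 - delta. Early mass: half of t^2 / 4u does so, the other
    half is at least r t / 32. Late sup: half of r^2 u makes the integral converge, the other half
    exceeds 2 r t. *)
Lemma weight_bounds (delta : R) : 0 < delta -> delta < 1 -> exists2 K : R, 0 <= K & forall t, 1 <= t -> 1 <= 4 / r * t ->
  [/\ (\int[leb]_u (\1_(early t) u * (b u * w t u))%:E <= (K * t * expR (- ((1 - delta) * r * t)))%:E)%E,
      (\int[leb]_u (\1_(early t) u * w t u)%:E <= (K * t * expR (- (r * t / 32)))%:E)%E,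
      (\int[leb]_u (\1_(late t) u * (b u * w t u))%:E <= (K * expR (- (2 * r * t)))%:E)%E &
      (\int[leb]_u (\1_(late t) u * w t u)%:E <= K%:E)%E].
Proof.
move=> d0 d1.
have s1 : 0 <= 1 + sigma by rewrite addr_ge0 // ltW.
have sd : 0 <= 1 + sigma + d%:R by rewrite addr_ge0.
have d40 : 0 < delta / 4 by rewrite divr_gt0.
have [A1 A10 hA1] := powR_expNV_le s1 d40.
have [A2 A20 hA2] := powR_expNV_le sd d40.
have e80 : 0 < 8^-1 :> R by rewrite invr_gt0.
have [A3 A30 hA3] := powR_expNV_le s1 e80.
have c20 : 0 < r ^+ 2 / 2 by rewrite divr_gt0 // exprn_gt0.
have iE := integrable_expN c20.
pose I0 := \int[leb]_(u in `]0, +oo[) expR (- (r ^+ 2 / 2 * u)).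
have I00 : 0 <= I0 by apply: Rintegral_ge0 => u _; exact: expR_ge0.
have I0E : (\int[leb]_(u in `]0%R, +oo[) (expR (- (r ^+ 2 / 2 * u)))%:E = I0%:E)%E.
  by rewrite /I0 /Rintegral fineK //; apply: integrable_fin_num => //; exact: measurable_itv.
pose K := C * (A1 + A2) * (4 / r) + A3 * (4 / r) + 2 * C * I0 + sigma^-1.
have r40 : 0 <= 4 / r by rewrite divr_ge0 // ltW.
have p1 : 0 <= C * (A1 + A2) * (4 / r) by rewrite mulr_ge0 // mulr_ge0 // addr_ge0.
have p2 : 0 <= A3 * (4 / r) by exact: mulr_ge0.
have p3 : 0 <= 2 * C * I0 by rewrite mulr_ge0 // mulr_ge0.
have p4 : 0 <= sigma^-1 by rewrite invr_ge0 ltW.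
have K0 : 0 <= K by rewrite !addr_ge0.
have k1 : C * (A1 + A2) * (4 / r) <= K by rewrite /K -!addrA lerDl !addr_ge0.
have k2 : A3 * (4 / r) <= K by rewrite /K; lra.
have k3 : 2 * C * I0 <= K by rewrite /K; lra.
exists K => // t t1 rt1.
have t0 : 0 < t by exact: lt_le_trans t1.
have tt : 1 <= t ^+ 2 by rewrite exprn_ege1.
have bge u : 0 < u -> 0 <= b u.
  by move=> u0; rewrite mulr_ge0 ?expR_ge0 // mulr_ge0 // addr_ge0 // invr_ge0 exprn_ge0 // ltW.
split.
- apply: (le_trans (@integral_early_le t (fun u => b u * w t u) (C * (A1 + A2) * expR (- ((1 - delta) * r * t))) (ltW t0) _ _)).
  + by rewrite mulr_ge0 ?expR_ge0 // mulr_ge0 // addr_ge0.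
  + move=> u /early_itv/andP[u0 _]; rewrite mulr_ge0 ?bge ?subord_weight_ge0 //=.
    pose x := delta / 4 / u; have uN := powR_gt0 (1 + sigma) u0.
    have e1 : expR (- (r ^+ 2 * u)) * expR (- (t ^+ 2 / (4 * u))) <= expR (- ((1 - delta) * r * t)) * expR (- x).
      rewrite -!expRD ler_expR.
      (* The saddle of the subordination integral at u = t / (2 r): the difference is a square
         divided by u. *)
      have key : r * t <= r ^+ 2 * u + t ^+ 2 / (4 * u).
        rewrite -subr_ge0; have -> : r ^+ 2 * u + t ^+ 2 / (4 * u) - r * t = (r * u - t / 2) ^+ 2 / u by field; rewrite gt_eqF.
        by rewrite divr_ge0 ?sqr_ge0 // ltW.
      have hx : x <= delta * (t ^+ 2 / (4 * u)).
        have -> : x = delta * (1 / (4 * u)) by rewrite /x; field; rewrite gt_eqF.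
        by rewrite ler_wpM2l ?(ltW d0) // ler_wpM2r // invr_ge0 mulr_ge0 // ltW.
      have h2 : 0 <= delta * (r ^+ 2 * u) by rewrite mulr_ge0 ?(ltW d0) // mulr_ge0 ?sqr_ge0 // ltW.
      have h3 : (1 - delta) * (r * t) <= (1 - delta) * (r ^+ 2 * u + t ^+ 2 / (4 * u)) by rewrite ler_wpM2l // subr_ge0 ltW.
      by move: hx h2 h3; move: (t ^+ 2 / (4 * u)) => q; lra.
    have e2 : (1 + (u ^+ d)^-1) / u `^ (1 + sigma) * expR (- x) <= A1 + A2.
      rewrite mulrDl mulrDl; apply: lerD; first by rewrite mul1r; exact: hA1.
      apply: le_trans (hA2 u u0).
      have -> : u `^ (1 + sigma + d%:R) = u `^ (1 + sigma) * u ^+ d.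
        by rewrite powRD ?(gt_eqF u0) ?implybT // powR_mulrn // ltW.
      by rewrite invfM [X in X * _ <= _]mulrC.
    have -> : b u * w t u = C * ((1 + (u ^+ d)^-1) / u `^ (1 + sigma)) * (expR (- (r ^+ 2 * u)) * expR (- (t ^+ 2 / (4 * u)))).
      by rewrite /b /subord_weight; ring.
    have q0 : 0 <= C * ((1 + (u ^+ d)^-1) / u `^ (1 + sigma)).
      by rewrite mulr_ge0 // divr_ge0 ?powR_ge0 // addr_ge0 // invr_ge0 exprn_ge0 // ltW.
    apply: le_trans (ler_wpM2l q0 e1) _; move: e2.
    set z := _ / u `^ _; set y := expR (- x); set v := expR (- ((1 - delta) * r * t)) => e2.
    have -> : C * z * (v * y) = C * v * (z * y) by ring.
    by rewrite [leRHS]mulrAC ler_wpM2l // mulr_ge0 // expR_ge0.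
  rewrite lee_fin; set q := expR _.
  have -> : C * (A1 + A2) * q * (4 / r * t) = C * (A1 + A2) * (4 / r) * t * q by ring.
  by rewrite ler_wpM2r ?expR_ge0 // ler_wpM2r // ltW.
- apply: (le_trans (@integral_early_le t (w t) (A3 * expR (- (r * t / 32))) (ltW t0) _ _)).
  + by rewrite mulr_ge0 ?expR_ge0.
  + move=> u /early_itv/andP[u0 ut]; rewrite subord_weight_ge0 /=.
    have e1 : expR (- (t ^+ 2 / (4 * u))) <= expR (- (8^-1 / u)) * expR (- (r * t / 32)).
      rewrite -expRD ler_expR.
      have -> : t ^+ 2 / (4 * u) = t ^+ 2 * (8^-1 / u) + t ^+ 2 / (8 * u) by field; rewrite gt_eqF.
      have h1 : 8^-1 / u <= t ^+ 2 * (8^-1 / u) by rewrite ler_peMl // divr_ge0 // ltW.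
      have h2 : r * t / 32 <= t ^+ 2 / (8 * u).
        rewrite ler_pdivlMr ?mulr_gt0 //; move: ut; rewrite mulrAC ler_pdivlMr // => ut; nra.
      lra.
    rewrite /subord_weight mulrC; have v0 : 0 <= (u `^ (1 + sigma))^-1 by rewrite invr_ge0 powR_ge0.
    apply: le_trans (ler_wpM2l v0 e1) _; rewrite mulrA ler_wpM2r ?expR_ge0 //; exact: hA3.
  rewrite lee_fin; set q := expR _.
  have -> : A3 * q * (4 / r * t) = A3 * (4 / r) * t * q by ring.
  by rewrite ler_wpM2r ?expR_ge0 // ler_wpM2r // ltW.
- apply: (@le_trans _ _ (\int[leb]_(u in `]0%R, +oo[) ((2 * C * expR (- (2 * r * t)))%:E * (expR (- (r ^+ 2 / 2 * u)))%:E))%E).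
    rewrite [X in (_ <= X)%E]integral_mkcond.
    apply: (@ge0_le_integral_gen R _ (measurableTypeR R) leb) => u; rewrite indicE.
      have [/set_mem/late_itv lu|_] := boolP (u \in _); last by rewrite mul0r.
      have u0 : 0 < u by apply: lt_trans lu; exact: lt_le_trans rt1.
      by rewrite lee_fin mul1r mulr_ge0 ?bge ?subord_weight_ge0.
    have [/set_mem/late_itv lu|_] := boolP (u \in late t); last first.
      by rewrite mul0r patchE; case: ifP => // _; rewrite -EFinM lee_fin !mulr_ge0 ?expR_ge0.
    have u1 : 1 < u by exact: le_lt_trans rt1 lu.
    have u0 : 0 < u by exact: lt_trans u1.
    rewrite patchE mem_set /= ?in_itv /= ?u0 // mul1r -EFinM lee_fin.
    have e1 : expR (- (r ^+ 2 * u)) <= expR (- (2 * r * t)) * expR (- (r ^+ 2 / 2 * u)).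
      rewrite -expRD ler_expR; move: lu; rewrite mulrAC ltr_pdivrMr // => lu.
      have : r * (4 * t) <= r * (u * r) by rewrite ler_wpM2l // ltW.
      by rewrite expr2; lra.
    have e2 : 1 + (u ^+ d)^-1 <= 2.
      have : (u ^+ d)^-1 <= 1 by rewrite invf_le1 ?exprn_gt0 // exprn_ege1 // ltW.
      lra.
    have e3 : w t u <= 1.
      rewrite /subord_weight ler_pdivrMr ?powR_gt0 // mul1r.
      apply: (@le_trans _ _ 1); first by rewrite -expR0 ler_expR oppr_le0 divr_ge0 ?sqr_ge0 // mulr_ge0 // ltW.
      apply: (@le_trans _ _ (1 `^ (1 + sigma))); first by rewrite powR1.
      by apply: ge0_ler_powR; rewrite ?nnegrE // ltW.
    apply: (@le_trans _ _ (b u)); first by rewrite ler_piMr ?bge.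
    rewrite /b -[leRHS]mulrA; apply: ler_pM => //; rewrite ?expR_ge0 //.
      by rewrite mulr_ge0 // addr_ge0 // invr_ge0 exprn_ge0 // ltW.
    by rewrite [leRHS]mulrC ler_wpM2l.
  rewrite (ge0_integralZl_EFin leb) //.
  + by rewrite I0E -EFinM lee_fin mulrAC ler_wpM2r ?expR_ge0.
  + by have /integrableP[] := iE.
  + by rewrite mulr_ge0 ?expR_ge0 // mulr_ge0.
apply: (@le_trans _ _ (\int[leb]_(u in `[1%R, +oo[) ((u `^ (1 + sigma))^-1)%:E)%E).
  rewrite [X in (_ <= X)%E]integral_mkcond.
  apply: (@ge0_le_integral_gen R _ (measurableTypeR R) leb) => u; rewrite indicE.
    by rewrite lee_fin mulr_ge0 // subord_weight_ge0.
  have [/set_mem/late_itv lu|_] := boolP (u \in late t); last first.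
    by rewrite mul0r patchE; case: ifP => // _; rewrite lee_fin invr_ge0 powR_ge0.
  have u1 : 1 < u by exact: le_lt_trans rt1 lu.
  rewrite patchE mem_set /= ?in_itv /= ?(ltW u1) // mul1r lee_fin.
  rewrite /subord_weight ler_piMl ?invr_ge0 ?powR_ge0 // -expR0 ler_expR oppr_le0 divr_ge0 ?sqr_ge0 // mulr_ge0 //.
  by apply: ltW; exact: lt_trans u1.
by rewrite integral_powR_tail // lee_fin /K lerDr !addr_ge0.
Qed.

End WeightBounds.

(** * The L^p estimate for convolutions *)

Section ConvolutionLp.
Variables (R : realType) (G : topGroupType) (n : nat) (A : set (chart R G n)).
Hypothesis hG : is_lie_group A.
Hypothesis Gc : connected [set: G].
Variable mu : {measure set (borel G) -> \bar R}.
Hypothesis hmu : is_haar mu.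

(** Valid for an arbitrary f. The positive and negative parts are each bounded by the integral of
    |f|, since the integral need not be additive on nonmeasurable functions: hence the factor 2. *)
Lemma Rintegral_abs_le (f : G -> R) : (`|\int[mu]_x f x|%:E <= 2%:E * \int[mu]_x `|f x|%:E)%E.
Proof.
apply: (@le_trans _ _ `|\int[mu]_x (f x)%:E|%E).
  by rewrite /Rintegral; case: (integral _ _ _) => [r| |]; rewrite ?normr0 ?leey //= lee_fin lexx.
rewrite integralE; apply: le_trans (lee_abs_sub _ _) _.
have pos_le (k : G -> \bar R) : (forall x, 0 <= k x)%E -> (forall x, k x <= `|f x|%:E)%E ->
  (`|\int[mu]_x k x| <= \int[mu]_x `|f x|%:E)%E.
  by move=> k0 kf; rewrite gee0_abs ?integral_ge0 //; exact: ge0_le_integral_gen.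
have -> : (2%:E * \int[mu]_x `|f x|%:E = \int[mu]_x `|f x|%:E + \int[mu]_x `|f x|%:E)%E.
  by rewrite -[in RHS](mul1e (\int[mu]_x _)%E) -ge0_muleDl // -EFinD.
apply: leeD; apply: pos_le => x; rewrite ?funepos_ge0 ?funeneg_ge0 //.
  by rewrite funeposE -EFin_max lee_fin ge_max ler_norm normr_ge0.
by rewrite funenegE -EFinN -EFin_max lee_fin ge_max normr_ge0 andbT -normrN ler_norm.
Qed.

Lemma normc_le (z : R[i]) : Normc.normc z <= `|complex.Re z| + `|complex.Im z|.
Proof.
case: z => a b /=; rewrite -[leRHS]ger0_norm ?addr_ge0 // -sqrtr_sqr ler_wsqrtr //.
rewrite sqrrD !real_normK ?num_real // lerD2r lerDl mulrn_wge0 // mulr_ge0 //.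
Qed.

Lemma normc_ge0 (z : R[i]) : 0 <= Normc.normc z.
Proof. by case: z => a b; exact: sqrtr_ge0. Qed.

Variable v0 : G -> R[i].
Hypothesis v0_L1 : cintegrable mu v0.

Let V x : R := `|complex.Re (v0 x)| + `|complex.Im (v0 x)|.

Let V0 x : (0 <= (V x)%:E)%E. Proof. by rewrite lee_fin addr_ge0. Qed.

Let mV : measurable_fun setT (fun x : borel G => (V x)%:E).
Proof.
case: v0_L1 => /integrableP[m1 _] /integrableP[m2 _].
apply/measurable_EFinP; apply: measurable_funD; apply: measurableT_comp => //; exact/measurable_EFinP.
Qed.

Let V_mass : exists2 m : R, 0 <= m & (\int[mu]_x (V x)%:E = m%:E)%E.
Proof.
case: v0_L1 => /integrableP[/measurable_EFinP m1 i1] /integrableP[/measurable_EFinP m2 i2].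
have VE : (\int[mu]_x (V x)%:E = \int[mu]_x `|(complex.Re (v0 x))%:E| + \int[mu]_x `|(complex.Im (v0 x))%:E|)%E.
  rewrite -ge0_integralD //.
  - by apply/measurable_EFinP; apply: measurableT_comp.
  - by apply/measurable_EFinP; apply: measurableT_comp.
have fin : (\int[mu]_x (V x)%:E < +oo)%E by rewrite VE lte_add_pinfty.
have ge0 : (0 <= \int[mu]_x (V x)%:E)%E by exact: integral_ge0.
exists (fine (\int[mu]_x (V x)%:E)%E); first exact: fine_ge0.
by rewrite fineK // ge0_fin_numE.
Qed.

Let convV (q : G -> \bar R) (x : G) : \bar R := (\int[mu]_y ((V y)%:E * q (y^-1 * x)%g))%E.

Let convV_F (q : G -> \bar R) (z : G * G) : \bar R := ((V z.2)%:E * q (z.2^-1 * z.1)%g)%E.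

Let convV_F_measurable (q : G -> \bar R) : measurable_fun setT (q : borel G -> \bar R) ->
  measurable_fun setT (convV_F q : (borel G * borel G)%type -> \bar R).
Proof.
move=> mq; apply: emeasurable_funM; first by apply: (measurableT_comp mV); exact: measurable_snd.
apply: (measurableT_comp mq); have := div_borel hG Gc; move=> md.
by have := measurableT_comp md (measurable_swap (T1 := borel G) (T2 := borel G)); exact.
Qed.

Let convV_F_ge0 (q : G -> \bar R) z : (forall x, 0 <= q x)%E -> (0 <= convV_F q z)%E.
Proof. by move=> q0; rewrite mule_ge0. Qed.

Let convV_measurable (q : G -> \bar R) : measurable_fun setT (q : borel G -> \bar R) -> (forall x, 0 <= q x)%E ->
  measurable_fun setT (convV q : borel G -> \bar R).
Proof.
move=> mq q0; exact: (@measurable_fun_fubini_tonelli_F _ _ _ _ _ (sf_copy (haar_sigma_finite hG Gc hmu) : {sigma_finite_measure set (borel G) -> \bar R}) _ (convV_F_measurable mq) (fun z => convV_F_ge0 z q0)).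
Qed.

Let convV_ge0 (q : G -> \bar R) x : (forall x, 0 <= q x)%E -> (0 <= convV q x)%E.
Proof. by move=> q0; apply: integral_ge0 => y _; rewrite mule_ge0. Qed.

Let convV_mass (q : G -> \bar R) : measurable_fun setT (q : borel G -> \bar R) -> (forall x, 0 <= q x)%E ->
  (\int[mu]_x convV q x = (\int[mu]_x (V x)%:E) * \int[mu]_x q x)%E.
Proof.
move=> mq q0.
rewrite [LHS](tonelli hG Gc hmu (convV_F_measurable mq) (fun z => convV_F_ge0 z q0)).
rewrite -ge0_integralZr //; last exact: integral_ge0.
apply: eq_integral => y _; rewrite -(haar_left hmu y^-1%g mq q0) /convV_F /=.
rewrite ge0_integralZl //; by apply: (measurableT_comp mq); exact: lmul_borel.
Qed.

Let convV_sup (q : G -> \bar R) (S : R) x : (forall x, 0 <= q x)%E -> 0 <= S -> (forall x, q x <= S%:E)%E ->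
  (convV q x <= (\int[mu]_x (V x)%:E) * S%:E)%E.
Proof.
move=> q0 S0 qS; rewrite -ge0_integralZr // ?lee_fin //.
apply: ge0_le_integral_gen => y; first by rewrite mule_ge0.
by rewrite lee_wpmul2l.
Qed.

(* F ^ p is at most (sup F) ^ (p - 1) F, separately on the two parts of the kernel. *)
Lemma lp_two_parts (p : R) : 1 < p -> exists2 C : R, 0 <= C &
  forall (Q : G -> R) (q1 q2 : G -> \bar R) (P S1 S2 L1 L2 : R),
  (forall x, 0 <= Q x /\ ((Q x)%:E <= P%:E * (q1 x + q2 x))%E) ->
  measurable_fun setT (q1 : borel G -> \bar R) -> measurable_fun setT (q2 : borel G -> \bar R) ->
  (forall x, 0 <= q1 x)%E -> (forall x, 0 <= q2 x)%E -> 0 <= P -> 0 <= S1 -> 0 <= S2 ->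
  (forall x, q1 x <= S1%:E)%E -> (forall x, q2 x <= S2%:E)%E ->
  (\int[mu]_x q1 x <= L1%:E)%E -> (\int[mu]_x q2 x <= L2%:E)%E ->
  (\int[mu]_x (Normc.normc (cconvolution mu v0 Q x - cintegral mu v0 * (Q x)%:C%C) `^ p)%:E <=
    (C * P `^ p * (S1 `^ (p - 1) * L1 + S2 `^ (p - 1) * L2))%:E)%E.
Proof.
move=> p1; have p0 : 0 <= p by apply: ltW; exact: lt_trans p1.
have p10 : 0 <= p - 1 by rewrite subr_ge0 ltW.
have [m m0 mE] := V_mass.
pose nM := Normc.normc (cintegral mu v0); have nM0 : 0 <= nM by exact: normc_ge0.
(* 4 = 2 * 2: real and imaginary parts, each with the factor 2 of [Rintegral_abs_le]; [nM] accounts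
   for the term M Q. *)
pose k := 4 * m + nM; have k0 : 0 <= k by rewrite addr_ge0 // mulr_ge0.
exists (2 `^ p * k `^ p) => [|Q q1 q2 P S1 S2 L1 L2 hQ mq1 mq2 q10 q20 P0 S10 S20 qS1 qS2 qL1 qL2].
  by rewrite mulr_ge0 ?powR_ge0.
pose w (q : G -> \bar R) x := (4%:E * convV q x + nM%:E * q x)%E.
have w0 q x : (forall x, 0 <= q x)%E -> (0 <= w q x)%E.
  by move=> q0; rewrite adde_ge0 // mule_ge0 ?lee_fin // convV_ge0.
have mw q : measurable_fun setT (q : borel G -> \bar R) -> (forall x, 0 <= q x)%E -> measurable_fun setT (w q : borel G -> \bar R).
  by move=> mq q0; apply: emeasurable_funD; apply: measurable_funeM => //; exact: convV_measurable.
have w_sup q S x : (forall x, 0 <= q x)%E -> 0 <= S -> (forall x, q x <= S%:E)%E -> (w q x <= (k * S)%:E)%E.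
  move=> q0 S0 qS; rewrite /k mulrDl EFinD; apply: leeD.
    rewrite -mulrA EFinM lee_wpmul2l ?lee_fin //; have := convV_sup x q0 S0 qS; by rewrite mE -EFinM.
  by rewrite EFinM lee_wpmul2l ?lee_fin.
have w_mass q L : measurable_fun setT (q : borel G -> \bar R) -> (forall x, 0 <= q x)%E -> (\int[mu]_x q x <= L%:E)%E ->
    (\int[mu]_x w q x <= (k * L)%:E)%E.
  move=> mq q0 qL; rewrite /w ge0_integralD //; last 4 first.
  - by move=> x _; rewrite mule_ge0 ?lee_fin // convV_ge0.
  - by apply: measurable_funeM; exact: convV_measurable.
  - by move=> x _; rewrite mule_ge0 ?lee_fin.
  - exact: measurable_funeM.
  rewrite !ge0_integralZl ?lee_fin //; [|exact: convV_measurable|by move=> x _; exact: convV_ge0].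
  have -> : (k * L)%:E = (4%:E * (m%:E * L%:E) + nM%:E * L%:E)%E by rewrite -!EFinM -EFinD /k mulrDl mulrA.
  rewrite convV_mass // mE; apply: leeD.
    by rewrite lee_wpmul2l ?lee_fin // lee_wpmul2l ?lee_fin.
  by rewrite lee_wpmul2l ?lee_fin.
pose F x := Normc.normc (cconvolution mu v0 Q x - cintegral mu v0 * (Q x)%:C%C).
have F_le x : ((F x)%:E <= P%:E * (w q1 x + w q2 x))%E.
  have conv_le (f : G -> R) : (forall y, `|f y| <= V y) ->
    (`|\int[mu]_y (f y * Q (y^-1 * x)%g)|%:E <= 2%:E * (P%:E * (convV q1 x + convV q2 x)))%E.
    move=> fV; apply: le_trans (Rintegral_abs_le _) _; rewrite lee_wpmul2l ?lee_fin //.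
    have mF q : measurable_fun setT (q : borel G -> \bar R) -> measurable_fun setT (fun y : borel G => (V y)%:E * q (y^-1 * x)%g)%E.
      move=> mq; apply: emeasurable_funM => //; apply: (measurableT_comp mq).
      by apply: (measurableT_comp (f := (fun y => y * x)%g : borel G -> borel G)); [exact: rmul_borel|exact: inv_borel].
    rewrite /convV -ge0_integralD //; last 4 first.
    - by move=> y _; rewrite mule_ge0.
    - exact: mF.
    - by move=> y _; rewrite mule_ge0.
    - exact: mF.
    rewrite -ge0_integralZl ?lee_fin //; last 2 first.
    - by apply: emeasurable_funD; exact: mF.
    - by move=> y _; rewrite adde_ge0 // mule_ge0.
    apply: ge0_le_integral_gen => y; first by rewrite lee_fin.
    have [Q0 QP] := hQ (y^-1 * x)%g.
    apply: (@le_trans _ _ ((V y)%:E * (Q (y^-1 * x)%g)%:E)%E).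
      by rewrite -EFinM lee_fin normrM (ger0_norm Q0) ler_wpM2r.
    rewrite -ge0_muleDr // muleCA lee_wpmul2l //.
  have Re_le y : `|complex.Re (v0 y)| <= V y by rewrite lerDl.
  have Im_le y : `|complex.Im (v0 y)| <= V y by rewrite lerDr.
  have [Q0 QP] := hQ x.
  have h1 := conv_le _ Re_le; have h2 := conv_le _ Im_le.
  have h3 : F x <= `|\int[mu]_y (complex.Re (v0 y) * Q (y^-1 * x)%g)| + `|\int[mu]_y (complex.Im (v0 y) * Q (y^-1 * x)%g)| + nM * Q x.
    apply: le_trans (le_normcD _ _) _; apply: lerD; last first.
      rewrite normcN Normc.normcM; apply: ler_wpM2l => //.
      by rewrite /= expr0n addr0 sqrtr_sqr ger0_norm.
    apply: le_trans (normc_le _) _; rewrite /cconvolution /cintegral /=; apply: lerD.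
      by rewrite le_eqVlt; apply/orP; left; apply/eqP; congr (`|_|); apply: eq_Rintegral => y _; case: (v0 y) => a b /=; rewrite mulr0 subr0.
    by rewrite le_eqVlt; apply/orP; left; apply/eqP; congr (`|_|); apply: eq_Rintegral => y _; case: (v0 y) => a b /=; rewrite mulr0 add0r.
  apply: (@le_trans _ _ (2%:E * (P%:E * (convV q1 x + convV q2 x)) + 2%:E * (P%:E * (convV q1 x + convV q2 x)) + nM%:E * (P%:E * (q1 x + q2 x)))%E).
    apply: (@le_trans _ _ ((`|\int[mu]_y (complex.Re (v0 y) * Q (y^-1 * x)%g)|%:E + `|\int[mu]_y (complex.Im (v0 y) * Q (y^-1 * x)%g)|%:E) + (nM * Q x)%:E)%E).
      by rewrite -!EFinD lee_fin.
    by apply: leeD; [exact: leeD|rewrite EFinM lee_wpmul2l ?lee_fin].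
  have c1 : (0 <= convV q1 x)%E by exact: convV_ge0.
  have c2 : (0 <= convV q2 x)%E by exact: convV_ge0.
  rewrite /w -ge0_muleDl ?lee_fin // -EFinD.
  rewrite le_eqVlt; apply/orP; left; apply/eqP.
  have e1 : (4%:E * convV q1 x + 4%:E * convV q2 x = (2 + 2)%:E * (convV q1 x + convV q2 x))%E.
    by rewrite -ge0_muleDr //; congr (_%:E * _)%E; ring.
  have e2 : (nM%:E * q1 x + nM%:E * q2 x = nM%:E * (q1 x + q2 x))%E by rewrite ge0_muleDr.
  have s1 : (0 <= (2 + 2)%:E * (convV q1 x + convV q2 x))%E by rewrite -e1 adde_ge0 // mule_ge0.
  have s2 : (0 <= nM%:E * (q1 x + q2 x))%E by rewrite mule_ge0 // adde_ge0.
  by rewrite [in RHS]addeACA e1 e2 [RHS]ge0_muleDr // muleCA [X in (_ + X)%E]muleCA.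
have F0 x : 0 <= F x by exact: normc_ge0.
have key x : ((F x `^ p)%:E <= (2 `^ p * P `^ p)%:E * (((k * S1) `^ (p - 1))%:E * w q1 x + ((k * S2) `^ (p - 1))%:E * w q2 x))%E.
  have := F_le x; have := w_sup q1 S1 x q10 S10 qS1; have := w_sup q2 S2 x q20 S20 qS2.
  have := w0 q1 x q10; have := w0 q2 x q20.
  case: (w q1 x) => [r1| |] //; case: (w q2 x) => [r2| |] //.
  rewrite !lee_fin => r20 r10 r2S r1S FP.
  have {}FP : F x <= P * (r1 + r2) by rewrite -lee_fin EFinM EFinD.
  (* The p-th power of a sum is bounded through the larger term, which gives the factor 2^p and
     keeps the two parts separate. *)
  pose r := Num.max r1 r2.
  have r0 : 0 <= r by rewrite le_max r10.
  have FP2 : F x <= 2 * P * r.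
    apply: le_trans FP _; rewrite -mulrA mulrCA ler_wpM2l // mulr_natl mulr2n; apply: lerD; by rewrite le_max lexx ?orbT.
  apply: (@le_trans _ _ ((2 * P * r) `^ p)).
    by apply: ge0_ler_powR; rewrite ?nnegrE // !mulr_ge0.
  have -> : (2 * P * r) `^ p = 2 `^ p * P `^ p * r `^ p by rewrite !powRM ?mulr_ge0.
  rewrite ler_wpM2l ?mulr_ge0 ?powR_ge0 //.
  have pw (s S : R) : 0 <= s -> s <= k * S -> s `^ p <= (k * S) `^ (p - 1) * s.
    move=> s0 sS; have [->|sn] := eqVneq s 0; first by rewrite powR0 ?mulr0 // gt_eqF // (lt_trans ltr01).
    have -> : s `^ p = s `^ (p - 1) * s.
      by rewrite -[in X in _ * X](powRr1 s0) -powRD ?subrK // sn implybT.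
    rewrite ler_wpM2r //; apply: ge0_ler_powR; rewrite ?nnegrE //; exact: le_trans sS.
  have t1 := pw r1 S1 r10 r1S; have t2 := pw r2 S2 r20 r2S.
  have u1 : 0 <= (k * S1) `^ (p - 1) * r1 by rewrite mulr_ge0 ?powR_ge0.
  have u2 : 0 <= (k * S2) `^ (p - 1) * r2 by rewrite mulr_ge0 ?powR_ge0.
  rewrite /r; case: (leP r1 r2) => _.
    by apply: le_trans t2 _; rewrite lerDr.
  by apply: le_trans t1 _; rewrite lerDl.
have Fp0 x : (0 <= (F x `^ p)%:E)%E by rewrite lee_fin powR_ge0.
apply: le_trans (@ge0_le_integral_gen R _ (borel G) mu _ _ Fp0 key) _.
have pE0 a b : (0 <= ((a : R) `^ b)%:E)%E by rewrite lee_fin powR_ge0.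
have mz q (z : \bar R) : measurable_fun setT (q : borel G -> \bar R) -> (forall x, 0 <= q x)%E -> measurable_fun setT (fun x : borel G => z * w q x)%E.
  by move=> mq q0; apply: measurable_funeM; exact: mw.
rewrite ge0_integralZl //; last 3 first.
- by apply: emeasurable_funD; exact: mz.
- by move=> x _; rewrite adde_ge0 // mule_ge0 // w0.
- by rewrite lee_fin mulr_ge0 ?powR_ge0.
rewrite ge0_integralD //; last 4 first.
- by move=> x _; rewrite mule_ge0 // w0.
- exact: mz.
- by move=> x _; rewrite mule_ge0 // w0.
- exact: mz.
rewrite !ge0_integralZl //; last 4 first.
- exact: mw.
- by move=> x _; exact: w0.
- exact: mw.
- by move=> x _; exact: w0.
have -> : 2 `^ p * k `^ p * P `^ p * (S1 `^ (p - 1) * L1 + S2 `^ (p - 1) * L2) =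
  (2 `^ p * P `^ p) * ((k * S1) `^ (p - 1) * (k * L1) + (k * S2) `^ (p - 1) * (k * L2)).
  have kp : k `^ p = k `^ (p - 1) * k.
    have [->|kn] := eqVneq k 0; first by rewrite powR0 ?mulr0 // gt_eqF // (lt_trans ltr01).
    by rewrite -[in X in _ * X](powRr1 k0) -powRD ?subrK // kn implybT.
  by rewrite kp !powRM //; ring.
rewrite [leRHS]EFinM lee_wpmul2l ?lee_fin ?mulr_ge0 ?powR_ge0 // EFinD; apply: leeD.
  by rewrite EFinM lee_wpmul2l // w_mass.
by rewrite EFinM lee_wpmul2l // w_mass.
Qed.

End ConvolutionLp.

(** Divide by e^(- (p - 1) r t), the exponential of the right side because p / p' = p - 1. The early
    part has lost delta (p - 1) <= 1/64 and gained 1/32 through the mass, which leaves e^(- r t /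
    64); the late part leaves e^(- (p - 1) r t). Either one beats any power of t, so b is
    arbitrary. *)
Lemma rate_absorption (R : realType) (C D K r p p' s b delta eps : R) :
  0 <= C -> 0 <= D -> 0 <= K -> 0 < r -> 1 < p -> p^-1 + p'^-1 = 1 ->
  delta * (p - 1) <= 64^-1 -> 0 < eps ->
  \forall t \near +oo, C * (t `^ s * D) `^ p *
    ((K * t * expR (- ((1 - delta) * r * t))) `^ (p - 1) * (K * t * expR (- (r * t / 32))) +
     (K * expR (- (2 * r * t))) `^ (p - 1) * K) <= (eps * (t `^ b * expR (- (r * t / p')))) `^ p.
Proof.
move=> C0 D0 K0 r0 p1 pp' dp e0; set q := p - 1.
have p0 : 0 < p by exact: lt_trans p1.
have q0 : 0 < q by rewrite subr_gt0.
have pq : p'^-1 * p = q.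
  by have -> : p'^-1 = 1 - p^-1 by [rewrite -pp' addrC addKr]; rewrite mulrBl mul1r mulVf ?gt_eqF.
pose a := C * D `^ p * (K `^ q * K).
have a0 : 0 <= a by rewrite !mulr_ge0 ?powR_ge0.
(* Makes a (e + e) at most eps^p, also when a = 0. *)
pose e := eps `^ p / (2 * (a + 1)).
have a1 : 0 < 2 * (a + 1) by rewrite mulr_gt0 // ltr_wpDl.
have e'0 : 0 < e by rewrite divr_gt0 ?powR_gt0.
have r64 : 0 < r / 64 by rewrite divr_gt0.
have qr0 : 0 < q * r by rewrite mulr_gt0.
near=> t.
have t0 : 0 < t by near: t; exact: nbhs_pinfty_gt.
have h1 : t `^ (s * p + p - b * p) * expR (- (r / 64 * t)) <= e.
  by near: t; exact: powR_expN_small.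
have h2 : t `^ (s * p - b * p) * expR (- (q * r * t)) <= e.
  by near: t; exact: powR_expN_small.
have tD x y : t `^ (x + y) = t `^ x * t `^ y by rewrite powRD // (gt_eqF t0) implybT.
have E1 : expR (- ((1 - delta) * r * t)) `^ q * expR (- (r * t / 32)) <= expR (- (q * r * t)) * expR (- (r / 64 * t)).
  rewrite -expRM -!expRD ler_expR.
  have : delta * q * (r * t) <= 64^-1 * (r * t) by rewrite ler_wpM2r // mulr_ge0 // ltW.
  rewrite -subr_ge0 => dq; rewrite -subr_ge0.
  by apply: le_trans dq _; rewrite le_eqVlt; apply/orP; left; apply/eqP; field.
have E3 : expR (- (2 * r * t)) `^ q = expR (- (q * r * t)) * expR (- (q * r * t)).
  by rewrite -expRM -expRD; congr expR; ring.
have E4 : expR (- (r * t / p')) `^ p = expR (- (q * r * t)).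
  by rewrite -expRM -pq; congr expR; ring.
have tq : t `^ q * t = t `^ p.
  by rewrite -[in X in _ * X](powRr1 (ltW t0)) -tD subrK.
have ltb : 0 <= t `^ (b * p) * expR (- (q * r * t)) by rewrite mulr_ge0 ?powR_ge0 ?expR_ge0.
have pE (x y z : R) : 0 <= x -> 0 <= y -> (x * y) `^ z = x `^ z * y `^ z by exact: powRM.
apply: (@le_trans _ _ (a * (e + e) * (t `^ (b * p) * expR (- (q * r * t))))); last first.
  rewrite pE ?mulr_ge0 ?powR_ge0 ?expR_ge0 ?(ltW e0) // [in leRHS]pE ?powR_ge0 ?expR_ge0 // E4 -powRrM.
  rewrite ler_wpM2r // /e.
  have -> : a * (eps `^ p / (2 * (a + 1)) + eps `^ p / (2 * (a + 1))) = eps `^ p * (a / (a + 1)).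
    by field; rewrite gt_eqF // ltr_wpDl.
  by rewrite ler_piMr ?powR_ge0 // ler_pdivrMr ?mul1r ?lerDl // ltr_wpDl.
have expE0 (x : R) := expR_ge0 x.
rewrite !pE ?mulr_ge0 ?powR_ge0 ?(ltW t0) //.
rewrite -powRrM E3; set X := expR _ `^ q in E1 *; set Y := expR (- (r * t / 32)) in E1 *.
set Z := expR (- (q * r * t)) in E1 h2 ltb *; set W := expR (- (r / 64 * t)) in E1 h1.
have -> : C * (t `^ (s * p) * D `^ p) * (K `^ q * t `^ q * X * (K * t * Y) + K `^ q * (Z * Z) * K) =
  a * (t `^ (s * p) * (t `^ q * t * (X * Y) + Z * Z)) by rewrite /a; ring.
rewrite -[leRHS]mulrA ler_wpM2l // tq.
apply: (@le_trans _ _ (t `^ (s * p) * (t `^ p * (Z * W) + Z * Z))).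
  by rewrite ler_wpM2l ?powR_ge0 // lerD2r ler_wpM2l ?powR_ge0.
have -> : t `^ (s * p) * (t `^ p * (Z * W) + Z * Z) =
  (t `^ (s * p + p - b * p) * W + t `^ (s * p - b * p) * Z) * (t `^ (b * p) * Z).
  have s1 : t `^ (s * p + p - b * p) * t `^ (b * p) = t `^ (s * p) * t `^ p by rewrite -!tD subrK.
  have s2 : t `^ (s * p - b * p) * t `^ (b * p) = t `^ (s * p) by rewrite -!tD subrK.
  transitivity (t `^ (s * p) * t `^ p * (Z * W) + t `^ (s * p) * (Z * Z)); first by ring.
  by rewrite -s1 -[in X in _ + X]s2; ring.
by rewrite ler_wpM2r // lerD.
Unshelve. all: by end_near.
Qed.

Lemma cLnorm_le (R : realType) (G : topGroupType) (mu : {measure set (borel G) -> \bar R}) (p z : R) (f : G -> R[i]) :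
  0 < p -> 0 <= z -> (\int[mu]_x (Normc.normc (f x) `^ p)%:E <= (z `^ p)%:E)%E -> (cLnorm mu p f <= z%:E)%E.
Proof.
move=> p0 z0 h; have pn : p != 0 by rewrite gt_eqF.
rewrite /cLnorm unlock.
have i0 : (0 <= \int[mu]_x (Normc.normc (f x) `^ p)%:E)%E by apply: integral_ge0 => x _; rewrite lee_fin powR_ge0.
have -> : (\int[mu]_x (`|(Normc.normc (f x))%:E| `^ p) = \int[mu]_x (Normc.normc (f x) `^ p)%:E)%E.
  by apply: eq_integral => x _; rewrite abse_EFin ger0_norm ?normc_ge0 // poweR_EFin.
apply: (@le_trans _ _ ((z `^ p)%:E `^ p^-1)%E).
  apply: gt0_ler_poweR; rewrite ?invr_ge0 ?(ltW p0) // in_itv /= ?i0 ?leey //.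
  by rewrite lee_fin powR_ge0.
by rewrite poweR_EFin lee_fin -powRrM mulfV // powRr1.
Qed.

(** The factor e^(r^2 us) in the constant compensates e^(- r^2 u) for u <= us. *)
Lemma heat_majorant_le (R : realType) (G : Type) (h : R -> G -> R) (C us r : R) (d : nat) :
  0 < C -> 0 < us ->
  (forall (u : R) x, 0 < u -> u <= us -> h u x <= C / u ^+ d) ->
  (forall (u : R) x, us <= u -> h u x <= C * expR (- (r ^+ 2 * u))) ->
  forall (u : R) x, 0 < u -> h u x <= heat_majorant r (C * expR (r ^+ 2 * us)) d u.
Proof.
move=> C0 us0 small large u x u0; rewrite /heat_majorant; set w := (u ^+ d)^-1.
have w0 : 0 <= w by rewrite invr_ge0 exprn_ge0 // ltW.
have [uus|uus] := leP u us.
  apply: le_trans (small _ _ u0 uus) _; rewrite -/w mulrAC -(mulrA C) -expRD.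
  have e1 : 1 <= expR (r ^+ 2 * us - r ^+ 2 * u).
    by rewrite -expR0 ler_expR -mulrBr mulr_ge0 ?sqr_ge0 // subr_ge0.
  rewrite -mulrA ler_wpM2l ?(ltW C0) //; apply: (@le_trans _ _ (1 * (1 + w))); first by rewrite mul1r lerDr.
  by rewrite ler_wpM2r // addr_ge0.
apply: le_trans (large _ x (ltW uus)) _; rewrite ler_wpM2r ?expR_ge0 // -mulrA ler_peMr ?(ltW C0) //.
have e1 : 1 <= expR (r ^+ 2 * us) by rewrite -expR0 ler_expR mulr_ge0 ?sqr_ge0 // ltW.
by apply: le_trans e1 _; rewrite ler_peMr ?expR_ge0 // lerDl.
Qed.

Theorem corollary4p3 (R : realType)
  (G : topGroupType) (n : nat) (A : set (chart R G n))
  (hG : is_lie_group A)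
  (G_connected : connected [set: G])
  (G_noncompact : ~ compact [set: G])
  (G_center : finite_set (@group_center G))
  (g : vectType R) (exp : g -> G) (br : g -> g -> g)
  (hg : is_lie_algebra A exp br)
  (g_semisimple : semisimple br)
  (K : set G) (hK : maximal_compact_subgroup K)
  (theta : 'End(g)) (htheta : is_cartan_involution br theta)
  (htheta_K : forall X, theta X = X <-> forall s : R, K (exp (s *: X)))
  (E : seq g) (hE : orthonormal_basis br (cartan_p theta) E)
  (a : {vspace g}) (ha : maximal_abelian br (cartan_p theta) a)
  (Sp : seq g) (hSp : positive_system br a Sp)
  (mu : {measure set (borel G) -> \bar R}) (hmu : is_haar mu)
  (hmu_riem : riemannian_normalized K exp br (cartan_p theta) mu)
  (h : R -> G -> R) (hh : is_heat_kernel K exp E A mu h)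
  (sigma : R) (sigma_gt0 : 0 < sigma) (sigma_lt1 : sigma < 1)
  (v0 : G -> R[i]) (v0_L1 : cintegrable mu v0) (v0_biK : bi_invariant K v0)
  (p p' : R) (p_gt1 : 1 < p) (pp' : p^-1 + p'^-1 = 1) :
  let Q := extension_kernel h sigma in
  let v := fun t => cconvolution mu v0 (Q t) in
  let M := cintegral mu v0 in
  let err := fun t x => v t x - M * (Q t x)%:C%C in
  let ell := (\dim a)%:R : R in
  let r := (size (reduced_roots br a Sp))%:R : R in
  let rate := fun t => t `^ (p'^-1 * (sigma - ell / 2 - 2^-1 - r)) *
                       expR (- (knorm br (rho br a Sp) * t / p')) in
  forall eps : R, 0 < eps ->
    \forall t \near +oo, (cLnorm mu p (err t) <= (eps * rate t)%:E)%E.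
Proof.
move=> Q v M err ell m rate eps eps0.
pose r := knorm br (rho br a Sp).
have N0 := two_rho_killing_gt0 hG G_connected hmu hg htheta hE hK hh ha hSp G_noncompact.
have rhoE : rho br a Sp = 2^-1 *: two_rho br a Sp by [].
have r2 : killing br (rho br a Sp) (rho br a Sp) = killing br (two_rho br a Sp) (two_rho br a Sp) / 4.
  rewrite rhoE (killingZl (br_linear_r hG hg) (br_linear_l hG hg)) (killingZr (br_linear_r hG hg) (br_linear_l hG hg)).
  by field.
have r0 : 0 < r by rewrite /r /knorm sqrtr_gt0 r2 divr_gt0.
have rr : r ^+ 2 = killing br (two_rho br a Sp) (two_rho br a Sp) / 4.
  by rewrite /r /knorm sqr_sqrtr r2 // divr_ge0 // ltW.
have [C1 [us [C10 us0 small large]]] :=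
  heat_kernel_bound hG G_connected hmu hg htheta hE hK hmu_riem hh ha hSp.
rewrite -rr in large.
have maj := heat_majorant_le C10 us0 small large.
set C := C1 * _ in maj; set d := \dim _ in maj.
have C0 : 0 <= C by rewrite mulr_ge0 ?expR_ge0 // ltW.
have [sh _ h_int _ _] := hh.
have h_cont (u : R) x : 0 < u -> {for (u, x), continuous (fun z => h z.1 z.2)}.
  exact: (smooth_pos_cont hG).
have h_ge0 (u : R) x : 0 < u -> 0 <= h u x by move=> /h_int[].
have h_mass (u : R) : 0 < u -> (\int[mu]_x (h u x)%:E = 1)%E by move=> /h_int[].
(* Below 1 for [weight_bounds], and small enough that the loss delta (p - 1) in the exponent is at
   most half of the gain 1/32. *)
pose delta := Num.min 2^-1 (64 * (p - 1))^-1.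
have p10 : 0 < p - 1 by rewrite subr_gt0.
have delta0 : 0 < delta by rewrite lt_min !invr_gt0 ltr0n mulr_gt0.
have delta1 : delta < 1 by rewrite gt_min; apply/orP; left; lra.
have deltap : delta * (p - 1) <= 64^-1.
  apply: (@le_trans _ _ ((64 * (p - 1))^-1 * (p - 1))).
    by rewrite ler_wpM2r ?(ltW p10) // ge_min lexx orbT.
  by rewrite invfM -mulrA mulVf ?mulr1 // gt_eqF.
have [L L0 bounds] := weight_bounds d sigma_gt0 r0 C0 delta0 delta1.
have [B B0 lp] := lp_two_parts hG G_connected hmu v0_L1 p_gt1.
pose D := (2 `^ (2 * sigma) * Gamma sigma)^-1.
have D0 : 0 <= D.
  rewrite invr_ge0 mulr_ge0 ?powR_ge0 //; apply: Rintegral_ge0 => u _.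
  by rewrite mulr_ge0 ?powR_ge0 ?expR_ge0.
have p0 : 0 < p by exact: lt_trans p_gt1.
near=> t.
have t1 : 1 <= t by near: t; exact: nbhs_pinfty_ge.
have t0 : 0 < t by exact: lt_le_trans t1.
have rt1 : 1 <= 4 / r * t.
  rewrite -ler_pdivrMl ?divr_gt0 // mulr1 invf_div; near: t; apply: nbhs_pinfty_ge; exact: num_real.
have [b1 b2 b3 b4] := bounds t t1 rt1.
have rate0 : 0 <= eps * rate t by rewrite mulr_ge0 ?(ltW eps0) // mulr_ge0 ?powR_ge0 ?expR_ge0.
have De : measurable (early r t : set (measurableTypeR R)) /\ early r t `<=` [set u | 0 < u].
  by split; [exact: early_measurable|move=> u /early_itv/andP[]].
have Dl : measurable (late r t : set (measurableTypeR R)) /\ late r t `<=` [set u | 0 < u].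
  split; [exact: late_measurable|move=> u /late_itv]; apply: lt_trans; exact: lt_le_trans rt1.
apply: cLnorm_le => //.
apply: le_trans (lp (Q t) (subord_part h sigma (early r t) t) (subord_part h sigma (late r t) t)
  (t `^ (2 * sigma) * D) (L * t * expR (- ((1 - delta) * r * t))) (L * expR (- (2 * r * t)))
  (L * t * expR (- (r * t / 32))) L _ _ _ _ _ _ _ _ _ _ _ _) _.
- move=> x; apply: extension_kernel_le => // u u0; have [ut|ut] := leP u (4 / r * t).
    by left; apply/early_itv; rewrite u0.
  by right; apply/late_itv.
- exact: (subord_part_measurable hG).
- exact: (subord_part_measurable hG).
- by move=> x; exact: subord_part_ge0.
- by move=> x; exact: subord_part_ge0.
- by rewrite mulr_ge0 ?powR_ge0.
- by rewrite mulr_ge0 ?expR_ge0 // mulr_ge0 // ltW.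
- by rewrite mulr_ge0 ?expR_ge0.
- by move=> x; exact: le_trans (subord_part_sup h_ge0 sigma t x maj De) b1.
- by move=> x; exact: le_trans (subord_part_sup h_ge0 sigma t x maj Dl) b3.
- by rewrite (subord_part_mass hG G_connected hmu h_cont h_ge0 h_mass).
- by rewrite (subord_part_mass hG G_connected hmu h_cont h_ge0 h_mass).
(* The power of t in [rate] is matched with the free exponent b of [rate_absorption]: the
   exponential room makes its value immaterial. *)
rewrite lee_fin; near: t; exact: rate_absorption.
Unshelve. all: by end_near.
Qed.
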